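(* Let $M$ be a manifold and $X\in\mathfrak X(M)$. Then $\hat{\mathrm L}_X$ preserves moderateness and negligibility, i.e. $\hat{\mathrm L}_X(\hat{\mathcal E}_m(M))\subseteq\hat{\mathcal E}_m(M)$ and $\hat{\mathrm L}_X(\hat{\mathcal N}(M))\subseteq\hat{\mathcal N}(M)$.
   Context: Conventions. A manifold is an orientable smooth paracompact Hausdorff manifold of finite dimension $n$; integrals of $n$-forms are taken with respect to a fixed orientation. $I=(0,1]$. $\Omega^n_c(M)$ is the space of compactly supported smooth $n$-forms and $\mathfrak X(M)$ the space of smooth vector fields. $A\subset\subset B$ means that $A$ is compact and contained in the interior of $B$. Smoothness of maps on or into locally convex spaces is in the sense of convenient calculus (Kriegl–Michor). $f(\varepsilon)=O(g(\varepsilon))$ means: there are $\varepsilon_0,C>0$ with $|f(\varepsilon)|\le Cg(\varepsilon)$ for $\varepsilon\le\varepsilon_0$. Smoothing kernels. $\widetilde{\mathcal A}_q(M)$ ($q\in\mathbb{N}_0$) is the set of all $\Phi\in C^\infty(I\times M,\Omega^n_c(M))$, $(\varepsilon,x)\mapsto[y\mapsto\Phi_{\varepsilon,x}(y)]$, such that for any Riemannian metric $h$ on $M$ (the conditions do not depend on the choice of $h$): (SK1) $\forall K\subset\subset M$ $\exists\varepsilon_0,C>0$ $\forall x\in K$ $\forall\varepsilon<\varepsilon_0$: $\operatorname{supp}\Phi_{\varepsilon,x}\subseteq B^h_{C\varepsilon}(x)$; (SK2) $\forall K\subset\subset M$ $\forall j,k\in\mathbb{N}_0$ $\forall X_1,\dots,X_j,Y_1,\dots,Y_k\in\mathfrak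 X(M)$: $\|(\mathrm L^{x+y}_{X_1}\cdots\mathrm L^{x+y}_{X_j}\mathrm L^y_{Y_1}\cdots\mathrm L^y_{Y_k}\Phi)_{\varepsilon,x}(y)\|_h=O(\varepsilon^{-n-k})$ uniformly for $x\in K$, $y\in M$; (SK3) $\forall K\subset\subset M$ $\forall j\in\mathbb{N}_0$ $\forall X_1,\dots,X_j\in\mathfrak X(M)$ $\forall f\in C^\infty(M)$: $\int_Mf\cdot(\mathrm L^x_{X_1}\cdots\mathrm L^x_{X_j}\Phi)_{\varepsilon,x}=(\mathrm L_{X_1}\cdots\mathrm L_{X_j}f)(x)+O(\varepsilon^{q+1})$ uniformly for $x\in K$. Here $B^h_r(x)$ is the $h$-ball, $\|\cdot\|_h$ the norm on $n$-forms induced by $h$, $\mathrm L^x_X$ is the Lie (directional) derivative in the parameter $x$, $\mathrm L^y_X$ the Lie derivative of the $n$-form in $y$, and $\mathrm L^{x+y}_X=\mathrm L^x_X+\mathrm L^y_X$. Basic space: $\hat{\mathcal E}(M)=C^\infty(\Omega^n_c(M)\times M)$ (scalar-valued). For $R\in\hat{\mathcal E}(M)$, $(\hat{\mathrm L}_XR)(\omega,x)=-\mathrm d_1R(\omega,x)(\mathrm L_X\omega)+(\mathrm L^x_XR)(\omega,x)$, where $\mathrm d_1$ is the differential in the first variable and $\mathrm L_X\omega$ the Lie derivative of $\omega$. Moderateness: $\hat{\mathcal E}_m(M)$ is the set of $R\in\hat{\mathcal E}(M)$ such that $\forall K\subset\subset M$ $\forall j\in\mathbb{N}_0$ $\exists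 q\in\mathbb{N}_0$ $\exists N\in\mathbb{N}$ $\forall\Phi\in\widetilde{\mathcal A}_q(M)$ $\forall X_1,\dots,X_j\in\mathfrak X(M)$: $\mathrm L^x_{X_1}\cdots\mathrm L^x_{X_j}(R(\Phi_{\varepsilon,x},x))=O(\varepsilon^{-N})$ uniformly for $x\in K$. Negligibility: $\hat{\mathcal N}(M)$ is the set of $R\in\hat{\mathcal E}(M)$ such that $\forall K\subset\subset M$ $\forall j\in\mathbb{N}_0$ $\forall m\in\mathbb{N}$ $\exists q\in\mathbb{N}_0$ $\forall\Phi\in\widetilde{\mathcal A}_q(M)$ $\forall X_1,\dots,X_j\in\mathfrak X(M)$: $\mathrm L^x_{X_1}\cdots\mathrm L^x_{X_j}(R(\Phi_{\varepsilon,x},x))=O(\varepsilon^m)$ uniformly for $x\in K$. *)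

(* Defs.v *)
From HB Require Import structures.
From mathcomp Require Import all_boot all_order all_algebra.
From mathcomp Require Import all_classical all_reals all_analysis.
Import Order.TTheory GRing.Theory Num.Theory.
Import numFieldNormedType.Exports.

Set Implicit Arguments.
Unset Strict Implicit.
Unset Printing Implicit Defensive.

Local Open Scope classical_set_scope.
Local Open Scope ring_scope.

(* Used below only for finite-dimensional V and W. *)
Section smooth_maps.
Context {R : realType} {V W : normedModType R}.

Definition iterD (vs : seq V) (f : V -> W) : V -> W :=
  foldr (fun v (g : V -> W) => fun x => 'D_v g x) f vs.

(* f is C^oo on the open set U: all iterated directional derivatives exist and
   are continuous at the points of U. *)
Definition smooth_on (U : set V) (f : V -> W) : Prop :=
  forall (vs : seq V) (x : V), U x ->
    {for x, continuous (iterD vs f)} /\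
    forall v : V, derivable (iterD vs f) x v.

End smooth_maps.

Definition locally_finite {T : topologicalType} (V : set (set T)) : Prop :=
  forall x : T, exists2 N : set T, nbhs x N &
    finite_set [set A | V A /\ A `&` N !=set0].

Definition paracompact (T : topologicalType) : Prop :=
  forall C : set (set T), C `<=` open -> \bigcup_(A in C) A = setT ->
    exists V : set (set T),
      [/\ V `<=` open, \bigcup_(A in V) A = setT,
          forall A, V A -> exists2 B, C B & A `<=` B & locally_finite V].

(* A chart is a homeomorphism from an open subset cdom of M onto an open subset
   of R^n; cmap and cinv have no meaning outside these sets. *)
Record chart (R : realType) (n : nat) (M : topologicalType) := Chart {
  cdom : set M;
  cmap : M -> 'rV[R]_n;
  cinv : 'rV[R]_n -> M;
  cdom_open : open cdom;
  cimg_open : open (cmap @` cdom);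
  cmapK : forall p, cdom p -> cinv (cmap p) = p;
  cmap_continuous : forall p, cdom p -> {for p, continuous cmap};
  cinv_continuous : forall z, (cmap @` cdom) z -> {for z, continuous cinv} }.

Definition cimg (R : realType) (n : nat) (M : topologicalType)
  (phi : chart R n M) : set 'rV[R]_n := cmap phi @` cdom phi.

(* The smooth structure is given by a (not necessarily maximal) atlas. The
   preferred chart chart_at p is only used to identify T_pM with R^n: below, a
   tangent vector at p is the row vector of its components in chart_at p. *)
Record manifold (R : realType) (n : nat) := Manifold {
  mpoint :> topologicalType;
  atlas : set (chart R n mpoint);
  chart_at : mpoint -> chart R n mpoint;
  chart_at_atlas : forall p, atlas (chart_at p);
  chart_at_dom : forall p, cdom (chart_at p) p;
  atlas_smooth : forall phi psi, atlas phi -> atlas psi ->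
    smooth_on (cmap phi @` (cdom phi `&` cdom psi)) (cmap psi \o cinv phi);
  manifold_hausdorff : hausdorff_space mpoint;
  manifold_paracompact : paracompact mpoint }.

Section calculus_on_manifolds.
Context {R : realType} {n : nat}.
Variable M : manifold R n.

Implicit Types (phi : chart R n M) (p x y : M) (z : 'rV[R]_n) (A : 'M[R]_n).

Definition cmap_at p : 'rV[R]_n := cmap (chart_at p) p.

(* v |-> v *m to_chart phi p maps the components of a tangent vector at p in
   chart_at p to its components in phi. *)
Definition to_chart phi p : 'M[R]_n :=
  jacobian (cmap phi \o cinv (chart_at p)) (cmap_at p).

(* The inverse change of components, at the point with phi-coordinates z. *)
Definition from_chart phi z : 'M[R]_n :=
  jacobian (cmap (chart_at (cinv phi z)) \o cinv phi) z.

Definition smooth_fun (f : M -> R) : Prop :=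
  forall phi, atlas phi -> smooth_on (cimg phi) (f \o cinv phi).

Definition smooth_curve (c : R -> M) : Prop :=
  continuous c /\
  forall phi, atlas phi -> smooth_on [set t | cdom phi (c t)] (cmap phi \o c).

Definition velocity (c : R -> M) (t : R) : 'rV[R]_n :=
  'D_1 (cmap (chart_at (c t)) \o c) t.

Definition vfield_rep (X : M -> 'rV[R]_n) phi z : 'rV[R]_n :=
  X (cinv phi z) *m to_chart phi (cinv phi z).

Record vfield := VField {
  vfun :> M -> 'rV[R]_n;
  vfield_smooth : forall phi, atlas phi ->
    smooth_on (cimg phi) (vfield_rep vfun phi) }.

(* L_X f = X f. *)
Definition lie_fun (X : vfield) (f : M -> R) : M -> R :=
  fun p => 'D_(X p) (f \o cinv (chart_at p)) (cmap_at p).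

Definition metric_rep (h : M -> 'M[R]_n) phi z : 'M[R]_n :=
  from_chart phi z *m h (cinv phi z) *m (from_chart phi z)^T.

Record riemannian_metric := RiemannianMetric {
  gram :> M -> 'M[R]_n;
  gram_sym : forall p, (gram p)^T = gram p;
  gram_pos : forall p (v : 'rV[R]_n), v != 0 -> 0 < (v *m gram p *m v^T) 0 0;
  gram_smooth : forall phi, atlas phi ->
    smooth_on (cimg phi) (metric_rep gram phi) }.

Definition curve_length (h : riemannian_metric) (c : R -> M) : R :=
  \int[lebesgue_measure]_(t in `[0, 1])
     Num.sqrt ((velocity c t *m h (c t) *m (velocity c t)^T) 0 0).

(* piecewise_path h x y l: some piecewise smooth path from x to y has length
   l. *)
Inductive piecewise_path (h : riemannian_metric) : M -> M -> R -> Prop :=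
| path_const x : piecewise_path h x x 0
| path_cons (c : R -> M) y l : smooth_curve c -> piecewise_path h (c 1) y l ->
    piecewise_path h (c 0) y (curve_length h c + l).

(* +oo if x and y lie in different components. *)
Definition hdist (h : riemannian_metric) x y : \bar R :=
  ereal_inf [set l%:E | l in piecewise_path h x y].

Definition hball (h : riemannian_metric) x (r : R) : set M :=
  [set y | (hdist h x y < r%:E)%E].

(* An alternating n-linear form on R^n, as a function of the n rows of a
   matrix. *)
Definition alternating_form (a : 'M[R]_n -> R) : Prop :=
  (forall A B C (i : 'I_n) (b c : R),
     row i A = b *: row i B + c *: row i C ->
     row' i B = row' i A -> row' i C = row' i A -> a A = b * a B + c * a C) /\
  (forall A (i j : 'I_n), i != j -> row i A = row j A -> a A = 0).

(* The ambient vector space of all families w of functions of n tangent vectors;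
   n-forms are singled out by is_form below. *)
Definition preform : Type := M -> 'M[R]_n -> R^o.

Implicit Types w : preform.

(* The pull-back of w along cinv phi. *)
Definition form_rep phi w z A : R := w (cinv phi z) (A *m from_chart phi z).

Definition is_form w : Prop :=
  (forall p, alternating_form (w p)) /\
  (forall phi, atlas phi -> forall A,
     smooth_on (cimg phi) (fun z => form_rep phi w z A)).

Definition supp w : set M := closure [set p | exists A, w p A != 0].

Definition Omega_K (K : set M) : set preform :=
  [set w | is_form w /\ supp w `<=` K].

Definition Omega_c : set preform := [set w | is_form w /\ compact (supp w)].

(* Lie derivative of a covariant tensor field,
   (L_X w)(v_1,..,v_n) = X(w(v_1,..,v_n)) - sum_i w(v_1,..,[X,v_i],..,v_n),
   where the v_i are extended by vector fields with constant components in the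
   chart chart_at p, so that [X,v_i] = - D_{v_i} X there. *)
Definition lie_form (X : vfield) w : preform := fun p A =>
  'D_(X p) (fun z => form_rep (chart_at p) w z A) (cmap_at p) +
  \sum_(i < n) w p (\matrix_j
     if j == i then 'D_(row i A) (vfield_rep X (chart_at p)) (cmap_at p)
     else row j A).

(* The norm induced by h: the absolute value on orthonormal bases (the set
   below is a singleton for alternating a). *)
Definition form_norm (h : riemannian_metric) p (a : 'M[R]_n -> R) : R :=
  sup [set `|a A| | A in [set A | A *m h p *m A^T = 1%:M]].

(* The seminorms of uniform convergence of derivatives on compact subsets of
   charts generate the Frechet topology of Omega_K. *)
Record form_seminorm := FormSeminorm {
  fs_chart : chart R n M;
  fs_chart_atlas : atlas fs_chart;
  fs_cpt : set 'rV[R]_n;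
  fs_compact : compact fs_cpt;
  fs_sub : fs_cpt `<=` cimg fs_chart;
  fs_dirs : seq 'rV[R]_n;
  fs_arg : 'M[R]_n }.

Definition form_seminorm_val (s : form_seminorm) w : R :=
  sup [set `|iterD (fs_dirs s)
                  (fun z => form_rep (fs_chart s) w z (fs_arg s)) z|
      | z in fs_cpt s].

(* Continuous seminorms for the inductive limit topology on Omega_c: seminorms
   whose restriction to each Omega_K is continuous. *)
Definition continuous_seminorm (pn : preform -> R) : Prop :=
  [/\ forall w1 w2, Omega_c w1 -> Omega_c w2 -> pn (w1 + w2) <= pn w1 + pn w2,
      forall (a : R) w, Omega_c w -> pn (a *: w) = `|a| * pn w &
      forall K : set M, compact K ->
        exists (C : R) (ss : seq form_seminorm), forall w, Omega_K K w ->
          pn w <= C * \sum_(s <- ss) form_seminorm_val s w].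

(* Smooth curves into the locally convex space Omega_c: derivatives of all
   orders exist as limits of difference quotients in Omega_c. *)
Definition smooth_form_curve (c : R -> preform) : Prop :=
  exists d : nat -> R -> preform,
    [/\ d 0%N = c, forall k t, Omega_c (d k t) &
        forall k t (pn : preform -> R), continuous_seminorm pn ->
          pn (s^-1 *: (d k (t + s) - d k t) - d k.+1 t) @[s --> 0^'] --> (0 : R)].

End calculus_on_manifolds.

Fixpoint integral_rV (R : realType) (n : nat) : ('rV[R]_n -> R) -> R :=
  match n with
  | 0 => fun f => f 0
  | m.+1 => fun f => \int[lebesgue_measure]_t
      integral_rV (fun v : 'rV[R]_m => f (row_mx t%:M v : 'rV[R]_(1 + m)))
  end.

(* The sign of p |-> orient p in a chart. Orienting point by point (rather than
   chart by chart) also covers charts with disconnected domain and n = 0. *)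
Definition orient_rep (R : realType) (n : nat) (M : manifold R n)
    (o : M -> R) (phi : chart R n M) (z : 'rV[R]_n) : R :=
  o (cinv phi z) * Num.sg (\det (from_chart phi z)).

(* orient p = 1 iff the basis of T_pM given by chart_at p is positive. *)
Record orientation (R : realType) (n : nat) (M : manifold R n) := Orientation {
  orient :> M -> R;
  orient_sign : forall p, orient p = 1 \/ orient p = -1;
  orient_continuous : forall phi, atlas phi -> forall z, cimg phi z ->
    {for z, continuous (orient_rep orient phi)} }.

Section generalized_functions.
Context {R : realType} {n : nat} {M : manifold R n}.
Variable o : orientation M.

Implicit Types (X : vfield M) (K : set M).

(* The linear functional which is the coordinate integral on forms supported in
   the domain of a chart; it is unique on Omega_c by partitions of unity. *)
Definition is_integral (J : preform M -> R) : Prop :=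
  (forall (a : R) (w1 w2 : preform M), Omega_c w1 -> Omega_c w2 ->
     J (a *: w1 + w2) = a * J w1 + J w2) /\
  (forall phi (w : preform M), atlas phi -> Omega_c w -> supp w `<=` cdom phi ->
     J w = integral_rV (fun z => if z \in cimg phi then
             orient_rep o phi z * form_rep phi w z 1%:M else 0)).

Definition integral_form : preform M -> R := xget (fun _ => 0) is_integral.

Definition unitI : set R := [set e | 0 < e <= 1].

(* f e x = O(g e) uniformly for x in D. *)
Definition bigO_unif (T : Type) (D : set T) (f : R -> T -> R) (g : R -> R) :=
  exists e0 C : R, [/\ 0 < e0, 0 < C &
    forall e x, unitI e -> e <= e0 -> D x -> `|f e x| <= C * g e].

(* Only the values at e in I = (0, 1] are meaningful. *)
Definition kernel : Type := R -> M -> preform M.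

(* Smooth I x M -> Omega_c in the convenient sense: smooth curves are mapped to
   smooth curves. *)
Definition smooth_kernel (Phi : kernel) : Prop :=
  forall (e : R -> R) (c : R -> M), smooth_on setT e ->
    (forall t, unitI (e t)) -> smooth_curve c ->
    smooth_form_curve (fun t => Phi (e t) (c t)).

(* Evaluation at y is continuous on Omega_c, so the directional derivative in x
   can be computed pointwise in y. *)
Definition Lx X (Phi : kernel) : kernel := fun e x y A =>
  lie_fun X (fun x' => Phi e x' y A) x.

Definition Ly X (Phi : kernel) : kernel := fun e x => lie_form X (Phi e x).

Definition Lxy X (Phi : kernel) : kernel := fun e x =>
  Lx X Phi e x + Ly X Phi e x.

Definition iterL (L : vfield M -> kernel -> kernel) (Xs : seq (vfield M))
  (Phi : kernel) : kernel := foldr L Phi Xs.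

Definition iter_lie_fun (Xs : seq (vfield M)) (f : M -> R) : M -> R :=
  foldr (@lie_fun R n M) f Xs.

Definition SK1 (h : riemannian_metric M) (Phi : kernel) : Prop :=
  forall K, compact K -> exists e0 C : R, [/\ 0 < e0, 0 < C &
    forall x e, K x -> unitI e -> e < e0 ->
      supp (Phi e x) `<=` hball h x (C * e)].

Definition SK2 (h : riemannian_metric M) (Phi : kernel) : Prop :=
  forall K, compact K -> forall Xs Ys : seq (vfield M),
    bigO_unif (K `*` [set: M])
      (fun e xy => form_norm h xy.2
         (iterL Lxy Xs (iterL Ly Ys Phi) e xy.1 xy.2))
      (fun e => e ^- (n + size Ys)).

Definition SK3 (q : nat) (Phi : kernel) : Prop :=
  forall K, compact K -> forall (Xs : seq (vfield M)) (f : M -> R),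
    smooth_fun f ->
    bigO_unif K
      (fun e x => integral_form (fun y A => f y * iterL Lx Xs Phi e x y A)
                  - iter_lie_fun Xs f x)
      (fun e => e ^+ q.+1).

Definition smoothing_kernels (q : nat) : set kernel :=
  [set Phi | smooth_kernel Phi /\
     forall h : riemannian_metric M, [/\ SK1 h Phi, SK2 h Phi & SK3 q Phi]].

(* Functions on Omega_c x M; values off Omega_c are never used. *)
Definition gfun : Type := preform M -> M -> R.

(* Smooth in the convenient sense. *)
Definition basic_space : set gfun :=
  [set F | forall (w : R -> preform M) (c : R -> M),
     smooth_form_curve w -> smooth_curve c ->
     smooth_on setT (fun t => F (w t) (c t))].

(* d_1 F(w, x)(v). *)
Definition d1 (F : gfun) (w : preform M) (x : M) (v : preform M) : R :=
  'D_1 (fun t : R => F (w + t *: v) x) 0.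

Definition hatL X (F : gfun) : gfun := fun w x =>
  - d1 F w x (lie_form X w) + lie_fun X (F w) x.

Definition moderate_gfun : set gfun :=
  [set F | basic_space F /\
     forall K, compact K -> forall j : nat, exists q N : nat,
     forall Phi, smoothing_kernels q Phi ->
     forall Xs : seq (vfield M), size Xs = j ->
       bigO_unif K (fun e => iter_lie_fun Xs (fun x => F (Phi e x) x))
                   (fun e => e ^- N)].

Definition negligible_gfun : set gfun :=
  [set F | basic_space F /\
     forall K, compact K -> forall j m : nat, exists q : nat,
     forall Phi, smoothing_kernels q Phi ->
     forall Xs : seq (vfield M), size Xs = j ->
       bigO_unif K (fun e => iter_lie_fun Xs (fun x => F (Phi e x) x))
                   (fun e => e ^+ m)].

End generalized_functions.

(* Main.v *)
(* Put Psi = L^{x+y}_X Phi. By the chain rule, hatL_X R evaluated along Phi is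
   L_X (x |-> R(Phi_{e,x}, x)) minus the derivative of R at (Phi_{e,x}, x) in
   the direction Psi_{e,x}; only the second term needs an argument. For smooth a
   on M and any bounded smooth r on (0,1], the kernel Phi + (a - r) Psi is again
   in A_q: for (SK1) points close in a chart are joined by short paths, (SK2)
   follows from [L^y_Y, L^{x+y}_X] = L^y_{[Y,X]}, and in (SK3) Stokes' theorem
   makes the moments of Psi, with their x-derivatives, of order e^(q+1). The
   bounds on R along these kernels are uniform over constants |r| <= B, since a
   sequence of violations would be interpolated by one smooth function r. If a
   is an integer multiple of the coordinate x_i and r its value at a point p,
   the factor a - r vanishes at p, so that the x-derivatives at p of R along the
   perturbed kernel are polynomials in the integer; a Vandermonde combination
   extracts the linear coefficient, which contains the derivatives of R in the
   direction Psi. R is smooth in the convenient sense only, so Boman's theorem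
   is what makes R along kernels smooth in several parameters. *)

(* The definitions bound only x-derivatives of [x |-> F(Phi_{e,x}, x)]; no bound on second
   derivatives of [F] in its first argument is available, so a derivative in the direction Psi
   cannot be obtained from difference quotients in a constant coefficient of Psi. It has to appear
   as part of an x-derivative, hence the coefficient depends on [x], and order [j] for [hatL X F]
   uses the orders up to [j.+1] for [F]. A fixed function [a(x)] does not vanish at all points of
   [K]; subtracting its value at the point brings in a constant that varies with the point, while
   the constants in the definitions depend on the kernel. This is why uniformity in [r] has to be
   produced by interpolation. Only a nonnegative gauge [g e] enters these arguments, so moderateness
   and negligibility are treated at once. In dimension 0 there is no coordinate to perturb with, and
   Psi vanishes. The calculus of curves is developed for spaces with seminorms, because it is
   applied both to normed spaces and to compactly supported forms. *)
Require Import Defs.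
From HB Require Import structures.
From mathcomp Require Import all_boot all_order all_algebra.
From mathcomp Require Import all_classical all_reals all_analysis.
From mathcomp Require Import perm ring lra.
Import Order.TTheory GRing.Theory Num.Theory.
Import numFieldNormedType.Exports.
Local Open Scope classical_set_scope.
Local Open Scope ring_scope.

Set Implicit Arguments.
Unset Strict Implicit.
Unset Printing Implicit Defensive.

Local Notation iterD := Defs.iterD (only parsing).

(** * Curves in locally convex spaces *)

Section negligible_at_zero.
Context {R : realType}.
Implicit Types f g : R -> R.

(** Little-o of [s] at 0, from above only, since [f] will be a seminorm of a remainder. No quotient
    by [s] occurs, so [s = 0] needs no exception. *)
Definition osm f := forall e : R, 0 < e -> \forall s \near 0, f s <= e * `|s|.

Lemma osmD f g : osm f -> osm g -> osm (fun s => f s + g s).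
Proof.
move=> hf hg e e0; have e2 : 0 < e / 2 by lra.
near=> s; have h1 : f s <= e / 2 * `|s| by near: s; apply: hf.
have h2 : g s <= e / 2 * `|s| by near: s; apply: hg.
lra.
Unshelve. all: by end_near. Qed.

Lemma osm_near f g : (\forall s \near 0, f s <= g s) -> osm g -> osm f.
Proof.
move=> fg hg e e0; near=> s; apply: (@le_trans _ _ (g s)); near: s => //.
exact: hg.
Unshelve. all: by end_near. Qed.

Lemma osm_le f g : (forall s, f s <= g s) -> osm g -> osm f.
Proof. by move=> fg; apply: osm_near; near=> s; exact: fg.
Unshelve. all: by end_near. Qed.

Lemma osmZ C f : 0 <= C -> osm f -> osm (fun s => C * f s).
Proof.
move=> C0 hf e e0; have C1 : 0 < C + 1 by lra.
near=> s.
have h : f s <= e / (C + 1) * `|s| by near: s; apply: hf; rewrite divr_gt0.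
have h2 : C * (e / (C + 1) * `|s|) <= e * `|s|.
  rewrite !mulrA ler_wpM2r// ler_pdivrMr//; nra.
by apply: (le_trans _ h2); rewrite ler_wpM2l.
Unshelve. all: by end_near. Qed.

Lemma osm0 : osm (fun=> 0).
Proof. move=> e e0; near=> s; rewrite mulr_ge0// ltW.
Unshelve. all: by end_near. Qed.

Lemma near0_lt (d : R) : 0 < d -> \forall s \near (0 : R), `|s| < d.
Proof.
by move=> d0; apply: (filterS _ (nbhsx_ballx 0 _ d0)) => s; rewrite /ball/= sub0r normrN.
Qed.

Lemma near0P (P : R -> Prop) :
  (\forall s \near 0, P s) -> exists2 d, 0 < d & forall s, `|s| < d -> P s.
Proof.
by move=> /nbhs_ballP[d/= d0 h]; exists d => // s sd; apply: h; rewrite /ball/= sub0r normrN.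
Qed.

Lemma osm_sq (C : R) : 0 <= C -> osm (fun s => C * `|s| ^+ 2).
Proof.
move=> C0 e e0; have C1 : 0 < C + 1 by lra.
near=> s.
have h : `|s| < e / (C + 1) by near: s; apply: near0_lt; rewrite divr_gt0.
rewrite expr2 mulrA ler_wpM2r//.
move: h; rewrite ltr_pdivlMr// => h.
have := normr_ge0 s; nra.
Unshelve. all: by end_near. Qed.

Lemma osm_comp f (u : R -> R) (C : R) : 0 <= C -> f 0 <= 0 ->
  (\forall s \near 0, `|u s| <= C * `|s|) -> osm f -> osm (f \o u).
Proof.
move=> C0 f0 hu hf e e0; have C1 : 0 < C + 1 by lra.
have [d d0 hd] := near0P (hf (e / (C + 1)) (divr_gt0 e0 C1)).
near=> s.
have us : `|u s| <= C * `|s| by near: s.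
have sd : `|s| < d / (C + 1) by near: s; apply: near0_lt; rewrite divr_gt0.
have h : f (u s) <= e / (C + 1) * `|u s|.
  apply: hd; move: sd; rewrite ltr_pdivlMr//; have := normr_ge0 s; nra.
apply: (le_trans h); rewrite mulrAC ler_pdivrMr//.
have := normr_ge0 s; nra.
Unshelve. all: by end_near. Qed.

End negligible_at_zero.

(* The part of the structure of a locally convex space that curves see: a
   subspace cs_set of V with a separating family of seminorms. *)
Record cspace (R : realType) := CSpace {
  cs_sort :> lmodType R;
  cs_set : set cs_sort;
  cs_sn : set (cs_sort -> R);
  cs_set0 : cs_set 0;
  cs_lin : forall a u v, cs_set u -> cs_set v -> cs_set (a *: u + v);
  cs_snD : forall p, cs_sn p -> forall u v, cs_set u -> cs_set v ->
    p (u + v) <= p u + p v;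
  cs_snZ : forall p, cs_sn p -> forall a u, cs_set u -> p (a *: u) = `|a| * p u;
  cs_sep : forall u, cs_set u -> (forall p, cs_sn p -> p u = 0) -> u = 0 }.

(** * Equalities of linear combinations by reflection *)

Section lmod_normalisation.
Context {R : pzRingType} {V : lmodType R}.

Inductive lexp :=
  LAtom of nat | LZero | LAdd of lexp & lexp | LOpp of lexp | LScale of R & lexp.

Fixpoint leval (env : seq V) e : V :=
  match e with
  | LAtom i => nth 0 env i
  | LZero => 0
  | LAdd a b => leval env a + leval env b
  | LOpp a => - leval env a
  | LScale k a => k *: leval env a
  end.

Fixpoint lcoef (i : nat) e : R :=
  match e with
  | LAtom j => if Nat.eqb i j then 1 else 0
  | LZero => 0
  | LAdd a b => lcoef i a + lcoef i b
  | LOpp a => - lcoef i a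
  | LScale k a => k * lcoef i a
  end.

Fixpoint latoms (n : nat) e : bool :=
  match e with
  | LAtom j => Nat.ltb j n
  | LZero => true
  | LAdd a b => latoms n a && latoms n b
  | LOpp a | LScale _ a => latoms n a
  end.

(** Computes to a conjunction of equations between coefficients, which is what the tactic below has
    to prove. *)
Fixpoint lcoef_eq (n : nat) (a b : lexp) : Prop :=
  match n with 0%N => True | n'.+1 => lcoef n' a = lcoef n' b /\ lcoef_eq n' a b end.

Lemma levalE env e : latoms (size env) e ->
  leval env e = \sum_(i < size env) lcoef i e *: nth 0 env i.
Proof.
elim: e => [j||a IHa b IHb|a IHa|k a IHa] /=.
- move=> /PeanoNat.Nat.ltb_lt/ssrnat.ltP jn.
  rewrite (bigD1 (Ordinal jn))//= PeanoNat.Nat.eqb_refl scale1r big1 ?addr0// => i ij.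
  case: PeanoNat.Nat.eqb_spec => [e|_]; last by rewrite scale0r.
  by move/eqP: ij => []; apply: val_inj.
- by move=> _; rewrite big1// => i _; rewrite scale0r.
- move=> /andP[ha hb]; rewrite IHa// IHb// -big_split/=.
  by apply: eq_bigr => i _; rewrite scalerDl.
- by move=> ha; rewrite IHa// -sumrN; apply: eq_bigr => i _; rewrite scaleNr.
- by move=> ha; rewrite IHa// scaler_sumr; apply: eq_bigr => i _; rewrite scalerA.
Qed.

Lemma lcoef_eqP n a b : lcoef_eq n a b -> forall i : 'I_n, lcoef i a = lcoef i b.
Proof.
elim: n => [_ [//]|n IH /= [h1 h2] [i ilt]] /=; have := ilt.
by rewrite ltnS leq_eqVlt => /orP[/eqP->//|i_n]; apply: (IH h2 (Ordinal i_n)).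
Qed.

Lemma leval_eq env a b : latoms (size env) a && latoms (size env) b ->
  lcoef_eq (size env) a b -> leval env a = leval env b.
Proof.
move=> /andP[ha hb] h; rewrite !levalE//; apply: eq_bigr => i _.
by rewrite (lcoef_eqP h).
Qed.

End lmod_normalisation.

Ltac lmod_find x l :=
  lazymatch l with
  | nil => constr:(0%N)
  | cons ?y ?l' => match constr:(tt) with
    | _ => let _ := match constr:(tt) with _ => constr_eq x y end in constr:(0%N)
    | _ => let k := lmod_find x l' in constr:(S k)
    end
  end.
Ltac lmod_in x l :=
  lazymatch l with
  | nil => constr:(false)
  | cons ?y ?l' => match constr:(tt) with
    | _ => let _ := match constr:(tt) with _ => constr_eq x y end in constr:(true)
    | _ => lmod_in x l'
    end
  end.
Ltac lmod_atoms t l :=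
  lazymatch t with
  | 0 => l
  | (?a + ?b) => let l1 := lmod_atoms a l in lmod_atoms b l1
  | (- ?a) => lmod_atoms a l
  | (?k *: ?a) => lmod_atoms a l
  | _ => lazymatch lmod_in t l with true => l | false => constr:(cons t l) end
  end.
Ltac lmod_reify R V t l :=
  lazymatch t with
  | 0 => constr:(@LZero R)
  | (?a + ?b) => let a' := lmod_reify R V a l in let b' := lmod_reify R V b l in
      constr:(@LAdd R a' b')
  | (- ?a) => let a' := lmod_reify R V a l in constr:(@LOpp R a')
  | (?k *: ?a) => let a' := lmod_reify R V a l in constr:(@LScale R k a')
  | _ => let i := lmod_find t l in constr:(@LAtom R i)
  end.
(* Proves equalities between linear combinations in a module V over R, given a
   tactic for the equalities of coefficients. *)
Ltac lmod_with R V tac :=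
  lazymatch goal with |- ?a = ?b =>
    let l0 := constr:(@nil V) in
    let l1 := lmod_atoms a l0 in let l := lmod_atoms b l1 in
    let a' := lmod_reify R V a l in let b' := lmod_reify R V b l in
    refine (@leval_eq R V l a' b' (erefl true) _);
    cbn [lcoef_eq lcoef size PeanoNat.Nat.eqb]; repeat split; tac
  end.

Section cspace_theory.
Context {R : realType} {E : cspace R}.
Implicit Types (u v : E) (a : R) (b c : R -> E) (p : E -> R).
Local Notation S := (@cs_set R E).
Local Notation sn := (@cs_sn R E).
Local Ltac lmod := lmod_with R E ltac:(ring).

Lemma csZ a u : S u -> S (a *: u).
Proof. by move=> Su; rewrite -[_ *: _]addr0; apply: cs_lin => //; apply: cs_set0. Qed.
Lemma csD u v : S u -> S v -> S (u + v).
Proof. by move=> Su Sv; rewrite -[u]scale1r; apply: cs_lin. Qed.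
Lemma csN u : S u -> S (- u).
Proof. by rewrite -scaleN1r; apply: csZ. Qed.
Lemma csB u v : S u -> S v -> S (u - v).
Proof. by move=> Su Sv; apply: csD => //; apply: csN. Qed.
Lemma cs_sum (I : Type) (r : seq I) (F : I -> E) :
  (forall i, S (F i)) -> S (\sum_(i <- r) F i).
Proof. by move=> h; elim/big_ind: _ => //; [exact: cs_set0|exact: csD]. Qed.

Lemma sn0 p : sn p -> p 0 = 0.
Proof. by move=> hp; rewrite -[0](scale0r 0) cs_snZ//; [rewrite normr0 mul0r|exact: cs_set0]. Qed.
Lemma snN p u : sn p -> S u -> p (- u) = p u.
Proof. by move=> hp Su; rewrite -scaleN1r cs_snZ// normrN1 mul1r. Qed.
Lemma sn_ge0 p u : sn p -> S u -> 0 <= p u.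
Proof.
move=> hp Su; have := cs_snD hp Su (csN Su).
by rewrite subrr sn0// snN//; lra.
Qed.
Lemma snB p u v : sn p -> S u -> S v -> p (u - v) <= p u + p v.
Proof. by move=> hp Su Sv; rewrite -[p v]snN//; apply: cs_snD => //; apply: csN. Qed.
Lemma sn_dist p u v : sn p -> S u -> S v -> p (u - v) = p (v - u).
Proof. by move=> hp Su Sv; rewrite -snN// ?opprB//; apply: csB. Qed.
Lemma sn_tri p u v : sn p -> S u -> S v -> p u <= p v + p (u - v).
Proof. by move=> hp Su Sv; rewrite -{1}(subrKC v u); apply: cs_snD => //; apply: csB. Qed.
Lemma sn_sum p (I : Type) (r : seq I) (F : I -> E) : sn p ->
  (forall i, S (F i)) -> p (\sum_(i <- r) F i) <= \sum_(i <- r) p (F i).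
Proof.
move=> hp h; elim: r => [|i r IH]; first by rewrite !big_nil sn0.
rewrite !big_cons; apply: (le_trans (cs_snD hp (h i) _)); first exact: cs_sum.
by rewrite lerD2l.
Qed.

Definition der c t d := forall p, sn p -> osm (fun s => p (c (t + s) - c t - s *: d)).

(** Smooth curves as sequences of successive derivatives, as in [smooth_form_curve]; [NS_SC] and
    [smooth_form_curveP] treat the two instances. *)
Definition SC c := exists d : nat -> R -> E,
  [/\ d 0%N = c, forall k t, S (d k t) & forall k t, der (d k) t (d k.+1 t)].

Lemma SC_S c t : SC c -> S (c t).
Proof. by case=> d [<- h _]. Qed.

(** Derivatives within the class can be chosen one after another. Product and chain rules then need
    no formula for higher derivatives, only a class that is stable under one derivative. *)
Lemma SC_coind (P : (R -> E) -> Prop) :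
  (forall c, P c -> (forall t, S (c t)) /\
     exists2 c', P c' & forall t, der c t (c' t)) ->
  forall c, P c -> SC c.
Proof.
move=> H c Pc.
pose nx c := xget c [set c' | P c' /\ forall t, der c t (c' t)].
have nxP (b : R -> E) : P b -> P (nx b) /\ forall t, der b t (nx b t).
  by move=> /H[_ [c' Pc' dc']]; rewrite /nx; case: xgetP => [y _ //|/(_ c')[]].
have itP k : P (iter k nx c) by elim: k => //= k /nxP[].
exists (fun k => iter k nx c); split => // k t.
- by have /H[+ _] := itP k; apply.
- by have /nxP[_] := itP k; apply.
Qed.

Lemma SC_tail c : SC c -> exists c', SC c' /\ forall t, der c t (c' t).
Proof.
move=> [d [d0 dS dd]]; exists (d 1%N); split; last by rewrite -d0.
by exists (fun k => d k.+1).
Qed.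

Lemma der_ext c b t d : c =1 b -> der c t d -> der b t d.
Proof. by move=> cb; have -> : b = c by apply/funext => s; rewrite cb. Qed.

Lemma der_near c b t d : (\forall s \near 0, c (t + s) = b (t + s)) -> der c t d -> der b t d.
Proof.
move=> cb dc p hp; apply: (osm_near _ (dc p hp)); near=> s.
rewrite (_ : b (t + s) = c (t + s)); last by apply/esym; near: s.
by have /nbhs_singleton := cb; rewrite addr0 => ->.
Unshelve. all: by end_near. Qed.

(** [s (d1 - d2)] is a difference of two remainders, hence o(s) in every seminorm, and the seminorms
    separate points. *)
Lemma der_unique c t d1 d2 : (forall s, S (c s)) -> S d1 -> S d2 ->
  der c t d1 -> der c t d2 -> d1 = d2.
Proof.
move=> Sc S1 S2 h1 h2; apply/subr0_eq/cs_sep; first exact: csB.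
move=> p hp; apply: le_anti; rewrite sn_ge0 ?andbT//; last exact: csB.
apply/ler_addgt0Pl => e e0; rewrite addr0.
have /near0P[d d0 hd] := osmD (h1 p hp) (h2 p hp) e0.
have [s [s0 sd]] : exists s, 0 < s /\ s < d by exists (d / 2); split; lra.
have sE : `|s| = s by rewrite ger0_norm// ltW.
have /hd : `|s| < d by rewrite sE.
set u := c (t + s) - c t; rewrite sE.
have Su : S u by apply: csB.
have := snB hp (csB Su (csZ s S2)) (csB Su (csZ s S1)).
rewrite [X in p X](_ : _ = s *: (d1 - d2)); last first.
  lmod.
rewrite cs_snZ//; last exact: csB.
rewrite sE => k1 k2.
have : s * p (d1 - d2) <= e * s by lra.
by rewrite mulrC ler_pM2r.
Qed.

Lemma der_cst v t : S v -> der (fun=> v) t 0.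
Proof. by move=> Sv p hp; rewrite subrr; under eq_fun do rewrite scaler0 subr0 sn0//; exact: osm0. Qed.

Lemma derD c b t d e : (forall s, S (c s)) -> (forall s, S (b s)) -> S d -> S e ->
  der c t d -> der b t e -> der (fun s => c s + b s) t (d + e).
Proof.
move=> Sc Sb Sd Se h1 h2 p hp; apply: osm_le (osmD (h1 p hp) (h2 p hp)) => s.
rewrite [X in p X <= _](_ : _ = (c (t + s) - c t - s *: d) + (b (t + s) - b t - s *: e)).
  apply: cs_snD => //; do !apply: csB => //; exact: csZ.
lmod.
Qed.

Lemma derZ a c t d : (forall s, S (c s)) -> S d -> der c t d ->
  der (fun s => a *: c s) t (a *: d).
Proof.
move=> Sc Sd h p hp; apply: osm_le (osmZ (normr_ge0 a) (h p hp)) => s.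
rewrite -cs_snZ//; last by do !apply: csB => //; exact: csZ.
by rewrite !scalerBr !scalerA mulrC.
Qed.

Lemma der_bound c t d : (forall s, S (c s)) -> S d -> der c t d ->
  forall p, sn p -> \forall s \near 0, p (c (t + s) - c t) <= (p d + 1) * `|s|.
Proof.
move=> Sc Sd h p hp; near=> s.
have h1 : p (c (t + s) - c t - s *: d) <= 1 * `|s| by near: s; apply: h.
have := cs_snD hp (csB (csB (Sc (t + s)) (Sc t)) (csZ s Sd)) (csZ s Sd).
by rewrite subrK cs_snZ//; lra.
Unshelve. all: by end_near. Qed.

Lemma der_cont c t d : (forall s, S (c s)) -> S d -> der c t d ->
  forall p, sn p -> forall e, 0 < e -> \forall s \near 0, p (c (t + s) - c t) < e.
Proof.
move=> Sc Sd h p hp e e0.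
have C0 : 0 < p d + 1 by have := sn_ge0 hp Sd; lra.
near=> s.
have h1 : p (c (t + s) - c t) <= (p d + 1) * `|s| by near: s; exact: (der_bound Sc Sd h hp).
have h2 : `|s| < e / (p d + 1) by near: s; apply: near0_lt; rewrite divr_gt0.
by move: h2; rewrite ltr_pdivlMr//; lra.
Unshelve. all: by end_near. Qed.

Lemma der_sum (I : Type) (r : seq I) (c : I -> R -> E) (d : I -> E) t :
  (forall i s, S (c i s)) -> (forall i, S (d i)) -> (forall i, der (c i) t (d i)) ->
  der (fun s => \sum_(i <- r) c i s) t (\sum_(i <- r) d i).
Proof.
move=> Sc Sd h; elim: r => [|i r IH].
  rewrite big_nil; apply: (@der_ext (fun=> 0)); first by move=> s; rewrite big_nil.
  exact/der_cst/cs_set0.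
rewrite big_cons; apply: (@der_ext (fun s => c i s + \sum_(j <- r) c j s)).
  by move=> s; rewrite big_cons.
by apply: derD => // [s|]; exact: cs_sum.
Qed.

(* A supremum argument: p is only subadditive, so the mean value theorem does
   not apply to t |-> p (c t). *)
Lemma der_mvt c c' p (x y B : R) : (forall t, S (c t)) -> (forall t, S (c' t)) ->
  sn p -> x <= y ->
  (forall t, x <= t <= y -> der c t (c' t)) ->
  (forall t, x <= t <= y -> p (c' t) <= B) -> p (c y - c x) <= B * (y - x).
Proof.
move=> Sc Sc' hp xy dc pc.
apply/ler_addgt0Pl => e' e'0.
pose e := e' / (y - x + 1).
have e0 : 0 < e by rewrite divr_gt0//; lra.
suff : p (c y - c x) <= (B + e) * (y - x).
  move=> /le_trans; apply; rewrite mulrDl addrC lerD2r /e mulrAC ler_pdivrMr; last lra.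
  nra.
(* The bound is propagated from [x] as far as possible with slope [B + e]; the slack [e] absorbs the
   remainder of the derivative. *)
pose T := [set t | x <= t <= y /\ forall u : R, x <= u <= t -> p (c u - c x) <= (B + e) * (u - x)].
have Tx : T x.
  split; first by rewrite lexx.
  by move=> u; rewrite -eq_le => /eqP <-; rewrite !subrr sn0// mulr0.
have hT : has_sup T by split; [exists x|exists y => t [/andP[]]].
set m := sup T.
have xm : x <= m by apply: sup_ubound => //; case: hT.
have my : m <= y by apply: sup_le_ub; [exists x|move=> t [/andP[]]].
have mB : p (c' m) <= B by apply: pc; rewrite xm.
(* Used on both sides of [m]: to the left it puts [m] into [T], to the right it carries [T] beyond
   [m] unless [m = y]. *)
have /near0P[d d0 hd] : \forall s \near 0, p (c (m + s) - c m) <= (B + e) * `|s|.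
  near=> s.
  have h1 : p (c (m + s) - c m - s *: c' m) <= e * `|s|.
    by near: s; apply: dc => //; rewrite xm.
  have := cs_snD hp (csB (csB (Sc (m + s)) (Sc m)) (csZ s (Sc' m))) (csZ s (Sc' m)).
  rewrite subrK cs_snZ// mulrDl => /le_trans; apply.
  have := normr_ge0 s; nra.
have Tm : forall u : R, x <= u <= m -> p (c u - c x) <= (B + e) * (u - x).
  move=> u /andP[xu]; rewrite le_eqVlt => /orP[/eqP ->|um]; last first.
    have [t [_ Tt] ut] := sup_gt (ltac:(by exists x) : T !=set0) um.
    by apply: Tt; rewrite xu ltW.
  have dm : m - d < m by lra.
  have [t Tt ut] := sup_gt (ltac:(by exists x) : T !=set0) dm.
  have tm : t <= m by apply: sup_ubound => //; case: hT.
  have tx : x <= t by case: Tt => /andP[].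
  have /hd : `|t - m| < d by rewrite distrC ger0_norm; lra.
  rewrite (subrKC m t) (sn_dist hp)// distrC (ger0_norm (_ : 0 <= m - t)); last lra.
  have := Tt.2 t; rewrite tx lexx => /(_ isT).
  have := cs_snD hp (csB (Sc m) (Sc t)) (csB (Sc t) (Sc x)); rewrite addrA subrK.
  lra.
have [->|ym] : y = m \/ m < y by move: my; rewrite le_eqVlt => /orP[/eqP ->|]; [left|right].
  by apply: Tm; rewrite xm lexx.
pose t := Num.min y (m + d / 2).
have tm : m < t by rewrite lt_min ym/=; lra.
have ty : t <= y by rewrite ge_min lexx.
have td : t <= m + d / 2 by rewrite ge_min lexx orbT.
suff : T t by move=> Tt; have := sup_ubound (proj2 hT) Tt; rewrite -/m; lra.
split; first by rewrite ty andbT; lra.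
move=> u /andP[xu ut].
have [um|mu] := leP u m; first by apply: Tm; rewrite xu.
have /hd : `|u - m| < d by rewrite ger0_norm; lra.
rewrite (subrKC m u) (ger0_norm (_ : 0 <= u - m)); last lra.
have := Tm m; rewrite xm lexx => /(_ isT).
have := cs_snD hp (csB (Sc u) (Sc m)) (csB (Sc m) (Sc x)); rewrite addrA subrK.
lra.
Unshelve. all: by end_near. Qed.

Lemma der_mvt_abs c c' p (x r B : R) : (forall t, S (c t)) -> (forall t, S (c' t)) ->
  sn p -> (forall u : R, `|u| <= `|r| -> der c (x + u) (c' (x + u))) ->
  (forall u : R, `|u| <= `|r| -> p (c' (x + u)) <= B) ->
  p (c (x + r) - c x) <= B * `|r|.
Proof.
move=> Sc Sc' hp dc pc.
have [r0|r0] := leP 0 r.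
  have := @der_mvt c c' p x (x + r) B Sc Sc' hp.
  rewrite (_ : x + r - x = r) ?(ger0_norm r0); last lra.
  apply => [|t /andP[t1 t2]|t /andP[t1 t2]]; first lra.
  - rewrite -(subrKC x t); apply: dc; rewrite !ger0_norm; lra.
  - rewrite -(subrKC x t); apply: pc; rewrite !ger0_norm; lra.
have rE : `|r| = - r by rewrite ltr0_norm.
have := @der_mvt c c' p (x + r) x B Sc Sc' hp.
rewrite {1}(_ : x - (x + r) = - r) ?(ltr0_norm r0) 1?sn_dist//; last lra.
apply => [|t /andP[t1 t2]|t /andP[t1 t2]]; first lra.
- rewrite -(subrKC x t); apply: dc; rewrite rE ler_norml; apply/andP; split; lra.
- rewrite -(subrKC x t); apply: pc; rewrite rE ler_norml; apply/andP; split; lra.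
Qed.

End cspace_theory.

(** * Smooth maps between normed spaces *)

Section directional_derivatives.
Context {R : realType} {V W : normedModType R}.
Implicit Types (f g : V -> W) (U : set V).

(** The form of derivative used in [der], through which the rules for curves become available in
    normed spaces. *)
Lemma is_deriveP f x v d :
  is_derive x v f d <-> osm (fun s => `|f (x + s *: v) - f x - s *: d|).
Proof.
split=> [[df dE] e e0|h].
  move: df => /derivable_nbhs/eqaddoP/(_ e e0); rewrite dE.
  apply: filterS => s /=.
  by rewrite opprD !fctE /= [_ *: v + x]addrC addrA; apply.
suff : (fun h => h^-1 *: ((f \o shift x) (h *: v) - f x)) @ 0^' --> d.
  by move=> fd; apply: DeriveDef; [apply/cvg_ex; exists d|exact/cvg_lim].
apply/cvgrPdist_le => e e0.
move: (h e e0); rewrite /dnbhs => he; near=> s.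
have s0 : s != 0 by near: s; exact: nbhs_dnbhs_neq.
have : `|f (x + s *: v) - f x - s *: d| <= e * `|s|.
  by near: s; exact: (cvg_within _ he).
rewrite -ler_pdivrMr ?normr_gt0// mulrC -normfV -normrZ; apply: le_trans.
by rewrite distrC /= [_ *: v + x]addrC (scalerBr _ (f _ - f x)) scalerA mulVf// scale1r.
Unshelve. all: by end_near. Qed.

Lemma smooth_onS U U' f : U' `<=` U -> smooth_on U f -> smooth_on U' f.
Proof. by move=> s h vs x /s; exact: h. Qed.

Lemma smooth_on_cont U f x : smooth_on U f -> U x -> {for x, continuous f}.
Proof. by move=> h Ux; case: (h [::] x Ux). Qed.

Lemma smooth_on_derivable U f x v : smooth_on U f -> U x -> derivable f x v.
Proof. by move=> h Ux; case: (h [::] x Ux). Qed.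

Lemma smooth_on_is_derive U f x v : smooth_on U f -> U x -> is_derive x v f ('D_v f x).
Proof. by move=> h Ux; apply/derivableP; apply: smooth_on_derivable h Ux. Qed.

Lemma iterD_rcons vs v f : iterD (rcons vs v) f = iterD vs ('D_v f).
Proof. by rewrite /iterD foldr_rcons. Qed.

Lemma smooth_onD U f v : smooth_on U f -> smooth_on U ('D_v f).
Proof. by move=> h vs x Ux; rewrite -iterD_rcons; exact: h. Qed.

Lemma smooth_on_iterD U f vs : smooth_on U f -> smooth_on U (iterD vs f).
Proof. by move=> h us x Ux; rewrite /iterD -foldr_cat; exact: h. Qed.

Lemma open_near U x : open U -> U x -> \near x, U x.
Proof. by move=> oU Ux; exact: (open_nbhs_nbhs (conj oU Ux)). Qed.

Lemma eq_on_D U f g v : open U -> {in U, f =1 g} -> {in U, 'D_v f =1 'D_v g}.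
Proof.
move=> oU fg x xU; apply: near_eq_derive; rewrite inE in xU.
by apply: filterS (open_near oU xU) => y Uy; rewrite fg ?inE.
Qed.

Lemma eq_on_iterD U f g vs : open U -> {in U, f =1 g} -> {in U, iterD vs f =1 iterD vs g}.
Proof. by move=> oU fg; elim: vs => //= v vs IH; exact: eq_on_D. Qed.

(** The analogue of [SC_coind]. A derivative has to lie in the class only up to equality on [U]: as
    [U] is open, this does not affect continuity and derivability at its points. *)
Lemma smooth_coind U (P : (V -> W) -> Prop) : open U ->
  (forall f, P f -> (forall x, U x -> {for x, continuous f} /\ forall v, derivable f x v) /\
    forall v, exists2 g, P g & {in U, 'D_v f =1 g}) ->
  forall f, P f -> smooth_on U f.
Proof.
move=> oU HP f Pf vs x Ux.
have [g Pg fg] : exists2 g, P g & {in U, iterD vs f =1 g}.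
  elim: vs => [|v vs [g Pg IH]] /=; first by exists f.
  have [_ /(_ v)[k Pk gk]] := HP _ Pg; exists k => // y yU.
  by rewrite -gk//; exact: (eq_on_D _ oU IH).
have fgx : {near x, g =1 iterD vs f}.
  by apply: filterS (open_near oU Ux) => y Uy; rewrite fg ?inE.
have [/(_ x Ux)[cg dg] _] := HP _ Pg; split; last first.
  by move=> v; exact: (near_eq_derivable fgx).
change (iterD vs f @ x --> iterD vs f x); rewrite -(nbhs_singleton fgx).
exact: (cvg_trans (near_eq_cvg fgx)).
Qed.

Lemma eq_smooth_on U f g : open U -> {in U, f =1 g} -> smooth_on U f -> smooth_on U g.
Proof.
move=> oU fg sf; apply: (@smooth_coind U (fun g => exists2 f, smooth_on U f & {in U, f =1 g})) => //.
  move=> {f g fg sf} g [f sf fg]; split=> [x Ux|v]; last first.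
    exists ('D_v g) => //; exists ('D_v f); [exact: smooth_onD|exact: eq_on_D].
  have fgx : {near x, f =1 g}.
    by apply: filterS (open_near oU Ux) => y Uy; rewrite fg ?inE.
  split; last by move=> v; apply: (near_eq_derivable fgx); exact: smooth_on_derivable Ux.
  change (g @ x --> g x); rewrite -(nbhs_singleton fgx).
  have cf : f @ x --> f x := smooth_on_cont sf Ux.
  apply: cvg_trans cf; apply: near_eq_cvg; exact: fgx.
by exists f.
Qed.

Lemma smooth_on_local U f :
  (forall x, U x -> exists2 U', U' x & smooth_on U' f) -> smooth_on U f.
Proof. by move=> h vs x Ux; have [U' Ox] := h x Ux; apply. Qed.

End directional_derivatives.

Section normed_cspace.
Context {R : realType} (W : normedModType R).

Definition NS : cspace R.
Proof.
refine (@CSpace R W setT [set (@Num.norm R W)] I (fun _ _ _ _ _ => I) _ _ _).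
- by move=> p -> u v _ _; exact: ler_normD.
- by move=> p -> a u _; exact: normrZ.
- by move=> u _ /(_ _ erefl) h; apply/eqP; rewrite -normr_eq0 h.
Defined.

Lemma NS_der (c : R -> W) t d : @der R NS c t d <-> is_derive t 1 c d.
Proof.
rewrite is_deriveP; split=> [/(_ _ erefl) h|h p ->];
  by apply: osm_le h => s; rewrite [s *: 1]mulr1.
Qed.

End normed_cspace.
Arguments NS : clear implicits.
Arguments NS {R} W.

Section cspace_curves.
Context {R : realType} {E : cspace R}.
Implicit Types (c b : R -> E) (a : R -> R) (p : E -> R).
Local Notation S := (@cs_set R E).
Local Notation sn := (@cs_sn R E).
Local Ltac lmod := lmod_with R E ltac:(ring).

Lemma scalar_bound (a : R -> R) (t a1 : R) : is_derive t 1 a a1 ->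
  \forall s \near 0, `|a (t + s) - a t| <= (`|a1| + 1) * `|s|.
Proof.
move=> /NS_der h.
exact: (@der_bound R (NS R^o) a t a1 (fun=> I) I h _ erefl).
Qed.

Lemma der_mul a c (t a1 : R) (c1 : E) : (forall s, S (c s)) -> S c1 ->
  is_derive t 1 a a1 -> der c t c1 ->
  der (fun s => a s *: c s) t (a1 *: c t + a t *: c1).
Proof.
move=> Sc S1 da dc p hp.
have /NS_der/(_ _ erefl) da' := da; have := scalar_bound da => ba.
have Cge : 0 <= (`|a1| + 1) * p c1 by rewrite mulr_ge0 ?sn_ge0// addr_ge0.
have h1 : osm (fun s => (`|a t| + `|a1| + 1) * p (c (t + s) - c t - s *: c1)).
  by apply: osmZ; [rewrite !addr_ge0|exact: dc].
have h2 : osm (fun s => p (c t) * `|a (t + s) - a t - s *: a1|).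
  by apply: osmZ; [exact: sn_ge0|].
apply: (osm_near _ (osmD (osmD h1 h2) (osm_sq Cge))); near=> s.
(* The remainder of [c], the remainder of [a], and [s] times the increment of [a], which is
   O(s^2). *)
rewrite [X in p X](_ : _ = a (t + s) *: (c (t + s) - c t - s *: c1) +
  (a (t + s) - a t - s * a1) *: c t + (s * (a (t + s) - a t)) *: c1); last lmod.
have bs : `|a (t + s) - a t| <= (`|a1| + 1) * `|s| by near: s.
have s1 : `|s| < 1 by near: s; exact: near0_lt.
have as_ : `|a (t + s)| <= `|a t| + `|a1| + 1.
  rewrite -(subrK (a t) (a (t + s))) (le_trans (ler_normD _ _))//.
  have := normr_ge0 a1; nra.
have Sr : S (c (t + s) - c t - s *: c1) by do !apply: csB => //; exact: csZ.
apply: (le_trans (cs_snD hp _ _)); [by apply: csD; exact: csZ|exact: csZ|].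
apply: lerD; last first.
  rewrite cs_snZ// normrM.
  rewrite (_ : _ * p c1 * _ = `|s| * ((`|a1| + 1) * `|s|) * p c1); last ring.
  by rewrite ler_wpM2r ?sn_ge0// ler_wpM2l.
apply: (le_trans (cs_snD hp _ _)); [exact: csZ|exact: csZ|].
rewrite !cs_snZ//; apply: lerD; last by rewrite mulrC.
by rewrite ler_wpM2r// sn_ge0.
Unshelve. all: by end_near. Qed.

Lemma der_comp a c (t a1 : R) (c1 : E) : (forall s, S (c s)) -> S c1 ->
  is_derive t 1 a a1 -> der c (a t) c1 -> der (fun s => c (a s)) t (a1 *: c1).
Proof.
move=> Sc S1 da dc p hp.
have /NS_der/(_ _ erefl) da' := da; have := scalar_bound da => ba.
pose u s := a (t + s) - a t.
have h1 : osm ((fun r => p (c (a t + r) - c (a t) - r *: c1)) \o u).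
  apply: (@osm_comp _ _ _ (`|a1| + 1)) => //.
  - by rewrite addr0 subrr scale0r subrr sn0.
  - exact: dc.
have h2 : osm (fun s => p c1 * `|a (t + s) - a t - s *: a1|).
  by apply: osmZ; [exact: sn_ge0|].
apply: (osm_le _ (osmD h1 h2)) => s /=.
rewrite -[a t + u s]/(a t + (a (t + s) - a t)) subrKC.
rewrite [X in p X](_ : _ = (c (a (t + s)) - c (a t) - u s *: c1) +
  (a (t + s) - a t - s * a1) *: c1); last by rewrite /u; lmod.
apply: (le_trans (cs_snD hp _ _)); [by do !apply: csB => //; exact: csZ|exact: csZ|].
by rewrite lerD2l cs_snZ// mulrC.
Qed.

End cspace_curves.

Section smooth_algebra.
Context {R : realType} {V : normedModType R}.
Implicit Types (U : set V) (a b : V -> R).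

Lemma is_derive_line (W : normedModType R) (f : V -> W) x v d :
  is_derive x v f d <-> is_derive (0 : R) 1 (fun s => f (x + s *: v)) d.
Proof.
rewrite !is_deriveP; split=> h; apply: osm_le h => s;
  by rewrite scale0r addr0 add0r [s *: 1]mulr1.
Qed.

Lemma smooth_cst (W : normedModType R) U (w : W) : open U -> smooth_on U (fun=> w).
Proof.
move=> oU; apply: (@smooth_coind _ _ _ U (fun f => exists w, f = fun=> w)) => //.
  move=> _ [{}w ->]; split=> [x _|v]; first by split; [exact: cvg_cst|move=> v; exact: derivable_cst].
  by exists (fun=> 0); [exists 0|move=> x _; rewrite derive_cst].
by exists w.
Qed.

Lemma is_deriveZf (W : normedModType R) a (f : V -> W) x v da df :
  is_derive x v a da -> is_derive x v f df ->
  is_derive x v (fun y => a y *: f y) (da *: f x + a x *: df).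
Proof.
move=> /is_derive_line ha /is_derive_line/NS_der hf; apply/is_derive_line/NS_der.
have := @der_mul R (NS W) _ _ _ _ _ (fun=> I) I ha hf.
by rewrite !scale0r !addr0.
Qed.

(** The product rule turns one product into a sum of two, so the closure of products under sums is
    stable under derivatives, as [smooth_coind] requires. *)
Inductive smooth_products (W : normedModType R) U : (V -> W) -> Prop :=
| sp_base a f : smooth_on U a -> smooth_on U f -> smooth_products U (fun x => a x *: f x)
| sp_add f g : smooth_products U f -> smooth_products U g ->
    smooth_products U (fun x => f x + g x).

Lemma smooth_products_smooth (W : normedModType R) U (f : V -> W) : open U ->
  smooth_products U f -> smooth_on U f.
Proof.
move=> oU; apply: smooth_coind => // {}f.
elim=> {f} [a f sa sf|f g _ [IH1 IH2] _ [IH1' IH2']].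
  split=> [x Ux|v].
    split; first by apply: cvgZ; [exact: smooth_on_cont Ux|exact: smooth_on_cont Ux].
    by move=> v; apply: ex_derive; exact: (is_deriveZf (smooth_on_is_derive v sa Ux) (smooth_on_is_derive v sf Ux)).
  exists (fun x => 'D_v a x *: f x + a x *: 'D_v f x).
    exact: (sp_add (sp_base (smooth_onD v sa) sf) (sp_base sa (smooth_onD v sf))).
  move=> x; rewrite inE => Ux; apply: derive_val.
  by apply: is_deriveZf; [exact: (smooth_on_is_derive _ sa)|exact: (smooth_on_is_derive _ sf)].
split=> [x Ux|v].
  have [c1 d1] := IH1 _ Ux; have [c2 d2] := IH1' _ Ux.
  by split; [exact: cvgD|move=> v; exact: derivableD].
have [f' Pf' Ef] := IH2 v; have [g' Pg' Eg] := IH2' v.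
exists (fun x => f' x + g' x); first exact: sp_add.
move=> x xU; have Ux := xU; rewrite inE in Ux.
have [_ d1] := IH1 _ Ux; have [_ d2] := IH1' _ Ux.
by rewrite -Ef// -Eg//; exact: deriveD.
Qed.

Lemma smooth_scale (W : normedModType R) U a (f : V -> W) : open U ->
  smooth_on U a -> smooth_on U f -> smooth_on U (fun x => a x *: f x).
Proof. by move=> oU sa sf; apply: smooth_products_smooth => //; exact: sp_base. Qed.

Lemma smooth_mul U a b : open U ->
  smooth_on U a -> smooth_on U b -> smooth_on U (fun x => a x * b x).
Proof. exact: smooth_scale. Qed.

Lemma smooth_add (W : normedModType R) U (f g : V -> W) : open U ->
  smooth_on U f -> smooth_on U g -> smooth_on U (fun x => f x + g x).
Proof.
move=> oU sf sg; apply: smooth_products_smooth => //.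
have h (k : V -> W) : smooth_on U k -> smooth_products U k.
  move=> sk; rewrite (_ : k = fun x => (fun=> 1) x *: k x); last first.
    by apply/funext => x; rewrite scale1r.
  exact: (@sp_base W U (fun=> 1) k (smooth_cst _ oU) sk).
by apply: sp_add; exact: h.
Qed.

Lemma smooth_scalec (W : normedModType R) U (k : R) (f : V -> W) : open U ->
  smooth_on U f -> smooth_on U (fun x => k *: f x).
Proof. by move=> oU sf; apply: (@smooth_scale W U (fun=> k)) => //; exact: smooth_cst. Qed.

Lemma smooth_opp (W : normedModType R) U (f : V -> W) : open U ->
  smooth_on U f -> smooth_on U (fun x => - f x).
Proof.
move=> oU sf; rewrite (_ : (fun x => _) = fun x => -1 *: f x); first exact: smooth_scalec.
by apply/funext => x; rewrite scaleN1r.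
Qed.

Lemma smooth_sub (W : normedModType R) U (f g : V -> W) : open U ->
  smooth_on U f -> smooth_on U g -> smooth_on U (fun x => f x - g x).
Proof. by move=> oU sf sg; apply: smooth_add => //; exact: smooth_opp. Qed.

Lemma smooth_sum (W : normedModType R) U (I : Type) (r : seq I) (f : I -> V -> W) :
  open U -> (forall i, smooth_on U (f i)) -> smooth_on U (fun x => \sum_(i <- r) f i x).
Proof.
move=> oU h; elim: r => [|i r IH].
  by under eq_fun do rewrite big_nil; exact: smooth_cst.
by under eq_fun do rewrite big_cons; exact: smooth_add.
Qed.

Lemma smooth_prod U (I : Type) (r : seq I) (f : I -> V -> R) :
  open U -> (forall i, smooth_on U (f i)) -> smooth_on U (fun x => \prod_(i <- r) f i x).
Proof.
move=> oU h; elim: r => [|i r IH].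
  by under eq_fun do rewrite big_nil; exact: smooth_cst.
by under eq_fun do rewrite big_cons; exact: (@smooth_mul U (f i) _ oU (h i) IH).
Qed.

Lemma is_derive_unique (W : normedModType R) (f : V -> W) x v d1 d2 :
  is_derive x v f d1 -> is_derive x v f d2 -> d1 = d2.
Proof. by move=> [_ <-] [_ <-]. Qed.

End smooth_algebra.

Section smooth_curves.
Context {R : realType} {E : cspace R}.
Implicit Types (c b : R -> E) (a : R -> R) (p : E -> R).
Local Notation S := (@cs_set R E).
Local Notation sn := (@cs_sn R E).
Local Ltac lmod := lmod_with R E ltac:(ring).

Lemma SC_cst v : S v -> SC (fun=> v : E).
Proof.
move=> Sv; exists (fun k _ => if k is 0%N then v else 0); split=> // [[|k] _|[|k] t] //.
- exact: cs_set0.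
- exact: der_cst.
- exact/der_cst/cs_set0.
Qed.

Lemma SC_add c b : SC c -> SC b -> SC (fun s => c s + b s).
Proof.
move=> [d [<- dS dd]] [e [<- eS ee]].
exists (fun k s => d k s + e k s); split=> // [k t|k t]; first exact: csD.
by apply: derD.
Qed.

Inductive mul_class : (R -> E) -> Prop :=
| mul_base a c : smooth_on setT a -> SC c -> mul_class (fun s => a s *: c s)
| mul_sum c b : mul_class c -> mul_class b -> mul_class (fun s => c s + b s).

Lemma SC_mul a c : smooth_on setT a -> SC c -> SC (fun s => a s *: c s).
Proof.
move=> ha hc; apply: (@SC_coind R E mul_class); last exact: mul_base.
move=> {a c ha hc} x; elim=> {x} [a c sa sc|c b _ [Sc [c' Pc dc]] _ [Sb [b' Pb db]]].
  split; first by move=> t; apply: csZ; exact: SC_S.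
  have [c' [sc' dc]] := SC_tail sc.
  exists (fun s => 'D_1 a s *: c s + a s *: c' s).
    exact: mul_sum (mul_base (smooth_onD _ sa) sc) (mul_base sa sc').
  move=> t; apply: der_mul => //; [by move=> s; exact: SC_S|exact: SC_S|].
  exact: (smooth_on_is_derive _ sa).
split; first by move=> t; exact: csD.
exists (fun s => c' s + b' s); first exact: mul_sum.
have Sc' : forall s, S (c' s) by move=> s; elim: Pc s => [a d _ sd s|d e _ Hd _ He s];
  [apply: csZ; exact: SC_S|exact: csD].
have Sb' : forall s, S (b' s) by move=> s; elim: Pb s => [a d _ sd s|d e _ Hd _ He s];
  [apply: csZ; exact: SC_S|exact: csD].
by move=> t; apply: derD.
Qed.

Lemma SC_scale k c : SC c -> SC (fun s => k *: c s).
Proof. by move=> hc; apply: (@SC_mul (fun=> k)) => //; apply: smooth_cst; exact: openT. Qed.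


(** The chain rule produces the derivative of [a] as a factor; therefore the class contains products
    with scalar functions. *)
Inductive comp_class a : (R -> E) -> Prop :=
| comp_base (b : R -> R) c : smooth_on setT b -> SC c -> comp_class a (fun s => b s *: c (a s))
| comp_sum c b : comp_class a c -> comp_class a b -> comp_class a (fun s => c s + b s).

Lemma SC_comp a c : smooth_on setT a -> SC c -> SC (fun s => c (a s)).
Proof.
move=> sa sc; apply: (@SC_coind R E (comp_class a)); last first.
  rewrite (_ : (fun s => _) = fun s => (fun=> 1) s *: c (a s)).
    exact: (@comp_base a (fun=> 1) c (smooth_cst _ openT) sc).
  by apply/funext => s; rewrite scale1r.
have PS x : comp_class a x -> forall s, S (x s).
  elim=> [b d _ sd s|d e _ Hd _ He s]; last exact: csD.
  by apply: csZ; exact: SC_S.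
move=> {c sc} x Px; split; first exact: PS.
elim: Px => {x} [b c sb sc|c b Pc [c' Pc' dc] Pb [b' Pb' db]]; last first.
  exists (fun s => c' s + b' s); first exact: comp_sum.
  by move=> t; apply: derD => //; exact: PS.
have [c' [sc' dc]] := SC_tail sc.
exists (fun s => 'D_1 b s *: c (a s) + (b s * 'D_1 a s) *: c' (a s)).
  apply: comp_sum; first exact: (comp_base _ (smooth_onD _ sb) sc).
  exact: (comp_base _ (smooth_mul openT sb (smooth_onD _ sa)) sc').
move=> t; rewrite -scalerA; apply: der_mul; [by move=> s; exact: SC_S|by apply: csZ; exact: SC_S|exact: (smooth_on_is_derive _ sb)|].
apply: der_comp => //; [by move=> s; exact: SC_S|exact: SC_S|exact: (smooth_on_is_derive _ sa)].
Qed.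

(** Equality has to be kept on a neighbourhood in the induction, because the derivative at a point
    depends on the curve around it. *)
Lemma der_near_eq (d e : nat -> R -> E) (t : R) :
  (forall k s, S (d k s)) -> (forall k s, der (d k) s (d k.+1 s)) ->
  (forall k s, S (e k s)) -> (forall k s, der (e k) s (e k.+1 s)) ->
  (\forall s \near t, d 0%N s = e 0%N s) -> forall k, \forall s \near t, d k s = e k s.
Proof.
move=> dS dd eS ee h; elim=> // k /near_join IH; near=> s.
apply: (der_unique (t := s) (dS k)) => //.
apply: der_near (ee k s).
have : \forall u \near s, d k u = e k u by near: s; exact: IH.
move=> /nbhs_ballP[r/= r0 hr]; apply: filterS (near0_lt r0) => u ur.
by rewrite hr// /ball/= opprD addNKr normrN.
Unshelve. all: by end_near. Qed.

Lemma SC_local c :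
  (forall t : R, exists2 b, SC b & \forall s \near t, c s = b s) -> SC c.
Proof.
move=> h; have h' : forall t : R, exists b, SC b /\ \forall s \near t, c s = b s.
  by move=> t; have [b] := h t; exists b.
have [b hb] := choice h'.
have /(@choice _ _ _)[d hd] : forall t, exists d : nat -> R -> E,
    [/\ d 0%N = b t, forall k s, S (d k s) & forall k s, der (d k) s (d k.+1 s)].
  by move=> t; case: (hb t) => [[d]] ? ?; exists d.
have d0 t : d t 0%N = b t by case: (hd t).
have dS t k s : S (d t k s) by case: (hd t).
have dd t k s : der (d t k) s (d t k.+1 s) by case: (hd t).
have dE t k : \forall s \near t, d s k s = d t k s.
  have /near_join cb := (hb t).2; near=> s.
  have cs : \forall u \near s, c u = b t u by near: s; exact: cb.
  have bs : \forall u \near s, d s 0%N u = d t 0%N u.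
    by rewrite !d0; apply: filterS2 cs (hb s).2 => u -> ->.
  exact: (nbhs_singleton (der_near_eq (dS s) (dd s) (dS t) (dd t) bs k)).
(* At [t] the derivatives are those of the local model chosen for [t]; by [dE] the models chosen at
   nearby points give the same values. *)
exists (fun k t => d t k t); split=> [|//|k t].
  by apply/funext => t; rewrite d0 -(nbhs_singleton (hb t).2).
apply: der_near (dd t k t).
move: (dE t k) => /nbhs_ballP[r/= r0 hr]; apply: filterS (near0_lt r0) => u ur.
by rewrite -hr// /ball/= opprD addNKr normrN.
Unshelve. all: by end_near. Qed.

Lemma der_lin (E' : cspace R) (T : E -> E') c t d :
  (forall k u v, S u -> S v -> T (k *: u + v) = k *: T u + T v) ->
  (forall p : E' -> R, @cs_sn _ E' p -> exists C p0,
     [/\ 0 <= C, sn p0 & forall u, S u -> p (T u) <= C * p0 u]) ->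
  (forall s, S (c s)) -> S d -> der c t d -> der (fun t => T (c t)) t (T d).
Proof.
move=> Tl Tsn Sc Sd dc p hp; have [C [p0 [C0 hp0 pT]]] := Tsn _ hp.
apply: osm_le (osmZ C0 (dc _ hp0)) => s.
have TB u v : S u -> S v -> T (u - v) = T u - T v.
  by move=> Su Sv; rewrite addrC -scaleN1r Tl// scaleN1r addrC.
have TZ (a : R) u : S u -> T (a *: u) = a *: T u.
  move=> Su; rewrite -[a *: u]addr0 Tl//; last exact: cs_set0.
  by rewrite -(subrr u) TB// subrr addr0.
apply: le_trans (pT _ _); last by apply: csB; [exact: csB|exact: csZ].
by rewrite !TB// ?TZ//; [exact: csB|exact: csZ].
Qed.

Lemma SC_lin (E' : cspace R) (T : E -> E') c :
  (forall u, S u -> cs_set (T u)) ->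
  (forall k u v, S u -> S v -> T (k *: u + v) = k *: T u + T v) ->
  (forall p : E' -> R, @cs_sn _ E' p -> exists C p0,
     [/\ 0 <= C, sn p0 & forall u, S u -> p (T u) <= C * p0 u]) ->
  SC c -> SC (fun t => T (c t)).
Proof.
move=> TS Tl Tsn [d [<- dS dd]].
exists (fun k t => T (d k t)); split=> // [k t|k t]; first exact: TS.
exact: der_lin (dd k t).
Qed.

End smooth_curves.

Lemma NS_SC {R : realType} {W : normedModType R} (c : R -> W) :
  @SC R (NS W) c <-> smooth_on setT c.
Proof.
split=> [sc|sc].
  apply: (@smooth_coind _ _ _ setT (fun c => @SC R (NS W) c)) => //; first exact: openT.
  move=> {c sc} c sc; have [c' [sc' dc]] := SC_tail sc.
  have dc1 (x : R) : is_derive x 1 c (c' x) by apply/NS_der.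
  have dcv (x v : R) : is_derive x v c (v *: c' x).
    have /is_deriveP h := dc1 x; apply/is_deriveP => e e0.
    have v0 : 0 <= `|v| by [].
    have h2 := @osm_comp _ _ (fun s => s * v) `|v| v0 _ _ h.
    suff h3 : osm ((fun s : R => `|c (x + s%:A) - c x - s *: c' x|) \o  *%R^~ v).
      apply: filterS (h3 e e0) => s /=.
      by rewrite [_%:A]mulr1 scalerA.
    apply: h2.
    - by rewrite scale0r addr0 subrr sub0r scale0r normrN normr0.
    - by near=> s; rewrite normrM mulrC.
  split=> [x _|v].
    split; last by move=> v; apply: ex_derive; exact: dcv.
    by apply: differentiable_continuous; apply/derivable1_diffP; apply: ex_derive; exact: dc1.
  exists (fun x => v *: c' x); first exact: SC_scale.
  by move=> x _; apply: derive_val; exact: dcv.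
exists (fun k => iter k (fun f : R -> W => 'D_(1 : R) f) c); split=> // k t.
apply/NS_der; apply: smooth_on_is_derive (I : setT t).
by elim: k => //= k IH; exact: smooth_onD.
Unshelve. all: by end_near. Qed.

Lemma is_derive_inv {R : realType} {V : normedModType R} (f : V -> R) x v d :
  f x != 0 -> is_derive x v f d ->
  is_derive x v (fun y => (f y)^-1) (- (f x) ^- 2 * d).
Proof.
move=> f0 [df <-]; apply: DeriveDef; first exact: derivableV.
by rewrite deriveV.
Qed.

(** * Taylor expansion and division by powers of the parameter *)

Section taylor.
Context {R : realType} {E : cspace R}.
Implicit Types (d : nat -> R -> E) (p : E -> R).
Local Notation S := (@cs_set R E).
Local Notation sn := (@cs_sn R E).
Local Ltac lmod := lmod_with R E ltac:(ring).

Lemma derN (c : R -> E) t x : (forall s, S (c s)) -> S x -> der c t x ->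
  der (fun s => - c s) t (- x).
Proof.
move=> Sc Sx h; rewrite -scaleN1r; apply: (@der_ext R E (fun s => -1 *: c s)).
  by move=> s; rewrite scaleN1r.
exact: derZ.
Qed.

Definition tay d k (t r : R) : E := \sum_(l < k) (r ^+ l / l`!%:R) *: d l t.

Lemma tay_S d k t r : (forall k t, S (d k t)) -> S (tay d k t r).
Proof. by move=> dS; apply: cs_sum => l; exact: csZ. Qed.

Lemma tayS d k t r :
  tay d k.+1 t r = d 0%N t + \sum_(l < k) (r ^+ l.+1 / l.+1`!%:R) *: d l.+1 t.
Proof. by rewrite /tay big_ord_recl/= expr0 fact0 divr1 scale1r. Qed.

Lemma tay0 d k t : tay d k.+1 t 0 = d 0%N t.
Proof. by rewrite tayS big1 ?addr0// => l _; rewrite expr0n mul0r scale0r. Qed.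

Lemma is_derive_expfact l (u : R) :
  is_derive u 1 (fun r : R => r ^+ l.+1 / l.+1`!%:R) (u ^+ l / l`!%:R).
Proof.
have h : is_derive u 1 (fun r : R => r ^+ l.+1) (l.+1%:R * u ^+ l).
  apply: DeriveDef; first exact: exprn_derivable.
  by rewrite exp_derive /= [_ *: 1]mulr1.
have := @is_deriveZf R R R (fun=> l.+1`!%:R^-1) (fun r : R => r ^+ l.+1) u 1 0 _ (is_derive_cst _ _ _) h.
rewrite scale0r add0r.
rewrite (_ : (fun y => _) = fun r : R => r ^+ l.+1 / l.+1`!%:R); last first.
  by apply/funext => r; rewrite mulrC.
move/is_derive_eq; apply.
rewrite /= factS natrM invfM; change (l.+1%:R^-1 * l`!%:R^-1 * (l.+1%:R * u ^+ l) = u ^+ l / l`!%:R).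
have : l`!%:R != 0 :> R by rewrite pnatr_eq0 -lt0n fact_gt0.
have : l.+1%:R != 0 :> R by rewrite pnatr_eq0.
move: (l.+1%:R) (l`!%:R) => x y x0 y0; field; by rewrite x0 y0.
Qed.

Lemma der_tay d k t u : (forall k t, S (d k t)) ->
  der (fun r => tay d k.+1 t r) u (tay (fun l => d l.+1) k t u).
Proof.
move=> dS; under eq_fun do rewrite tayS.
rewrite -[tay _ _ _ _]add0r.
refine (@derD R E (fun=> d 0%N t) (fun r => \sum_(l < k) (r ^+ l.+1 / l.+1`!%:R) *: d l.+1 t)
  u 0 (tay (fun l => d l.+1) k t u) _ _ _ _ _ _) => //.
- by move=> s; apply: cs_sum => i; exact: csZ.
- exact: cs_set0.
- by apply: tay_S.
- exact: der_cst.
apply: der_sum => [i s|i|i]; [exact: csZ|exact: csZ|].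
rewrite -[_ *: _]addr0 -(scaler0 _ (u ^+ i.+1 / i.+1`!%:R)).
apply: (@der_mul R E (fun r : R => r ^+ i.+1 / i.+1`!%:R) (fun=> d i.+1 t)) => //.
- exact: cs_set0.
- exact: is_derive_expfact.
- exact: der_cst.
Qed.

Lemma der_shift (c : R -> E) t u x : (forall s, S (c s)) -> S x ->
  der c (t + u) x -> der (fun s => c (t + s)) u x.
Proof.
move=> Sc Sx h; rewrite -[x]scale1r.
apply: (@der_comp R E (fun s : R => t + s)) => //.
by have := is_deriveD (is_derive_cst t u 1) (is_derive_id u 1); rewrite add0r.
Qed.

(** The derivative of the remainder of order [k.+1] is the remainder of order [k] of the shifted
    sequence, and the mean value inequality integrates its bound. The factor [1 / k!] is given
    up. *)
Lemma taylor d p B t r k : (forall k t, S (d k t)) ->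
  (forall k t, der (d k) t (d k.+1 t)) -> sn p ->
  (forall u : R, `|u| <= `|r| -> p (d k (t + u)) <= B) ->
  p (d 0%N (t + r) - tay d k t r) <= B * `|r| ^+ k.
Proof.
move=> + + hp; elim: k d r => [|k IH] d r dS dd h.
  by rewrite /tay big_ord0 subr0 expr0 mulr1; apply: h.
have B0 : 0 <= B by apply: (le_trans (sn_ge0 hp (dS k.+1 (t + 0)))); apply: h; rewrite normr0.
pose c u := d 0%N (t + u) - tay d k.+1 t u.
pose c' u := d 1%N (t + u) - tay (fun l => d l.+1) k t u.
have Sc u : S (c u) by apply: csB => //; exact: tay_S.
have Sc' u : S (c' u) by apply: csB => //; apply: tay_S.
have := @der_mvt_abs R E c c' p 0 r (B * `|r| ^+ k) Sc Sc' hp.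
rewrite exprSr mulrA (_ : c 0 = 0) ?subr0 ?add0r; last by rewrite /c addr0 tay0 subrr.
apply => u ur.
  rewrite add0r /c /c'; apply: derD.
  - by move=> s.
  - by move=> s; apply: csN; exact: tay_S.
  - by [].
  - by apply: csN; apply: tay_S.
  - exact: der_shift.
  - by apply: derN; [move=> s; exact: tay_S|apply: tay_S|exact: der_tay].
rewrite add0r; apply: (le_trans (IH (fun l => d l.+1) u _ _ _)) => //.
  by move=> v vu; apply: h; exact: le_trans ur.
by rewrite ler_wpM2l// lerXn2r// ?nnegrE.
Qed.


(* x = y / s^m extends smoothly to 0 when y vanishes there to order m: the
   derivative of x is (s y' - m y) / s^(m+1), which is of the same kind. *)
Definition divided (x : R -> E) := exists m (d : nat -> R -> E),
  [/\ forall k t, S (d k t), forall k t, der (d k) t (d k.+1 t),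
      forall i, (i < m)%N -> d i 0 = 0,
      x 0 = m`!%:R^-1 *: d m 0 & forall s, s != 0 -> x s = s ^- m *: d 0%N s].

Lemma divided_SC x : divided x -> SC x.
Proof.
apply: SC_coind => {}x [m [d [dS dd d0 x0 xs]]].
have Sx t : S (x t).
  by have [->|t0] := eqVneq t 0; [rewrite x0|rewrite xs//]; exact: csZ.
split=> //.
(* The [k]-th derivative of [s y' - m y]. At 0 it is [k - m] times the [k]-th derivative of [y],
   hence 0 for [k <= m]. *)
pose e k s := s *: d k.+1 s + (k%:R - m%:R) *: d k s.
have eS k t : S (e k t) by apply: csD; exact: csZ.
have ed k t : der (e k) t (e k.+1 t).
  have -> : e k.+1 t = (1 *: d k.+1 t + t *: d k.+2 t) + (k%:R - m%:R) *: d k.+1 t.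
    rewrite /e -natr1; lmod.
  apply: derD; [by move=> s; exact: csZ|by move=> s; exact: csZ|by apply: csD; exact: csZ|exact: csZ| |].
    by apply: der_mul => //; exact: is_derive_id.
  exact: derZ.
pose x' s := if s == 0 then m.+1`!%:R^-1 *: d m.+1 0 else s ^- m.+1 *: e 0%N s.
exists x'.
  exists m.+1, e; split=> //.
  - move=> i im; rewrite /e scale0r add0r.
    move: im; rewrite ltnS leq_eqVlt => /orP[/eqP->|im]; first by rewrite subrr scale0r.
    by rewrite d0// scaler0.
  - rewrite /x' eqxx /e scale0r add0r -natr1 addrAC subrr add0r scale1r//.
  - by move=> s s0; rewrite /x' (negbTE s0).
move=> t; have [->|t0] := eqVneq t 0; last first.
  rewrite /x' (negbTE t0).
  have tm0 : t ^+ m != 0 by rewrite expf_eq0 (negbTE t0) andbF.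
  have hd : is_derive t 1 (fun s : R => s ^- m) (- (m%:R) * t ^- m.+1).
    have hm : is_derive t 1 (fun s : R => s ^+ m) (m%:R * t ^+ m.-1).
      apply: DeriveDef; first exact: exprn_derivable.
      by rewrite exp_derive /= [_ *: 1]mulr1.
    have := @is_derive_inv R R (fun s : R => s ^+ m) t 1 _ tm0 hm.
    move/is_derive_eq; apply.
    change (- (t ^+ m) ^- 2 * (m%:R * t ^+ m.-1) = - m%:R * t ^- m.+1).
    case: (m) => [|k]; first by rewrite mul0r mulr0 oppr0 mul0r.
    rewrite /= !exprS; field.
    by rewrite t0 /= expf_eq0 (negbTE t0) andbF.
  have := @der_mul R E (fun s : R => s ^- m) (d 0%N) t _ _ (dS 0%N) (dS 1%N t) hd (dd 0%N t).
  rewrite (_ : _ + _ = t ^- m.+1 *: e 0%N t); last first.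
    rewrite /e; lmod_with R E idtac.
    + rewrite !exprS; field; by rewrite t0 /= expf_eq0 (negbTE t0) andbF.
    + rewrite !exprS; field; by rewrite t0 /= expf_eq0 (negbTE t0) andbF.
  apply: der_near; near=> s; rewrite xs//.
  have : `|s| < `|t| by near: s; apply: near0_lt; rewrite normr_gt0.
  apply: contraTneq => /eqP; rewrite addrC addr_eq0 => /eqP ->.
  by rewrite normrN ltxx.
move=> p hp; rewrite /x' eqxx.
have : exists B, \forall s \near 0, p (d m.+2 s) <= B.
  exists (p (d m.+2 0) + 1); near=> s.
  have h : p (d m.+2 (0 + s) - d m.+2 0) < 1 by near: s; exact: (der_cont (dS m.+2) _ (dd m.+2 0)).
  rewrite add0r in h.
  by apply: (le_trans (sn_tri hp (dS _ _) (dS m.+2 0))); rewrite lerD2l ltW.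
move=> [B /near0P[r r0 hB]].
have B0 : 0 <= B by apply: (le_trans (sn_ge0 hp (dS m.+2 0))); apply: hB; rewrite normr0.
apply: osm_near (osm_sq B0); near=> s.
rewrite add0r; have [->|s0] := eqVneq s 0.
  by rewrite subrr scale0r subrr sn0// mulr_ge0// exprn_ge0.
have sm0 : s ^+ m != 0 by rewrite expf_eq0 (negbTE s0) andbF.
have sm_gt0 : 0 < `|s ^+ m| by rewrite normr_gt0.
have := @taylor d p B 0 s m.+2 dS dd hp.
have sr : `|s| < r by near: s; exact: near0_lt.
have hBu u : `|u| <= `|s| -> p (d m.+2 (0 + u)) <= B.
  by move=> us; rewrite add0r; apply: hB; exact: le_lt_trans sr.
move=> /(_ hBu); rewrite add0r /tay big_ord_recr big_ord_recr/= big1 ?add0r; last first.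
  by move=> i _; rewrite d0 ?scaler0.
move=> h; rewrite -(ler_pM2l sm_gt0) -cs_snZ//; last by apply: csB; [exact: csB|do !apply: csZ].
rewrite mulrCA normrX -exprD addn2.
apply: le_trans h; rewrite le_eqVlt; apply/orP; left; apply/eqP; congr p.
rewrite xs// x0; lmod_with R E idtac.
- by rewrite !mulr0 !subr0 mulr1 mulfV// addr0 subr0.
- by move: (m`!%:R^-1) (m.+1`!%:R^-1) (s ^- m) => x1 x2 x3; rewrite exprS; ring.
- by move: (m`!%:R^-1) (m.+1`!%:R^-1) (s ^- m) => x1 x2 x3; rewrite exprS; ring.
Unshelve. all: by end_near. Qed.

(** Hadamard's lemma: the difference quotient [r] is smooth through 0. In the chain rule it writes a
    curve of forms as a line whose direction varies smoothly. *)
Lemma hadamard (w : R -> E) : SC w -> exists r : R -> E,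
  [/\ SC r, forall s, w s = w 0 + s *: r s & der w 0 (r 0)].
Proof.
move=> [d [<- dS dd]].
pose r s := if s == 0 then d 1%N 0 else s^-1 *: (d 0%N s - d 0%N 0).
exists r; split; last by rewrite /r eqxx.
- apply: divided_SC.
  exists 1%N, (fun k s => d k s - (if k is 0%N then d 0%N 0 else 0)); split.
  + by move=> k t; apply: csB => //; case: k => // *; exact: cs_set0.
  + move=> k t; apply: derD => //.
    * by move=> s; apply: csN; case: k => // *; exact: cs_set0.
    * by apply: csN; exact: cs_set0.
    * rewrite oppr0; case: k => [|k]; first by apply: der_cst; exact: csN.
      by apply: der_cst; apply: csN; exact: cs_set0.
  + by case=> // _; rewrite subrr.
  + by rewrite /r eqxx subr0 invr1 scale1r.
  + by move=> s s0; rewrite /r (negbTE s0) expr1.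
- move=> s; rewrite /r; have [->|s0] := eqVneq s 0; first by rewrite scale0r addr0.
  by rewrite scalerA mulfV// scale1r subrKC.
Qed.

End taylor.

Opaque Defs.smooth_on.

Section smooth_real_valued.
Context {R : realType} {V : normedModType R}.
Implicit Types (f g : V -> R) (U : set V).

Lemma smooth_addR U f g : open U ->
  smooth_on U f -> smooth_on U g -> smooth_on U (fun x => f x + g x).
Proof. exact: smooth_add. Qed.

Lemma smooth_oppR U f : open U -> smooth_on U f -> smooth_on U (fun x => - f x).
Proof. exact: smooth_opp. Qed.

Lemma smooth_subR U f g : open U ->
  smooth_on U f -> smooth_on U g -> smooth_on U (fun x => f x - g x).
Proof. exact: smooth_sub. Qed.

Lemma smooth_sumR U (I : Type) (r : seq I) (f : I -> V -> R) :
  open U -> (forall i, smooth_on U (f i)) -> smooth_on U (fun x => \sum_(i <- r) f i x).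
Proof. exact: smooth_sum. Qed.

End smooth_real_valued.

Section composition_on_the_line.
Context {R : realType}.

Lemma is_derive_comp1 (V W : normedModType R) (f : R -> W) (a : V -> R) x v (a1 : R) (f1 : W) :
  is_derive x v a a1 -> is_derive (a x) 1 f f1 ->
  is_derive x v (fun s => f (a s)) (a1 *: f1).
Proof.
move=> /is_derive_line ha /NS_der hf; apply/is_derive_line/NS_der.
by apply: (@der_comp R (NS W)) => //; rewrite scale0r addr0.
Qed.

Lemma is_derive_param (V : normedModType R) (x v : V) t :
  is_derive (t : R) 1 (fun s : R => x + s *: v) v.
Proof.
apply/is_deriveP; apply: osm_le (osm0) => s.
rewrite [s *: 1]mulr1 (_ : _ - s *: v = 0) ?normr0//.
by lmod_with R V ltac:(ring).
Qed.

Lemma smooth_comp1 (W : normedModType R) (f : R -> W) (a : R -> R) :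
  smooth_on setT a -> smooth_on setT f -> smooth_on setT (fun s => f (a s)).
Proof. by move=> ha /NS_SC hf; apply/NS_SC; exact: (@SC_comp R (NS W)). Qed.

Lemma smooth_id (V : normedModType R) : smooth_on setT (@id V).
Proof.
apply: (@smooth_coind _ V V setT (fun f => f = id \/ exists c, f = fun=> c)); [exact: openT| |by left].
move=> _ [->|[c ->]]; (split; [move=> x _; split=> [|v]|move=> v]).
- exact: cvg_id.
- exact: derivable_id.
- by exists (fun=> v); [right; exists v|move=> x _; rewrite derive_id].
- exact: cvg_cst.
- exact: derivable_cst.
- by exists (fun=> 0); [right; exists 0|move=> x _; rewrite derive_cst].
Qed.

Lemma smooth_affine (a b : R) : smooth_on setT (fun x : R => a * x + b).
Proof.
apply: smooth_add; [exact: openT| |exact/smooth_cst/openT].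
by apply: smooth_mul; [exact: openT|exact/smooth_cst/openT|exact: smooth_id].
Qed.

Lemma is_derive_affine (a b t : R) : is_derive t 1 (fun x : R => a * x + b) a.
Proof.
have := is_deriveD (is_deriveZf (is_derive_cst a t 1) (is_derive_id t 1)) (is_derive_cst b t 1).
by move/is_derive_eq; apply; rewrite scale0r add0r addr0 [_ *: 1]mulr1.
Qed.

(** By the quotient rule the functions [g / f ^+ k] with [g] smooth are stable under derivatives. *)
Lemma smooth_inv (V : normedModType R) (U : set V) (f : V -> R) : open U ->
  (forall x, U x -> f x != 0) -> smooth_on U f -> smooth_on U (fun x => (f x)^-1).
Proof.
move=> oU f0 sf.
apply: (@smooth_coind _ V R U (fun h => exists (g : V -> R) k,
    smooth_on U g /\ h = fun x => (f x) ^- k * g x)) => //; last first.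
  by exists (fun=> 1), 1%N; split; [exact: smooth_cst|apply/funext => x; rewrite mulr1].
move=> _ [g [k [sg ->]]].
have D x v : U x -> is_derive x v (fun x => (f x) ^- k * g x)
    (f x ^- k.+1 * ('D_v g x * f x - k%:R * 'D_v f x * g x)).
  move=> Ux; have fx := f0 _ Ux; have fk : f x ^+ k != 0 by rewrite expf_eq0 (negbTE fx) andbF.
  have hf := smooth_on_is_derive v sf Ux; have hg := smooth_on_is_derive v sg Ux.
  have hfk : is_derive x v (fun x => f x ^+ k) (k%:R * f x ^+ k.-1 * 'D_v f x).
    have hm : is_derive (f x) 1 (fun s : R => s ^+ k) (k%:R * f x ^+ k.-1).
      apply: DeriveDef; first exact: exprn_derivable.
      by rewrite exp_derive /= [_ *: 1]mulr1.
    by have := is_derive_comp1 hf hm; move/is_derive_eq; apply; exact: mulrC.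
  have := is_deriveZf (@is_derive_inv R V (fun x => f x ^+ k) x v _ fk hfk) hg.
  move/is_derive_eq; apply.
  change (- f x ^+ k ^- 2 * (k%:R * f x ^+ k.-1 * 'D_v f x) * g x + f x ^- k * 'D_v g x =
    f x ^- k.+1 * ('D_v g x * f x - k%:R * 'D_v f x * g x)).
  case: (k) => [|m]; first by rewrite !mul0r mulr0 !mul0r expr0 add0r subr0; field.
  by rewrite /= !exprS; field; rewrite fx /= expf_eq0 (negbTE fx) andbF.
split=> [x Ux|v].
  split; last by move=> v; apply: ex_derive; exact: D.
  apply: cvgM; last exact: smooth_on_cont Ux.
  apply: cvgV; first by rewrite expf_eq0 (negbTE (f0 _ Ux)) andbF.
  exact: (@continuous_comp _ _ _ f (fun y => y ^+ k) x (smooth_on_cont sf Ux) (@exprn_continuous _ k (f x))).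
exists (fun x => f x ^- k.+1 * ('D_v g x * f x - k%:R * 'D_v f x * g x)).
  exists (fun x => 'D_v g x * f x - k%:R * 'D_v f x * g x), k.+1; split; last by [].
  have sDf := smooth_onD v sf; have sDg := smooth_onD v sg.
  apply: (smooth_subR oU (smooth_mul oU sDg sf)).
  apply: (smooth_mul oU _ sg); apply: (smooth_mul oU _ sDf); exact: smooth_cst.
by move=> x; rewrite inE => Ux; apply: derive_val; exact: D.
Qed.

End composition_on_the_line.

(** * Boman's theorem *)

Section plateau_functions.
Context {R : realType}.
Implicit Types (p : {poly R}) (x y : R).

Lemma pow_le_exp k : exists C : R, 0 <= C /\ forall y, 0 <= y -> y ^+ k <= C * expR y.
Proof.
(* The inequality [1 + u <= expR u] at [u = y / k.+1], raised to the power [k.+1], gives the first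
   term; the summand 1 is for [y < 1]. *)
exists (k.+1%:R ^+ k.+1 + 1); split; first by rewrite addr_ge0// exprn_ge0.
move=> y y0.
have k0 : 0 < k.+1%:R :> R by rewrite ltr0n.
have h : (y / k.+1%:R) ^+ k.+1 <= expR y.
  rewrite [y in expR y](_ : y = y / k.+1%:R * k.+1%:R); last by rewrite mulfVK// gt_eqF.
  rewrite expRM_natr lerXn2r ?nnegrE ?expR_ge0// ?divr_ge0// ?ltW//.
  by apply: lt_le_trans (expR_ge1Dx _); rewrite ltrDr.
have {h} : y ^+ k.+1 <= k.+1%:R ^+ k.+1 * expR y.
  by move: h; rewrite expr_div_n ler_pdivrMr ?exprn_gt0// mulrC.
have e1 : 1 <= expR y by rewrite -expR0 ler_expR.
rewrite mulrDl mul1r; have [y1|/ltW y1] := leP 1 y.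
  rewrite exprS => h; apply: le_trans (_ : y * y ^+ k <= _); last lra.
  by rewrite ler_peMl// exprn_ge0.
have : y ^+ k <= 1 by rewrite exprn_ile1.
have : 0 <= k.+1%:R ^+ k.+1 * expR y :> R by rewrite mulr_ge0 ?exprn_ge0// expR_ge0.
lra.
Qed.

Lemma poly_le_exp p : exists C : R, 0 <= C /\ forall y, 0 <= y -> `|p.[y]| <= C * expR y.
Proof.
have [C hC] := choice pow_le_exp.
exists (\sum_(i < size p) `|p`_i| * C i); split.
  by apply: sumr_ge0 => i _; rewrite mulr_ge0//; case: (hC i).
move=> y y0; rewrite horner_coef (le_trans (ler_norm_sum _ _ _))// mulr_suml.
apply: ler_sum => i _; rewrite normrM -mulrA ler_wpM2l// ger0_norm ?exprn_ge0//.
by case: (hC i) => _; apply.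
Qed.

(** The polynomial makes these functions stable under derivatives: differentiating
    [p(1/x) exp(-1/x)] replaces [p] by ['X^2 (p - p')]. *)
Definition flat p x := if 0 < x then p.[x^-1] * expR (- x^-1) else 0.

Lemma is_derive_flat p x : is_derive x 1 (flat p) (flat ('X^2 * (p - p^`())) x).
Proof.
have [x0|x0|xE] := ltrgtP 0 x; last rewrite -xE {x xE}.
- have : is_derive x 1 (fun x => p.[x^-1] * expR (- x^-1)) (flat ('X^2 * (p - p^`())) x).
    have hi : is_derive x 1 (fun x => x^-1) (- x ^- 2 * 1).
      by apply: (@is_derive_inv R R id) => //; rewrite gt_eqF.
    have hp : is_derive (x^-1) 1 (horner p) (p^`()).[x^-1].
      by apply: DeriveDef; [exact: derivable_horner|rewrite derivE derive1E].
    have h1 := is_derive_comp1 hi hp.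
    have hn : is_derive x 1 (fun x => - x^-1) (- (- x ^- 2 * 1)) by exact: is_deriveN hi.
    have h2 := is_derive_comp1 hn (is_derive_expR _).
    have := is_deriveZf h1 h2; move/is_derive_eq; apply.
    rewrite /flat x0 hornerM hornerXn hornerD hornerN.
    change (- x ^- 2 * 1 * p^`().[x^-1] * expR (- x^-1) + p.[x^-1] * (- (- x ^- 2 * 1) * expR (- x^-1)) =
      x^-1 ^+ 2 * (p.[x^-1] - p^`().[x^-1]) * expR (- x^-1)).
    rewrite exprVn; ring.
  apply: near_eq_is_derive; near=> y; rewrite /flat.
  suff -> : 0 < y by [].
  by near: y; exact: (open_near (@open_gt R 0) x0).
- rewrite {2}/flat ltNge ltW//=.
  have : is_derive x 1 (fun=> 0 : R) 0 by exact: is_derive_cst.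
  apply: near_eq_is_derive; near=> y; rewrite /flat.
  suff : y < 0 by move=> ?; rewrite ltNge ltW.
  by near: y; exact: (open_near (@open_lt R 0) x0).
- rewrite {2}/flat ltxx; apply/is_deriveP.
  (* The factor ['X^2] yields the bound [C s^2], hence derivative 0 at 0. *)
  have [C [C0 hC]] := poly_le_exp ('X^2 * p).
  apply: osm_le (osm_sq C0) => s; rewrite add0r [s *: 1]mulr1 scaler0 !subr0 /flat ltxx subr0.
  case: ifPn => s0; last by rewrite normr0 mulr_ge0// exprn_ge0.
  have := hC s^-1; rewrite invr_ge0 ltW// => /(_ isT).
  rewrite hornerM hornerXn !normrM normfV (gtr0_norm s0) -invfM -expr2.
  rewrite ler_pdivrMl ?exprn_gt0// => h.
  rewrite (ger0_norm (expR_ge0 _)) expRN ler_pdivrMr ?expR_gt0//.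
  by apply: (le_trans h); rewrite mulrCA mulrA.
Unshelve. all: by end_near. Qed.

Lemma smooth_flat p : smooth_on setT (flat p).
Proof.
apply: (@smooth_coind _ R R setT (fun f => exists p, f = flat p)); [exact: openT| |by exists p].
move=> _ {p} [p ->].
have D x v : is_derive x v (flat p) (v *: flat ('X^2 * (p - p^`())) x).
  have h := is_derive_flat p x; apply/is_derive_line.
  apply: (@is_derive_comp1 R R R (flat p) (fun s => x + s *: v)); last by rewrite scale0r addr0.
  exact: is_derive_param.
split=> [x _|v].
  split; last by move=> v; apply: ex_derive; exact: D.
  by apply/differentiable_continuous/derivable1_diffP; apply: ex_derive; exact: is_derive_flat.
exists (flat ((v *: ('X^2 * (p - p^`()))))); first by eexists.
move=> x _; apply: derive_val; apply: (is_derive_eq (D x v)).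
by rewrite /flat; case: ifP => _; rewrite ?scaler0// hornerZ [LHS]mulrA.
Qed.

Definition step y := flat 1 y / (flat 1 y + flat 1 (1 - y)).

Lemma flat1_gt0 x : 0 < x -> 0 < flat 1 x.
Proof. by move=> x0; rewrite /flat x0 hornerC mul1r expR_gt0. Qed.
Lemma flat1_le0 x : x <= 0 -> flat 1 x = 0.
Proof. by move=> x0; rewrite /flat ltNge x0. Qed.
Lemma flat1_ge0 x : 0 <= flat 1 x.
Proof. by have [/flat1_le0 ->|/flat1_gt0/ltW] := leP x 0. Qed.
Lemma step_den y : 0 < flat 1 y + flat 1 (1 - y).
Proof.
have [y0|y0] := leP y 0.
  by rewrite ltr_wpDl ?flat1_ge0// flat1_gt0//; lra.
by rewrite ltr_pwDl ?flat1_ge0// flat1_gt0.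
Qed.

Lemma smooth_step : smooth_on setT step.
Proof.
have s1 := smooth_flat 1.
have s2 : smooth_on setT (fun y => flat 1 (1 - y)).
  have := smooth_comp1 (smooth_affine (-1) 1) s1.
  by under eq_fun do rewrite mulN1r addrC.
apply: (@smooth_mul _ _ _ (flat 1) (fun y => (flat 1 y + flat 1 (1 - y))^-1) openT s1).
apply: smooth_inv; first exact: openT.
  by move=> x _; rewrite gt_eqF// step_den.
exact: (@smooth_add _ _ _ _ (flat 1) (fun x => flat 1 (1 - x)) openT s1 s2).
Qed.

Lemma step_le0 y : y <= 0 -> step y = 0.
Proof. by move=> y0; rewrite /step flat1_le0// mul0r. Qed.
Lemma step_ge1 y : 1 <= y -> step y = 1.
Proof.
move=> y1; have := step_den y; rewrite /step (@flat1_le0 (1 - y)) ?addr0 => [h|]; last lra.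
by rewrite mulfV// gt_eqF.
Qed.

Definition plateau y := step (3 + 2 * y) * step (3 - 2 * y).

Lemma smooth_plateau : smooth_on setT plateau.
Proof.
apply: smooth_mul; first exact: openT.
- have := smooth_comp1 (smooth_affine 2 3) smooth_step.
  by under eq_fun do rewrite addrC.
- have := smooth_comp1 (smooth_affine (-2) 3) smooth_step.
  by under eq_fun do rewrite mulNr addrC.
Qed.

Lemma plateau1 y : `|y| <= 1 -> plateau y = 1.
Proof. by rewrite ler_norml => /andP[a b]; rewrite /plateau !step_ge1 ?mulr1//; lra. Qed.

Lemma plateau0 y : 3 / 2 <= `|y| -> plateau y = 0.
Proof.
by rewrite /plateau ler_normr => /orP[h|h]; [rewrite (@step_le0 (3 - 2 * y)) ?mulr0|rewrite step_le0 ?mul0r]; lra.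
Qed.

End plateau_functions.

Section bump_series.
Context {R : realType} {W : normedModType R}.
Variable T : nat -> R.
Hypothesis T0 : forall j, 0 < T j.
Hypothesis T4 : forall j, T j.+1 <= T j / 4.
Implicit Types (b : R -> R) (a : nat -> W) (s t : R).

Let Tlt i j : (i < j)%N -> T j <= T i / 4.
Proof.
elim: j => // j IH; rewrite ltnS leq_eqVlt => /orP[/eqP->//|/IH].
have := T4 j; have := T0 j; lra.
Qed.

Let bterm b a j t : W := b (8 * ((t - T j) / T j)) *: a j.

(** The sum over [j] of bumps at [T j] with coefficients [a j]. By [T4] the intervals of radius
    [T j / 4] around the [T j] are disjoint, so at most one term is nonzero and a choice replaces
    the sum. The factor 8 in [bterm] shrinks the support [|y| <= 3/2] of [b] to radius [3/16 T j],
    inside these intervals. *)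
Definition bump_series b a t : W :=
  if pselect (exists j, `|t - T j| < T j / 4) is left h then bterm b a (sval (cid h)) t else 0.

Definition bump_like b := smooth_on setT b /\ forall y, 3 / 2 < `|y| -> b y = 0.

Let bterm0 b a j t : bump_like b -> T j / 4 <= `|t - T j| -> bterm b a j t = 0.
Proof.
move=> [_ b0] h; rewrite /bterm b0 ?scale0r//.
rewrite !normrM normfV (gtr0_norm (T0 j)) ger0_norm// mulrA ltr_pdivlMr//.
by have := T0 j; lra.
Qed.

Lemma bump_series_near b a j t : bump_like b -> T j / 2 < t < T j * 3 / 2 ->
  bump_series b a t = b (8 * ((t - T j) / T j)) *: a j.
Proof.
move=> hb /andP[t1 t2]; rewrite /bump_series; case: pselect => [h|h]; last first.
  rewrite -/(bterm b a j t) bterm0// leNgt; apply/negP => h'; apply: h.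
  by exists j.
case: cid => i /=; rewrite ltr_norml => /andP[h1 h2]; rewrite -/(bterm b a i t).
have [ij|ij|->//] := ltngtP i j.
- by exfalso; have := Tlt ij; have := T0 i; have := T0 j; lra.
- by exfalso; have := Tlt ij; have := T0 i; have := T0 j; lra.
Qed.

Lemma bump_series_away b a t : (forall j, T j / 4 <= `|t - T j|) -> bump_series b a t = 0.
Proof.
move=> h; rewrite /bump_series; case: pselect => // hx; exfalso; case: hx => j.
by rewrite ltNge h.
Qed.

Lemma bump_series_le0 b a t : t <= 0 -> bump_series b a t = 0.
Proof.
move=> t0; apply: bump_series_away => j; have := T0 j => ?.
by rewrite ler0_norm; lra.
Qed.

(** Derivatives of the series multiply the coefficients by powers of [1 / T j]; this decay outweighs
    all of them at 0. *)
Definition rapid a := forall m, exists C, forall j, `|a j| <= C * T j ^+ m.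

Lemma bump_like_bounded b : bump_like b -> exists C, forall y, `|b y| <= C.
Proof.
move=> [sb b0].
have cb : {within `[(- 2 : R), 2], continuous b}.
  by apply: continuous_subspaceT => y; exact: (smooth_on_cont sb).
have cn : {within `[(- 2 : R), 2], continuous (fun y => `|b y|)}.
  by move=> y; apply: cvg_norm; exact: cb.
have [c _ hc] := EVT_max (ltac:(lra) : (-2 : R) <= 2) cn.
exists `|b c| => y; have [y2|y2] := ltP (3 / 2) `|y|; first by rewrite b0// normr0.
by apply: hc; rewrite in_itv/= -ler_norml (le_trans y2)//; lra.
Qed.

Lemma bump_like_D b : bump_like b -> bump_like ('D_1 b).
Proof.
move=> [sb b0].
split; first exact: smooth_onD.
  move=> y y2.
  have : is_derive y 1 (fun=> 0 : R) 0 by exact: is_derive_cst.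
  have o2 : open [set z : R | 3 / 2 < `|z|].
    by apply: (@open_comp _ _ (fun z : R => `|z|) [set z | 3 / 2 < z]) => [z _|];
      [exact: norm_continuous|exact: open_gt].
  move=> h; apply: derive_val; apply: near_eq_is_derive h.
  by apply: filterS (open_near o2 y2) => z /= z2; rewrite b0.
Qed.

(** Termwise differentiation gives a series of the same kind with coefficients [8 / T j * a j]. The
    delicate point is 0: on the [j]-th bump [s] is comparable to [T j], so [a j = O(T j ^+ 2)]
    bounds the series by O(s^2). *)
Lemma bump_series_derive b a (U : set R) t : bump_like b -> U t -> (U 0 -> rapid a) ->
  is_derive t 1 (bump_series b a) (bump_series ('D_1 b) (fun j => (8 / T j) *: a j) t).
Proof.
move=> hb Ut ra; have [sb b0] := hb.
have hb' := bump_like_D hb.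
have [[j tj]|tj] := pselect (exists j, T j / 2 < t < T j * 3 / 2).
  rewrite (@bump_series_near _ _ j)//.
  have ho : open [set s | T j / 2 < s < T j * 3 / 2].
    rewrite (_ : [set s | _] = `]T j / 2, T j * 3 / 2[%classic); first exact: itv_open.
    by apply/seteqP; split=> s /=; rewrite in_itv.
  have : is_derive t 1 (fun t => b (8 * ((t - T j) / T j)) *: a j)
      ('D_1 b (8 * ((t - T j) / T j)) *: ((8 / T j) *: a j)).
    have hd : is_derive t 1 (fun t => 8 * ((t - T j) / T j)) (8 / T j).
      rewrite (_ : (fun t => _) = fun t => (8 / T j) * t + -8); first exact: is_derive_affine.
      by apply/funext => s; field; rewrite gt_eqF.
    have := is_deriveZf (is_derive_comp1 hd (smooth_on_is_derive (1 : R) sb I)) (is_derive_cst (a j) t 1).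
    move/is_derive_eq; apply; rewrite scaler0 addr0 /cst scalerA; congr (_ *: _).
    exact: mulrC.
  apply: near_eq_is_derive.
  by apply: filterS (open_near ho tj) => s hs; rewrite -bump_series_near.
have tj' j : t <= T j / 2 \/ T j * 3 / 2 <= t.
  have [h|h] := leP t (T j / 2); [by left|right].
  by rewrite leNgt; apply/negP => h'; apply: tj; exists j; rewrite h.
(* A positive [t] outside all the intervals from [T j / 2] to [3/2 T j] has a neighbourhood that
   avoids every bump. *)
have away s : `|s - t| < t / 10 -> forall j, T j / 4 <= `|s - T j|.
  rewrite ltr_norml => /andP[h1 h2] j; rewrite leNgt ltr_norml; apply/negP => /andP[h3 h4].
  by have [] := tj' j; lra.
have [t0|t0|t0] := ltrgtP t 0.
- rewrite (bump_series_le0 _ _ (ltW t0)).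
  have : is_derive t 1 (fun=> 0 : W) 0 by exact: is_derive_cst.
  apply: near_eq_is_derive.
  by apply: filterS (open_near (@open_lt R 0) t0) => s /= s0; rewrite bump_series_le0// ltW.
- rewrite (bump_series_away _ _ (away t _)); last by rewrite subrr normr0; lra.
  have : is_derive t 1 (fun=> 0 : W) 0 by exact: is_derive_cst.
  apply: near_eq_is_derive.
  have t10 : 0 < t / 10 by lra.
  apply: filterS (nbhsx_ballx t _ t10) => s; rewrite /ball/= distrC => st.
  by rewrite bump_series_away//; exact: away.
- rewrite {t tj tj' away}t0 in Ut *; rewrite bump_series_le0//; apply/is_deriveP.
  have [C hC] := ra Ut 2%N; have [B hB] := bump_like_bounded hb.
  have C0 : 0 <= C.
    by have := le_trans (normr_ge0 _) (hC 0%N); rewrite pmulr_lge0// exprn_gt0.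
  have B0 : 0 <= B by apply: le_trans (hB 0).
  apply: osm_le (osm_sq (_ : 0 <= B * (C * 4))); last by do !apply: mulr_ge0.
  move=> s; rewrite add0r [s *: 1]mulr1 (bump_series_le0 _ _ (lexx 0)) scaler0 !subr0.
  rewrite /bump_series; case: pselect => [h|_]; last by rewrite normr0 !mulr_ge0// exprn_ge0.
  case: cid => j /= hj; rewrite /bterm normrZ -mulrA.
  apply: ler_pM => //; apply: (le_trans (hC j)); rewrite -mulrA ler_wpM2l//.
  move: hj; rewrite ltr_norml => /andP[h1 h2]; have := T0 j => Tj.
  rewrite ger0_norm; last lra.
  rewrite (_ : 4 * s ^+ 2 = (2 * s) ^+ 2); last ring.
  by rewrite lerXn2r// ?nnegrE; lra.
Qed.

(** The decay condition concerns sets [U] that contain 0. On the positive half-line the bumps are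
    locally finite, and arbitrary values can be interpolated. *)
Lemma smooth_bump_series b a (U : set R) : open U -> bump_like b -> (U 0 -> rapid a) ->
  smooth_on U (bump_series b a).
Proof.
move=> oU hb ha.
apply: (@smooth_coind _ R W U (fun f => exists b a, [/\ bump_like b, U 0 -> rapid a &
  f = bump_series b a])) => //; last by exists b, a.
move=> _ {b a hb ha}[b [a [hb ha ->]]].
have D t v : U t -> is_derive t v (bump_series b a) (v *: bump_series ('D_1 b) (fun j => (8 / T j) *: a j) t).
  move=> Ut; apply/is_derive_line.
  apply: (@is_derive_comp1 R R W (bump_series b a) (fun s => t + s *: v)).
    exact: is_derive_param.
  by rewrite scale0r addr0; apply: bump_series_derive Ut ha.
split=> [t Ut|v].
  split; last by move=> v; apply: ex_derive; exact: D.
  by apply/differentiable_continuous/derivable1_diffP; apply: ex_derive; exact: (bump_series_derive hb Ut).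
exists (bump_series ('D_1 b) (fun j => (v * (8 / T j)) *: a j)).
  exists ('D_1 b), (fun j => (v * (8 / T j)) *: a j); split=> //; first exact: bump_like_D.
  move=> /ha ra m; have [C hC] := ra m.+1; exists (`|v| * (8 * C)) => j.
  rewrite normrZ normrM -!mulrA ler_wpM2l// normrM normfV (gtr0_norm (T0 j)) ger0_norm//.
  rewrite -mulrA ler_wpM2l// ler_pdivrMl//.
  by rewrite mulrCA -exprS.
move=> t; rewrite inE => Ut; apply: derive_val; apply: is_derive_eq (D t v Ut) _.
rewrite /bump_series; case: pselect => [h|_]; last exact: scaler0.
rewrite /bterm !scalerA; congr (_ *: _); ring.
Qed.

End bump_series.

Section interpolation.
Context {R : realType}.

Definition scale4 (j : nat) : R := 4^-1 ^+ j.+1.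

Lemma scale4_gt0 j : 0 < scale4 j.
Proof. by rewrite exprn_gt0// invr_gt0. Qed.

Lemma scale4_4 j : scale4 j.+1 <= scale4 j / 4.
Proof. by rewrite /scale4 exprS mulrC. Qed.

Lemma scale4_le1 j : scale4 j <= 1.
Proof. by rewrite /scale4 exprn_ile1// ?invr_ge0// invf_le1//; lra. Qed.

Lemma scale4_small (d : R) : 0 < d -> exists N, forall j, (N <= j)%N -> scale4 j < d.
Proof.
move=> d0; have h : (fun n => (4^-1 : R) ^+ n) @ \oo --> (0 : R).
  by apply: cvg_expr; rewrite ger0_norm ?invr_ge0// invf_lt1//; lra.
have /cvgrPdist_lt/(_ d d0)[N _ hN] := h.
exists N => j Nj; have := hN j.+1 (leqW Nj).
by rewrite /= sub0r normrN ger0_norm// exprn_ge0// invr_ge0.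
Qed.

Lemma rapid_le (W : normedModType R) (a : nat -> W) (K : R) : 0 <= K ->
  (forall j, `|a j| <= K * scale4 j ^+ j) -> rapid scale4 a.
Proof.
move=> K0 h m.
(* For [j >= m] the power [scale4 j ^+ j] is at most [scale4 j ^+ m]; the sum accounts for the
   finitely many other [j]. *)
exists (K + \sum_(j < m) `|a j| / scale4 j ^+ m) => j.
have sm := exprn_gt0 m (scale4_gt0 j).
have S0 : 0 <= \sum_(j < m) `|a j| / scale4 j ^+ m.
  by apply: sumr_ge0 => i _; rewrite divr_ge0// exprn_ge0// ltW// scale4_gt0.
have [jm|mj] := ltnP j m.
  rewrite mulrDl -[leLHS]add0r lerD ?mulr_ge0// ?(ltW sm)//.
  rewrite (bigD1 (Ordinal jm))//= mulrDl mulfVK ?gt_eqF// lerDl mulr_ge0// ?(ltW sm)//.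
  by apply: sumr_ge0 => i _; rewrite divr_ge0// exprn_ge0// ltW// scale4_gt0.
apply: (le_trans (h j)); rewrite mulrDl -[leLHS]addr0 lerD ?mulr_ge0// ?(ltW sm)//.
rewrite ler_wpM2l//; apply: ler_wiXn2l => //; last exact: scale4_le1.
exact/ltW/scale4_gt0.
Qed.

Lemma bump_like_plateau : bump_like (@plateau R).
Proof. by split; [exact: smooth_plateau|move=> y /ltW; exact: plateau0]. Qed.

Lemma bump_like_mulX : bump_like (fun y : R => y * plateau y).
Proof.
split; first exact: (smooth_mul openT (@smooth_id R R) smooth_plateau).
by move=> y /ltW h; rewrite plateau0// mulr0.
Qed.

(** The special curve lemma. [B1] moves [p] to the points [q j]; [B2], built from [y * plateau y],
    tilts the curve so that it runs along [v] with a known nonzero speed, in which 8 is the factor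
    inside the bumps. The rate [scale4 j ^+ j] makes both series smooth at 0. *)
Lemma curve_through (W : normedModType R) (q : nat -> W) (p v : W) :
  (forall j, `|q j - p| <= scale4 j ^+ j) ->
  exists c : R -> W, [/\ smooth_on setT c, c 0 = p &
    forall j, \forall t \near scale4 j,
      c t = q j + (8 * scale4 j ^+ j / scale4 j * (t - scale4 j)) *: v].
Proof.
move=> hq; pose B1 := bump_series scale4 (@plateau R) (fun j => q j - p).
pose B2 := bump_series scale4 (fun y => y * plateau y) (fun j => scale4 j ^+ j *: v).
have s1 : smooth_on setT B1.
  apply: (smooth_bump_series scale4_gt0 scale4_4 openT bump_like_plateau) => _.
  by apply: (@rapid_le _ _ 1) => // j; rewrite mul1r.
have s2 : smooth_on setT B2.
  apply: (smooth_bump_series scale4_gt0 scale4_4 openT bump_like_mulX) => _.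
  apply: (@rapid_le _ _ `|v|) => // j.
  by rewrite normrZ mulrC ger0_norm// exprn_ge0// ltW// scale4_gt0.
exists (fun t => p + (B1 t + B2 t)); split.
- apply: (smooth_add openT (smooth_cst p openT)); exact: (smooth_add openT s1 s2).
- by rewrite /B1 /B2 !(bump_series_le0 scale4_gt0)// !addr0.
move=> j; have T0 := scale4_gt0 j; have d0 : 0 < scale4 j / 8 by lra.
apply: filterS (nbhsx_ballx _ _ d0) => t; rewrite /ball/= ltr_norml => /andP[h1 h2].
rewrite /B1 /B2 !(@bump_series_near _ _ _ scale4_gt0 scale4_4 _ _ j); first last.
- lra.
- exact: bump_like_plateau.
- lra.
- exact: bump_like_mulX.
have b1 : plateau (8 * ((t - scale4 j) / scale4 j)) = 1.
  rewrite plateau1// !normrM normfV (gtr0_norm T0) ger0_norm// mulrA ler_pdivrMr//.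
  rewrite mul1r -ler_pdivlMl// ler_norml; lra.
rewrite b1 scale1r mulr1 addrA subrKC; congr (_ + _).
rewrite scalerA; congr (_ *: _); field.
by rewrite gt_eqF.
Qed.

(** These weights read off the coefficient of degree [k] of a polynomial of degree below [m] from
    its values at 0, ..., [m - 1]. They serve for finite differences here and for the linear
    coefficient in the perturbation parameter at the end. *)
Lemma vandermonde_weights m k : (k < m)%N ->
  exists b : 'I_m -> R, forall l, (l < m)%N -> \sum_j b j * (j%:R) ^+ l = (l == k)%:R.
Proof.
move=> km; pose a : 'rV[R]_m := \row_j j%:R.
have Vu : Vandermonde m a \in unitmx.
  rewrite unitmxE det_Vandermonde unitfE.
  apply/prodf_neq0 => i _; apply/prodf_neq0 => j ij.
  by rewrite !mxE subr_eq0 eqr_nat gt_eqF.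
pose x := invmx (Vandermonde m a) *m delta_mx (Ordinal km) (0 : 'I_1).
exists (fun j => x j 0) => l lm.
have : (Vandermonde m a *m x) (Ordinal lm) 0 = (l == k)%:R.
  by rewrite mulKVmx// mxE eqxx andbT.
rewrite mxE => <-; apply: eq_bigr => j _.
by rewrite !mxE mulrC.
Qed.

End interpolation.

Section derivative_sequences.
Context {R : realType} {E : cspace R}.
Local Notation S := (@cs_set R E).
Local Notation sn := (@cs_sn R E).

Definition derseq (d : nat -> R -> E) :=
  (forall k t, S (d k t)) /\ (forall k t, der (d k) t (d k.+1 t)).

Lemma derseq_uniq d e t : derseq d -> derseq e ->
  (\forall s \near t, d 0%N s = e 0%N s) -> forall k, d k t = e k t.
Proof.
move=> [dS dd] [eS ee] h k.
exact: (nbhs_singleton (der_near_eq dS dd eS ee h k)).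
Qed.

Lemma derseq_affine d (m r : R) : derseq d -> derseq (fun k s => m ^+ k *: d k (m * s + r)).
Proof.
move=> [dS dd]; split=> k t; first exact: csZ.
rewrite exprSr -scalerA; apply: derZ => //; first by apply: csZ.
exact: (@der_comp R E (fun s => m * s + r) (d k) t m _ (dS k) (dS _ _) (is_derive_affine _ _ _)).
Qed.

End derivative_sequences.

(* Boman's argument: h need only be smooth along smooth curves. Derivatives of
   any order along a fixed direction are locally bounded, since otherwise a
   smooth curve through a fast sequence of bad points would contradict the
   smoothness of h along it. *)
Section boman.
Context {R : realType} {E : cspace R} {W : normedModType R}.
Local Notation S := (@cs_set R E).
Local Notation sn := (@cs_sn R E).
Local Ltac lmod := lmod_with R E ltac:(ring).
Variable h : W -> E.
Hypothesis hsm : forall c : R -> W, smooth_on setT c -> SC (fun t => h (c t)).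

Lemma smooth_param (q v : W) : smooth_on setT (fun r : R => q + r *: v).
Proof.
apply: (smooth_add openT (smooth_cst q openT)).
exact: (smooth_scale openT (@smooth_id R R) (smooth_cst v openT)).
Qed.

Let line_exists : exists D : W * W -> nat -> R -> E, forall vq,
  derseq (D vq) /\ forall r, D vq 0%N r = h (vq.2 + r *: vq.1).
Proof.
have H : forall vq : W * W, exists D : nat -> R -> E,
    derseq D /\ forall r, D 0%N r = h (vq.2 + r *: vq.1).
  move=> [v q]; have [d [d0 dS dd]] := hsm (smooth_param q v).
  by exists d; split=> // r; rewrite d0.
by have [D hD] := choice H; exists D.
Qed.

Definition line v q := sval (cid line_exists) (v, q).
(** The [k]-th derivative of [h] at [q] along [v]. Derivative sequences are chosen for all lines
    separately; [lineE] shows that the choices along one line are consistent. *)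
Definition dline k v q := line v q k 0.

Lemma line_derseq v q : derseq (line v q).
Proof. by rewrite /line; case: cid => D /= /(_ (v, q))[]. Qed.
Lemma line0 v q r : line v q 0%N r = h (q + r *: v).
Proof. by rewrite /line; case: cid => D /= /(_ (v, q))[]. Qed.

Lemma dline_S k v q : S (dline k v q).
Proof. by case: (line_derseq v q) => + _; apply. Qed.

Lemma h_S q : S (h q).
Proof. by have := dline_S 0 0 q; rewrite /dline line0 scaler0 addr0. Qed.

Lemma lineE k v q r : line v q k r = dline k v (q + r *: v).
Proof.
have d1 := line_derseq v (q + r *: v).
have d2 := derseq_affine 1 r (line_derseq v q).
rewrite /dline (derseq_uniq d1 d2); first by rewrite expr1n scale1r mul1r add0r.
near=> s; rewrite /= expr0 scale1r !line0 mul1r scalerDl addrA addrAC.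
Unshelve. all: by end_near. Qed.

Lemma dline_bounded k v q p : sn p -> exists (d B : R), 0 < d /\
  forall q', `|q' - q| < d -> p (dline k v q') <= B.
Proof.
move=> hp; apply: contrapT => hN.
pose m j : R := 8 * scale4 j ^+ j / scale4 j.
have m0 j : 0 < m j by rewrite divr_gt0 ?scale4_gt0// mulr_gt0// exprn_gt0// scale4_gt0.
(* [m j] is the speed of the special curve at time [scale4 j]. There the [k]-th derivative of [h]
   along the curve is [m j ^+ k] times the one along [v], so its seminorm exceeds [j.+1], although
   it is continuous at time 0. *)
have /choice[Q hQ] : forall j, exists q', `|q' - q| <= scale4 j ^+ j /\
    j.+1%:R * (m j ^+ k)^-1 < p (dline k v q').
  move=> j; apply: contrapT => hj; apply: hN.
  exists (scale4 j ^+ j), (j.+1%:R * (m j ^+ k)^-1); split.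
    by rewrite exprn_gt0// scale4_gt0.
  move=> q' qq; rewrite leNgt; apply/negP => hlt; apply: hj.
  by exists q'; split=> //; exact: ltW.
have [c [sc c0 cn]] := curve_through v (fun j => (hQ j).1).
have [d [d0 dS dd]] := hsm sc.
have dE j : d k (scale4 j) = m j ^+ k *: dline k v (Q j).
  have := @derseq_uniq R E d _ (scale4 j) (conj dS dd)
    (derseq_affine (m j) (- (m j * scale4 j)) (line_derseq v (Q j))).
  move=> ->; first by rewrite subrr.
  apply: filterS (cn j) => t ct; rewrite d0 ct expr0 scale1r line0.
  by rewrite -mulrBr.
have Sdk := dS k 0.
have /near0P[r r0 hr] := der_cont (dS k) (dS k.+1 0) (dd k 0) hp ltr01.
have [N hN'] := scale4_small r0.
have [M hM] : exists M, p (d k 0) + 1 <= M%:R.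
  by exists (Num.bound (p (d k 0) + 1)); apply: ltW; apply: archi_boundP; rewrite addr_ge0// sn_ge0.
pose j := (N + M)%N.
have sj : `|scale4 j : R| < r by rewrite gtr0_norm ?scale4_gt0//; apply: hN'; rewrite leq_addr.
have := hr _ sj; rewrite add0r => h1.
have := sn_tri hp (dS k (scale4 j)) Sdk.
rewrite {1}dE cs_snZ//; last exact: dline_S.
rewrite ger0_norm; last by rewrite exprn_ge0// ltW.
have := (hQ j).2; rewrite ltr_pdivrMr ?exprn_gt0// mulrC => h2 h3.
have : (M%:R : R) <= j.+1%:R by rewrite ler_nat /j leqW// leq_addl.
lra.
Qed.

Lemma line_taylor k v q p : sn p -> exists (d B : R), [/\ 0 < d, 0 <= B &
  forall q' r, `|q' - q| < d -> `|r| < d ->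
    p (h (q' + r *: v) - \sum_(l < k) (r ^+ l / l`!%:R) *: dline l v q') <= B * `|r| ^+ k].
Proof.
move=> hp; have [d [B [d0 hB]]] := dline_bounded k v q hp.
have v0 : 0 < `|v| + 1 by rewrite ltr_wpDl.
have v1 : 0 < 2 * (`|v| + 1) by lra.
(* With this radius [q' + u *: v] stays within distance [d] of [q]. *)
exists (d / (2 * (`|v| + 1))), B; split.
- by rewrite divr_gt0.
- by apply: le_trans (hB q _); [apply: sn_ge0 => //; exact: dline_S|rewrite subrr normr0].
move=> q' r; rewrite !ltr_pdivlMr// => qd rd.
have [dS dd] := line_derseq v q'.
have := @taylor R E (line v q') p B 0 r k dS dd hp.
rewrite add0r line0; apply => u ur.
rewrite add0r lineE; apply: hB.
rewrite addrAC; apply: (le_lt_trans (ler_normD _ _)); rewrite normrZ.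
have := normr_ge0 (q' - q); have := normr_ge0 v; have := normr_ge0 u; nra.
Qed.

Lemma h_cont_line q v p (e : R) : sn p -> 0 < e ->
  \forall r \near (0 : R), p (h (q + r *: v) - h q) < e.
Proof.
move=> hp e0; have [dS dd] := line_derseq v q.
have := der_cont (dS 0%N) (dS 1%N 0) (dd 0%N 0) hp e0.
by apply: filterS => s; rewrite add0r !line0 scale0r addr0.
Qed.

Definition fd_weights k (b : 'I_k.+2 -> R) :=
  forall l, (l < k.+2)%N -> \sum_j b j * (j%:R) ^+ l = (l == k)%:R.

(** There are [k.+2] nodes, one more than order [k] asks for, so that the error is O(r^(k+2)). After
    division by [r ^+ k] an error O(r^2) remains, small enough for a further derivative. The bound
    is uniform for base points near [q]. *)
Lemma finite_difference k v q p b : sn p -> @fd_weights k b ->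
  exists (d B : R), [/\ 0 < d, 0 <= B & forall q' r, `|q' - q| < d -> `|r| < d ->
    p (r ^+ k *: dline k v q' - k`!%:R *: \sum_j b j *: h (q' + (j%:R * r) *: v))
      <= B * `|r| ^+ k.+2].
Proof.
move=> hp hb; have [d [B [d0 B0 hd]]] := line_taylor k.+2 v q hp.
have k20 : (0 : R) < k.+2%:R by rewrite ltr0n.
exists (d / k.+2%:R), (k`!%:R * \sum_j (`|b j| * (B * k.+2%:R ^+ k.+2))); split.
- by rewrite divr_gt0.
- apply: mulr_ge0 => //; apply: sumr_ge0 => j _; apply: mulr_ge0; first by [].
  apply: mulr_ge0; [exact: B0|apply: exprn_ge0; exact: ltW].
move=> q' r qd rd.
have {}qd : `|q' - q| < d.
  by apply: lt_le_trans qd _; rewrite ler_pdivrMr// ler_peMr ?(ltW d0)// ler1n.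
have hj (j : 'I_k.+2) : p (h (q' + (j%:R * r) *: v) -
    \sum_(l < k.+2) ((j%:R * r) ^+ l / l`!%:R) *: dline l v q') <= B * k.+2%:R ^+ k.+2 * `|r| ^+ k.+2.
  have jk : (j%:R : R) <= k.+2%:R by rewrite ler_nat ltnW.
  apply: le_trans (hd _ _ qd _) _.
    rewrite normrM ger0_norm//; move: rd; rewrite ltr_pdivlMr// => rd.
    by apply: le_lt_trans rd; rewrite mulrC ler_wpM2l.
  rewrite -mulrA ler_wpM2l// -exprMn lerXn2r ?nnegrE//.
  by rewrite normrM ger0_norm// ler_wpM2r.
pose F j := h (q' + (j%:R * r) *: v) - \sum_(l < k.+2) ((j%:R * r) ^+ l / l`!%:R) *: dline l v q'.
have FS j : S (F j).
  by apply: csB; [exact: h_S|apply: cs_sum => l; apply: csZ; exact: dline_S].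
have k0 : k`!%:R != 0 :> R by rewrite pnatr_eq0 -lt0n fact_gt0.
rewrite (_ : _ - _ = - (k`!%:R *: \sum_j b j *: F j)); last first.
  rewrite /F; under [in RHS]eq_bigr do rewrite scalerBr.
  rewrite sumrB scalerBr opprB; congr (_ - _).
  under eq_bigr do rewrite scaler_sumr.
  rewrite exchange_big/=.
  under eq_bigr => l _ do under eq_bigr => j _ do rewrite scalerA.
  under eq_bigr => l _ do rewrite -scaler_suml.
  have E1 (l : 'I_k.+2) : \sum_(j < k.+2) b j * ((j%:R * r) ^+ l / l`!%:R) = (l == k :> nat)%:R * (r ^+ l / l`!%:R).
    rewrite -hb// mulr_suml; apply: eq_bigr => j _.
    by rewrite exprMn !mulrA.
  under eq_bigr do rewrite E1.
  rewrite (bigD1 (Ordinal (ltnW (ltnSn k.+1))))//= eqxx mul1r big1 ?addr0; last first.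
    move=> l; rewrite -val_eqE /= => /negbTE ->; by rewrite mul0r scale0r.
  by rewrite scalerA mulrC mulfVK.
have SS : S (\sum_j b j *: F j) by apply: cs_sum => j; exact: csZ.
rewrite snN//; last exact: csZ.
rewrite cs_snZ// ger0_norm// -mulrA ler_wpM2l//.
apply: (le_trans (sn_sum _ hp (fun j : 'I_k.+2 => csZ (b j) (FS j)))).
rewrite mulr_suml; apply: ler_sum => j _.
rewrite cs_snZ// -mulrA ler_wpM2l//; exact: hj.
Qed.


(** Once the coefficients below [l] vanish, the term of degree [l] dominates the others for small
    [r], while the whole sum is o(r^l). *)
Lemma poly_vanish (A : nat -> E) k p : sn p -> (forall l, S (A l)) ->
  (forall e : R, 0 < e -> \forall r \near (0 : R),
    p (\sum_(l < k.+1) r ^+ l *: A l) <= e * `|r| ^+ k) ->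
  forall l, (l <= k)%N -> p (A l) = 0.
Proof.
move=> hp AS hA; apply: ltn_ind => l IH lk.
apply: le_anti; rewrite sn_ge0// andbT; apply/ler_addgt0Pl => e' e'0; rewrite addr0.
pose C := \sum_(i < k.+1) p (A i).
have C0 : 0 <= C by apply: sumr_ge0 => i _; exact: sn_ge0.
have e0 : 0 < e' / 2 by lra.
have [d d0 hd] := near0P (hA _ e0).
pose r := Num.min (Num.min (d / 2) 1) (e' / 2 / (C + 1)).
have r0 : 0 < r by rewrite !lt_min divr_gt0// ltr01 divr_gt0//; lra.
have rd : r < d by rewrite !gt_min; apply/orP; left; apply/orP; left; lra.
have r1 : r <= 1 by rewrite !ge_min lexx orbT.
have rC : r * (C + 1) <= e' / 2.
  by rewrite -ler_pdivlMr; [rewrite !ge_min lexx orbT|lra].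
have := hd r; rewrite gtr0_norm// => /(_ rd) h1.
have h2 := sn_tri hp (csZ (r ^+ l) (AS l)) (cs_sum (index_enum 'I_k.+1) (fun i => csZ (r ^+ i) (AS i))).
have {}lk' : (l < k.+1)%N by [].
have := h2; rewrite [X in _ + p X](_ : _ = - \sum_(i < k.+1 | i != Ordinal lk') r ^+ i *: A i); last first.
  by rewrite (bigD1 (Ordinal lk'))//= opprD addrA subrr sub0r.
have Sr : S (\sum_(i < k.+1 | i != Ordinal lk') r ^+ i *: A i).
  by rewrite big_mkcond; apply: cs_sum => i; case: ifP => _; [exact: csZ|exact: cs_set0].
rewrite snN// cs_snZ// ger0_norm ?exprn_ge0 ?(ltW r0)// => h3.
have h4 : p (\sum_(i < k.+1 | i != Ordinal lk') r ^+ i *: A i) <= r ^+ l.+1 * C.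
  rewrite big_mkcond/=; apply: (le_trans (sn_sum _ hp _)) => [i|].
    by case: ifP => _; [exact: csZ|exact: cs_set0].
  rewrite mulr_sumr; apply: ler_sum => i _; case: ifPn => il; last first.
    by rewrite sn0// mulr_ge0 ?sn_ge0// exprn_ge0// ltW.
  rewrite cs_snZ// ger0_norm ?exprn_ge0 ?(ltW r0)//.
  have [il'|li] := ltnP i l; first by rewrite IH ?mulr0//; exact: leq_trans (ltnW il') lk.
  rewrite ler_wpM2r ?sn_ge0//; apply: ler_wiXn2l => //; first exact: ltW.
  by rewrite ltn_neqAle li andbT eq_sym.
have h5 : r ^+ k <= r ^+ l by apply: ler_wiXn2l => //; exact: ltW.
have rl0 : 0 < r ^+ l by exact: exprn_gt0.
rewrite -(ler_pM2l rl0); apply: (le_trans h3).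
apply: (le_trans (lerD h1 h4)).
rewrite exprSr -mulrA; apply: (@le_trans _ _ (r ^+ l * (e' / 2) + r ^+ l * (e' / 2))); last lra.
apply: lerD; first by rewrite mulrC ler_wpM2r// ltW.
by rewrite ler_pM2l//; apply: le_trans rC; rewrite ler_pM2l//; lra.
Qed.

(** A finite difference with a fixed step [rho] approximates the derivative at all base points near
    [q], and it involves only finitely many values of [h], each continuous along lines. *)
Lemma dline_cont k v u q p (e : R) : sn p -> 0 < e ->
  \forall r \near (0 : R), p (dline k v (q + r *: u) - dline k v q) < e.
Proof.
move=> hp e0; have [b hb] := @vandermonde_weights R k.+2 k (leqnSn k.+1).
have [d [B [d0 B0 hd]]] := finite_difference v q hp hb.
(* Makes the error [B rho^2] of each of the two approximations at most [e / 8]. *)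
pose rho := Num.min (Num.min (d / 2) 1) (e / 8 / (B + 1)).
have r0 : 0 < rho by rewrite !lt_min divr_gt0// ltr01 divr_gt0//; lra.
have rd : rho < d by rewrite !gt_min; apply/orP; left; apply/orP; left; lra.
have r1 : rho <= 1 by rewrite !ge_min lexx orbT.
have rB : rho * (B + 1) <= e / 8.
  by rewrite -ler_pdivlMr; [rewrite !ge_min lexx orbT|lra].
have rk0 : 0 < rho ^+ k by exact: exprn_gt0.
pose K := k`!%:R * (\sum_j `|b j| + 1).
have sb0 : 0 <= \sum_j `|b j| by apply: sumr_ge0.
have K0 : 0 < K by rewrite mulr_gt0// ?ltr0n ?fact_gt0//; lra.
have e2 : 0 < e * rho ^+ k / (4 * K) by apply: divr_gt0; apply: mulr_gt0.
near=> r.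
have ru : `|r *: u| < d.
  rewrite normrZ; have : `|r| < d / (`|u| + 1).
    by near: r; apply: near0_lt; rewrite divr_gt0// ltr_wpDl.
  rewrite ltr_pdivlMr ?ltr_wpDl//; have := normr_ge0 r; lra.
have hj : forall j : 'I_k.+2, p (h ((q + (j%:R * rho) *: v) + r *: u) - h (q + (j%:R * rho) *: v)) <
    e * rho ^+ k / (4 * K).
  by near: r; apply: filter_forall => j; exact: h_cont_line.
have h1 := hd (q + r *: u) rho; have h2 := hd q rho.
rewrite addrC addKr (gtr0_norm r0) in h1.
rewrite subrr normr0 (gtr0_norm r0) in h2.
have {}h1 := h1 ru rd; have {}h2 := h2 d0 rd.
pose Y j := h (q + r *: u + (j%:R * rho) *: v) - h (q + (j%:R * rho) *: v).
have YS j : S (Y j) by apply: csB; exact: h_S.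
have h3 : p (k`!%:R *: \sum_(j < k.+2) b j *: Y j) <= e * rho ^+ k / 4.
  rewrite cs_snZ//; last by apply: cs_sum => j; exact: csZ.
  rewrite ger0_norm//.
  apply: (@le_trans _ _ (k`!%:R * \sum_(j < k.+2) `|b j| * (e * rho ^+ k / (4 * K)))).
    rewrite ler_wpM2l//; apply: (le_trans (sn_sum _ hp (fun j : 'I_k.+2 => csZ (b j) (YS j)))).
    apply: ler_sum => j _; rewrite cs_snZ// ler_wpM2l//; apply: ltW.
    by rewrite /Y addrAC; exact: hj.
  rewrite -mulr_suml mulrA.
  rewrite [leRHS](_ : _ = K * (e * rho ^+ k / (4 * K))); last by field; rewrite gt_eqF.
  by rewrite ler_wpM2r ?(ltW e2)// /K ler_wpM2l//; lra.
pose a1 := rho ^+ k *: dline k v (q + r *: u) -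
  k`!%:R *: \sum_(j < k.+2) b j *: h (q + r *: u + (j%:R * rho) *: v).
pose a2 := rho ^+ k *: dline k v q - k`!%:R *: \sum_(j < k.+2) b j *: h (q + (j%:R * rho) *: v).
have s1 : S a1 by apply: csB; apply: csZ; [exact: dline_S|apply: cs_sum => j; apply: csZ; exact: h_S].
have s2 : S a2 by apply: csB; apply: csZ; [exact: dline_S|apply: cs_sum => j; apply: csZ; exact: h_S].
have s3 : S (k`!%:R *: \sum_(j < k.+2) b j *: Y j) by apply: csZ; apply: cs_sum => j; exact: csZ.
have E1 : rho ^+ k *: (dline k v (q + r *: u) - dline k v q) =
    (a1 - a2) + k`!%:R *: \sum_(j < k.+2) b j *: Y j.
  have -> : k`!%:R *: \sum_(j < k.+2) b j *: Y j =
      k`!%:R *: \sum_(j < k.+2) b j *: h (q + r *: u + (j%:R * rho) *: v) -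
      k`!%:R *: \sum_(j < k.+2) b j *: h (q + (j%:R * rho) *: v).
    rewrite -scalerBr -sumrB; congr (_ *: _); apply: eq_bigr => j _.
    by rewrite -scalerBr.
  rewrite /a1 /a2; lmod.
rewrite -(ltr_pM2l rk0) -{1}[rho ^+ k]gtr0_norm// -cs_snZ//; last by apply: csB; exact: dline_S.
rewrite E1; apply: (le_lt_trans (cs_snD hp (csB s1 s2) s3)).
have := snB hp s1 s2; rewrite -/a1 in h1; rewrite -/a2 in h2.
have h4 : B * rho ^+ k.+2 <= rho ^+ k * (e / 8).
  rewrite (_ : B * rho ^+ k.+2 = rho ^+ k * (B * rho * rho)); last by rewrite !exprS; ring.
  rewrite ler_pM2l//; apply: le_trans rB.
  have : B * rho * rho <= B * rho by rewrite ler_piMr// mulr_ge0// ltW.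
  lra.
have : 0 < rho ^+ k * e by rewrite mulr_gt0.
lra.
Unshelve. all: by end_near. Qed.

Lemma line_taylor_near k v q p : sn p -> exists2 B : R, 0 <= B &
  \forall r \near (0 : R),
    p (h (q + r *: v) - \sum_(l < k) (r ^+ l / l`!%:R) *: dline l v q) <= B * `|r| ^+ k.
Proof.
move=> hp; have [d [B [d0 B0 hd]]] := line_taylor k v q hp.
exists B => //; apply: filterS (near0_lt d0) => r; apply: hd.
by rewrite subrr normr0.
Qed.

(** A finite difference along [v] at [q + r u], taken with the same [r] as step, has the nodes
    [q + r (u + j v)], which lie on lines through [q]. Taylor expansion along these lines gives this
    coefficient of [r ^+ l]. *)
Definition mixed k (b : 'I_k.+2 -> R) u v q l : E := \sum_(j < k.+2)
  (k`!%:R / l`!%:R * b j) *: (dline l (u + j%:R *: v) q - dline l (j%:R *: v) q).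

Lemma mixed_S k b u v q l : S (@mixed k b u v q l).
Proof. by apply: cs_sum => j; apply: csZ; apply: csB; exact: dline_S. Qed.

Lemma mixed_expansion k v u q p b : sn p -> @fd_weights k b -> exists2 C : R, 0 <= C &
  \forall r \near (0 : R), p (r ^+ k *: (dline k v (q + r *: u) - dline k v q) -
    \sum_(l < k.+2) r ^+ l *: mixed b u v q l) <= C * `|r| ^+ k.+2.
Proof.
move=> hp hb; have [d [B [d0 B0 hd]]] := finite_difference v q hp hb.
have H w : exists B : R, 0 <= B /\ \forall r \near (0 : R),
    p (h (q + r *: w) - \sum_(l < k.+2) (r ^+ l / l`!%:R) *: dline l w q) <= B * `|r| ^+ k.+2.
  by have [B' ? ?] := line_taylor_near k.+2 w q hp; exists B'.
have [T hT] := choice H.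
pose C := 2 * B + k`!%:R * \sum_(j < k.+2) (`|b j| * (T (u + j%:R *: v) + T (j%:R *: v))).
exists C.
  apply: addr_ge0; first by rewrite mulr_ge0.
  rewrite mulr_ge0// sumr_ge0// => j _; rewrite mulr_ge0// addr_ge0//; [exact: (hT _).1|exact: (hT _).1].
near=> r.
have rd : `|r| < d by near: r; exact: near0_lt.
have ru : `|r *: u| < d.
  rewrite normrZ; have : `|r| < d / (`|u| + 1).
    by near: r; apply: near0_lt; rewrite divr_gt0// ltr_wpDl.
  rewrite ltr_pdivlMr ?ltr_wpDl//; have := normr_ge0 r; lra.
have h1 := hd (q + r *: u) r; have h2 := hd q r.
rewrite addrC addKr in h1; rewrite subrr normr0 in h2.
have {}h1 := h1 ru rd; have {}h2 := h2 d0 rd.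
have hY1 : forall j : 'I_k.+2, p (h (q + r *: (u + j%:R *: v)) -
    \sum_(l < k.+2) (r ^+ l / l`!%:R) *: dline l (u + j%:R *: v) q) <= T (u + j%:R *: v) * `|r| ^+ k.+2.
  by near: r; apply: filter_forall => j; exact: (hT _).2.
have hY2 : forall j : 'I_k.+2, p (h (q + r *: (j%:R *: v)) -
    \sum_(l < k.+2) (r ^+ l / l`!%:R) *: dline l (j%:R *: v) q) <= T (j%:R *: v) * `|r| ^+ k.+2.
  by near: r; apply: filter_forall => j; exact: (hT _).2.
pose Y w := h (q + r *: w) - \sum_(l < k.+2) (r ^+ l / l`!%:R) *: dline l w q.
have YS w : S (Y w).
  by apply: csB; [exact: h_S|apply: cs_sum => l; apply: csZ; exact: dline_S].
pose a1 := r ^+ k *: dline k v (q + r *: u) -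
  k`!%:R *: \sum_(j < k.+2) b j *: h (q + r *: u + (j%:R * r) *: v).
pose a2 := r ^+ k *: dline k v q - k`!%:R *: \sum_(j < k.+2) b j *: h (q + (j%:R * r) *: v).
have s1 : S a1 by apply: csB; apply: csZ; [exact: dline_S|apply: cs_sum => j; apply: csZ; exact: h_S].
have s2 : S a2 by apply: csB; apply: csZ; [exact: dline_S|apply: cs_sum => j; apply: csZ; exact: h_S].
pose Z := \sum_(j < k.+2) b j *: (Y (u + j%:R *: v) - Y (j%:R *: v)).
have SZ : S Z by apply: cs_sum => j; apply: csZ; exact: csB.
have pZ : p (k`!%:R *: Z) <= k`!%:R * (\sum_(j < k.+2) (`|b j| * (T (u + j%:R *: v) + T (j%:R *: v)))) * `|r| ^+ k.+2.
  rewrite cs_snZ// ger0_norm// -mulrA ler_wpM2l// mulr_suml.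
  apply: (le_trans (sn_sum _ hp (fun j : 'I_k.+2 => csZ (b j) (csB (YS (u + j%:R *: v)) (YS (j%:R *: v)))))).
  apply: ler_sum => j _; rewrite cs_snZ//; last exact: csB.
  rewrite -mulrA ler_wpM2l// mulrDl (le_trans (snB hp (YS _) (YS _)))//.
  by apply: lerD; [exact: hY1|exact: hY2].
have -> : r ^+ k *: (dline k v (q + r *: u) - dline k v q) -
    \sum_(l < k.+2) r ^+ l *: mixed b u v q l = (a1 - a2) + k`!%:R *: Z.
  have EM : \sum_(l < k.+2) r ^+ l *: mixed b u v q l = k`!%:R *: \sum_(j < k.+2) b j *:
      (\sum_(l < k.+2) (r ^+ l / l`!%:R) *: dline l (u + j%:R *: v) q -
       \sum_(l < k.+2) (r ^+ l / l`!%:R) *: dline l (j%:R *: v) q).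
    rewrite scaler_sumr; under eq_bigr do rewrite scaler_sumr.
    rewrite exchange_big/=; apply: eq_bigr => j _.
    rewrite -sumrB !scaler_sumr; apply: eq_bigr => l _.
    rewrite -scalerBr !scalerA; congr (_ *: _).
    by move: (l`!%:R^-1) => x; ring.
  have EZ : k`!%:R *: Z = k`!%:R *: \sum_(j < k.+2) b j *: h (q + r *: u + (j%:R * r) *: v)
      - k`!%:R *: \sum_(j < k.+2) b j *: h (q + (j%:R * r) *: v)
      - \sum_(l < k.+2) r ^+ l *: mixed b u v q l.
    rewrite EM -!scalerBr; congr (_ *: _).
    rewrite -!sumrB; apply: eq_bigr => j _.
    rewrite -!scalerBr /Y; congr (_ *: _).
    have -> : q + r *: (u + (j : nat)%:R *: v) = q + r *: u + (j%:R * r) *: v by lmod_with R W ltac:(ring).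
    have -> : r *: ((j : nat)%:R *: v) = (j%:R * r) *: v by lmod_with R W ltac:(ring).
    lmod.
  rewrite EZ /a1 /a2; lmod.
apply: (le_trans (cs_snD hp (csB s1 s2) (csZ _ SZ))).
have h3 := snB hp s1 s2; rewrite -/a1 in h1; rewrite -/a2 in h2.
rewrite /C mulrDl; apply: lerD pZ; lra.
Unshelve. all: by end_near. Qed.

(** By [dline_cont] the increment times [r ^+ k] is o(r^k), so in [mixed_expansion] the coefficients
    up to order [k] vanish. The one of order [k.+1] is then the derivative, a combination of
    derivatives of order [k.+1] along [u + j v] and [j v]. *)
Lemma dline_der0 k v u q b : @fd_weights k b ->
  der (fun t => dline k v (q + t *: u)) 0 (mixed b u v q k.+1).
Proof.
move=> hb p hp; have [C C0 hC] := mixed_expansion v u q hp hb.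
have MS := mixed_S b u v q; have DS := dline_S k v.
have van : forall l, (l <= k)%N -> p (mixed b u v q l) = 0.
  have [D D0 DE] : exists2 D, 0 <= D & D = p (mixed b u v q k.+1).
    by eexists; [|reflexivity]; exact: sn_ge0.
  apply: (poly_vanish hp MS) => e e0; near=> r.
  have h1 : p (r ^+ k *: (dline k v (q + r *: u) - dline k v q) -
      \sum_(l < k.+2) r ^+ l *: mixed b u v q l) <= C * `|r| ^+ k.+2 by near: r.
  have h2 : p (dline k v (q + r *: u) - dline k v q) < e / 3.
    by near: r; apply: dline_cont => //; lra.
  have h3 : `|r| * (C + 1) <= e / 3.
    rewrite -ler_pdivlMr; last lra.
    by apply: ltW; near: r; apply: near0_lt; rewrite !divr_gt0//; lra.
  have h4 : `|r| * (D + 1) <= e / 3.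
    rewrite -ler_pdivlMr; last lra.
    by apply: ltW; near: r; apply: near0_lt; rewrite !divr_gt0//; lra.
  have r1 : `|r| <= 1 by apply: ltW; near: r; exact: near0_lt.
  pose a := r ^+ k *: (dline k v (q + r *: u) - dline k v q).
  have Sa : S a by apply: csZ; exact: csB.
  pose Sg := \sum_(l < k.+2) r ^+ l *: mixed b u v q l.
  have SSg : S Sg by apply: cs_sum => l; exact: csZ.
  have E1 : \sum_(l < k.+1) r ^+ l *: mixed b u v q l = a - (a - Sg) - r ^+ k.+1 *: mixed b u v q k.+1.
    have -> : Sg = \sum_(l < k.+1) r ^+ l *: mixed b u v q l + r ^+ k.+1 *: mixed b u v q k.+1.
      exact: big_ord_recr.
    lmod.
  rewrite E1; apply: (le_trans (snB hp (csB Sa (csB Sa SSg)) (csZ _ (MS _)))).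
  apply: (le_trans (lerD (snB hp Sa (csB Sa SSg)) (lexx _))).
  rewrite !cs_snZ//; last exact: csB.
  rewrite !normrX.
  have rk : 0 <= `|r| ^+ k by exact: exprn_ge0.
  have h5 : `|r| ^+ k * p (dline k v (q + r *: u) - dline k v q) <= `|r| ^+ k * (e / 3).
    by rewrite ler_wpM2l// ltW.
  have h6 : C * `|r| ^+ k.+2 <= `|r| ^+ k * (e / 3).
    rewrite !exprSr mulrCA -[leLHS]mulrA ler_wpM2l//; have := normr_ge0 r; nra.
  have h7 : `|r| ^+ k.+1 * p (mixed b u v q k.+1) <= `|r| ^+ k * (e / 3).
    rewrite exprSr -mulrA ler_wpM2l//; rewrite -DE; have := normr_ge0 r; nra.
  rewrite -/a -/Sg in h1; lra.
apply: osm_near (osm_sq C0); near=> r.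
have h1 : p (r ^+ k *: (dline k v (q + r *: u) - dline k v q) -
    \sum_(l < k.+2) r ^+ l *: mixed b u v q l) <= C * `|r| ^+ k.+2 by near: r.
rewrite add0r scale0r addr0; have [->|r0] := eqVneq r 0.
  by rewrite !scale0r addr0 subrr subr0 sn0// normr0 expr0n mulr0.
have rk0 : 0 < `|r| ^+ k by rewrite exprn_gt0// normr_gt0.
pose g := dline k v (q + r *: u) - dline k v q - r *: mixed b u v q k.+1.
have Sg : S g by apply: csB; [exact: csB|exact: csZ].
rewrite -/g -(ler_pM2l rk0) -normrX -cs_snZ// normrX.
pose Z := \sum_(l < k.+1) r ^+ l *: mixed b u v q l.
have SZ : S Z by apply: cs_sum => l; exact: csZ.
have pZ : p Z = 0.
  apply: le_anti; rewrite sn_ge0// andbT; apply: (le_trans (sn_sum _ hp (fun l : 'I_k.+1 => csZ (r ^+ l) (MS l)))).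
  by rewrite big1// => l _; rewrite cs_snZ// van ?mulr0// -ltnS.
have -> : r ^+ k *: g = (r ^+ k *: (dline k v (q + r *: u) - dline k v q) -
    \sum_(l < k.+2) r ^+ l *: mixed b u v q l) + Z.
  rewrite big_ord_recr/= -/Z /g exprSr; lmod.
apply: (le_trans (cs_snD hp _ SZ)).
  by apply: csB; [apply: csZ; exact: csB|apply: cs_sum => l; exact: csZ].
by rewrite pZ addr0 mulrCA -exprD addn2.
Unshelve. all: by end_near. Qed.

(** By [dline_der0] differentiation along [u] stays within linear combinations of the [dline k v],
    as [SC_coind] requires. *)
Inductive dline_comb (q u : W) : (R -> E) -> Prop :=
| dc_base k v : dline_comb q u (fun t => dline k v (q + t *: u))
| dc_add c d : dline_comb q u c -> dline_comb q u d -> dline_comb q u (fun t => c t + d t)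
| dc_scale (a : R) c : dline_comb q u c -> dline_comb q u (fun t => a *: c t).

Lemma dline_comb_sum q u (I : Type) (r : seq I) (c : I -> R -> E) :
  (forall i, dline_comb q u (c i)) -> dline_comb q u (fun t => \sum_(i <- r) c i t).
Proof.
move=> hc; elim: r => [|i r IH].
  rewrite (_ : (fun t => _) = fun t => 0 *: dline 0 0 (q + t *: u)).
    by apply: dc_scale; exact: dc_base.
  by apply/funext => t; rewrite big_nil scale0r.
under eq_fun do rewrite big_cons; exact: dc_add.
Qed.

Lemma dline_comb_S q u c : dline_comb q u c -> forall t, S (c t).
Proof.
by elim=> [k v t|d e _ Hd _ He t|a d _ Hd t]; [exact: dline_S|exact: csD|exact: csZ].
Qed.

Lemma SC_dline k v q u : SC (fun t => dline k v (q + t *: u)).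
Proof.
apply: (@SC_coind R E (dline_comb q u)); last exact: dc_base.
move=> {k v} c hc; split; first exact: dline_comb_S hc.
elim: hc => {c} [k v|c d Pc [c' Pc' dc] Pd [d' Pd' dd]|a c Pc [c' Pc' dc]].
- have [b hb] := @vandermonde_weights R k.+2 k (leqnSn k.+1).
  exists (fun t => mixed b u v (q + t *: u) k.+1).
    apply: dline_comb_sum => j; apply: dc_scale.
    rewrite (_ : (fun t => _) = fun t => dline k.+1 (u + (j : nat)%:R *: v) (q + t *: u) +
        -1 *: dline k.+1 ((j : nat)%:R *: v) (q + t *: u)).
      by apply: dc_add; [exact: dc_base|apply: dc_scale; exact: dc_base].
    by apply/funext => t; rewrite scaleN1r.
  move=> t; have := dline_der0 v u (q + t *: u) hb.
  have sh : (fun s => dline k v (q + s *: u)) =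
      (fun s => (fun r => dline k v (q + t *: u + r *: u)) (- t + s)).
    apply/funext => s; congr (dline k v _); lmod_with R W ltac:(ring).
  move=> h0; rewrite sh; apply: (@der_shift R E (fun r => dline k v (q + t *: u + r *: u))).
  + by move=> s; exact: dline_S.
  + exact: mixed_S.
  + by rewrite addNr.
- exists (fun t => c' t + d' t); first exact: dc_add.
  by move=> t; exact: (derD (dline_comb_S Pc) (dline_comb_S Pd) (dline_comb_S Pc' t) (dline_comb_S Pd' t)).
- exists (fun t => a *: c' t); first exact: dc_scale.
  by move=> t; exact: (derZ a (dline_comb_S Pc) (dline_comb_S Pc' t)).
Qed.

Lemma dline1_der v q : der (fun r => h (q + r *: v)) 0 (dline 1 v q).
Proof.
have [_ dd] := line_derseq v q; have := dd 0%N 0.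
by apply: der_ext => r; rewrite line0.
Qed.

End boman.

Section linear_images.
Context {R : realType}.

Lemma smooth_lin (V W W' : normedModType R) (U : set V) (f : V -> W) (T : W -> W') (C : R) :
  open U -> (forall k u v, T (k *: u + v) = k *: T u + T v) ->
  (forall u, `|T u| <= C * `|u|) -> smooth_on U f -> smooth_on U (fun x => T (f x)).
Proof.
move=> oU Tl TC sf.
have C0 : 0 <= `|C| by [].
have TC' u : `|T u| <= `|C| * `|u|.
  by apply: (le_trans (TC u)); rewrite ler_wpM2r// ler_norm.
have T0 : T 0 = 0 by have := Tl (-1) 0 0; rewrite scaler0 addr0 scaleN1r addNr.
have TZ k u : T (k *: u) = k *: T u by rewrite -[k *: u]addr0 Tl T0 addr0.
have TB u v : T (u - v) = T u - T v by rewrite -scaleN1r addrC Tl scaleN1r addrC.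
have D (g : V -> W) x v d : is_derive x v g d -> is_derive x v (fun x => T (g x)) (T d).
  move=> /is_deriveP h; apply/is_deriveP; apply: osm_le (osmZ C0 h) => s.
  by rewrite -TZ -!TB.
apply: (@smooth_coind _ V W' U (fun g => exists2 f, smooth_on U f & g = fun x => T (f x))) => //; last by exists f.
move=> _ {f sf} [f sf ->]; split=> [x Ux|v].
  split; last first.
    by move=> v; apply: ex_derive; apply: D; exact: (smooth_on_is_derive v sf Ux).
  have cf : f @ x --> f x := smooth_on_cont sf Ux.
  apply/cvgrPdist_lt => e e0.
  have C1 : 0 < `|C| + 1 by lra.
  move/cvgrPdist_lt : cf => /(_ (e / (`|C| + 1))); rewrite divr_gt0// => /(_ isT).
  apply: filterS => y; rewrite ltr_pdivlMr// -TB => h.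
  apply: (le_lt_trans (TC' _)); apply: le_lt_trans h.
  by rewrite mulrC ler_wpM2l//; lra.
exists (fun x => T ('D_v f x)).
  by exists ('D_v f) => //; exact: smooth_onD.
move=> x; rewrite inE => Ux; apply: derive_val; apply: D.
exact: (smooth_on_is_derive v sf Ux).
Qed.

Lemma smooth_pair (c : R -> R * R) : smooth_on setT c ->
  smooth_on setT (fun t => (c t).1) /\ smooth_on setT (fun t => (c t).2).
Proof.
move=> sc; split.
  apply: (@smooth_lin R (R * R)%type R setT c fst 1) => //; first exact: openT.
  by move=> u; rewrite mul1r le_max lexx.
apply: (@smooth_lin R (R * R)%type R setT c snd 1) => //; first exact: openT.
by move=> u; rewrite mul1r le_max lexx orbT.
Qed.

Lemma coord_le_norm m n (A : 'M[R]_(m, n)) i j : `|A i j| <= `|A|.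
Proof.
rewrite [leRHS]/Num.Def.normr/= mx_normrE.
by apply: (@le_trans _ _ `|A (i, j).1 (i, j).2|) => //; exact: le_bigmax.
Qed.

Lemma norm_le_coord m n (A : 'M[R]_(m, n)) (C : R) : 0 <= C ->
  (forall i j, `|A i j| <= C) -> `|A| <= C.
Proof.
by move=> C0 h; rewrite [leLHS]/Num.Def.normr/= mx_normrE bigmax_le// => -[i j] _; exact: h.
Qed.

Lemma smooth_coord (V : normedModType R) (U : set V) n (f : V -> 'rV[R]_n) :
  open U -> smooth_on U f <-> forall j, smooth_on U (fun x => f x 0 j).
Proof.
move=> oU; split=> [sf j|h].
  apply: (@smooth_lin V _ R U f (fun A : 'rV[R]_n => A 0 j) 1) => //.
  - by move=> k u v; rewrite !mxE.
  - by move=> u; rewrite mul1r coord_le_norm.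
rewrite (_ : f = fun x => \sum_j f x 0 j *: delta_mx 0 j); last first.
  by apply/funext => x; rewrite [LHS]row_sum_delta.
apply: smooth_sum => // j; apply: smooth_scale => //; exact: smooth_cst.
Qed.

End linear_images.

Section two_parameters.
Context {R : realType} {E : cspace R}.

(** Boman's argument in the plane: the derivative in [s] on the axis [s = 0] is [dline] along (0,
    1), followed along [t |-> (t, 0)]. It makes derivatives of maps smooth that are known to be
    smooth along curves only. *)
Lemma SC_two_parameters (H : R -> R -> E) :
  (forall a b : R -> R, smooth_on setT a -> smooth_on setT b -> SC (fun t => H (a t) (b t))) ->
  exists2 g : R -> E, SC g & forall t, der (fun s => H t s) 0 (g t).
Proof.
move=> hH; pose h (x : R * R) := H x.1 x.2.
have hsm : forall c : R -> R * R, smooth_on setT c -> SC (fun t => h (c t)).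
  by move=> c sc; have [s1 s2] := smooth_pair sc; exact: (hH _ _ s1 s2).
exists (fun t => dline hsm 1 (0, 1) ((0, 0) + t *: (1, 0))).
  exact: SC_dline.
move=> t; have := dline1_der hsm (0, 1) ((0, 0) + t *: (1, 0)).
apply: der_ext => r; rewrite /h /=; congr (H _ _).
- by rewrite [_ *: 1]mulr1 [_ *: 0]mulr0 add0r addr0.
- by rewrite [_ *: 1]mulr1 [_ *: 0]mulr0 !add0r.
Qed.

End two_parameters.

(** * Differential calculus in finite dimension *)

Section euclidean_calculus.
Context {R : realType}.

Lemma is_derive_segment (V W : normedModType R) (f : V -> W) y v (s : R) d :
  is_derive (y + s *: v) v f d -> is_derive s 1 (fun r : R => f (y + r *: v)) d.
Proof.
rewrite !is_deriveP; apply: osm_le => r.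
by rewrite [r *: 1]mulr1 scalerDl addrA.
Qed.

(* The staircase from x to x + h along the coordinate axes. *)
Lemma smooth_expansion n (W : normedModType R) (U : set 'rV[R]_n) (f : 'rV[R]_n -> W) x :
  open U -> smooth_on U f -> U x -> forall e : R, 0 < e -> \forall h \near (0 : 'rV[R]_n),
  `|f (x + h) - f x - \sum_i h 0 i *: 'D_(delta_mx 0 i) f x| <= e * `|h|.
Proof.
move=> oU sf Ux e0 e0_gt0.
pose e := e0 / n.+1%:R; have e_gt0 : 0 < e by rewrite divr_gt0.
have [d d0 hd] : exists2 d : R, 0 < d & forall y, `|y - x| < d -> U y /\
    forall i : 'I_n, `|'D_(delta_mx 0 i) f y - 'D_(delta_mx 0 i) f x| <= e.
  suff : \forall y \near x, U y /\ forall i : 'I_n, `|'D_(delta_mx 0 i) f y - 'D_(delta_mx 0 i) f x| <= e.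
    move=> /nbhs_ballP[d/= d0 hd]; exists d => // y yd; apply: hd.
    by rewrite -ball_normE /= distrC.
  near=> y; split; first by near: y; exact: (open_near oU Ux).
  near: y; apply: filter_forall => i.
  have c : 'D_(delta_mx 0 i) f @ x --> 'D_(delta_mx 0 i) f x.
    by apply: (smooth_on_cont (smooth_onD _ sf) Ux).
  by move/cvgrPdist_le : c => /(_ e e_gt0); apply: filterS => z; rewrite distrC.
have nd : \forall h \near (0 : 'rV[R]_n), `|h| < d.
  by apply: filterS (nbhsx_ballx 0 _ d0) => h; rewrite -ball_normE/= sub0r normrN.
apply: filterS nd => h hhd.
pose tr k : 'rV[R]_n := \row_i if (i < k)%N then h 0 i else 0.
have trh k : `|tr k| <= `|h|.
  apply: norm_le_coord => // i j; rewrite !mxE; case: ifP => _.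
    exact: coord_le_norm.
  by rewrite normr0.
have H k : (k <= n)%N -> `|f (x + tr k) - f x - \sum_(i < n | (i < k)%N) h 0 i *: 'D_(delta_mx 0 i) f x| <= k%:R * e * `|h|.
  elim: k => [_|k IH kn].
    rewrite big1 => [|i //]; rewrite (_ : tr 0%N = 0); last by apply/rowP => i; rewrite !mxE.
    by rewrite addr0 subrr subr0 normr0 !mul0r.
  pose i0 := Ordinal kn.
  have trS s : tr k + s *: delta_mx 0 i0 = \row_i (if (i < k)%N then h 0 i else if i == i0 then s else 0).
    apply/rowP => i; rewrite !mxE eqxx/=; case: ifPn => ik.
      by rewrite (_ : i == i0 = false) ?mulr0 ?addr0//; apply/negbTE; rewrite -val_eqE/= ltn_eqF.
    by case: eqP => _; rewrite ?mulr1 ?mulr0 add0r.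
  have trk : tr k.+1 = tr k + h 0 i0 *: delta_mx 0 i0.
    rewrite trS; apply/rowP => i; rewrite !mxE ltnS leq_eqVlt -val_eqE/=.
    have [ik|_] := eqVneq (i : nat) k; last by case: ifP.
    by rewrite ik ltnn/=; congr (h 0 _); exact: val_inj.
  pose c s := f (x + tr k + s *: delta_mx 0 i0) - s *: 'D_(delta_mx 0 i0) f x.
  pose c' s := 'D_(delta_mx 0 i0) f (x + tr k + s *: delta_mx 0 i0) - 'D_(delta_mx 0 i0) f x.
  have hs s : `|s| <= `|h 0 i0| -> `|x + tr k + s *: delta_mx 0 i0 - x| < d.
    move=> sh; rewrite (_ : _ - x = tr k + s *: delta_mx 0 i0); last first.
      by lmod_with R ('rV[R]_n) ltac:(ring).
    apply: le_lt_trans hhd.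
    rewrite trS; apply: norm_le_coord => // i j; rewrite !mxE; case: ifP => _; first exact: coord_le_norm.
    case: ifP => _; last by rewrite normr0.
    by apply: (le_trans sh); exact: coord_le_norm.
  have := @der_mvt_abs R (NS W) c c' Num.norm 0 (h 0 i0) e (fun=> I) (fun=> I) erefl.
  have D (s : R) : `|s| <= `|h 0 i0| -> is_derive s 1 c (c' s).
    move=> sh; apply: is_deriveB.
      by apply: is_derive_segment; apply: (smooth_on_is_derive _ sf); exact: (hd _ (hs _ sh)).1.
    have := is_deriveZf (is_derive_id s 1) (is_derive_cst ('D_(delta_mx 0 i0) f x) s 1).
    by move/is_derive_eq; apply; rewrite scale1r scaler0 addr0.
  rewrite add0r /c scale0r addr0 scale0r subr0 => mvt.
  have {}mvt : `|f (x + tr k.+1) - f (x + tr k) - h 0 i0 *: 'D_(delta_mx 0 i0) f x| <= e * `|h|.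
    have -> : f (x + tr k.+1) - f (x + tr k) - h 0 i0 *: 'D_(delta_mx 0 i0) f x =
      f (x + tr k + h 0 i0 *: delta_mx 0 i0) - h 0 i0 *: 'D_(delta_mx 0 i0) f x - f (x + tr k).
      have AC (a b c0 : W) : a - b - c0 = a - c0 - b by rewrite addrAC.
      by rewrite AC trk addrA.
    apply: (le_trans (mvt _ _)) => [u hu|u hu|].
    - by apply/NS_der; rewrite add0r; exact: D.
    - by rewrite add0r; exact: (hd _ (hs _ hu)).2.
    - by rewrite ler_wpM2l ?(ltW e_gt0)// coord_le_norm.
  rewrite (bigD1 i0)//=.
  have -> : \sum_(i < n | (i < k.+1)%N && (i != i0)) h 0 i *: 'D_(delta_mx 0 i) f x =
      \sum_(i < n | (i < k)%N) h 0 i *: 'D_(delta_mx 0 i) f x.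
    apply: eq_bigl => i; rewrite -val_eqE/= ltnS leq_eqVlt.
    by case: eqP => [->|_]; rewrite ?ltnn ?andbF ?andbT.
  set Sg := \sum_(i < n | _) _ in IH *.
  have -> : f (x + tr k.+1) - f x - (h 0 i0 *: 'D_(delta_mx 0 i0) f x + Sg) =
     (f (x + tr k.+1) - f (x + tr k) - h 0 i0 *: 'D_(delta_mx 0 i0) f x) + (f (x + tr k) - f x - Sg).
    by lmod_with R W ltac:(ring).
  apply: (le_trans (ler_normD _ _)); have := IH (ltnW kn).
  by rewrite -natr1; lra.
have := H n (leqnn n); rewrite (_ : tr n = h); last by apply/rowP => i; rewrite !mxE ltn_ord.
under eq_bigl do rewrite ltn_ord.
move=> /le_trans; apply; rewrite ler_wpM2r// /e mulrCA ler_piMr ?(ltW e0_gt0)//.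
by rewrite ler_pdivrMr// mul1r ler_nat.
Unshelve. all: by end_near. Qed.

Definition grad n (W : normedModType R) (f : 'rV[R]_n -> W) x (v : 'rV[R]_n) : W :=
  \sum_i v 0 i *: 'D_(delta_mx 0 i) f x.

Lemma differentiable_linear (V W : normedModType R) (f : V -> W) (L : {linear V -> W}) x :
  continuous L -> (forall e : R, 0 < e -> \forall h \near (0 : V),
    `|f (x + h) - f x - L h| <= e * `|h|) -> differentiable f x.
Proof.
move=> Lc hL.
have gE : f \o shift x = cst (f x) + L +o_ (0 : V) id.
  apply/eqaddoP => e e0; apply: filterS (hL _ e0) => h.
  by rewrite !fctE /= [h + x]addrC opprD addrA.
by apply/diff_locallyP; rewrite (diff_unique Lc gE).
Qed.

(** [smooth_on] speaks of directional derivatives only; this yields linearity in the direction and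
    access to the chain rule. *)
Lemma smooth_differentiable n (W : normedModType R) (U : set 'rV[R]_n) (f : 'rV[R]_n -> W) x :
  open U -> smooth_on U f -> U x -> differentiable f x.
Proof.
move=> oU sf Ux.
have glin : linear (grad f x).
  move=> a u v; rewrite /grad scaler_sumr -big_split/=; apply: eq_bigr => i _.
  by rewrite !mxE scalerDl scalerA.
pose gM := GRing.isLinear.Build _ _ _ _ _ glin.
pose gL : {linear 'rV[R]_n -> W} := HB.pack (grad f x) gM.
have gcont : continuous gL.
  have sg : smooth_on setT (grad f x).
    apply: (smooth_sum _ openT) => i; apply: (smooth_scale openT _ (smooth_cst _ openT)).
    exact: ((smooth_coord _ openT).1 (@smooth_id R _) i).
  by move=> v; exact: (smooth_on_cont sg).
apply: (@differentiable_linear _ _ _ gL) => // e e0.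
exact: (smooth_expansion oU sf Ux e0).
Qed.

Lemma smooth_derive_linear n (W : normedModType R) (U : set 'rV[R]_n) (f : 'rV[R]_n -> W) x a u v :
  open U -> smooth_on U f -> U x -> 'D_(a *: u + v) f x = a *: 'D_u f x + 'D_v f x.
Proof.
move=> oU sf Ux; have df := smooth_differentiable oU sf Ux.
by rewrite !deriveE// linearP.
Qed.

Lemma smooth_deriveE n (W : normedModType R) (U : set 'rV[R]_n) (f : 'rV[R]_n -> W) x v :
  open U -> smooth_on U f -> U x -> 'D_v f x = \sum_i v 0 i *: 'D_(delta_mx 0 i) f x.
Proof.
move=> oU sf Ux; have df := smooth_differentiable oU sf Ux.
rewrite {1}[v]row_sum_delta !deriveE// linear_sum; apply: eq_bigr => i _.
by rewrite linearZ/= deriveE.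
Qed.

Lemma is_derive_comp (V V' W : normedModType R) (g : V -> V') (f : V' -> W) x v d :
  is_derive x v g d -> differentiable f (g x) -> is_derive x v (f \o g) ('D_d f (g x)).
Proof.
move=> /is_derive_line hg df.
have dg : differentiable (fun s : R => g (x + s *: v)) 0.
  by apply/derivable1_diffP; exact: (@ex_derive _ _ _ _ _ _ _ hg).
have df' : differentiable f ((fun s : R => g (x + s *: v)) 0) by rewrite scale0r addr0.
have dc := differentiable_comp dg df'.
apply/is_derive_line; apply: DeriveDef; first by apply/derivable1_diffP; exact: dc.
rewrite -[fun s => _]/(f \o (fun s : R => g (x + s *: v))) deriveE//.
rewrite diff_comp//=.
have -> : 'd (fun s : R => g (x + s *: v)) 0 1 = d.
  by rewrite -deriveE//; case: hg.
by rewrite scale0r addr0 deriveE.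
Qed.

(** The chain rule differentiates [f] in coordinate directions and moves the components of the
    derivative of [g] into the scalar factor [a]. *)
Inductive smooth_composites (V : normedModType R) n (W : normedModType R) (O : set V)
    (U : set 'rV[R]_n) (g : V -> 'rV[R]_n) : (V -> W) -> Prop :=
| sc_base (a : V -> R) f : smooth_on O a -> smooth_on U f -> smooth_composites O U g (fun x => a x *: f (g x))
| sc_add f f' : smooth_composites O U g f -> smooth_composites O U g f' ->
    smooth_composites O U g (fun x => f x + f' x).

Lemma smooth_composites_sum (V : normedModType R) n (W : normedModType R) (O : set V)
    (U : set 'rV[R]_n) (g : V -> 'rV[R]_n) (I : Type) (r : seq I) (f : I -> V -> W) :
  open O -> open U -> (forall i, smooth_composites O U g (f i)) ->
  smooth_composites O U g (fun x => \sum_(i <- r) f i x).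
Proof.
move=> oO oU hf; elim: r => [|i r IH].
  rewrite (_ : (fun x => _) = fun x => (fun=> 0) x *: (fun=> (0 : W)) (g x)).
    by apply: (@sc_base _ _ _ _ _ _ (fun=> 0) (fun=> 0)); exact: smooth_cst.
  by apply/funext => x; rewrite big_nil scale0r.
by under eq_fun do rewrite big_cons; exact: sc_add.
Qed.

Lemma smooth_comp (V : normedModType R) n (W : normedModType R) (O : set V)
    (U : set 'rV[R]_n) (g : V -> 'rV[R]_n) (f : 'rV[R]_n -> W) :
  open O -> open U -> (forall x, O x -> U (g x)) ->
  smooth_on O g -> smooth_on U f -> smooth_on O (f \o g).
Proof.
move=> oO oU OU sg sf.
apply: (@smooth_coind R V W O (smooth_composites O U g)) => //; last first.
  rewrite (_ : f \o g = fun x => (fun=> 1) x *: f (g x)).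
    by apply: sc_base => //; exact: smooth_cst.
  by apply/funext => x /=; rewrite scale1r.
move=> {f sf} k; elim=> {k} [a f sa sf|f f' Pf [IH1 IH2] Pf' [IH1' IH2']].
  have D x v : O x -> is_derive x v (fun x => a x *: f (g x))
      ('D_v a x *: f (g x) + a x *: 'D_('D_v g x) f (g x)).
    move=> Ox; apply: is_deriveZf; first exact: (smooth_on_is_derive _ sa).
    apply: is_derive_comp; first exact: (smooth_on_is_derive _ sg).
    by apply: (smooth_differentiable oU sf); exact: OU.
  split=> [x Ox|v].
    split; last by move=> v; apply: ex_derive; exact: D.
    apply: cvgZ; first exact: (smooth_on_cont sa).
    apply: (@continuous_comp _ _ _ g f x); first exact: (smooth_on_cont sg).
    by apply: (smooth_on_cont sf); exact: OU.
  (* [None] stands for the derivative of the scalar factor, [Some j] for the [j]-th term of the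
     chain rule. *)
  exists (fun x => \sum_(i <- None :: [seq Some j | j <- enum 'I_n])
      (if i is Some j then (a x * 'D_v g x 0 j) *: 'D_(delta_mx 0 j) f (g x) else 'D_v a x *: f (g x))).
    apply: smooth_composites_sum => // -[j|].
      apply: (@sc_base V n W O U g (fun x => a x * 'D_v g x 0 j) _ _ (smooth_onD _ sf)).
      exact: (smooth_mul oO sa ((smooth_coord _ oO).1 (smooth_onD v sg) j)).
    by exact: (@sc_base V n W O U g ('D_v a) f (smooth_onD v sa) sf).
  move=> x; rewrite inE => Ox; rewrite (derive_val (is_derive := D x v Ox)).
  rewrite big_cons big_map big_enum/=; congr (_ + _).
  rewrite (smooth_deriveE _ oU sf (OU _ Ox)) scaler_sumr; apply: eq_bigr => j _.
  by rewrite scalerA.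
split=> [x Ox|v].
  have [c1 d1] := IH1 _ Ox; have [c2 d2] := IH1' _ Ox.
  by split; [exact: cvgD|move=> v; exact: derivableD].
have [k Pk Ek] := IH2 v; have [k' Pk' Ek'] := IH2' v.
exists (fun x => k x + k' x); first exact: sc_add.
move=> x xO; have Ox := xO; rewrite inE in Ox.
have [_ d1] := IH1 _ Ox; have [_ d2] := IH1' _ Ox.
by rewrite -Ek// -Ek'//; exact: deriveD.
Qed.

(** The second difference over the parallelogram with sides [s u] and [s v] is symmetric in [u] and
    [v]; two mean value estimates compare it with [s^2] times either mixed derivative. *)
Lemma smooth_schwarz (V W : normedModType R) (U : set V) (f : V -> W) x u v :
  open U -> smooth_on U f -> U x -> 'D_u ('D_v f) x = 'D_v ('D_u f) x.
Proof.
move=> oU sf Ux.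
have key u' v' e : 0 < e -> \forall s \near (0 : R),
    `|f (x + s *: u' + s *: v') - f (x + s *: v') - (f (x + s *: u') - f x) -
      (s * s) *: 'D_u' ('D_v' f) x| <= e * (s * s).
  move=> e0.
  have [d d0 hd] : exists2 d : R, 0 < d & forall y, `|y - x| < d -> U y /\
      `|'D_u' ('D_v' f) y - 'D_u' ('D_v' f) x| <= e.
    suff : \forall y \near x, U y /\ `|'D_u' ('D_v' f) y - 'D_u' ('D_v' f) x| <= e.
      move=> /nbhs_ballP[d/= d0 hd]; exists d => // y yd; apply: hd.
      by rewrite -ball_normE /= distrC.
    near=> y; split; first by near: y; exact: (open_near oU Ux).
    near: y; have c : 'D_u' ('D_v' f) @ x --> 'D_u' ('D_v' f) x.
      by apply: (smooth_on_cont (smooth_onD _ (smooth_onD _ sf)) Ux).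
    by move/cvgrPdist_le : c => /(_ e e0); apply: filterS => z; rewrite distrC.
  have C0 : 0 < `|u'| + `|v'| + 1 by rewrite ltr_wpDl// addr_ge0.
  near=> s.
  have sd : `|s| < d / (`|u'| + `|v'| + 1) by near: s; apply: near0_lt; rewrite divr_gt0.
  rewrite ltr_pdivlMr// in sd.
  have hy a b : `|a| <= `|s| -> `|b| <= `|s| -> `|x + a *: u' + b *: v' - x| < d.
    move=> ha hb; rewrite (_ : _ - x = a *: u' + b *: v'); last by lmod_with R V ltac:(ring).
    apply: (le_lt_trans (ler_normD _ _)); rewrite !normrZ; apply: le_lt_trans sd.
    have h1 : `|a| * `|u'| <= `|s| * `|u'| by rewrite ler_wpM2r.
    have h2 : `|b| * `|v'| <= `|s| * `|v'| by rewrite ler_wpM2r.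
    have := normr_ge0 s; lra.
  pose c r := f (x + s *: u' + r *: v') - f (x + r *: v') - (r * s) *: 'D_u' ('D_v' f) x.
  pose c' r := 'D_v' f (x + s *: u' + r *: v') - 'D_v' f (x + r *: v') - s *: 'D_u' ('D_v' f) x.
  have hU a b : `|a| <= `|s| -> `|b| <= `|s| -> U (x + a *: u' + b *: v').
    by move=> ha hb; exact: (hd _ (hy _ _ ha hb)).1.
  have D (r : R) : `|r| <= `|s| -> is_derive r 1 c (c' r).
    move=> rs; apply: is_deriveB.
      apply: is_deriveB; apply: is_derive_segment; apply: (smooth_on_is_derive _ sf).
        exact: hU.
      by have := hU 0 r; rewrite normr0 scale0r addr0; apply.
    have := is_deriveZf (is_deriveZf (is_derive_id r 1) (is_derive_cst s r 1)) (is_derive_cst ('D_u' ('D_v' f) x) r 1).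
    by move/is_derive_eq; apply; rewrite scaler0 addr0 scaler0 addr0 scale1r.
  have B r : `|r| <= `|s| -> `|c' r| <= e * `|s|.
    move=> rs.
    pose g a := 'D_v' f (x + r *: v' + a *: u') - a *: 'D_u' ('D_v' f) x.
    pose g' a := 'D_u' ('D_v' f) (x + r *: v' + a *: u') - 'D_u' ('D_v' f) x.
    have hU' a : `|a| <= `|s| -> U (x + r *: v' + a *: u') /\ `|g' a| <= e.
      by move=> ha; rewrite /g' addrAC; apply: hd; exact: hy.
    have := @der_mvt_abs R (NS W) g g' Num.norm 0 s e (fun=> I) (fun=> I) erefl.
    rewrite add0r {3}/g scale0r addr0 scale0r subr0 => mvt.
    rewrite (_ : c' r = g s - 'D_v' f (x + r *: v')); last first.
      have AC (a b c0 : W) : a - b - c0 = a - c0 - b by rewrite addrAC.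
      by rewrite /c' AC /g (_ : x + s *: u' + r *: v' = x + r *: v' + s *: u')//; rewrite addrAC.
    apply: mvt => a ha; rewrite add0r; last exact: (hU' _ ha).2.
    apply/NS_der; apply: is_deriveB.
      by apply: (@is_derive_segment _ _ ('D_v' f)); apply: (smooth_on_is_derive _ (smooth_onD _ sf)); exact: (hU' _ ha).1.
    have := is_deriveZf (is_derive_id a 1) (is_derive_cst ('D_u' ('D_v' f) x) a 1).
    by move/is_derive_eq; apply; rewrite scaler0 addr0 scale1r.
  have := @der_mvt_abs R (NS W) c c' Num.norm 0 s (e * `|s|) (fun=> I) (fun=> I) erefl.
  rewrite add0r => mvt.
  have E : c s - c 0 = f (x + s *: u' + s *: v') - f (x + s *: v') - (f (x + s *: u') - f x) -
      (s * s) *: 'D_u' ('D_v' f) x.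
    by rewrite /c !scale0r mul0r scale0r !addr0 subr0; lmod_with R W ltac:(ring).
  rewrite -E; apply: (le_trans (mvt _ _)) => [a ha|a ha|].
  - by rewrite add0r; apply/NS_der; exact: D.
  - by rewrite add0r; exact: B.
  - by rewrite -mulrA -normrM ger0_norm// -expr2 sqr_ge0.
apply/eqP; rewrite -subr_eq0 -normr_eq0; apply/eqP/le_anti; rewrite normr_ge0 andbT.
apply/ler_addgt0Pl => e e0; rewrite addr0.
have e2 : 0 < e / 2 by lra.
have /near0P[d1 d10 h1] := key u v (e / 2) e2.
have /near0P[d2 d20 h2] := key v u (e / 2) e2.
pose s := Num.min d1 d2 / 2.
have m0 : 0 < Num.min d1 d2 by rewrite lt_min d10.
have s0 : 0 < s by rewrite /s; lra.
have sm : s < Num.min d1 d2 by rewrite /s; lra.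
have := h1 s; have := h2 s; rewrite gtr0_norm//.
rewrite (lt_le_trans sm) ?ge_min ?lexx ?orbT// (lt_le_trans sm) ?ge_min ?lexx ?orbT//.
move=> /(_ isT) k2 /(_ isT) k1.
have ss : 0 < s * s by rewrite mulr_gt0.
rewrite -(ler_pM2l ss) -[s * s in leLHS](ger0_norm (ltW ss)) -normrZ.
set X := f (x + s *: u + s *: v) in k1; set A := f (x + s *: v) in k1 k2; set B := f (x + s *: u) in k1 k2.
have E : f (x + s *: v + s *: u) = X by rewrite /X addrAC.
rewrite E in k2.
rewrite (_ : (s * s) *: _ = (X - B - (A - f x) - (s * s) *: 'D_v ('D_u f) x) - (X - A - (B - f x) - (s * s) *: 'D_u ('D_v f) x)); last by lmod_with R W ltac:(ring).
apply: (le_trans (ler_normB _ _)); apply: (le_trans (lerD k2 k1)).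
rewrite -mulrDl -splitr mulrC; exact: lexx.
Unshelve. all: by end_near. Qed.

(** Smoothness is tested on curves defined on the whole line; inserting [clamp] turns a curve given
    near one time into such a curve without changing it there. *)
Definition clamp (d t : R) : R := t * plateau (2 * t / d).

Lemma smooth_clamp d : smooth_on setT (clamp d).
Proof.
apply: (smooth_mul openT (@smooth_id R R)).
have := smooth_comp1 (smooth_affine (2 / d) 0) (@smooth_plateau R).
by congr (smooth_on setT _); apply/funext => t; rewrite addr0 mulrAC.
Qed.

Lemma step_le1 (x : R) : step x <= 1.
Proof.
rewrite /step ler_pdivrMr ?step_den// mul1r lerDl; exact: flat1_ge0.
Qed.
Lemma step_ge0 (x : R) : 0 <= step x.
Proof. by rewrite /step divr_ge0 ?flat1_ge0// ltW// step_den. Qed.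
Lemma plateau_ge0 (x : R) : 0 <= plateau x.
Proof. by rewrite /plateau mulr_ge0 ?step_ge0. Qed.
Lemma plateau_le1 (x : R) : plateau x <= 1.
Proof. by rewrite /plateau mulr_ile1 ?step_ge0 ?step_le1. Qed.

Lemma clamp_id d t : 0 < d -> `|t| <= d / 2 -> clamp d t = t.
Proof.
move=> d0 td; rewrite /clamp plateau1 ?mulr1//.
rewrite normrM normfV normrM (gtr0_norm d0) ger0_norm// ler_pdivrMr//; lra.
Qed.

Lemma clamp_lt d t : 0 < d -> `|clamp d t| < d.
Proof.
move=> d0; rewrite /clamp normrM (ger0_norm (plateau_ge0 _)).
have [td|td] := ltP `|t| d.
  by apply: le_lt_trans td; rewrite ler_piMr// plateau_le1.
rewrite plateau0 ?mulr0//.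
by rewrite normrM normfV normrM (gtr0_norm d0) ger0_norm// ler_pdivlMr//; lra.
Qed.

(** Functions smooth along all curves in [U] form a class for [smooth_coind]: clamped lines give the
    derivatives, the special curve lemma gives continuity, and [SC_two_parameters] shows that a
    derivative is again smooth along curves. *)
Lemma boman_smooth (V : normedModType R) (U : set V) (f : V -> R) : open U ->
  (forall c : R -> V, smooth_on setT c -> (forall t, U (c t)) ->
     smooth_on setT (fun t => f (c t))) ->
  smooth_on U f.
Proof.
move=> oU.
apply: (@smooth_coind R V R U (fun f => forall c : R -> V, smooth_on setT c ->
  (forall t, U (c t)) -> smooth_on setT (fun t => f (c t)))) => // {}f hf.
have ballU x : U x -> exists2 r : R, 0 < r & forall y, `|y - x| < r -> U y.
  move=> Ux; have /nbhs_ballP[r/= r0 hr] := open_near oU Ux.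
  by exists r => // y yr; apply: hr; rewrite -ball_normE/= distrC.
have lineU x v : U x -> exists2 r : R, 0 < r & forall s : R, `|s| < r -> U (x + s *: v).
  move=> /ballU[r r0 hr]; have v1 : 0 < `|v| + 1 by rewrite ltr_wpDl.
  exists (r / (`|v| + 1)); first by rewrite divr_gt0.
  move=> s; rewrite ltr_pdivlMr// => sr; apply: hr.
  rewrite addrAC subrr add0r normrZ; have := normr_ge0 s; nra.
have dline x v : U x -> exists d, is_derive x v f d.
  move=> Ux; have [r r0 hr] := lineU x v Ux.
  have sc : smooth_on setT (fun t => x + clamp r t *: v).
    apply: (smooth_add openT (smooth_cst _ openT)).
    exact: (smooth_scale openT (smooth_clamp r) (smooth_cst _ openT)).
  have := hf _ sc (fun t => hr _ (clamp_lt t r0)) => sfc.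
  exists ('D_1 (fun t : R => f (x + clamp r t *: v)) 0).
  apply/is_derive_line.
  have h := smooth_on_is_derive (1 : R) sfc (I : [set: R] 0); refine (near_eq_is_derive _ h).
  have r2 : 0 < r / 2 by lra.
  by apply: filterS (near0_lt r2) => t tr; rewrite clamp_id// ltW.
split=> [x Ux|v].
  split; last by move=> v; have [d [h _]] := dline x v Ux; exact: h.
  have [r r0 hr] := ballU x Ux.
  change (f @ x --> f x); apply/cvgrPdist_lt => e e0.
  apply: contrapT => hN.
  (* Points where continuity fails by [e], so close to [x] that one smooth curve passes through all
     of them. *)
  have /choice[q hq] : forall j, exists q, `|q - x| <= scale4 j ^+ j /\ e <= `|f x - f q|.
    move=> j; apply: contrapT => hj; apply: hN.
    have T0 : (0 : R) < scale4 j ^+ j by rewrite exprn_gt0// scale4_gt0.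
    apply: filterS (nbhsx_ballx x _ T0) => y; rewrite -ball_normE/= distrC => yx.
    rewrite ltNge; apply/negP => he; apply: hj; exists y; split=> //; exact: ltW.
  have [c [sc c0 cn]] := curve_through 0 (fun j => (hq j).1).
  have [d d0 hd] : exists2 d : R, 0 < d & forall t : R, `|t| < d -> U (c t).
    have cc : c @ (0 : R) --> c 0 by exact: (smooth_on_cont sc).
    have : \forall t \near (0 : R), U (c t).
      by apply: cc; rewrite c0; exact: open_near.
    by move=> /near0P.
  have scl := smooth_comp1 (smooth_clamp d) sc.
  have sfc := hf _ scl (fun t => hd _ (clamp_lt t d0)).
  have cf : (fun t => f (c (clamp d t))) @ (0 : R) --> f (c (clamp d 0)).
    exact: (smooth_on_cont sfc).
  have cl0 : clamp d 0 = 0 by rewrite /clamp mul0r.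
  rewrite cl0 c0 in cf.
  move/cvgrPdist_lt : cf => /(_ e e0)/near0P[d1 d10 hd1].
  have d2 : 0 < Num.min d1 (d / 2) by rewrite lt_min d10; lra.
  have [N hN'] := scale4_small d2.
  have := hN' N (leqnn N); rewrite lt_min => /andP[N1 N2].
  have N0 := @scale4_gt0 R N.
  have := hd1 (scale4 N); rewrite gtr0_norm// => /(_ N1).
  rewrite clamp_id//; last by rewrite gtr0_norm// ltW.
  rewrite (nbhs_singleton (cn N)) scaler0 addr0 ltNge.
  by rewrite (hq N).2.
exists ('D_v f); last by move=> x _.
move=> c sc cU.
apply/NS_SC; apply: SC_local => t0.
have [r r0 hr] := ballU (c t0) (cU t0).
have v1 : 0 < `|v| + 1 by rewrite ltr_wpDl.
have [d d0 hd] : exists2 d : R, 0 < d & forall s : R, `|s| < d -> `|c (t0 + s) - c t0| < r / 2.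
  have cc : c @ t0 --> c t0 by exact: (smooth_on_cont sc).
  have r2 : 0 < r / 2 by lra.
  move/cvgrPdist_lt : cc => /(_ _ r2)/nbhs_ballP[d/= d0 hd].
  exists d => // s sd; rewrite distrC; apply: hd.
  by rewrite /ball/= opprD addNKr normrN.
pose d' := r / 2 / (`|v| + 1).
have d'0 : 0 < d' by rewrite !divr_gt0.
(* The derivative in [t] at 0 is that of [f] along [v] at the points of [c]; both parameters are
   clamped so that every point lies in [U]. *)
pose H s t := f (c (t0 + clamp d s) + clamp d' t *: v).
have UH s t : U (c (t0 + clamp d s) + clamp d' t *: v).
  apply: hr; rewrite addrAC; apply: (le_lt_trans (ler_normD _ _)).
  have h1 := hd _ (clamp_lt s d0); have h2 := clamp_lt t d'0.
  rewrite {2}/d' ltr_pdivlMr// in h2.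
  by rewrite normrZ; have := normr_ge0 (clamp d' t); lra.
have [|g sg dg] := @SC_two_parameters R (NS R^o) H.
  move=> a b sa sb; apply/NS_SC; apply: hf; last by move=> t; exact: UH.
  apply: (smooth_add openT).
    apply: (smooth_comp1 _ sc); apply: (smooth_addR openT (smooth_cst _ openT)).
    exact: (smooth_comp1 sa (smooth_clamp d)).
  exact: (smooth_scale openT (smooth_comp1 sb (smooth_clamp d')) (smooth_cst _ openT)).
exists (fun t => g (1 * t + - t0)).
  exact: (SC_comp (smooth_affine 1 (- t0)) sg).
have d2 : 0 < d / 2 by lra.
apply: filterS (nbhsx_ballx t0 _ d2) => t; rewrite /ball/= distrC => td.
rewrite mul1r; apply: derive_val.
have /NS_der h := dg (t - t0).
apply/is_derive_line; apply: near_eq_is_derive h.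
have d'2 : 0 < d' / 2 by lra.
apply: filterS (near0_lt d'2) => s sd; rewrite /H !clamp_id ?subrKC//; exact: ltW.
Unshelve. all: by end_near. Qed.

End euclidean_calculus.

Lemma open_eq_is_derive {R : realType} {V W : normedModType R} (U : set V) (f g : V -> W) x v d :
  open U -> U x -> (forall y, U y -> f y = g y) -> is_derive x v f d -> is_derive x v g d.
Proof.
move=> oU Ux fg df; refine (near_eq_is_derive _ df).
by apply: (filterS _ (open_near oU Ux)) => y Uy; rewrite fg.
Qed.

Lemma addr_cancel (W : zmodType) (a b c : W) : a + c - (b + c) = - b + a.
Proof. by rewrite opprD addrACA subrr addr0 addrC. Qed.

Section derivative_of_fields.
Context {R : realType} {n : nat}.
Implicit Types (U : set 'rV[R]_n).

Lemma smooth_derive_field (W : normedModType R) U (Y : 'rV[R]_n -> 'rV[R]_n) (g : 'rV[R]_n -> W) :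
  open U -> smooth_on U Y -> smooth_on U g -> smooth_on U (fun y => 'D_(Y y) g y).
Proof.
move=> oU sY sg; apply: (@eq_smooth_on _ _ _ U (fun y => \sum_i Y y 0 i *: 'D_(delta_mx 0 i) g y)) => //.
  by move=> x; rewrite inE => Ux; rewrite -(smooth_deriveE _ oU sg).
apply: smooth_sum => // i; apply: (smooth_scale oU _ (smooth_onD _ sg)).
exact: ((smooth_coord _ oU).1 sY i).
Qed.

Lemma derive_of_field (W : normedModType R) U (Y : 'rV[R]_n -> 'rV[R]_n) (g : 'rV[R]_n -> W) x u :
  open U -> smooth_on U Y -> smooth_on U g -> U x ->
  'D_u (fun y => 'D_(Y y) g y) x = 'D_('D_u Y x) g x + 'D_(Y x) ('D_u g) x.
Proof.
move=> oU sY sg Ux.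
have E : {in U, (fun y => 'D_(Y y) g y) =1 (fun y => \sum_i Y y 0 i *: 'D_(delta_mx 0 i) g y)}.
  by move=> y; rewrite inE => Uy; rewrite -(smooth_deriveE _ oU sg).
rewrite (eq_on_D u oU E) ?inE//.
have sYi i : smooth_on U (fun y => Y y 0 i) by exact: ((smooth_coord _ oU).1 sY i).
have D i : is_derive x u (fun y => Y y 0 i *: 'D_(delta_mx 0 i) g y)
    ('D_u Y x 0 i *: 'D_(delta_mx 0 i) g x + Y x 0 i *: 'D_(delta_mx 0 i) ('D_u g) x).
  rewrite -(smooth_schwarz u (delta_mx 0 i) oU sg Ux).
  have -> : 'D_u Y x 0 i = 'D_u (fun y => Y y 0 i) x.
    by rewrite (derive_mx (smooth_on_derivable sY Ux)) mxE.
  apply: is_deriveZf; first exact: (smooth_on_is_derive _ (sYi i)).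
  exact: (smooth_on_is_derive _ (smooth_onD _ sg)).
rewrite (_ : (fun y => _) = \sum_i (fun y => Y y 0 i *: 'D_(delta_mx 0 i) g y)); last first.
  by apply/funext => y; rewrite fct_sumE.
rewrite (derive_val (is_derive := is_derive_sum D)) big_split/=.
by rewrite -(smooth_deriveE _ oU sg Ux) -(smooth_deriveE _ oU (smooth_onD u sg) Ux).
Qed.

(** The terms with second derivatives of [g] cancel by symmetry. The values of [g] are vectors, so
    that transition maps can be inserted for [g]. *)
Lemma derive_commutator (W : normedModType R) U (X Y : 'rV[R]_n -> 'rV[R]_n) (g : 'rV[R]_n -> W) x :
  open U -> smooth_on U X -> smooth_on U Y -> smooth_on U g -> U x ->
  'D_(X x) (fun y => 'D_(Y y) g y) x - 'D_(Y x) (fun y => 'D_(X y) g y) x =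
  'D_('D_(X x) Y x - 'D_(Y x) X x) g x.
Proof.
move=> oU sX sY sg Ux; rewrite (derive_of_field _ oU sY sg Ux) (derive_of_field _ oU sX sg Ux).
rewrite (smooth_schwarz (X x) (Y x) oU sg Ux).
have -> : 'D_(X x) Y x - 'D_(Y x) X x = (-1) *: 'D_(Y x) X x + 'D_(X x) Y x by rewrite scaleN1r addrC.
rewrite (smooth_derive_linear _ _ _ oU sg Ux) scaleN1r.
exact: addr_cancel.
Qed.

Lemma smooth_jacobianE m U (f : 'rV[R]_n -> 'rV[R]_m) x v : open U -> smooth_on U f -> U x ->
  'D_v f x = v *m jacobian f x.
Proof. by move=> oU sf Ux; apply: deriveEjacobian; exact: smooth_differentiable sf Ux. Qed.

End derivative_of_fields.

(** * Calculus on a manifold *)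

Section charts.
Context {R : realType} {n : nat} {M : manifold R n}.
Implicit Types (phi psi chi : chart R n M) (p q : M) (z : 'rV[R]_n).

Definition trans phi psi := cmap psi \o cinv phi.
Definition tdom phi psi : set 'rV[R]_n := [set z | cimg phi z /\ cdom psi (cinv phi z)].
Definition jac phi psi z : 'M[R]_n := jacobian (trans phi psi) z.

Lemma open_cimg phi : open (cimg phi).
Proof. exact: cimg_open. Qed.
Arguments open_cimg : clear implicits.

Lemma cimg_cmap phi p : cdom phi p -> cimg phi (cmap phi p).
Proof. by move=> h; exists p. Qed.

Lemma cdom_cinv phi z : cimg phi z -> cdom phi (cinv phi z).
Proof. by move=> [p hp <-]; rewrite cmapK. Qed.

Lemma cinvK phi z : cimg phi z -> cmap phi (cinv phi z) = z.
Proof. by move=> [p hp <-]; rewrite cmapK. Qed.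

Lemma tdomE phi psi : tdom phi psi = cmap phi @` (cdom phi `&` cdom psi).
Proof.
apply/seteqP; split=> z.
  by move=> [[p hp <-]]; rewrite cmapK// => hq; exists p.
by move=> [p [hp hq] <-]; split; [exists p|rewrite cmapK].
Qed.

Lemma open_tdom phi psi : open (tdom phi psi).
Proof.
rewrite openE => z [hz hp].
have c : cinv phi @ z --> cinv phi z by exact: cinv_continuous hz.
have h1 : \forall y \near z, cdom psi (cinv phi y).
  by apply: c; exact: (open_nbhs_nbhs (conj (@cdom_open _ _ _ psi) hp)).
have h2 : \forall y \near z, cimg phi y by exact: (open_nbhs_nbhs (conj (open_cimg phi) hz)).
by rewrite /interior; near=> y; split; near: y.
Unshelve. all: by end_near. Qed.

Arguments open_tdom : clear implicits.

Lemma trans_smooth phi psi : atlas phi -> atlas psi -> smooth_on (tdom phi psi) (trans phi psi).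
Proof. by move=> a1 a2; rewrite tdomE; exact: atlas_smooth. Qed.

Lemma tdom_cmap phi psi p : cdom phi p -> cdom psi p -> tdom phi psi (cmap phi p).
Proof. by move=> h1 h2; split; [exact: cimg_cmap|rewrite cmapK]. Qed.

Lemma trans_cmap phi psi p : cdom phi p -> trans phi psi (cmap phi p) = cmap psi p.
Proof. by move=> h; rewrite /trans/= cmapK. Qed.

Lemma trans_cinv phi psi z : tdom phi psi z -> cinv psi (trans phi psi z) = cinv phi z.
Proof. by move=> [h1 h2]; rewrite /trans/= cmapK. Qed.

Lemma trans_tdom phi psi z : tdom phi psi z -> tdom psi phi (trans phi psi z).
Proof.
move=> [h1 h2]; have := tdom_cmap h2 (cdom_cinv h1).
by rewrite /trans.
Qed.

Lemma transE phi psi z v : atlas phi -> atlas psi -> tdom phi psi z ->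
  is_derive z v (trans phi psi) (v *m jac phi psi z).
Proof.
move=> a1 a2 hz; rewrite /jac -(smooth_jacobianE v (open_tdom phi psi) (trans_smooth a1 a2) hz).
exact: (smooth_on_is_derive _ (trans_smooth a1 a2)).
Qed.

Lemma trans_differentiable phi psi z : atlas phi -> atlas psi -> tdom phi psi z ->
  differentiable (trans phi psi) z.
Proof. by move=> a1 a2; exact: (smooth_differentiable (open_tdom phi psi) (trans_smooth a1 a2)). Qed.

Lemma jac_chain phi psi chi z : atlas phi -> atlas psi -> atlas chi ->
  tdom phi psi z -> tdom phi chi z ->
  jac phi chi z = jac phi psi z *m jac psi chi (trans phi psi z).
Proof.
move=> a1 a2 a3 h2 h3.
have h23 : tdom psi chi (trans phi psi z) by have := tdom_cmap h2.2 h3.2.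
apply/row_matrixP => i; rewrite !rowE mulmxA.
have D2 := @transE phi psi z (delta_mx 0 i) a1 a2 h2.
have := is_derive_comp D2 (trans_differentiable a2 a3 h23).
have [_ ->] := @transE psi chi _ (delta_mx 0 i *m jac phi psi z) a2 a3 h23.
move=> D3; have D1 := @transE phi chi z (delta_mx 0 i) a1 a3 h3.
have E y : tdom phi psi y -> (trans psi chi \o trans phi psi) y = trans phi chi y.
  by move=> hy; rewrite /= {1}/trans /= (trans_cinv hy).
exact: (is_derive_unique D1 (open_eq_is_derive (open_tdom phi psi) h2 E D3)).
Qed.

Lemma jac_id phi z : atlas phi -> cimg phi z -> jac phi phi z = 1%:M.
Proof.
move=> a1 hz; have hz' : tdom phi phi z by split=> //; exact: cdom_cinv.
apply/row_matrixP => i; rewrite !rowE mulmx1.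
have E y : cimg phi y -> id y = trans phi phi y by move=> hy; rewrite /trans /= (cinvK hy).
have D := open_eq_is_derive (open_cimg phi) hz E (is_derive_id z (delta_mx 0 i)).
exact: (is_derive_unique (@transE phi phi z (delta_mx 0 i) a1 a1 hz') D).
Qed.

Lemma jac_inv phi psi z : atlas phi -> atlas psi -> tdom phi psi z ->
  jac phi psi z *m jac psi phi (trans phi psi z) = 1%:M.
Proof.
move=> a1 a2 hz; rewrite -jac_chain ?jac_id//; first exact: hz.1.
by split; [exact: hz.1|exact: (cdom_cinv hz.1)].
Qed.

Lemma cdom_at p : cdom (chart_at p) p. Proof. exact: chart_at_dom. Qed.
Lemma atlas_at p : atlas (chart_at p). Proof. exact: chart_at_atlas. Qed.
Arguments cdom_at : clear implicits.
Arguments atlas_at : clear implicits.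
Hint Resolve cdom_at atlas_at : core.

Lemma to_chartE phi p : to_chart phi p = jac (chart_at p) phi (cmap_at p).
Proof. by []. Qed.

Lemma from_chartE phi z : from_chart phi z = jac phi (chart_at (cinv phi z)) z.
Proof. by []. Qed.

Lemma cimg_at p : cimg (chart_at p) (cmap_at p).
Proof. exact: cimg_cmap. Qed.
Arguments cimg_at : clear implicits.

Lemma cinv_at p : cinv (chart_at p) (cmap_at p) = p.
Proof. exact: cmapK. Qed.

Lemma tdom_at phi p : cdom phi p -> tdom (chart_at p) phi (cmap_at p).
Proof. by move=> hp; exact: tdom_cmap. Qed.

Lemma tdom_to phi z : cimg phi z -> tdom phi (chart_at (cinv phi z)) z.
Proof. by move=> hz; split. Qed.

Lemma vfield_rep_trans (X : M -> 'rV[R]_n) phi psi z : atlas phi -> atlas psi ->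
  tdom phi psi z -> vfield_rep X psi (trans phi psi z) = vfield_rep X phi z *m jac phi psi z.
Proof.
move=> a1 a2 hz; rewrite /vfield_rep (trans_cinv hz) -mulmxA; set p := cinv phi z.
suff -> : to_chart psi p = to_chart phi p *m jac phi psi z by [].
rewrite !to_chartE.
have hp : cdom phi p by exact: (cdom_cinv hz.1).
rewrite (jac_chain (atlas_at p) a1 a2 (tdom_at hp) (tdom_at hz.2)).
by rewrite {3}/cmap_at (trans_cmap _ (cdom_at p)) /p (cinvK hz.1).
Qed.

Lemma vfield_rep_at (X : M -> 'rV[R]_n) p : vfield_rep X (chart_at p) (cmap_at p) = X p.
Proof. by rewrite /vfield_rep cinv_at to_chartE (jac_id (atlas_at p) (cimg_at p)) mulmx1. Qed.

Lemma vfield_repE (X : M -> 'rV[R]_n) phi p : cdom phi p ->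
  vfield_rep X phi (cmap phi p) = X p *m jac (chart_at p) phi (cmap_at p).
Proof. by move=> hp; rewrite /vfield_rep cmapK. Qed.

Lemma form_repE phi (w : preform M) p A : cdom phi p ->
  form_rep phi w (cmap phi p) A = w p (A *m jac phi (chart_at p) (cmap phi p)).
Proof. by move=> hp; rewrite /form_rep from_chartE cmapK. Qed.

Lemma form_rep_trans (w : preform M) phi psi z A : atlas phi -> atlas psi -> tdom phi psi z ->
  form_rep phi w z A = form_rep psi w (trans phi psi z) (A *m jac phi psi z).
Proof.
move=> a1 a2 hz; rewrite /form_rep (trans_cinv hz) !from_chartE (trans_cinv hz) -mulmxA.
by rewrite -(jac_chain a1 a2 (atlas_at _) hz (tdom_to hz.1)).
Qed.

Lemma form_rep_at (w : preform M) p A : form_rep (chart_at p) w (cmap_at p) A = w p A.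
Proof. by rewrite (form_repE _ _ (cdom_at p)) (jac_id (atlas_at p) (cimg_at p)) mulmx1. Qed.

End charts.
Arguments open_cimg {R n M} phi.
Arguments open_tdom {R n M} phi psi.
Arguments cdom_at {R n M} p.
Arguments atlas_at {R n M} p.
Arguments cimg_at {R n M} p.
#[global] Hint Resolve cdom_at atlas_at : core.

Section smooth_functions.
Context {R : realType} {n : nat} {M : manifold R n}.
Implicit Types (phi psi chi : chart R n M) (p q : M) (z : 'rV[R]_n) (f g : M -> R).

Lemma continuous_open_preimage (T1 T2 : topologicalType) (f : T1 -> T2) (U : set T2) :
  continuous f -> open U -> open (f @^-1` U).
Proof. by move=> cf oU; apply: open_comp => // x _; exact: cf. Qed.

Lemma chart_curve phi (c : R -> 'rV[R]_n) : atlas phi -> smooth_on setT c ->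
  (forall t, cimg phi (c t)) -> @smooth_curve R n M (cinv phi \o c).
Proof.
move=> a1 sc hc; have cc : continuous c by move=> t; exact: (smooth_on_cont sc).
split=> [t|psi a2].
  exact: (continuous_comp (cc t) (cinv_continuous (hc t))).
rewrite (_ : [set t | _] = c @^-1` (tdom phi psi)); last first.
  by apply/seteqP; split=> t /=; [move=> ?; split|case].
apply: (@smooth_comp R R n 'rV[R]_n (c @^-1` (tdom phi psi)) (tdom phi psi) c (trans phi psi)).
- exact: (continuous_open_preimage cc (open_tdom phi psi)).
- exact: open_tdom.
- by [].
- exact: (smooth_onS (@subsetT _ _) sc).
- exact: (trans_smooth a1 a2).
Qed.

Lemma smooth_fun_curve f (c : R -> M) : smooth_fun f -> smooth_curve c -> smooth_on setT (f \o c).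
Proof.
move=> sf [cc sc]; apply: smooth_on_local => t _.
pose phi := chart_at (c t); exists (c @^-1` cdom phi); first exact: cdom_at.
have o1 : open (c @^-1` cdom phi) by exact: (continuous_open_preimage cc (@cdom_open _ _ _ phi)).
apply: (@eq_smooth_on _ _ _ _ ((f \o cinv phi) \o (cmap phi \o c)) _ o1).
  by move=> s; rewrite inE => hs; rewrite /= (cmapK hs).
apply: (@smooth_comp R R n R _ (cimg phi) (cmap phi \o c) _ o1 (open_cimg phi)).
- by move=> s hs; exact: cimg_cmap.
- exact: (sc _ (atlas_at _)).
- exact: (sf _ (atlas_at _)).
Qed.

(** Boman's theorem in charts: together with [smooth_fun_curve], smoothness on [M] is smoothness
    along curves. *)
Lemma curve_smooth_fun f : (forall c, smooth_curve c -> smooth_on setT (f \o c)) -> smooth_fun f.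
Proof.
move=> h phi a1; apply: boman_smooth; first exact: open_cimg.
by move=> c sc hc; apply: (h (cinv phi \o c)); exact: chart_curve.
Qed.

Lemma smooth_fun_cst (a : R) : smooth_fun (fun _ : M => a).
Proof. by move=> phi _; apply: smooth_cst; exact: open_cimg. Qed.
Lemma smooth_funD f g : smooth_fun f -> smooth_fun g -> smooth_fun (fun x => f x + g x).
Proof. by move=> sf sg phi a1; exact: (@smooth_addR R _ _ (f \o cinv phi) (g \o cinv phi) (open_cimg phi) (sf _ a1) (sg _ a1)). Qed.
Lemma smooth_funM f g : smooth_fun f -> smooth_fun g -> smooth_fun (fun x => f x * g x).
Proof. by move=> sf sg phi a1; exact: (@smooth_mul R _ _ (f \o cinv phi) (g \o cinv phi) (open_cimg phi) (sf _ a1) (sg _ a1)). Qed.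

Lemma smooth_fun_chart_at f p : smooth_fun f -> {for p, continuous f}.
Proof.
move=> sf; pose phi := chart_at p.
have c1 : (f \o cinv phi) @ cmap phi p --> (f \o cinv phi) (cmap phi p).
  by apply: (smooth_on_cont (sf phi (atlas_at p))); exact: cimg_at.
have c2 : cmap phi @ p --> cmap phi p by apply: cmap_continuous; exact: cdom_at.
have c3 := cvg_comp _ _ c2 c1; change (f @ p --> f p).
have E : (f \o cinv phi) (cmap phi p) = f p by rewrite /= cmapK//; exact: cdom_at.
rewrite -E; apply: cvg_trans c3; apply: near_eq_cvg.
by apply: filterS (open_nbhs_nbhs (conj (@cdom_open _ _ _ phi) (cdom_at p))) => q hq; rewrite /= cmapK.
Qed.

Lemma lie_fun_chart (X : vfield M) f phi p : smooth_fun f -> atlas phi -> cdom phi p ->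
  lie_fun X f p = 'D_(vfield_rep X phi (cmap phi p)) (f \o cinv phi) (cmap phi p).
Proof.
move=> sf a1 hp; rewrite /lie_fun vfield_repE//.
have ht := tdom_at hp.
have D := transE (X p) (atlas_at p) a1 ht.
have df : differentiable (f \o cinv phi) (trans (chart_at p) phi (cmap_at p)).
  apply: (@smooth_differentiable R n R _ (f \o cinv phi) _ (open_cimg phi) (sf _ a1)).
  by rewrite /cmap_at trans_cmap//; exact: cimg_cmap.
have := is_derive_comp D df; rewrite {2}/cmap_at trans_cmap// => D2.
apply: (@derive_val); refine (open_eq_is_derive (open_tdom _ _) ht _ D2).
by move=> y hy; rewrite /= (trans_cinv hy).
Qed.

Lemma lie_fun_cinv (X : vfield M) f phi z : smooth_fun f -> atlas phi -> cimg phi z ->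
  lie_fun X f (cinv phi z) = 'D_(vfield_rep X phi z) (f \o cinv phi) z.
Proof. by move=> sf a1 hz; rewrite (lie_fun_chart _ sf a1 (cdom_cinv hz)) cinvK. Qed.

Lemma lie_fun_smooth (X : vfield M) f : smooth_fun f -> smooth_fun (lie_fun X f).
Proof.
move=> sf phi a1.
refine (@eq_smooth_on _ _ _ _ _ _ (open_cimg phi) _ (@smooth_derive_field R n R _ _ (f \o cinv phi) (open_cimg phi) (vfield_smooth X a1) (sf _ a1))).
by move=> z; rewrite inE => hz; rewrite /= (lie_fun_cinv _ sf a1 hz).
Qed.

Lemma iter_lie_fun_smooth (Xs : seq (vfield M)) f : smooth_fun f -> smooth_fun (iter_lie_fun Xs f).
Proof. by move=> sf; elim: Xs => [|X Xs IH]; [exact: sf|exact: (lie_fun_smooth X IH)]. Qed.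

(** A clamped line in the chart at [p], with the velocity of [X] at time 0. One curve serves for all
    [f], so the rules for [lie_fun] at [p] reduce to those for derivatives on the line. *)
Lemma vfield_curve (X : vfield M) p : exists c : R -> M, [/\ smooth_curve c, c 0 = p &
  forall f, smooth_fun f -> is_derive (0 : R) 1 (f \o c) (lie_fun X f p)].
Proof.
pose phi := chart_at p; pose z := cmap phi p; pose v := vfield_rep X phi z.
have hz : cimg phi z by exact: cimg_at.
have /nbhs_ballP[r/= r0 hr] := open_near (open_cimg phi) hz.
have v1 : 0 < `|v| + 1 by rewrite ltr_wpDl.
pose d := r / (`|v| + 1); have d0 : 0 < d by rewrite divr_gt0.
pose c t := z + clamp d t *: v.
have sc : smooth_on setT c.
  apply: (smooth_add openT (smooth_cst _ openT)).
  exact: (smooth_scale openT (smooth_clamp d) (smooth_cst _ openT)).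
have hc t : cimg phi (c t).
  apply: hr; rewrite -ball_normE/= opprD addNKr normrN normrZ.
  have := clamp_lt t d0; rewrite {2}/d ltr_pdivlMr//.
  by have := normr_ge0 (clamp d t); lra.
have c0 : c 0 = z by rewrite /c /clamp mul0r scale0r addr0.
exists (cinv phi \o c); split; first exact: (chart_curve (atlas_at p) sc hc).
  by rewrite /= c0 /z cmapK//; exact: cdom_at.
move=> f sf; rewrite (lie_fun_chart _ sf (atlas_at p) (cdom_at p)) -/phi -/z -/v.
have h := smooth_on_is_derive v (sf _ (atlas_at p)) hz.
move/is_derive_line : h => h; apply: near_eq_is_derive h.
have d2 : 0 < d / 2 by lra.
by apply: filterS (near0_lt d2) => s sd; rewrite /= /c clamp_id// ltW.
Qed.

Lemma lie_funD (X : vfield M) f g p : smooth_fun f -> smooth_fun g ->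
  lie_fun X (fun x => f x + g x) p = lie_fun X f p + lie_fun X g p.
Proof.
move=> sf sg; have [c [_ _ hc]] := vfield_curve X p.
exact: (is_derive_unique (hc _ (smooth_funD sf sg)) (is_deriveD (hc _ sf) (hc _ sg))).
Qed.

Lemma lie_funM (X : vfield M) f g p : smooth_fun f -> smooth_fun g ->
  lie_fun X (fun x => f x * g x) p = lie_fun X f p * g p + f p * lie_fun X g p.
Proof.
move=> sf sg; have [c [_ c0 hc]] := vfield_curve X p.
have := is_deriveZf (hc _ sf) (hc _ sg); rewrite /= c0.
exact: (is_derive_unique (hc _ (smooth_funM sf sg))).
Qed.

Lemma lie_fun_cst (X : vfield M) (a : R) p : lie_fun X (fun=> a) p = 0.
Proof.
have [c [_ c0 hc]] := vfield_curve X p.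
exact: (is_derive_unique (hc _ (smooth_fun_cst a)) (is_derive_cst a _ _)).
Qed.

Lemma lie_funZ (X : vfield M) (a : R) f p : smooth_fun f ->
  lie_fun X (fun x => a * f x) p = a * lie_fun X f p.
Proof.
by move=> sf; rewrite (lie_funM _ _ (smooth_fun_cst a) sf) lie_fun_cst mul0r add0r.
Qed.

End smooth_functions.

Section compact_sets.
Context {R : realType}.

(** Compactness as an induction principle; it takes the place of finite covers and of partitions of
    unity. *)
Lemma compact_ind (T : topologicalType) (K : set T) (Q : set T -> Prop) : compact K ->
  Q set0 -> (forall A B, Q A -> Q B -> Q (A `|` B)) ->
  (forall p, K p -> exists2 A, nbhs p A & Q A) ->
  exists2 A, Q A & forall p, K p -> nbhs p A.
Proof.
move=> cK Q0 QU Qloc.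
(* A statement holds along [F] when it holds for all sets above some [A] with [Q A]; the
   near-covering form of compactness is applied to the statement that such a set is a neighbourhood
   of a point. *)
pose F := filter_from Q (fun A => [set B | A `<=` B]).
have FF : Filter F.
  apply: filter_from_filter; first by exists set0.
  move=> A B QA QB; exists (A `|` B); first exact: QU.
  by move=> D /= hD; split=> x hx; apply: hD; [left|right].
have [|A QA hA] := (compact_near_coveringP K).1 cK _ F (fun B x => nbhs x B) FF.
  move=> p /Qloc[N Np QN]; exists (N^°, [set B | N `<=` B]) => /=.
    by split; [exact: nbhs_interior|exists N].
  by move=> [x B] /= [hx NB]; exact: (filterS NB hx).
by exists A => //; exact: hA.
Qed.

Lemma compact_closed_ball n (z : 'rV[R]_n) (r : R) : compact [set y | `|z - y| <= r].
Proof.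
apply: bounded_closed_compact; last exact: closed_closed_ball_.
exists (`|z| + r); split; first exact: num_real.
move=> x hx y /= hy; apply: le_trans (ltW hx).
by rewrite -{1}(subKr z y) (le_trans (ler_normB _ _))// lerD2l.
Qed.

Lemma compact_cont_bounded (T : topologicalType) (K : set T) (f : T -> R) : compact K ->
  (forall p, K p -> {for p, continuous f}) -> exists C : R, 0 < C /\ forall p, K p -> `|f p| <= C.
Proof.
move=> cK cf.
have [|||A [C hC] hA] := @compact_ind T K (fun A => exists C : R, forall p, A p -> `|f p| <= C) cK.
- by exists 0.
- move=> A B [C hC] [D hD]; exists (`|C| + `|D|) => p [/hC|/hD] h; apply: (le_trans h).
    by rewrite (le_trans (ler_norm _))// lerDl.
  by rewrite (le_trans (ler_norm _))// lerDr.
- move=> p Kp; exists [set q | `|f q| <= `|f p| + 1]; last by exists (`|f p| + 1).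
  have /cvgrPdist_lt/(_ 1 ltr01) := cf p Kp; apply: filterS => q /= h.
  rewrite -(subKr (f p) (f q)) (le_trans (ler_normB _ _))// lerD2l; exact: ltW.
exists (`|C| + 1); split; first by rewrite ltr_wpDl.
move=> p /hA/nbhs_singleton/hC h; rewrite (le_trans h)// (le_trans (ler_norm _))// lerDl//.
Qed.

End compact_sets.

(** * Extension by zero of objects given in a chart *)

Section extension.
Context {R : realType} {n : nat} {M : manifold R n}.
Implicit Types (phi psi : chart R n M) (p q : M) (z : 'rV[R]_n) (C : set M).

Lemma open_cinv phi (U : set M) : open U -> open [set z | cimg phi z /\ U (cinv phi z)].
Proof.
move=> oU; rewrite openE => z [hz hp].
have c : cinv phi @ z --> cinv phi z by exact: cinv_continuous hz.
have h1 : \forall y \near z, U (cinv phi y).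
  by apply: c; exact: (open_nbhs_nbhs (conj oU hp)).
have h2 := open_near (open_cimg phi) hz.
by rewrite /interior; near=> y; split; near: y.
Unshelve. all: by end_near. Qed.

Arguments open_cinv phi {U}.

Lemma open_near_cinv phi (U : set 'rV[R]_n) p : cdom phi p -> nbhs (cmap phi p) U ->
  \forall q \near p, cdom phi q /\ U (cmap phi q).
Proof.
move=> hp hU; have h1 : nbhs p (cdom phi) by exact: (open_nbhs_nbhs (conj (@cdom_open _ _ _ phi) hp)).
have h2 : \forall q \near p, U (cmap phi q) by apply: (cmap_continuous hp).
by near=> q; split; near: q.
Unshelve. all: by end_near. Qed.

Lemma compact_cinv phi (K : set 'rV[R]_n) : compact K -> K `<=` cimg phi -> compact (cinv phi @` K).
Proof.
move=> cK Ks; apply: continuous_compact cK; apply: continuous_in_subspaceT => z.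
by rewrite inE => /Ks hz; exact: (cinv_continuous hz).
Qed.

Lemma closed_compact (C : set M) : compact C -> closed C.
Proof. by move=> cC; apply: (@compact_closed M); first exact: (@manifold_hausdorff _ _ M). Qed.

Definition extend phi (g : 'rV[R]_n -> R) : M -> R :=
  fun p => if pselect (cdom phi p) then g (cmap phi p) else 0.

Lemma extendE phi g p : cdom phi p -> extend phi g p = g (cmap phi p).
Proof. by rewrite /extend; case: pselect. Qed.

Lemma extend_cinv phi g z : cimg phi z -> extend phi g (cinv phi z) = g z.
Proof. by move=> hz; rewrite extendE ?cinvK//; exact: cdom_cinv. Qed.

(** [C] is closed in [M], not merely in the chart domain, so that the extension by zero is smooth at
    the boundary of the domain. *)
Definition vanishes_off phi C (g : 'rV[R]_n -> R) :=
  [/\ closed C, C `<=` cdom phi & forall z, cimg phi z -> ~ C (cinv phi z) -> g z = 0].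

Lemma extend_off phi C g p : vanishes_off phi C g -> ~ C p -> extend phi g p = 0.
Proof.
move=> [_ _ h] nC; rewrite /extend; case: pselect => // hp.
by apply: h; [exact: cimg_cmap|rewrite cmapK].
Qed.

(** Points over [C] have the overlap of the two charts as neighbourhood, the others the open
    complement of [C], where [F] vanishes. [F] will be the representation of a function or of a
    vector field. *)
Lemma smooth_extend (W : normedModType R) (F : 'rV[R]_n -> W) phi psi C g : atlas phi -> atlas psi ->
  vanishes_off phi C g ->
  smooth_on (tdom psi phi) F ->
  (forall z, cimg psi z -> ~ C (cinv psi z) -> F z = 0) ->
  smooth_on (cimg psi) F.
Proof.
move=> a1 a2 [cC Cd h] sF F0; apply: smooth_on_local => z hz.
have [hC|hC] := pselect (C (cinv psi z)).
  by exists (tdom psi phi) => //; split => //; exact: Cd.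
have oC : open (~` C) by exact: closed_openC.
exists [set z | cimg psi z /\ (~` C) (cinv psi z)]; first by [].
have oO := open_cinv psi oC.
apply: (eq_smooth_on oO _ (smooth_cst 0 oO)).
by move=> y; rewrite inE => -[h1 h2]; rewrite F0.
Qed.

Lemma smooth_fun_extend phi C g : atlas phi -> vanishes_off phi C g ->
  smooth_on (cimg phi) g -> smooth_fun (extend phi g).
Proof.
move=> a1 hC sg psi a2; apply: (smooth_extend a1 a2 hC); last first.
  by move=> z hz nC; exact: extend_off nC.
apply: (@eq_smooth_on _ _ _ _ (g \o trans psi phi) _ (open_tdom psi phi)).
  by move=> z; rewrite inE => hz; rewrite /= (extendE _ hz.2).
refine (smooth_comp (open_tdom psi phi) (open_cimg phi) _ (trans_smooth a2 a1) sg).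
by move=> z /trans_tdom[].
Qed.

(** The field represented by [g v] in [phi]; the Jacobian converts it to the components in
    [chart_at p], by which vectors at [p] are given. *)
Definition extend_vec phi (g : 'rV[R]_n -> R) (v : 'rV[R]_n) : M -> 'rV[R]_n := fun p =>
  extend phi g p *: (v *m jac phi (chart_at p) (cmap phi p)).

Lemma extend_vec_rep phi psi g v z : atlas phi -> atlas psi -> tdom psi phi z ->
  vfield_rep (extend_vec phi g v) psi z =
  g (trans psi phi z) *: 'D_v (trans phi psi) (trans psi phi z).
Proof.
move=> a1 a2 hz; pose p := cinv psi z; have hp : cdom phi p := hz.2.
have hp' : cdom psi p := cdom_cinv hz.1.
have ez : trans psi phi z = cmap phi p by [].
have ht := tdom_cmap hp hp'.
rewrite /vfield_rep -/p /extend_vec (extendE _ hp) -ez -scalemxAl -mulmxA.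
have [_ ->] := transE v a1 a2 (trans_tdom hz); congr (_ *: (_ *m _)).
by rewrite to_chartE ez (jac_chain a1 (atlas_at p) a2 (tdom_cmap hp (cdom_at p)) ht) (trans_cmap _ hp).
Qed.

Lemma extend_vec_smooth phi C g v : atlas phi -> vanishes_off phi C g ->
  smooth_on (cimg phi) g ->
  forall psi, atlas psi -> smooth_on (cimg psi) (vfield_rep (extend_vec phi g v) psi).
Proof.
move=> a1 hC sg psi a2; apply: (smooth_extend a1 a2 hC); last first.
  by move=> z hz nC; rewrite /vfield_rep /extend_vec (extend_off hC nC) scale0r mul0mx.
have E : {in tdom psi phi, (fun z => g (trans psi phi z) *: 'D_v (trans phi psi) (trans psi phi z))
    =1 vfield_rep (extend_vec phi g v) psi}.
  by move=> z; rewrite inE => hz; rewrite extend_vec_rep.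
refine (eq_smooth_on (open_tdom psi phi) E _).
have tt z : tdom psi phi z -> tdom phi psi (trans psi phi z) by exact: trans_tdom.
apply: (smooth_scale (open_tdom psi phi)).
  refine (@smooth_comp R _ n R _ (cimg phi) _ g (open_tdom psi phi) (open_cimg phi) _ (trans_smooth a2 a1) sg).
  by move=> z /tt[].
exact: (@smooth_comp R _ n _ _ _ _ ('D_v (trans phi psi)) (open_tdom psi phi) (open_tdom phi psi) tt (trans_smooth a2 a1) (smooth_onD v (trans_smooth a1 a2))).
Qed.

Lemma extend_vec_repE phi g v z : atlas phi -> cimg phi z ->
  vfield_rep (extend_vec phi g v) phi z = g z *: v.
Proof.
move=> a1 hz; have ht : tdom phi phi z by split=> //; exact: cdom_cinv.
have [_] := transE v a1 a1 (trans_tdom ht).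
have -> : trans phi phi z = z by rewrite /trans/= cinvK.
rewrite (jac_id a1 hz) mulmx1 => e.
by rewrite (extend_vec_rep _ _ a1 a1 ht) /trans/= cinvK// -/(trans phi phi) e.
Qed.

(* Equals 1 for [|z - z0| <= r] and 0 for [|z - z0| >= 3 r / 2]. *)
Definition box_bump z0 (r : R) z : R := \prod_(i < n) plateau ((z 0 i - z0 0 i) / r).

Lemma smooth_box_bump z0 r : smooth_on setT (box_bump z0 r).
Proof.
apply: (smooth_prod _ openT) => i.
have sc : smooth_on setT (fun z : 'rV[R]_n => z 0 i).
  exact: ((smooth_coord _ openT).1 (smooth_id (V := 'rV[R]_n)) i).
pose g (y : 'rV[R]_1) := plateau (r^-1 * y 0 0 + - (z0 0 i / r)).
have sg : smooth_on setT g.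
  have s0 : smooth_on setT (fun y : 'rV[R]_1 => y 0 0).
    exact: ((smooth_coord _ openT).1 (smooth_id (V := 'rV[R]_1)) 0).
  apply: boman_smooth openT _ => c sc' _.
  have s1 : smooth_on setT (fun t => c t 0 0) by exact: ((smooth_coord _ openT).1 sc' 0).
  exact: (smooth_comp1 (smooth_comp1 s1 (smooth_affine _ _)) (@smooth_plateau R)).
apply: (boman_smooth openT) => c sc' _.
have s1 : smooth_on setT (fun t => c t 0 i) by exact: ((smooth_coord _ openT).1 sc' i).
have := smooth_comp1 (smooth_comp1 s1 (smooth_affine r^-1 (- (z0 0 i / r)))) (@smooth_plateau R).
by congr (smooth_on setT _); apply/funext => t; congr plateau; rewrite mulrBl mulrC.
Qed.

Lemma box_bump1 z0 r z : 0 < r -> `|z0 - z| <= r -> box_bump z0 r z = 1.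
Proof.
move=> r0 hz; apply: big1 => i _; apply: plateau1.
rewrite normrM normfV (gtr0_norm r0) ler_pdivrMr// mul1r distrC.
by apply: le_trans hz; have := coord_le_norm (z0 - z) 0 i; rewrite !mxE.
Qed.

Lemma box_bump0 z0 r z : 0 < r -> 3 / 2 * r < `|z0 - z| -> box_bump z0 r z = 0.
Proof.
move=> r0; rewrite ltNge => /negP h; apply/eqP; apply/negP => /negP h'; apply: h.
apply: norm_le_coord => [|j i]; first by apply: mulr_ge0; lra.
rewrite ord1 !mxE; rewrite leNgt; apply/negP => h; move/negP: h'; apply; apply/eqP.
rewrite /box_bump (bigD1 i)//= plateau0 ?mul0r//.
by rewrite normrM normfV (gtr0_norm r0) ler_pdivlMr// distrC ltW.
Qed.

End extension.
Arguments open_cinv {R n M} phi {U}.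

Section frames.
Context {R : realType} {n : nat} {M : manifold R n}.
Implicit Types (phi psi : chart R n M) (p q : M) (z : 'rV[R]_n) (C : set M).

Lemma chart_ball p : exists2 r : R, 0 < r &
  forall z, `|cmap_at p - z| <= 2 * r -> cimg (chart_at p) z.
Proof.
have /nbhs_ballP[r/= r0 hr] := open_near (open_cimg (chart_at p)) (cimg_at p).
exists (r / 4); first lra.
move=> z hz; apply: hr; rewrite -ball_normE/=; lra.
Qed.

Lemma box_bump_vanishes p r (g : 'rV[R]_n -> R) : 0 < r ->
  (forall z, `|cmap_at p - z| <= 2 * r -> cimg (chart_at p) z) ->
  exists2 C, compact C & vanishes_off (chart_at p) C (fun z => g z * box_bump (cmap_at p) r z).
Proof.
move=> r0 hr; pose K := [set z | `|cmap_at p - z| <= 3 / 2 * r].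
have Ks : K `<=` cimg (chart_at p) by move=> z hz; apply: hr; apply: (le_trans hz); lra.
have cC : compact (cinv (chart_at p) @` K).
  by apply: compact_cinv Ks; exact: compact_closed_ball.
exists (cinv (chart_at p) @` K) => //; split; first exact: closed_compact.
  by move=> _ [z /Ks hz <-]; exact: cdom_cinv.
move=> z hz nC; rewrite box_bump0 ?mulr0//; rewrite ltNge; apply/negP => h.
by apply: nC; exists z.
Qed.

Lemma bump_at p : exists (rho : M -> R) C, [/\ smooth_fun rho, compact C, C `<=` cdom (chart_at p),
  forall q, ~ C q -> rho q = 0 & \forall q \near p, rho q = 1].
Proof.
have [r r0 hr] := chart_ball p.
have [C cC hC] := box_bump_vanishes (fun=> 1) r0 hr.
exists (extend (chart_at p) (fun z => 1 * box_bump (cmap_at p) r z)), C; split=> //.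
- apply: (smooth_fun_extend (atlas_at p) hC).
  apply: (smooth_mul (open_cimg _) (smooth_cst _ (open_cimg _))).
  exact: (smooth_onS (@subsetT _ _) (smooth_box_bump _ _)).
- by case: hC.
- by move=> q nC; exact: extend_off hC nC.
have hB : \forall z \near cmap (chart_at p) p, `|cmap_at p - z| <= r.
  apply/nbhs_ballP; exists r => //= z; rewrite -ball_normE/=; exact: ltW.
apply: (filterS _ (open_near_cinv (cdom_at p) hB)) => q [h1 h2].
by rewrite (extendE _ h1) box_bump1// mulr1.
Qed.

(** Coordinates and coordinate fields around [p], made global by a cut-off, because the definitions
    admit only functions and fields on all of [M]. *)
Lemma local_frame p : exists (r : R) (P : 'I_n -> M -> R) (Z : 'I_n -> vfield M),
  [/\ 0 < r, forall z, `|cmap_at p - z| <= r -> cimg (chart_at p) z,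
     forall i, smooth_fun (P i),
     forall i z, `|cmap_at p - z| <= r -> P i (cinv (chart_at p) z) = z 0 i &
     forall i z, `|cmap_at p - z| <= r -> vfield_rep (Z i) (chart_at p) z = delta_mx 0 i].
Proof.
have [r r0 hr] := chart_ball p; pose phi := chart_at p.
have hr' z : `|cmap_at p - z| <= r -> cimg phi z by move=> hz; apply: hr; apply: (le_trans hz); lra.
pose b := box_bump (cmap_at p) r.
have sb : smooth_on (cimg phi) b by exact: (smooth_onS (@subsetT _ _) (smooth_box_bump _ _)).
have sP i : smooth_on (cimg phi) (fun z => z 0 i * b z).
  apply: (smooth_mul (open_cimg _) _ sb); apply: (smooth_onS (@subsetT _ _)).
  exact: ((smooth_coord _ openT).1 (smooth_id (V := 'rV[R]_n)) i).
have sZ : smooth_on (cimg phi) (fun z => 1 * b z).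
  exact: (smooth_mul (open_cimg _) (smooth_cst _ (open_cimg _)) sb).
have [C _ hC] := box_bump_vanishes (fun=> 1) r0 hr.
exists r, (fun i => extend phi (fun z => z 0 i * b z)),
  (fun i => VField (extend_vec_smooth (delta_mx 0 i) (atlas_at p) hC sZ)); split=> //.
- move=> i; have [D _ hD] := box_bump_vanishes (fun z => z 0 i) r0 hr.
  exact: (smooth_fun_extend (atlas_at p) hD (sP i)).
- by move=> i z hz; rewrite (extend_cinv _ (hr' z hz)) /b box_bump1// mulr1.
- move=> i z hz; rewrite /= (extend_vec_repE _ _ (atlas_at p) (hr' z hz)) box_bump1// mul1r.
  by rewrite scale1r.
Qed.

Lemma compact_nbhd (K : set M) : compact K -> exists2 K', compact K' & forall p, K p -> nbhs p K'.
Proof.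
move=> cK; apply: compact_ind => // [||p _]; first exact: compact0.
  exact: compactU.
have [r r0 hr] := chart_ball p.
exists (cinv (chart_at p) @` [set z | `|cmap_at p - z| <= 2 * r]); last first.
  by apply: compact_cinv => //; exact: compact_closed_ball.
have hB : \forall z \near cmap (chart_at p) p, `|cmap_at p - z| <= 2 * r.
  apply/nbhs_ballP; exists (2 * r); first by rewrite /=; lra.
  by move=> z; rewrite -ball_normE/=; exact: ltW.
apply: (filterS _ (open_near_cinv (cdom_at p) hB)) => q [h1 h2].
by exists (cmap (chart_at p) q) => //; rewrite cmapK.
Qed.

Lemma smooth_fun_bounded (K : set M) (f : M -> R) : compact K -> smooth_fun f ->
  exists C : R, 0 < C /\ forall p, K p -> `|f p| <= C.
Proof. by move=> cK sf; apply: (@compact_cont_bounded R M K f cK) => p _; exact: smooth_fun_chart_at. Qed.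

End frames.

Lemma subr_congr (V : zmodType) (a b c d : V) : a = c -> b = d -> a - b = c - d.
Proof. by move=> -> ->. Qed.

Section bracket.
Context {R : realType} {n : nat} {M : manifold R n}.
Variables X Y : vfield M.
Implicit Types (phi psi : chart R n M) (p q : M) (z : 'rV[R]_n).

Definition bracket_rep phi z : 'rV[R]_n :=
  'D_(vfield_rep X phi z) (vfield_rep Y phi) z - 'D_(vfield_rep Y phi z) (vfield_rep X phi) z.

Definition bracket_fun p : 'rV[R]_n := bracket_rep (chart_at p) (cmap_at p).

(** The transformation rule of [V] under the change of charts, differentiated. *)
Lemma vfield_rep_derive (V : vfield M) phi psi z v : atlas phi -> atlas psi -> tdom phi psi z ->
  'D_(v *m jac phi psi z) (vfield_rep V psi) (trans phi psi z) =
  'D_v (fun y => 'D_(vfield_rep V phi y) (trans phi psi) y) z.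
Proof.
move=> a1 a2 hz.
have D := transE v a1 a2 hz; have ht := trans_tdom hz.
have df : differentiable (vfield_rep V psi) (trans phi psi z).
  exact: (smooth_differentiable (open_cimg psi) (vfield_smooth V a2) ht.1).
have D2 := is_derive_comp D df.
have E y : tdom phi psi y -> (vfield_rep V psi \o trans phi psi) y = 'D_(vfield_rep V phi y) (trans phi psi) y.
  move=> hy; rewrite /= (vfield_rep_trans _ a1 a2 hy).
  by have [_ ->] := transE (vfield_rep V phi y) a1 a2 hy.
have := open_eq_is_derive (open_tdom phi psi) hz E D2.
by move=> [_ ->].
Qed.

(** This is [derive_commutator] for the transition map: a field applied to that map is the
    representation of the field in [psi]. *)
Lemma bracket_rep_trans phi psi z : atlas phi -> atlas psi -> tdom phi psi z ->
  bracket_rep psi (trans phi psi z) = bracket_rep phi z *m jac phi psi z.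
Proof.
move=> a1 a2 hz; rewrite /bracket_rep !(vfield_rep_trans _ a1 a2 hz).
refine (etrans (subr_congr (vfield_rep_derive Y _ a1 a2 hz) (vfield_rep_derive X _ a1 a2 hz)) _).
have sV (V : vfield M) : smooth_on (tdom phi psi) (vfield_rep V phi).
  by apply: (smooth_onS _ (vfield_smooth V a1)) => y [].
rewrite (derive_commutator (open_tdom phi psi) (sV X) (sV Y) (trans_smooth a1 a2) hz).
by have [_ ->] := transE (bracket_rep phi z) a1 a2 hz.
Qed.

Lemma bracket_fun_rep phi z : atlas phi -> cimg phi z ->
  vfield_rep bracket_fun phi z = bracket_rep phi z.
Proof.
move=> a1 hz; set p := cinv phi z.
have hp : cdom phi p by exact: cdom_cinv.
rewrite /vfield_rep -/p /bracket_fun to_chartE.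
rewrite -(bracket_rep_trans (atlas_at p) a1 (tdom_at hp)).
by rewrite /cmap_at (trans_cmap _ (cdom_at p)) /p cinvK.
Qed.

Lemma bracket_smooth phi : atlas phi -> smooth_on (cimg phi) (vfield_rep bracket_fun phi).
Proof.
move=> a1; have oU := open_cimg phi.
have E : {in cimg phi, bracket_rep phi =1 vfield_rep bracket_fun phi}.
  by move=> z; rewrite inE => hz; rewrite bracket_fun_rep.
refine (eq_smooth_on oU E _).
have sX := vfield_smooth X a1; have sY := vfield_smooth Y a1.
exact: (smooth_sub oU (smooth_derive_field oU sX sY) (smooth_derive_field oU sY sX)).
Qed.

Definition bracket : vfield M := VField bracket_smooth.

Lemma bracketE phi z : atlas phi -> cimg phi z -> vfield_rep bracket phi z = bracket_rep phi z.
Proof. exact: bracket_fun_rep. Qed.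

End bracket.

(** * Forms of top degree *)

Section alternating_forms.
Context {R : realType} {n : nat}.
Implicit Types (A N : 'M[R]_n) (u v : 'rV[R]_n) (a b : 'M[R]_n -> R) (i j : 'I_n).

Definition setrow A i v : 'M[R]_n := \matrix_j if j == i then v else row j A.

Lemma row_setrow A i v : row i (setrow A i v) = v.
Proof. by rewrite rowK eqxx. Qed.

Lemma row_setrow_ne A i j v : j != i -> row j (setrow A i v) = row j A.
Proof. by move=> /negPf h; rewrite rowK h. Qed.

Lemma row'_setrow A i v : row' i (setrow A i v) = row' i A.
Proof.
apply/matrixP => k l; rewrite !mxE; have /negPf -> : lift i k != i by rewrite eq_sym neq_lift.
by rewrite mxE.
Qed.

Lemma setrow_id A i : setrow A i (row i A) = A.
Proof. by apply/row_matrixP => j; rewrite rowK; case: eqP => [->|]. Qed.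

Lemma setrow_comm A i j u v : i != j ->
  setrow (setrow A i u) j v = setrow (setrow A j v) i u.
Proof.
move=> ij; apply/row_matrixP => k; rewrite !rowK; case: (k =P j) => [->|_] //.
by rewrite eq_sym (negPf ij).
Qed.

Lemma alt_lin a A i (c : R) u v : alternating_form a ->
  a (setrow A i (c *: u + v)) = c * a (setrow A i u) + a (setrow A i v).
Proof.
move=> [h _]; rewrite -[a (setrow A i v)]mul1r.
by apply: (h _ _ _ i); rewrite ?row'_setrow// !row_setrow scale1r.
Qed.

Lemma alt_row0 a A i : alternating_form a -> a (setrow A i 0) = 0.
Proof.
move=> ha; have := alt_lin A i 1 0 0 ha; rewrite scaler0 addr0 mul1r => /eqP.
by rewrite -subr_eq0 opprD addNKr oppr_eq0 => /eqP.
Qed.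

Lemma alt_sum a A i (I : Type) (r : seq I) (c : I -> R) (v : I -> 'rV[R]_n) :
  alternating_form a ->
  a (setrow A i (\sum_(k <- r) c k *: v k)) = \sum_(k <- r) c k * a (setrow A i (v k)).
Proof.
move=> ha; elim: r => [|k r IH]; first by rewrite !big_nil alt_row0.
by rewrite !big_cons alt_lin// IH.
Qed.

Lemma alternating_detform : alternating_form (fun A : 'M[R]_n => \det A).
Proof.
split=> [A B C i b c|A i j ij e]; first exact: determinant_multilinear.
by apply: (determinant_alternate ij) => k; have /rowP/(_ k) := e; rewrite !mxE.
Qed.

Lemma alternating_comb (k : R) a b : alternating_form a -> alternating_form b ->
  alternating_form (fun A => k * a A + b A).
Proof.
move=> [a1 a2] [b1 b2]; split=> [A B C i c d h1 h2 h3|A i j ij e].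
  by rewrite (a1 A B C i c d)// (b1 A B C i c d)//; ring.
by rewrite (a2 _ _ _ ij e) (b2 _ _ _ ij e) mulr0 addr0.
Qed.

Lemma alt_swap a A i j : alternating_form a -> i != j -> a (xrow i j A) = - a A.
Proof.
move=> ha ij; have ji : j != i by rewrite eq_sym.
pose S u v := setrow (setrow A i u) j v.
have S2 u v : S u v = setrow (setrow A j v) i u by exact: setrow_comm.
have Suu u : a (S u u) = 0.
  by apply: (ha.2 _ i j ij); rewrite (row_setrow_ne _ _ ij) !row_setrow.
have D1 u u' v : a (S (u + u') v) = a (S u v) + a (S u' v).
  by rewrite !S2 -[u]scale1r (alt_lin _ _ _ _ _ ha) mul1r scale1r.
have D2 u v v' : a (S u (v + v')) = a (S u v) + a (S u v').
  by rewrite /S -[v]scale1r (alt_lin _ _ _ _ _ ha) mul1r scale1r.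
have := Suu (row i A + row j A); rewrite D1 !D2 !Suu add0r addr0.
have -> : S (row i A) (row j A) = A by rewrite /S !setrow_id.
have -> : S (row j A) (row i A) = xrow i j A.
  apply/row_matrixP => k; rewrite !rowK; apply/rowP => l; rewrite !mxE.
  case: (k =P j) => [->|/eqP kj]; first by rewrite tpermR mxE.
  case: (k =P i) => [->|/eqP ki]; first by rewrite tpermL mxE.
  by rewrite tpermD 1?eq_sym// mxE.
by move/eqP; rewrite addr_eq0 => /eqP ->; rewrite opprK.
Qed.

Lemma alt_perm a (s : 'S_n) : alternating_form a -> a 1%:M = 0 -> a (perm_mx s) = 0.
Proof.
move=> ha a1; have [ts -> /= hts] := prod_tpermP s.
elim: ts hts => [|[i j] ts IH] /=; first by rewrite big_nil perm_mx1.
move=> /andP[ij /IH h]; rewrite big_cons perm_mxM -xrowE.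
by rewrite (alt_swap _ ha ij) h oppr0.
Qed.

(** Rows are expanded into basis vectors one after another, [k] being the number of rows still
    arbitrary. In the end the matrix is a permutation matrix or has two equal rows. *)
Lemma alt_zero a A : alternating_form a -> a 1%:M = 0 -> a A = 0.
Proof.
move=> ha a1.
suff H k B : (forall i, (k <= i)%N -> exists j, row i B = delta_mx 0 j) -> a B = 0.
  by apply: (H n) => i; rewrite leqNgt ltn_ord.
elim: k B => [|k IH] B hB.
  have /choice[f hf] i := hB i (leq0n i).
  have [/injectiveP fi|/injectivePn[i [j ij e]]] := boolP (injectiveb f).
    have -> : B = perm_mx (perm fi); last exact: alt_perm.
    apply/row_matrixP => i; rewrite hf; apply/rowP => j.
    by rewrite !mxE permE eq_sym.
  by apply: (ha.2 _ i j ij); rewrite !hf e.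
have [kn|nk] := ltnP k n; last first.
  by apply: IH => i ki; have := ltn_ord i; rewrite ltnNge (leq_trans nk ki).
pose i0 := Ordinal kn; rewrite -(setrow_id B i0) [row i0 B]row_sum_delta.
rewrite (alt_sum _ _ _ _ _ ha) big1// => j _; rewrite IH ?mulr0// => i ki.
have [->|ii0] := eqVneq i i0; first by exists j; rewrite row_setrow.
rewrite (row_setrow_ne _ _ ii0); apply: hB; rewrite ltn_neqAle ki andbT.
by apply: contra ii0 => /eqP e; apply/eqP/val_inj.
Qed.

Lemma alternating_det a A : alternating_form a -> a A = \det A * a 1%:M.
Proof.
move=> ha; have hb := alternating_comb (- a 1%:M) alternating_detform ha.
have := alt_zero A hb; rewrite /= det1 mulr1 addNr => /(_ erefl)/eqP.
by rewrite addrC mulNr subr_eq0 mulrC => /eqP.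
Qed.

Lemma det_setrow_sum A N : \sum_i \det (setrow A i (row i N)) = \tr (N *m \adj A).
Proof.
apply: eq_bigr => i _; rewrite (expand_det_row _ i) mxE; apply: eq_bigr => j _.
rewrite !mxE eqxx mxE; congr (_ * _).
rewrite /cofactor; congr (_ * \det _); apply/matrixP => k l; rewrite !mxE.
have /negPf -> : lift i k != i by rewrite eq_sym neq_lift.
by rewrite mxE.
Qed.

(** By this identity the sum over [i] in [lie_form] becomes a divergence. For the determinant it
    comes from Laplace expansion along each row, and every alternating form is a multiple of the
    determinant. *)
Lemma alt_trace a A (B : 'M[R]_n) : alternating_form a ->
  \sum_i a (setrow A i (row i A *m B)) = \tr B * a A.
Proof.
move=> ha; under eq_bigr => i _ do rewrite (alternating_det _ ha) -row_mul.
rewrite -mulr_suml det_setrow_sum mxtrace_mulC mulmxA mul_adj_mx mul_scalar_mx mxtraceZ.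
by rewrite (alternating_det A ha); ring.
Qed.

End alternating_forms.

Section derivative_of_det.
Context {R : realType} {n : nat} {V : normedModType R}.

Lemma is_derive_prod (x v : V) (I : eqType) (r : seq I) (f : I -> V -> R) (d : I -> R) :
  uniq r -> (forall i, is_derive x v (f i) (d i)) ->
  is_derive x v (fun y => \prod_(i <- r) f i y)
    (\sum_(i <- r) \prod_(j <- r) (if j == i then d j else f j x)).
Proof.
move=> + h; elim: r => [_|i r IH /= /andP[ir ur]].
  rewrite big_nil (_ : (fun y => _) = cst 1); first exact: is_derive_cst.
  by apply/funext => y; rewrite big_nil.
rewrite (_ : (fun y => _) = fun y => f i y *: \prod_(j <- r) f j y); last first.
  by apply/funext => y; rewrite big_cons.
have := is_deriveZf (h i) (IH ur); move/is_derive_eq; apply.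
rewrite big_cons big_cons eqxx; congr (_ + _).
  congr (_ * _); apply: eq_big_seq => j jr; case: eqP => // e.
  by move: jr; rewrite e (negPf ir).
rewrite [_ *: _]mulr_sumr; apply: eq_big_seq => k kr; rewrite big_cons.
by case: eqP => // e; move: kr; rewrite -e (negPf ir).
Qed.

Lemma is_derive_bigsum (W : normedModType R) (x v : V) (I : Type) (r : seq I) (f : I -> V -> W) (d : I -> W) :
  (forall i, is_derive x v (f i) (d i)) ->
  is_derive x v (fun y => \sum_(i <- r) f i y) (\sum_(i <- r) d i).
Proof.
move=> h; elim: r => [|i r IH].
  rewrite big_nil (_ : (fun y => _) = cst 0); first exact: is_derive_cst.
  by apply/funext => y; rewrite big_nil.
rewrite big_cons (_ : (fun y => _) = f i \+ (fun y => \sum_(j <- r) f j y)); last first.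
  by apply/funext => y; rewrite big_cons.
exact: is_deriveD (h i) IH.
Qed.

(** Jacobi's formula. *)
Lemma is_derive_det (x v : V) (A : V -> 'M[R]_n) (D : 'M[R]_n) :
  (forall i j, is_derive x v (fun y => A y i j) (D i j)) ->
  is_derive x v (fun y => \det (A y)) (\tr (D *m \adj (A x))).
Proof.
move=> h.
have H (s : 'S_n) : is_derive x v (fun y => (-1) ^+ s *: \prod_i A y i (s i))
    ((-1) ^+ s *: \sum_i \prod_j (if j == i then D j (s j) else A x j (s j))).
  apply: is_deriveZ; apply: is_derive_prod (index_enum_uniq _) _ => i; exact: h.
have := is_derive_bigsum (index_enum _) H; move/is_derive_eq; apply.
rewrite -det_setrow_sum; under eq_bigr do rewrite scaler_sumr.
rewrite exchange_big; apply: eq_bigr => i _; apply: eq_bigr => s _.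
congr (_ * _); apply: eq_bigr => j _; rewrite !mxE.
by case: eqP => [->|_]; rewrite mxE.
Qed.

End derivative_of_det.

Lemma row_mulmx_sub {R : realType} {n : nat} (A B J : 'M[R]_n) i :
  row i (J *m B - A *m J) = delta_mx 0 i *m J *m B - delta_mx 0 i *m A *m J.
Proof. by rewrite rowE mulmxBr !mulmxA. Qed.

Lemma tr_adj_sub {R : realType} {n : nat} (A B J : 'M[R]_n) :
  \tr ((J *m B - A *m J) *m \adj J) = \det J * \tr B - \tr A * \det J.
Proof.
rewrite mulmxBl linearB/=; congr (_ - _).
  by rewrite mxtrace_mulC mulmxA mul_adj_mx mul_scalar_mx mxtraceZ.
by rewrite -mulmxA mul_mx_adj mul_mx_scalar mxtraceZ mulrC.
Qed.

Lemma add_shift (W : zmodType) (a b c p q : W) : a = b + c -> a = p -> b = q -> c = p - q.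
Proof. by move=> -> <- <-; rewrite addrC addKr. Qed.

Lemma leibniz_det {R : realType} (d J a B A : R) :
  d *: (J : R^o) + a *: ((J * B - A * J : R) : R^o) + A * (a *: (J : R^o)) = J * (d + B * a).
Proof. change (d * J + a * (J * B - A * J) + A * (a * J) = J * (d + B * a)); ring. Qed.

Section form_densities.
Context {R : realType} {n : nat} {M : manifold R n}.
Implicit Types (phi psi : chart R n M) (p q : M) (z : 'rV[R]_n) (w : preform M) (X Y : vfield M).

(* In the chart [phi] the form [w] is [den phi w dz_1 ... dz_n]. *)
Definition den phi w z : R := form_rep phi w z 1%:M.

Definition alt_form w := forall p, alternating_form (w p).

Lemma alt_form_repE phi w z A : alt_form w -> form_rep phi w z A = \det A * den phi w z.
Proof.
move=> ha; rewrite /den /form_rep mul1mx (alternating_det _ (ha _)) det_mulmx -mulrA.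
by rewrite -(alternating_det _ (ha _)).
Qed.

Lemma den_trans phi psi w z : alt_form w -> atlas phi -> atlas psi -> tdom phi psi z ->
  den phi w z = den psi w (trans phi psi z) * \det (jac phi psi z).
Proof.
by move=> ha a1 a2 hz; rewrite {1}/den (form_rep_trans _ _ a1 a2 hz) mul1mx alt_form_repE// mulrC.
Qed.

Lemma den_at w p A : alt_form w -> w p A = \det A * den (chart_at p) w (cmap_at p).
Proof. by move=> ha; rewrite -alt_form_repE// form_rep_at. Qed.

Lemma is_form_alt w : is_form w -> alt_form w. Proof. by case. Qed.

Lemma den_smooth phi w : is_form w -> atlas phi -> smooth_on (cimg phi) (den phi w).
Proof. by move=> [_ h] a1; exact: (h phi a1 1%:M). Qed.

Lemma is_formP w : alt_form w -> (forall phi, atlas phi -> smooth_on (cimg phi) (den phi w)) -> is_form w.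
Proof.
move=> ha hs; split=> // phi a1 A; have oU := open_cimg phi.
have E : {in cimg phi, (fun z => \det A * den phi w z) =1 (fun z => form_rep phi w z A)}.
  by move=> z _; rewrite alt_form_repE.
exact: (eq_smooth_on oU E (smooth_mul oU (smooth_cst _ oU) (hs phi a1))).
Qed.

Definition divg X phi z : R := \tr (jacobian (vfield_rep X phi) z).

Lemma divgE X phi z : atlas phi -> cimg phi z ->
  divg X phi z = \sum_i 'D_(delta_mx 0 i) (vfield_rep X phi) z 0 i.
Proof.
move=> a1 hz; apply: eq_bigr => i _.
rewrite (smooth_jacobianE _ (open_cimg phi) (vfield_smooth X a1) hz).
by rewrite -rowE [RHS]mxE.
Qed.

Lemma divg_smooth X phi : atlas phi -> smooth_on (cimg phi) (divg X phi).
Proof.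
move=> a1; have oU := open_cimg phi.
have E : {in cimg phi, (fun z => \sum_i 'D_(delta_mx 0 i) (vfield_rep X phi) z 0 i) =1 divg X phi}.
  by move=> z; rewrite inE => hz; rewrite divgE.
refine (eq_smooth_on oU E _); apply: (smooth_sumR _ oU) => i.
exact: ((smooth_coord _ oU).1 (smooth_onD _ (vfield_smooth X a1)) i).
Qed.

(** In top degree [L_X (a dz) = (X a + div X * a) dz]. *)
Definition lie_den X phi (a : 'rV[R]_n -> R) z : R :=
  'D_(vfield_rep X phi z) a z + divg X phi z * a z.

Lemma lie_den_smooth X phi (a : 'rV[R]_n -> R) : atlas phi -> smooth_on (cimg phi) a ->
  smooth_on (cimg phi) (lie_den X phi a).
Proof.
move=> a1 sa; have oU := open_cimg phi.
apply: (smooth_addR oU); first exact: (smooth_derive_field oU (vfield_smooth X a1) sa).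
exact: (smooth_mul oU (divg_smooth X a1) sa).
Qed.

Lemma eq_lie_den X phi (U : set 'rV[R]_n) (a b : 'rV[R]_n -> R) z : open U -> U z ->
  (forall y, U y -> a y = b y) -> lie_den X phi a z = lie_den X phi b z.
Proof.
move=> oU Uz ab; rewrite /lie_den (ab z Uz).
by rewrite (@eq_on_D _ _ _ U a b _ oU _ z) ?inE// => y; rewrite inE => /ab.
Qed.

Lemma lie_formE X w p A : is_form w ->
  lie_form X w p A = \det A * lie_den X (chart_at p) (den (chart_at p) w) (cmap_at p).
Proof.
move=> fw; have ha := is_form_alt fw; set phi := chart_at p.
have a1 : atlas phi := atlas_at p; have hz : cimg phi (cmap_at p) := cimg_at p.
have oU := open_cimg phi.
rewrite /lie_form -/phi /lie_den mulrDr; congr (_ + _).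
  have E : {in cimg phi, (fun z => form_rep phi w z A) =1 (fun z => \det A *: den phi w z)}.
    by move=> z _; rewrite alt_form_repE.
  rewrite (eq_on_D _ oU E) ?inE//.
  have D := smooth_on_is_derive (X p) (den_smooth fw a1) hz.
  rewrite (derive_val (is_derive := is_deriveZ (\det A) D)) vfield_rep_at.
  by [].
have -> : \det A * (divg X phi (cmap_at p) * den phi w (cmap_at p)) =
   divg X phi (cmap_at p) * w p A by rewrite (den_at _ _ ha) mulrCA.
rewrite -(alt_trace _ _ (ha p)); apply: eq_bigr => i _.
rewrite /setrow; congr (w p _); apply/row_matrixP => j; rewrite !rowK; case: eqP => // _.
exact: (smooth_jacobianE _ oU (vfield_smooth X a1) hz).
Qed.

Lemma lie_form_alt X w : is_form w -> alt_form (lie_form X w).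
Proof.
move=> fw p; pose c := lie_den X (chart_at p) (den (chart_at p) w) (cmap_at p).
have -> : lie_form X w p = fun A => c * \det A + 0.
  by apply/funext => A; rewrite lie_formE// addr0 mulrC.
apply: alternating_comb alternating_detform _.
by split=> [A B C i b d _ _ _|//]; rewrite !mulr0 addr0.
Qed.

(** Differentiating the transformation rule of [X] shows that the Jacobian matrix has derivative
    [J B - A J] along [X], with [A] and [B] the Jacobians of [X] in the two charts. Jacobi's formula
    turns this into a difference of divergences. *)
Lemma derive_jac phi psi X z : atlas phi -> atlas psi -> tdom phi psi z ->
  is_derive z (vfield_rep X phi z) (fun y => \det (jac phi psi y))
    (\det (jac phi psi z) * divg X psi (trans phi psi z) - divg X phi z * \det (jac phi psi z)).
Proof.
move=> a1 a2 hz; have oU := open_tdom phi psi; have st := trans_smooth a1 a2.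
pose J := jac phi psi z; pose A := jacobian (vfield_rep X phi) z.
pose B := jacobian (vfield_rep X psi) (trans phi psi z).
pose u := vfield_rep X phi z.
have rowD i : 'D_u ('D_(delta_mx 0 i) (trans phi psi)) z = row i (J *m B - A *m J).
  have sX : smooth_on (tdom phi psi) (vfield_rep X phi).
    by apply: (smooth_onS _ (vfield_smooth X a1)) => y [].
  have e1 := derive_of_field (delta_mx 0 i) oU sX st hz.
  have e2 := vfield_rep_derive X (delta_mx 0 i) a1 a2 hz.
  have e3 := etrans e2 e1; have ht := trans_tdom hz.
  have e4 := smooth_jacobianE (delta_mx 0 i *m jac phi psi z) (open_cimg psi) (vfield_smooth X a2) ht.1.
  have e5 := smooth_jacobianE (delta_mx 0 i) (open_cimg phi) (vfield_smooth X a1) hz.1.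
  have [_ e6] := transE ('D_(delta_mx 0 i) (vfield_rep X phi) z) a1 a2 hz.
  have e7 : row i (J *m B - A *m J) = delta_mx 0 i *m J *m B - delta_mx 0 i *m A *m J.
    exact: row_mulmx_sub.
  have e8 := etrans e6 (congr1 (fun v => v *m jac phi psi z) e5).
  exact: (etrans (add_shift e3 e4 e8) (esym e7)).
have entries i j : is_derive z u (fun y => jac phi psi y i j) ((J *m B - A *m J) i j).
  have E y : tdom phi psi y -> 'D_(delta_mx 0 i) (trans phi psi) y 0 j = jac phi psi y i j.
    by move=> hy; have [_ ->] := transE (delta_mx 0 i) a1 a2 hy; rewrite -rowE mxE.
  have sc : smooth_on (tdom phi psi) (fun y => 'D_(delta_mx 0 i) (trans phi psi) y 0 j).
    exact: ((smooth_coord _ oU).1 (smooth_onD _ st) j).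
  have D := smooth_on_is_derive u sc hz.
  have := open_eq_is_derive oU hz E D; move/is_derive_eq; apply.
  have := rowD i => /rowP/(_ j); rewrite mxE => <-.
  by rewrite (derive_mx (smooth_on_derivable (smooth_onD _ st) hz)) mxE.
have := is_derive_det entries; move/is_derive_eq; apply.
exact: tr_adj_sub.
Qed.

(** [lie_form] is computed at each [p] in its own chart [chart_at p], so its smoothness rests on
    independence of the chart. The derivative of the Jacobian determinant compensates the change of
    the divergence. *)
Lemma lie_den_trans phi psi X w z : is_form w -> atlas phi -> atlas psi -> tdom phi psi z ->
  lie_den X phi (den phi w) z = \det (jac phi psi z) * lie_den X psi (den psi w) (trans phi psi z).
Proof.
move=> fw a1 a2 hz; have ha := is_form_alt fw; have oU := open_tdom phi psi.
have ht := trans_tdom hz.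
pose b y := den psi w (trans phi psi y) *: \det (jac phi psi y).
have E y : tdom phi psi y -> den phi w y = b y by move=> hy; rewrite (den_trans ha a1 a2 hy).
rewrite (eq_lie_den _ _ oU hz E) {1}/lie_den.
have D1 := transE (vfield_rep X phi z) a1 a2 hz.
have df : differentiable (den psi w) (trans phi psi z).
  exact: (smooth_differentiable (open_cimg psi) (den_smooth fw a2) ht.1).
have D2 := is_derive_comp D1 df.
have D3 := is_deriveZf D2 (derive_jac X a1 a2 hz).
rewrite (derive_val (is_derive := D3)) /lie_den (vfield_rep_trans _ a1 a2 hz) /b.
exact: leibniz_det.
Qed.

Lemma den_lie X phi w z : is_form w -> atlas phi -> cimg phi z ->
  den phi (lie_form X w) z = lie_den X phi (den phi w) z.
Proof.
move=> fw a1 hz; set p := cinv phi z; have hp : cdom phi p by exact: cdom_cinv.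
rewrite {1}/den /form_rep mul1mx -/p lie_formE// from_chartE -/p.
have ht : tdom phi (chart_at p) z by exact: tdom_to.
rewrite (lie_den_trans X fw a1 (atlas_at p) ht).
by have -> : trans phi (chart_at p) z = cmap_at p by [].
Qed.

Lemma lie_is_form X w : is_form w -> is_form (lie_form X w).
Proof.
move=> fw; apply: is_formP; first exact: lie_form_alt.
move=> phi a1; have oU := open_cimg phi.
have E : {in cimg phi, lie_den X phi (den phi w) =1 den phi (lie_form X w)}.
  by move=> z; rewrite inE => hz; rewrite den_lie.
exact: (eq_smooth_on oU E (lie_den_smooth X a1 (den_smooth fw a1))).
Qed.

Lemma lie_den_lin X phi (k : R) (a b : 'rV[R]_n -> R) z : atlas phi -> cimg phi z ->
  smooth_on (cimg phi) a -> smooth_on (cimg phi) b ->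
  lie_den X phi (fun y => k * a y + b y) z = k * lie_den X phi a z + lie_den X phi b z.
Proof.
move=> a1 hz sa sb; set u := vfield_rep X phi z.
have D := is_deriveD (is_deriveZ k (smooth_on_is_derive u sa hz)) (smooth_on_is_derive u sb hz).
rewrite /lie_den -/u; have -> : 'D_u (fun y => k * a y + b y) z = k * 'D_u a z + 'D_u b z.
  exact: (derive_val (is_derive := D)).
by rewrite mulrDr mulrDr addrACA (mulrCA k).
Qed.

Lemma lie_denM X phi (f a : 'rV[R]_n -> R) z : atlas phi -> cimg phi z ->
  smooth_on (cimg phi) f -> smooth_on (cimg phi) a ->
  lie_den X phi (fun y => f y * a y) z =
  'D_(vfield_rep X phi z) f z * a z + f z * lie_den X phi a z.
Proof.
move=> a1 hz sf sa; set u := vfield_rep X phi z.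
have D := is_deriveZf (smooth_on_is_derive u sf hz) (smooth_on_is_derive u sa hz).
rewrite /lie_den -/u; have -> : 'D_u (fun y => f y * a y) z = 'D_u f z * a z + f z * 'D_u a z.
  exact: (derive_val (is_derive := D)).
by ring.
Qed.

End form_densities.

Section preform_values.
Context {R : realType} {n : nat} {M : manifold R n}.
Implicit Types u v : preform M.

Lemma preform_ext u v : (forall p A, (u p A : R) = v p A) -> u = v.
Proof. by move=> h; apply/funext => p; apply/funext => A; exact: h. Qed.

Lemma preform_combE (k : R) u v p A : (k *: u + v) p A = k * (u p A : R) + (v p A : R) :> R.
Proof. by []. Qed.

Lemma preform_addE u v p A : (u + v) p A = (u p A : R) + (v p A : R) :> R.
Proof. by []. Qed.

Lemma preform_subE u v p A : (u - v) p A = (u p A : R) - (v p A : R) :> R.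
Proof. by []. Qed.

Lemma preform_scaleE (k : R) u p A : (k *: u) p A = k * (u p A : R) :> R.
Proof. by []. Qed.

End preform_values.

(** * The locally convex space of compactly supported forms *)

Section form_space.
Context {R : realType} {n : nat} {M : manifold R n}.
Implicit Types (phi psi : chart R n M) (p q : M) (z : 'rV[R]_n) (w : preform M) (X Y : vfield M).

Lemma is_form_comb (k : R) w1 w2 : is_form w1 -> is_form w2 -> is_form (k *: w1 + w2).
Proof.
move=> f1 f2; apply: is_formP => [p|phi a1].
  exact: alternating_comb (is_form_alt f1 p) (is_form_alt f2 p).
have oU := open_cimg phi.
exact: (smooth_addR oU (smooth_mul oU (smooth_cst k oU) (den_smooth f1 a1)) (den_smooth f2 a1)).
Qed.

Lemma is_form0 : is_form (0 : preform M).
Proof.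
apply: is_formP => [p|phi a1].
  by split=> [A B C i b c _ _ _|//]; rewrite [LHS]/= !mulr0 addr0.
exact: smooth_cst (open_cimg phi).
Qed.

Lemma supp_out w p A : ~ supp w p -> w p A = 0.
Proof.
move=> h; apply/eqP; apply/negP => /negP h'; apply: h; apply: subset_closure.
by exists A.
Qed.

Lemma supp_sub w C : closed C -> (forall p, ~ C p -> forall A, w p A = 0) -> supp w `<=` C.
Proof.
move=> cC h; rewrite /supp [X in _ `<=` X](closure_id C).1//.
apply: closure_subset => p [A /eqP hA]; apply: contrapT => nC; exact: hA (h p nC A).
Qed.

Lemma supp_closed w : closed (supp w).
Proof. exact: closed_closure. Qed.
Arguments supp_closed : clear implicits.

Lemma Omega_cP w C : is_form w -> compact C -> (forall p, ~ C p -> forall A, w p A = 0) ->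
  Omega_c w.
Proof.
move=> fw cC h; split=> //; apply: (subclosed_compact (supp_closed w) cC).
by apply: supp_sub h; exact: closed_compact.
Qed.

Lemma Omega_c_is_form w : Omega_c w -> is_form w. Proof. by case. Qed.

Lemma Omega_c0 : Omega_c (0 : preform M).
Proof. exact: (Omega_cP is_form0 compact0). Qed.

Lemma Omega_c_comb (k : R) w1 w2 : Omega_c w1 -> Omega_c w2 -> Omega_c (k *: w1 + w2).
Proof.
move=> [f1 c1] [f2 c2]; apply: (Omega_cP (is_form_comb k f1 f2) (compactU c1 c2)) => p h A.
have -> : (k *: w1 + w2) p A = k * w1 p A + w2 p A by [].
by rewrite !supp_out ?mulr0 ?addr0// => h'; apply: h; [right|left].
Qed.

Lemma form_seminorm_bound (s : @form_seminorm R n M) w : is_form w -> exists C : R, 0 < C /\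
  forall z, fs_cpt s z ->
  `|iterD (fs_dirs s) (fun z => form_rep (fs_chart s) w z (fs_arg s)) z| <= C.
Proof.
move=> fw; apply: (compact_cont_bounded (@fs_compact _ _ _ s)) => z hz.
apply: (smooth_on_cont (smooth_on_iterD _ (fw.2 _ (@fs_chart_atlas _ _ _ s) (fs_arg s)))).
exact: (@fs_sub _ _ _ s).
Qed.

Lemma form_seminorm_ge (s : @form_seminorm R n M) w z : is_form w -> fs_cpt s z ->
  `|iterD (fs_dirs s) (fun z => form_rep (fs_chart s) w z (fs_arg s)) z| <= form_seminorm_val s w.
Proof.
move=> fw hz; apply: ub_le_sup; last by exists z.
have [C [_ hC]] := form_seminorm_bound s fw.
by exists C => _ [y hy <-]; exact: hC.
Qed.

Lemma form_seminorm_le (s : @form_seminorm R n M) w (C : R) : 0 <= C ->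
  (forall z, fs_cpt s z ->
  `|iterD (fs_dirs s) (fun z => form_rep (fs_chart s) w z (fs_arg s)) z| <= C) ->
  form_seminorm_val s w <= C.
Proof.
move=> C0 h; have [[z hz]|nz] := pselect (exists z, fs_cpt s z); last first.
  rewrite /form_seminorm_val (_ : [set _ | _ in _] = set0) ?sup0//.
  by apply/seteqP; split=> // y [z hz _]; exfalso; apply: nz; exists z.
apply: ge_sup; first by eexists; exists z.
by move=> _ [y hy <-]; exact: h.
Qed.

Lemma form_seminorm_ge0 (s : @form_seminorm R n M) w : is_form w -> 0 <= form_seminorm_val s w.
Proof.
move=> fw; have [[z hz]|nz] := pselect (exists z, fs_cpt s z).
  exact: le_trans (form_seminorm_ge fw hz).
rewrite /form_seminorm_val (_ : [set _ | _ in _] = set0) ?sup0//.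
by apply/seteqP; split=> // y [z hz _]; exfalso; apply: nz; exists z.
Qed.

(** Evaluation is continuous; hence the seminorms separate forms, and derivatives of curves of forms
    can be identified pointwise. *)
Lemma eval_seminorm y A : continuous_seminorm (fun w => `|w y A : R|).
Proof.
split=> [w1 w2 _ _|a w _|K cK].
- exact: (ler_normD (w1 y A : R) (w2 y A)).
- exact: (normrM a (w y A)).
have cK1 : compact [set cmap_at y] by exact: compact_set1.
have sK1 : [set cmap_at y] `<=` cimg (chart_at y) by move=> _ ->; exact: cimg_at.
exists `|\det A|, [:: FormSeminorm (atlas_at y) cK1 sK1 [::] 1%:M] => w [fw _].
rewrite big_seq1 (den_at _ _ (is_form_alt fw)) normrM ler_wpM2l//.
exact: (@form_seminorm_ge (FormSeminorm (atlas_at y) cK1 sK1 [::] 1%:M) w (cmap_at y) fw erefl).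
Qed.

Definition FS : cspace R.
Proof.
refine (@CSpace R (preform M) (@Omega_c R n M) (@continuous_seminorm R n M) Omega_c0
  Omega_c_comb _ _ _).
- by move=> p [].
- by move=> p [].
- move=> w _ h; apply/funext => y; apply/funext => A; apply/eqP; rewrite -normr_eq0.
  by rewrite (h _ (eval_seminorm y A)).
Defined.

Lemma smooth_form_curveP (c : R -> preform M) : smooth_form_curve c <-> @SC R FS c.
Proof.
have key (pn : preform M -> R) (u v d : preform M) (s : R) : continuous_seminorm pn -> s != 0 ->
    Omega_c u -> Omega_c v -> Omega_c d ->
    pn (s^-1 *: (u - v) - d) = `|s|^-1 * pn (u - v - s *: d).
  move=> [_ hZ _] s0 hu hv hd; rewrite -normfV -hZ; last first.
    by apply: (@csB R FS); [exact: (@csB R FS)|exact: (@csZ R FS)].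
  by rewrite (scalerBr _ (u - v)) scalerA mulVf// scale1r.
split=> -[d [d0 dS dd]]; exists d; split=> // k t pn hp.
- move=> e e0; have /cvgrPdist_le/(_ e e0)/nbhs_ballP[r /= r0 hr] := dd k t pn hp.
  apply: (filterS _ (near0_lt r0)) => s sr.
  have [->|s0] := eqVneq s 0.
    by rewrite scale0r addr0 subrr subr0 (@sn0 R FS)// normr0 mulr0.
  have := hr s; rewrite /ball/= sub0r normrN => /(_ sr s0).
  rewrite sub0r normrN (key _ _ _ _ _ hp s0 (dS _ _) (dS _ _) (dS _ _)) => h; have s1 : 0 < `|s| by rewrite normr_gt0.
  by rewrite -ler_pdivrMr// mulrC; apply: le_trans h; exact: ler_norm.
- apply/cvgrPdist_le => e e0; have /nbhs_ballP[r /= r0 hr] := dd k t pn hp e e0.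
  apply/nbhs_ballP; exists r => // s sr /= s0.
  rewrite sub0r normrN (key _ _ _ _ _ hp s0 (dS _ _) (dS _ _) (dS _ _)).
  have s1 : 0 < `|s| by rewrite normr_gt0.
  rewrite ger0_norm; last first.
    apply: mulr_ge0; first by rewrite invr_ge0.
    by apply: (@sn_ge0 R FS) => //; apply: (@csB R FS); [exact: (@csB R FS)|exact: (@csZ R FS)].
  by rewrite mulrC ler_pdivrMr//; exact: hr.
Qed.

End form_space.
Arguments supp_closed {R n M} w.
Arguments FS {R n} M.

Lemma tr_comm_cancel {R : realType} {n : nat} (A B : 'M[R]_n) (s : R) : \tr (A *m B) - \tr (B *m A) + s = s.
Proof. by rewrite mxtrace_mulC subrr add0r. Qed.

Lemma trace_of_commutator {R : realType} {n : nat} (A B : 'M[R]_n) (D U1 U2 : 'I_n -> 'rV[R]_n) :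
  (forall i, D i = (delta_mx 0 i *m A *m B + U1 i) - (delta_mx 0 i *m B *m A + U2 i)) ->
  \sum_i D i 0 i = \tr (A *m B) - \tr (B *m A) + (\sum_i U1 i 0 i - \sum_i U2 i 0 i).
Proof.
move=> h; have trE (C : 'M[R]_n) : \sum_i (delta_mx 0 i *m C : 'rV[R]_n) 0 i = \tr C.
  by apply: eq_bigr => i _; rewrite -rowE mxE.
rewrite -!trE -!sumrB -big_split; apply: eq_bigr => i _.
by rewrite h !mulmxA !mxE /=; ring.
Qed.

Lemma bracket_ring {R : realType} (L1 L2 b1 b2 dX dY X0 Y0 Xa Ya a : R) :
  L1 = b1 + (dY * a + Y0 * Xa) -> L2 = b2 + (dX * a + X0 * Ya) ->
  L1 + X0 * (Ya + Y0 * a) - (L2 + Y0 * (Xa + X0 * a)) = b1 - b2 + (dY - dX) * a.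
Proof. by move=> -> ->; ring. Qed.

Section iterated_derivatives_bound.
Context {R : realType} {n : nat}.
Variables (U K : set 'rV[R]_n).
Hypotheses (oU : open U) (cK : compact K) (KU : K `<=` U).
Local Notation V := 'rV[R]_n.
Implicit Types (g a : V -> R).

Lemma iterD_add vs g a : smooth_on U g -> smooth_on U a ->
  {in U, iterD vs (fun z => g z + a z) =1 fun z => iterD vs g z + iterD vs a z}.
Proof.
elim/last_ind: vs g a => [|vs v IH] g a sg sa z zU; first by [].
rewrite !iterD_rcons -(IH _ _ (smooth_onD v sg) (smooth_onD v sa) z zU).
apply: (eq_on_iterD _ oU) zU => y; rewrite inE => Uy.
exact: (derive_val (is_derive := is_deriveD (smooth_on_is_derive v sg Uy) (smooth_on_is_derive v sa Uy))).
Qed.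

(** Continuity of an operator in the topology of uniform convergence of derivatives: [C] and [L]
    depend on [vs] but not on [a], and the derivatives of [a] are taken at the same point of [K]. *)
Definition controlled (T : (V -> R) -> V -> R) := forall vs, exists (C : R) (L : seq (seq V)),
  0 <= C /\ forall a, smooth_on U a -> forall z, K z ->
    `|iterD vs (T a) z| <= C * \sum_(d <- L) `|iterD d a z|.

Lemma controlled_mul g ds : smooth_on U g -> controlled (fun a z => g z * iterD ds a z).
Proof.
move=> sg vs; elim/last_ind: vs g ds sg => [|vs v IH] g ds sg.
  have [C [C0 hC]] : exists C : R, 0 < C /\ forall z, K z -> `|g z| <= C.
    by apply: (compact_cont_bounded cK) => z Kz; exact: (smooth_on_cont sg (KU Kz)).
  exists C, [:: ds]; split=> [|a sa z Kz]; first exact: ltW.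
  by rewrite big_seq1/= normrM ler_wpM2r// hC.
have [C1 [L1 [C10 h1]]] := IH _ ds (smooth_onD v sg).
have [C2 [L2 [C20 h2]]] := IH _ (v :: ds) sg.
exists (C1 + C2), (L1 ++ L2); split=> [|a sa z Kz]; first exact: addr_ge0.
rewrite iterD_rcons.
have sd : smooth_on U (iterD ds a) by exact: smooth_on_iterD.
have sdv : smooth_on U (iterD (v :: ds) a) by exact: smooth_on_iterD.
have zU : z \in U by rewrite inE; exact: KU.
have E : {in U, 'D_v (fun z => g z * iterD ds a z) =1
    fun z => 'D_v g z * iterD ds a z + g z * iterD (v :: ds) a z}.
  move=> y; rewrite inE => Uy.
  exact: (derive_val (is_derive := is_deriveZf (smooth_on_is_derive v sg Uy) (smooth_on_is_derive v sd Uy))).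
rewrite (eq_on_iterD vs oU E zU).
rewrite (iterD_add _ (smooth_mul oU (smooth_onD v sg) sd) (smooth_mul oU sg sdv) zU).
apply: le_trans (ler_normD _ _) _.
have s1 : 0 <= \sum_(d <- L1) `|iterD d a z| by apply: sumr_ge0.
have s2 : 0 <= \sum_(d <- L2) `|iterD d a z| by apply: sumr_ge0.
apply: le_trans (lerD (h1 a sa z Kz) (h2 a sa z Kz)) _; rewrite big_cat/=; nra.
Qed.

Lemma controlled_sum (I : Type) (r : seq I) (T : I -> (V -> R) -> V -> R) :
  (forall i a, smooth_on U a -> smooth_on U (T i a)) ->
  (forall i, controlled (T i)) -> controlled (fun a z => \sum_(i <- r) T i a z).
Proof.
move=> sT hT vs; elim: r => [|i r [C2 [L2 [C20 h2]]]].
  exists 0, [::]; split=> // a sa z Kz.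
  rewrite big_nil mulr0 (_ : (fun z => _) = cst 0); last by apply/funext => y; rewrite big_nil.
  elim/last_ind: vs => [|vs v IH]; first by rewrite /= normr0.
  rewrite iterD_rcons (_ : 'D_v _ = cst 0)//; apply/funext => y; exact: derive_cst.
have [C1 [L1 [C10 h1]]] := hT i vs.
exists (C1 + C2), (L1 ++ L2); split=> [|a sa z Kz]; first exact: addr_ge0.
have zU : z \in U by rewrite inE; exact: KU.
rewrite (_ : (fun z => _) = fun z => T i a z + \sum_(j <- r) T j a z); last first.
  by apply/funext => y; rewrite big_cons.
have ss : smooth_on U (fun z => \sum_(j <- r) T j a z).
  by apply: (smooth_sumR _ oU) => j; exact: sT.
rewrite (iterD_add _ (sT i a sa) ss zU).
apply: le_trans (ler_normD _ _) _.
have s1 : 0 <= \sum_(d <- L1) `|iterD d a z| by apply: sumr_ge0.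
have s2 : 0 <= \sum_(d <- L2) `|iterD d a z| by apply: sumr_ge0.
apply: le_trans (lerD (h1 a sa z Kz) (h2 a sa z Kz)) _; rewrite big_cat/=; nra.
Qed.

Lemma controlled_ext (T T' : (V -> R) -> V -> R) :
  (forall a, smooth_on U a -> {in U, T a =1 T' a}) -> controlled T -> controlled T'.
Proof.
move=> TT h vs; have [C [L [C0 hC]]] := h vs; exists C, L; split=> // a sa z Kz.
have zU : z \in U by rewrite inE; exact: KU.
by rewrite -(eq_on_iterD vs oU (TT a sa) zU); exact: hC.
Qed.

End iterated_derivatives_bound.

Section lie_derivative_of_forms.
Context {R : realType} {n : nat} {M : manifold R n}.
Implicit Types (phi psi : chart R n M) (p q : M) (z : 'rV[R]_n) (w : preform M) (X Y : vfield M).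

Lemma lie_den_controlled X phi (K : set 'rV[R]_n) (k : R) : atlas phi -> compact K -> K `<=` cimg phi ->
  controlled (cimg phi) K (fun a z => k * lie_den X phi a z).
Proof.
move=> a1 cK KU; have oU := open_cimg phi.
pose g (i : option 'I_n) z := k * (if i is Some j then vfield_rep X phi z 0 j else divg X phi z).
pose ds (i : option 'I_n) : seq 'rV[R]_n := if i is Some j then [:: delta_mx 0 j] else [::].
have sg i : smooth_on (cimg phi) (g i).
  apply: (smooth_mul oU (smooth_cst k oU)); case: i => [j|].
    exact: ((smooth_coord _ oU).1 (vfield_smooth X a1) j).
  exact: divg_smooth.
have := @controlled_sum R n _ _ oU KU _ (index_enum _) (fun i a z => g i z * iterD (ds i) a z).
move=> /(_ _ _)/(controlled_ext oU KU _); apply.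
- move=> a sa z; rewrite inE => Uz; rewrite /lie_den.
  have eqs (I : finType) (F : option I -> R) : \sum_i F i = F None + \sum_j F (Some j).
    rewrite (bigD1 None)//=; congr (_ + _).
    rewrite (reindex_omap Some id)//=; last by case.
    by apply: eq_bigl => j; rewrite eqxx.
  rewrite eqs /g /ds /= addrC mulrDr mulrA; congr (_ + _).
  rewrite (smooth_deriveE _ oU sa Uz) mulr_sumr; apply: eq_bigr => j _.
  by rewrite -mulrA.
- by move=> i a sa; exact: (smooth_mul oU (sg i) (smooth_on_iterD _ sa)).
- by move=> i; exact: controlled_mul.
Qed.

Lemma lie_seminorm_val X (s : @form_seminorm R n M) : exists (C : R) (ss : seq (@form_seminorm R n M)),
  0 <= C /\ forall w, is_form w ->
  form_seminorm_val s (lie_form X w) <= C * \sum_(s' <- ss) form_seminorm_val s' w.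
Proof.
case: s => phi a1 K cK KU vs A /=; have oU := open_cimg phi.
have [C [L [C0 hC]]] := lie_den_controlled X (\det A) a1 cK KU vs.
pose mk d := FormSeminorm a1 cK KU d 1%:M.
exists C, (map mk L); split=> // w fw; rewrite big_map.
apply: form_seminorm_le => [|z Kz /=].
  by apply: mulr_ge0 => //; apply: sumr_ge0 => d _; exact: form_seminorm_ge0.
have E : {in cimg phi, (fun z => \det A * lie_den X phi (den phi w) z) =1
    (fun z => form_rep phi (lie_form X w) z A)}.
  move=> y; rewrite inE => Uy.
  by rewrite (alt_form_repE _ _ _ (lie_form_alt X fw)) den_lie.
have zU : z \in cimg phi by rewrite inE; exact: (KU z Kz).
rewrite -(eq_on_iterD vs oU E zU); apply: le_trans (hC _ (den_smooth fw a1) z Kz) _.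
rewrite ler_wpM2l// ler_sum// => d _.
exact: (@form_seminorm_ge _ _ _ (mk d) w z fw Kz).
Qed.

Lemma lie_form_lin X (k : R) w1 w2 : is_form w1 -> is_form w2 ->
  lie_form X (k *: w1 + w2) = k *: lie_form X w1 + lie_form X w2.
Proof.
move=> f1 f2; apply: preform_ext => p A; rewrite preform_combE.
rewrite (lie_formE X p A (is_form_comb k f1 f2)) (lie_formE X p A f1) (lie_formE X p A f2).
have -> := lie_den_lin X k (atlas_at p) (cimg_at p) (den_smooth f1 (atlas_at p)) (den_smooth f2 (atlas_at p)).
by rewrite mulrDr mulrCA.
Qed.

Lemma lie_form_out X w p A : is_form w -> ~ supp w p -> lie_form X w p A = 0.
Proof.
move=> fw hp; have oS : open (~` supp w) by exact/closed_openC/supp_closed.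
have oV := open_cinv (chart_at p) oS.
have hz : [set z | cimg (chart_at p) z /\ (~` supp w) (cinv (chart_at p) z)] (cmap_at p).
  by split; [exact: cimg_at|rewrite cinv_at].
have E y : [set z | cimg (chart_at p) z /\ (~` supp w) (cinv (chart_at p) z)] y ->
    den (chart_at p) w y = 0 by move=> [_ h]; exact: supp_out h.
rewrite lie_formE// (eq_lie_den _ _ oV hz E) /lie_den mulr0 addr0.
by rewrite (_ : 'D_ _ _ _ = 0) ?mulr0//; exact: derive_cst.
Qed.

Lemma lie_form_supp X w : is_form w -> supp (lie_form X w) `<=` supp w.
Proof. by move=> fw; apply: (supp_sub (supp_closed w)) => p hp A; exact: lie_form_out. Qed.

Lemma lie_Omega_c X w : Omega_c w -> Omega_c (lie_form X w).
Proof.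
move=> [fw cw]; apply: (Omega_cP (lie_is_form X fw) cw) => p hp A; exact: lie_form_out.
Qed.

(** [L_X] is a differential operator that does not enlarge supports, so it is continuous on every
    [Omega_K]. As a consequence it maps smooth curves of forms to smooth curves. *)
Lemma lie_continuous_seminorm X (pn : preform M -> R) : continuous_seminorm pn ->
  continuous_seminorm (fun w => pn (lie_form X w)).
Proof.
move=> [hD hZ hK]; split=> [w1 w2 h1 h2|a w hw|K cK].
- rewrite -[w1]scale1r lie_form_lin ?scale1r; [|exact: Omega_c_is_form..].
  by apply: hD; exact: lie_Omega_c.
- rewrite -[a *: w]addr0 lie_form_lin; [|exact: Omega_c_is_form|exact: is_form0].
  have -> : lie_form X (0 : preform M) = 0.
    apply/funext => p; apply/funext => A; apply: lie_form_out; first exact: is_form0.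
    have -> : supp (0 : preform M) = set0; last by [].
    rewrite /supp (_ : [set _ | _] = set0) ?closure0//.
    by apply/seteqP; split=> // q [B]; rewrite eqxx.
  by rewrite addr0 hZ//; exact: lie_Omega_c.
have [C [ss hss]] := hK K cK.
have [C' [ss' [C'0 h']]] : exists (C' : R) (ss' : seq (@form_seminorm R n M)), 0 <= C' /\
    forall w, is_form w -> \sum_(s <- ss) form_seminorm_val s (lie_form X w) <=
      C' * \sum_(s <- ss') form_seminorm_val s w.
  elim: ss {hss} => [|s ss [C2 [L2 [C20 h2]]]].
    by exists 0, [::]; split=> // w _; rewrite big_nil mul0r.
  have [C1 [L1 [C10 h1]]] := lie_seminorm_val X s.
  exists (C1 + C2), (L1 ++ L2); split=> [|w fw]; first exact: addr_ge0.
  have s1 : 0 <= \sum_(d <- L1) form_seminorm_val d w by apply: sumr_ge0 => d _; exact: form_seminorm_ge0.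
  have s2 : 0 <= \sum_(d <- L2) form_seminorm_val d w by apply: sumr_ge0 => d _; exact: form_seminorm_ge0.
  rewrite big_cons; apply: le_trans (lerD (h1 w fw) (h2 w fw)) _; rewrite big_cat/=; nra.
(* The sign of [C] is not known, hence the absolute value. *)
exists (`|C| * C'), ss' => w [fw sw]; apply: le_trans (hss _ _) _.
  by split; [exact: lie_is_form|exact: (subset_trans (lie_form_supp (X := X) fw) sw)].
have hs : 0 <= \sum_(s <- ss) form_seminorm_val s (lie_form X w).
  by apply: sumr_ge0 => s _; apply: form_seminorm_ge0; exact: lie_is_form.
apply: (@le_trans _ _ (`|C| * \sum_(s <- ss) form_seminorm_val s (lie_form X w))).
  by rewrite ler_wpM2r// ler_norm.
by rewrite -mulrA ler_wpM2l// h'.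
Qed.

Lemma lie_seminorm_dom X (pn : FS M -> R) : cs_sn pn -> exists (C : R) (p0 : FS M -> R),
  [/\ 0 <= C, @cs_sn _ (FS M) p0 & forall u : FS M, cs_set u -> pn (lie_form X u) <= C * p0 u].
Proof.
move=> hp; exists 1, (fun w => pn (lie_form X w)); split=> //.
  exact: lie_continuous_seminorm.
by move=> u _; rewrite mul1r.
Qed.

Lemma SC_lie X (c : R -> preform M) : @SC R (FS M) c -> @SC R (FS M) (fun t => lie_form X (c t)).
Proof.
apply: (@SC_lin R (FS M) (FS M) (lie_form X)).
- by move=> u; exact: lie_Omega_c.
- by move=> k u v hu hv; apply: lie_form_lin; exact: Omega_c_is_form.
- by move=> p; exact: lie_seminorm_dom.
Qed.

Lemma der_lie X (c : R -> preform M) t d : (forall s, Omega_c (c s)) -> Omega_c d ->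
  @der R (FS M) c t d -> @der R (FS M) (fun t => lie_form X (c t)) t (lie_form X d).
Proof.
apply: (@der_lin R (FS M) (FS M) (lie_form X)).
- by move=> k u v hu hv; apply: lie_form_lin; exact: Omega_c_is_form.
- by move=> p; exact: lie_seminorm_dom.
Qed.

Lemma der_eval (c : R -> preform M) t d y A : @der R (FS M) c t d ->
  is_derive t 1 (fun s => c s y A : R) (d y A : R).
Proof.
move=> dc; apply/is_deriveP; apply: osm_le (dc _ (eval_seminorm y A)) => s.
by rewrite [s *: 1]mulr1.
Qed.

(** With [A] and [B] the Jacobians of the two fields, the traces of [A B] and [B A] cancel, and
    derivatives of the divergences remain. *)
Lemma divg_bracket X Y phi z : atlas phi -> cimg phi z ->
  divg (bracket X Y) phi z = 'D_(vfield_rep X phi z) (divg Y phi) z - 'D_(vfield_rep Y phi z) (divg X phi) z.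
Proof.
move=> a1 hz; have oU := open_cimg phi.
have zU : z \in cimg phi by rewrite inE.
have sX := vfield_smooth X a1; have sY := vfield_smooth Y a1.
have Dd V u : 'D_u (divg V phi) z = \sum_i 'D_u ('D_(delta_mx 0 i) (vfield_rep V phi)) z 0 i.
  have E : {in cimg phi, (fun y => \sum_i 'D_(delta_mx 0 i) (vfield_rep V phi) y 0 i) =1 divg V phi}.
    by move=> y; rewrite inE => hy; rewrite divgE.
  rewrite -(eq_on_D u oU E zU).
  have sV i := smooth_onD (delta_mx 0 i) (vfield_smooth V a1).
  have D i : is_derive z u (fun y => 'D_(delta_mx 0 i) (vfield_rep V phi) y 0 i)
     ('D_u ('D_(delta_mx 0 i) (vfield_rep V phi)) z 0 i).
    have := smooth_on_is_derive u ((smooth_coord _ oU).1 (sV i) i) hz.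
    by rewrite (derive_mx (smooth_on_derivable (sV i) hz)) mxE.
  exact: (derive_val (is_derive := is_derive_bigsum (index_enum _) D)).
have E : {in cimg phi, bracket_rep X Y phi =1 vfield_rep (bracket X Y) phi}.
  by move=> y; rewrite inE => hy; rewrite bracketE.
have sXY := smooth_derive_field oU sX sY; have sYX := smooth_derive_field oU sY sX.
have DB i : 'D_(delta_mx 0 i) (vfield_rep (bracket X Y) phi) z =
    ('D_('D_(delta_mx 0 i) (vfield_rep X phi) z) (vfield_rep Y phi) z +
     'D_(vfield_rep X phi z) ('D_(delta_mx 0 i) (vfield_rep Y phi)) z) -
    ('D_('D_(delta_mx 0 i) (vfield_rep Y phi) z) (vfield_rep X phi) z +
     'D_(vfield_rep Y phi z) ('D_(delta_mx 0 i) (vfield_rep X phi)) z).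
  rewrite -(eq_on_D _ oU E zU).
  rewrite -(derive_of_field _ oU sX sY hz) -(derive_of_field _ oU sY sX hz).
  exact: (derive_val (is_derive := is_deriveB (smooth_on_is_derive _ sXY hz) (smooth_on_is_derive _ sYX hz))).
refine (etrans (divgE _ a1 hz) (etrans _ (esym (subr_congr (Dd Y _) (Dd X _))))).
pose A := jacobian (vfield_rep X phi) z; pose B := jacobian (vfield_rep Y phi) z.
have eA v : 'D_v (vfield_rep X phi) z = v *m A by exact: (smooth_jacobianE _ oU sX hz).
have eB v : 'D_v (vfield_rep Y phi) z = v *m B by exact: (smooth_jacobianE _ oU sY hz).
transitivity (\tr (A *m B) - \tr (B *m A) +
  (\sum_i 'D_(vfield_rep X phi z) ('D_(delta_mx 0 i) (vfield_rep Y phi)) z 0 i -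
   \sum_i 'D_(vfield_rep Y phi z) ('D_(delta_mx 0 i) (vfield_rep X phi)) z 0 i)); last first.
  exact: tr_comm_cancel.
apply: trace_of_commutator => i.
exact: (etrans (DB i) (subr_congr (congr1 (fun u => u + _) (etrans (eB _) (congr1 (mulmx^~ B) (eA _))))
  (congr1 (fun u => u + _) (etrans (eA _) (congr1 (mulmx^~ A) (eB _)))))).
Qed.

Lemma lie_den_bracket X Y phi (a : 'rV[R]_n -> R) z : atlas phi -> cimg phi z -> smooth_on (cimg phi) a ->
  lie_den X phi (lie_den Y phi a) z - lie_den Y phi (lie_den X phi a) z = lie_den (bracket X Y) phi a z.
Proof.
move=> a1 hz sa; have oU := open_cimg phi.
have sX := vfield_smooth X a1; have sY := vfield_smooth Y a1.
have D V (W : 'rV[R]_n -> R) u : smooth_on (cimg phi) V -> smooth_on (cimg phi) W ->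
   'D_u (fun y => 'D_(V y) a y + W y * a y) z =
   'D_u (fun y => 'D_(V y) a y) z + ('D_u W z * a z + W z * 'D_u a z).
  move=> sV sW; have sVa := smooth_derive_field oU sV sa.
  exact: (derive_val (is_derive := is_deriveD (smooth_on_is_derive u sVa hz)
    (is_deriveZf (smooth_on_is_derive u sW hz) (smooth_on_is_derive u sa hz)))).
rewrite /lie_den (divg_bracket X Y a1 hz) (bracketE X Y a1 hz).
rewrite -(derive_commutator oU sX sY sa hz).
exact: (bracket_ring (D _ _ _ sY (divg_smooth Y a1)) (D _ _ _ sX (divg_smooth X a1))).
Qed.

Lemma lie_form_bracket X Y w : is_form w ->
  lie_form X (lie_form Y w) - lie_form Y (lie_form X w) = lie_form (bracket X Y) w.
Proof.
move=> fw; apply: preform_ext => p A; rewrite preform_subE.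
have a1 := atlas_at p; have hz := cimg_at p; have oU := open_cimg (chart_at p).
have fX := lie_is_form X fw; have fY := lie_is_form Y fw.
rewrite (lie_formE X p A fY) (lie_formE Y p A fX) (lie_formE _ p A fw) -mulrBr -(lie_den_bracket X Y a1 hz (den_smooth fw a1)).
have e V W : lie_den V (chart_at p) (den (chart_at p) (lie_form W w)) (cmap_at p) =
   lie_den V (chart_at p) (lie_den W (chart_at p) (den (chart_at p) w)) (cmap_at p).
  by apply: (eq_lie_den _ _ oU hz) => y hy; rewrite den_lie.
exact: (congr1 (GRing.mul (\det A)) (subr_congr (e X Y) (e Y X))).
Qed.

Definition fmul (f : M -> R) w : preform M := fun p A => f p * w p A.

Lemma fmul_is_form (f : M -> R) w : smooth_fun f -> is_form w -> is_form (fmul f w).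
Proof.
move=> sf fw; apply: is_formP => [p|phi a1].
  have [h1 h2] := is_form_alt fw p; split=> [A B C i b c e1 e2 e3|A i j ij e].
    by rewrite /fmul (h1 A B C i b c e1 e2 e3); ring.
  by rewrite /fmul (h2 A i j ij e) mulr0.
exact: (smooth_mul (open_cimg phi) (sf phi a1) (den_smooth fw a1)).
Qed.

Lemma fmul_Omega_c (f : M -> R) w : smooth_fun f -> Omega_c w -> Omega_c (fmul f w).
Proof.
move=> sf [fw cw]; apply: (Omega_cP (fmul_is_form sf fw) cw) => p hp A.
by rewrite /fmul supp_out ?mulr0.
Qed.

Lemma lie_fmul X (f : M -> R) w : smooth_fun f -> is_form w ->
  lie_form X (fmul f w) = fmul (lie_fun X f) w + fmul f (lie_form X w).
Proof.
move=> sf fw; apply: preform_ext => p A; rewrite preform_addE {2 3}/fmul.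
have a1 := atlas_at p; have hz := cimg_at p.
rewrite (lie_formE _ _ _ (fmul_is_form sf fw)) (lie_formE _ _ _ fw).
have -> : lie_den X (chart_at p) (den (chart_at p) (fmul f w)) (cmap_at p) = _ :=
  lie_denM X a1 hz (sf _ a1) (den_smooth fw a1).
rewrite (lie_fun_chart X sf a1 (cdom_at p)) (den_at _ _ (is_form_alt fw)) /=.
rewrite -/(cmap_at p) cinv_at; move: ('D_ _ _ _) (lie_den _ _ _ _) => d l; ring.
Qed.

End lie_derivative_of_forms.

(** * Integration and Stokes' theorem *)

Section integration_on_the_line.
Context {R : realType}.
Local Notation mu := (@lebesgue_measure R).
Implicit Types (f g : R -> R) (L C B : R).

Lemma integral_support f L : (forall t, L < `|t| -> f t = 0) ->
  \int[mu]_t f t = \int[mu]_(t in `[- L, L]) f t.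
Proof.
move=> h; rewrite [RHS]Rintegral_mkcond; apply: eq_Rintegral => t _.
rewrite patchE; case: ifPn => // ht; apply: h; rewrite ltNge; apply: contra ht.
by rewrite ler_norml => h; rewrite inE/= in_itv.
Qed.

Lemma integrable_segment f a b : continuous f -> mu.-integrable `[a, b] (EFin \o f).
Proof.
by move=> cf; apply: continuous_compact_integrable; [exact: segment_compact|exact: continuous_subspaceT].
Qed.

Arguments integrable_segment {f a b}.

Lemma integral_segment_le f (a b B : R) : a <= b -> continuous f ->
  (forall t, a <= t <= b -> `|f t| <= B) -> `|\int[mu]_(t in `[a, b]) f t| <= B * (b - a).
Proof.
move=> ab cf h; have mI : measurable (`[a, b]%classic : set (measurableTypeR R)) by exact: measurable_itv.
have h1 := le_normr_Rintegral mI (integrable_segment cf); apply: (le_trans h1).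
have cn : continuous (fun t => `|f t|).
  by move=> t; exact: (continuous_comp (cf t) (@norm_continuous _ _ (f t))).
have cB : continuous (fun _ : R => B) by move=> t; exact: cvg_cst.
apply: (@le_trans _ _ (\int[mu]_(t in `[a, b]) B)).
  apply: (le_Rintegral mI (integrable_segment cn) (integrable_segment cB)) => t /=.
  by rewrite in_itv/=; exact: h.
have e : fine (lebesgue_measure (`[a, b]%classic : set R)) = b - a.
  rewrite lebesgue_measure_itv/= lte_fin; have [ab'|ba] := ltP a b; first by [].
  by apply/eqP; rewrite eq_sym subr_eq0 eq_le ba ab.
rewrite -e le_eqVlt; apply/orP; left; apply/eqP; exact: (Rintegral_cst _ mI B).
Qed.

Lemma lipschitz_continuous (V W : normedModType R) (f : V -> W) C :
  (forall x y, `|f x - f y| <= C * `|x - y|) -> continuous f.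
Proof.
move=> h x; apply/cvgrPdist_le => e e0; have C1 : 0 < `|C| + 1 by rewrite ltr_wpDl.
have d0 : 0 < e / (`|C| + 1) by rewrite divr_gt0.
apply/nbhs_ballP; exists (e / (`|C| + 1)) => // y; rewrite -ball_normE/= ltr_pdivlMr// => hy.
apply: le_trans (h x y) _; have := normr_ge0 (x - y); have := ler_norm C; nra.
Qed.

Lemma integral_of_derivative f g L : 0 < L -> (forall t, L < `|t| -> f t = 0) ->
  (forall t : R, is_derive t 1 f (g t)) -> continuous g -> \int[mu]_t g t = 0.
Proof.
move=> L0 f0 df cg.
have g0 t : L < `|t| -> g t = 0.
  move=> ht; have h : is_derive t 1 f 0.
    refine (@open_eq_is_derive R R R [set t : R | L < `|t|] (cst 0) f t 1 0 _ ht _ (is_derive_cst _ _ _)).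
      rewrite (_ : [set _ | _] = (fun t : R => `|t|) @^-1` [set t : R | L < t])//.
      by apply: open_comp (@open_gt R L) => x _; exact: norm_continuous.
    by move=> y /f0 ->.
  exact: (is_derive_unique (df t) h).
rewrite (integral_support (L := L + 1)); last by move=> t ht; apply: g0; lra.
have cf : continuous f.
  by move=> t; apply: differentiable_continuous; apply/derivable1_diffP; have [] := df t.
rewrite /Rintegral (@continuous_FTC2 R g f); first last.
- by move=> t _; rewrite derive1E; have [_ ->] := df t.
- split=> [t _||]; first by have [] := df t.
    by apply: cvg_at_right_filter; exact: cf.
  by apply: cvg_at_left_filter; exact: cf.
- exact: continuous_subspaceT.
- lra.
rewrite /= (f0 (L + 1)) ?(f0 (- (L + 1))) ?subrr// ?normrN; rewrite ger0_norm; lra.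
Qed.

End integration_on_the_line.
Arguments integrable_segment {R f a b}.

Section integration_on_space.
Context {R : realType}.
Implicit Types (L C B : R).

(* Lipschitz functions with support in a cube. *)
Definition lipc n L C (f : 'rV[R]_n -> R) :=
  (forall x y, `|f x - f y| <= C * `|x - y|) /\ forall x, L < `|x| -> f x = 0.

Definition rcons_vec n (t : R) (v : 'rV[R]_n) : 'rV[R]_(n.+1) := row_mx t%:M v : 'rV[R]_(1 + n).

Lemma rcons_vec0 n t (v : 'rV[R]_n) : rcons_vec t v 0 (lshift n 0 : 'I_(1 + n)) = t.
Proof. by have := row_mxEl (t%:M : 'rV[R]_1) v 0 0; rewrite [X in _ = X -> _]mxE eqxx mulr1n. Qed.

Lemma rcons_vecS n t (v : 'rV[R]_n) j : rcons_vec t v 0 (rshift 1 j : 'I_(1 + n)) = v 0 j.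
Proof. exact: (row_mxEr (t%:M : 'rV[R]_1) v 0 j). Qed.

Lemma ordS_ind n (P : 'I_n.+1 -> Prop) : P (lshift n 0 : 'I_(1 + n)) ->
  (forall j, P (rshift 1 j : 'I_(1 + n))) -> forall i, P i.
Proof. by move=> h0 hS i; case: (split_ordP (i : 'I_(1 + n))) => k ->; rewrite ?ord1. Qed.

Lemma rcons_vec_norm n t (v : 'rV[R]_n) : `|rcons_vec t v| = Num.max `|t| `|v|.
Proof.
apply/eqP; rewrite eq_le ge_max; apply/andP; split.
  apply: norm_le_coord => [|i j]; first by rewrite le_max normr_ge0.
  rewrite ord1; elim/ordS_ind: j => [|j]; first by rewrite rcons_vec0 le_max lexx.
  by rewrite rcons_vecS le_max coord_le_norm orbT.
apply/andP; split.
  have := coord_le_norm (rcons_vec t v) 0 (lshift n 0 : 'I_(1 + n)).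
  by rewrite rcons_vec0.
apply: norm_le_coord => // i j; rewrite ord1.
have := coord_le_norm (rcons_vec t v) 0 (rshift 1 j : 'I_(1 + n)).
by rewrite rcons_vecS.
Qed.

Lemma rowBE n (u v : 'rV[R]_n) i : (u - v) 0 i = u 0 i - v 0 i.
Proof. by rewrite !mxE. Qed.

Lemma rowDZE n (u v : 'rV[R]_n) (s : R) i : (u + s *: v) 0 i = u 0 i + s * v 0 i.
Proof. by rewrite !mxE. Qed.

Lemma rcons_vecB n t s (v u : 'rV[R]_n) : rcons_vec t v - rcons_vec s u = rcons_vec (t - s) (v - u).
Proof.
apply/rowP; apply: ordS_ind => [|j]; first by rewrite rowBE !rcons_vec0.
by rewrite rowBE !rcons_vecS rowBE.
Qed.

Lemma integral_rVS n (f : 'rV[R]_n.+1 -> R) :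
  integral_rV f = \int[lebesgue_measure]_t integral_rV (fun v => f (rcons_vec t v)).
Proof. by []. Qed.

Lemma lipc_slice n L C (f : 'rV[R]_n.+1 -> R) t : lipc L C f -> lipc L C (fun v => f (rcons_vec t v)).
Proof.
move=> [h1 h2]; split=> [x y|x hx].
  apply: le_trans (h1 _ _) _; rewrite rcons_vecB rcons_vec_norm subrr normr0.
  by rewrite (max_idPr (normr_ge0 _)).
by apply: h2; rewrite rcons_vec_norm lt_max hx orbT.
Qed.

Lemma lipc_ge0 n L C (f : 'rV[R]_n.+1 -> R) : lipc L C f -> 0 <= C.
Proof.
move=> [h _]; have := h (rcons_vec 1 0) 0.
have e : `|rcons_vec 1 (0 : 'rV[R]_n) - 0| = 1.
  by rewrite subr0 rcons_vec_norm normr0 normr1; apply/max_idPl.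
by rewrite e mulr1; exact: le_trans.
Qed.

Lemma lipcD n L C C' k (f g : 'rV[R]_n -> R) : lipc L C f -> lipc L C' g ->
  lipc L (C + `|k| * C') (fun x => f x + k * g x).
Proof.
move=> [f1 f2] [g1 g2]; split=> [x y|x hx]; last by rewrite f2// g2// mulr0 addr0.
have -> : f x + k * g x - (f y + k * g y) = (f x - f y) + k * (g x - g y) by ring.
apply: le_trans (ler_normD _ _) _; rewrite mulrDl lerD// normrM -mulrA ler_wpM2l//.
Qed.

(** Bound and linearity go together: in dimension [n] they show that the inner integral is Lipschitz
    in the outer variable and vanishes off a segment, so the next dimension is the integration of a
    continuous function over a segment. *)
Lemma integral_rV_facts n L : 0 < L ->
  (forall C B (f : 'rV[R]_n -> R), lipc L C f -> (forall x, `|f x| <= B) ->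
     `|integral_rV f| <= (2 * L) ^+ n * B) /\
  (forall C C' k (f g : 'rV[R]_n -> R), lipc L C f -> lipc L C' g ->
     integral_rV (fun x => f x + k * g x) = integral_rV f + k * integral_rV g).
Proof.
move=> L0; elim: n => [|n [IHb IHl]].
  by split=> [C B f _ h|//] /=; rewrite expr0 mul1r.
have L2 : 0 <= 2 * L by lra.
have lip C (f : 'rV[R]_n.+1 -> R) : lipc L C f ->
    (forall t s, `|integral_rV (fun v => f (rcons_vec t v)) - integral_rV (fun v => f (rcons_vec s v))|
      <= ((2 * L) ^+ n * C) * `|t - s|) /\
    (forall t, L < `|t| -> integral_rV (fun v => f (rcons_vec t v)) = 0).
  move=> hf; split=> [t s|t ht]; last first.
    apply/eqP; rewrite -normr_le0 -(mulr0 ((2 * L) ^+ n)); apply: (IHb _ _ _ (lipc_slice t hf)) => x.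
    by rewrite hf.2 ?normr0// rcons_vec_norm lt_max ht.
  rewrite -mulN1r -(IHl _ _ _ _ _ (lipc_slice t hf) (lipc_slice s hf)) -mulrA.
  apply: (IHb _ _ _ (lipcD (-1) (lipc_slice t hf) (lipc_slice s hf))) => x.
  rewrite mulN1r; apply: le_trans (hf.1 _ _) _; rewrite rcons_vecB rcons_vec_norm subrr normr0.
  by rewrite (max_idPl (normr_ge0 _)).
have cont C f (hf : lipc L C f) := @lipschitz_continuous R R R _ _ (lip C f hf).1.
split=> [C B f hf hB|C C' k f g hf hg]; rewrite !integral_rVS.
  rewrite (integral_support (lip _ _ hf).2) exprS.
  apply: le_trans (integral_segment_le (B := (2 * L) ^+ n * B) _ (cont _ _ hf) _) _.
  - lra.
  - by move=> t _; exact: (IHb _ _ _ (lipc_slice t hf)).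
  - by rewrite le_eqVlt; apply/orP; left; apply/eqP; ring.
have hfg := lipcD k hf hg.
rewrite (integral_support (lip _ _ hfg).2) (integral_support (lip _ _ hf).2) (integral_support (lip _ _ hg).2).
have mI : measurable (`[- L, L]%classic : set (measurableTypeR R)) by exact: measurable_itv.
have ck : continuous (fun t => k * integral_rV (fun v => g (rcons_vec t v))).
  by move=> t; apply: cvgMr; exact: cont hg t.
rewrite -(RintegralZl _ mI (integrable_segment (cont _ _ hg))).
rewrite -(RintegralD mI (integrable_segment (cont _ _ hf)) (integrable_segment ck)).
by apply: eq_Rintegral => t _; exact: (IHl _ _ _ _ _ (lipc_slice t hf) (lipc_slice t hg)).
Qed.

Lemma integral_rV_lin n L C C' k (f g : 'rV[R]_n -> R) : 0 < L -> lipc L C f -> lipc L C' g ->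
  integral_rV (fun x => f x + k * g x) = integral_rV f + k * integral_rV g.
Proof. by move=> L0; exact: (integral_rV_facts n L0).2. Qed.

Lemma integral_rV0 n : integral_rV (fun _ : 'rV[R]_n => 0) = 0 :> R.
Proof.
have h : lipc 1 0 (fun _ : 'rV[R]_n => 0 : R) by split=> // x y; rewrite subrr normr0 mul0r.
have := integral_rV_lin (-1) (ltr01) h h.
by rewrite (_ : (fun x => 0 + -1 * 0) = fun=> 0) => [->|]; [ring|apply/funext => x; rewrite mulr0 addr0].
Qed.

Lemma integral_rV_sum n L (I : Type) (r : seq I) (f : I -> 'rV[R]_n -> R) : 0 < L ->
  (forall i, exists C, lipc L C (f i)) ->
  (exists C', lipc L C' (fun x => \sum_(i <- r) f i x)) /\
  integral_rV (fun x => \sum_(i <- r) f i x) = \sum_(i <- r) integral_rV (f i).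
Proof.
move=> L0 h; elim: r => [|i r [[C' IH1] IH2]].
  have -> : (fun x : 'rV[R]_n => \sum_(i <- [::]) f i x) = fun=> 0.
    by apply/funext => x; rewrite big_nil.
  rewrite big_nil integral_rV0; split=> //; exists 0; split=> // x y.
  by rewrite subrr normr0 mul0r.
have -> : (fun x : 'rV[R]_n => \sum_(j <- i :: r) f j x) = fun x => f i x + 1 * \sum_(j <- r) f j x.
  by apply/funext => x; rewrite big_cons mul1r.
have [C hi] := h i; rewrite (integral_rV_lin 1 L0 hi IH1) big_cons IH2 mul1r; split=> //.
by eexists; exact: lipcD hi IH1.
Qed.

Definition test_fun n L (f : 'rV[R]_n -> R) :=
  smooth_on setT f /\ forall x, L < `|x| -> f x = 0.

Lemma test_funD n L (f : 'rV[R]_n -> R) v : test_fun L f -> test_fun L ('D_v f).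
Proof.
move=> [sf f0]; split=> [|x hx]; first exact: smooth_onD.
have oU : open [set x : 'rV[R]_n | L < `|x|].
  rewrite (_ : [set _ | _] = (fun x : 'rV[R]_n => `|x|) @^-1` [set t : R | L < t])//.
  by apply: open_comp (@open_gt R L) => y _; exact: norm_continuous.
have E : {in [set x : 'rV[R]_n | L < `|x|], f =1 cst 0} by move=> y; rewrite inE => /f0 ->.
by rewrite (eq_on_D v oU E) ?inE//; exact: derive_cst.
Qed.

Lemma test_fun_bounded n L (f : 'rV[R]_n -> R) : test_fun L f ->
  exists C, 0 < C /\ forall x, `|f x| <= C.
Proof.
move=> [sf f0].
have [C [C0 hC]] : exists C : R, 0 < C /\ forall x, [set x : 'rV[R]_n | `|0 - x| <= L] x -> `|f x| <= C.
  apply: compact_cont_bounded => [|x _]; first exact: compact_closed_ball.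
  exact: (smooth_on_cont sf).
exists C; split=> // x; have [xL|xL] := leP `|x| L; first by apply: hC; rewrite /= sub0r normrN.
by rewrite f0// normr0 ltW.
Qed.

Lemma smooth_mvt n (f : 'rV[R]_n -> R) x v : smooth_on setT f ->
  exists s, 0 <= s <= 1 /\ 'D_v f (x + s *: v) = f (x + v) - f x.
Proof.
move=> sf.
have D s : is_derive (s : R) 1 (fun r : R => f (x + r *: v)) ('D_v f (x + s *: v)).
  by apply: is_derive_segment; exact: (smooth_on_is_derive _ sf).
have cf : {within `[0, 1], continuous (fun r : R => f (x + r *: v))}.
  apply: continuous_subspaceT => s; apply: differentiable_continuous.
  by apply/derivable1_diffP; have [] := D s.
have [s] := @MVT_segment R (fun r : R => f (x + r *: v)) (fun s => 'D_v f (x + s *: v)) 0 1 ler01 (fun s _ => D s) cf.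
by rewrite in_itv/= scale1r scale0r addr0 subr0 mulr1 => hs ->; exists s.
Qed.

Lemma test_fun_lip n L (f : 'rV[R]_n -> R) : test_fun L f -> exists C, lipc L C f.
Proof.
move=> tf; have [C hC] := choice (fun i : 'I_n => test_fun_bounded (test_funD (delta_mx 0 i) tf)).
exists (\sum_i C i); split=> [x y|]; last by case: tf.
have [s [_ e]] := smooth_mvt y (x - y) tf.1; rewrite addrCA subrr addr0 in e; rewrite -e.
rewrite (smooth_deriveE _ openT tf.1)// mulr_suml; apply: le_trans (ler_norm_sum _ _ _) _.
apply: ler_sum => i _; rewrite normrM mulrC; apply: ler_pM => //; first exact: (hC i).2.
by have := coord_le_norm (x - y) 0 i.
Qed.

Lemma smooth_slice n (f : 'rV[R]_n.+1 -> R) t : smooth_on setT f ->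
  smooth_on setT (fun v : 'rV[R]_n => f (rcons_vec t v)).
Proof.
move=> sf; apply: (boman_smooth openT) => c sc _.
have h : smooth_on setT (fun s => rcons_vec t (c s)).
  apply/(smooth_coord _ openT); elim/ordS_ind => [|k].
    rewrite (_ : (fun x => _) = fun=> t); first exact: smooth_cst openT.
    by apply/funext => s; rewrite rcons_vec0.
  rewrite (_ : (fun x => _) = fun s => c s 0 k); first exact: ((smooth_coord _ openT).1 sc k).
  by apply/funext => s; rewrite rcons_vecS.
exact: (smooth_comp openT openT (fun _ _ => I) h sf).
Qed.

Lemma test_slice n L (f : 'rV[R]_n.+1 -> R) t : test_fun L f ->
  test_fun L (fun v : 'rV[R]_n => f (rcons_vec t v)).
Proof.
move=> [sf f0]; split; first exact: smooth_slice.
by move=> v hv; apply: f0; rewrite rcons_vec_norm lt_max hv orbT.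
Qed.

Lemma rcons_vec_line n t s (v w : 'rV[R]_n) r :
  rcons_vec t v + s *: rcons_vec r w = rcons_vec (t + s * r) (v + s *: w).
Proof.
apply/rowP; apply: ordS_ind => [|j]; first by rewrite rowDZE !rcons_vec0.
by rewrite rowDZE !rcons_vecS rowDZE.
Qed.

(** For the outer variable, differentiation under the integral leads to the fundamental theorem of
    calculus; for the others the inner integral vanishes by induction. *)
Lemma integral_rV_derive n L (f : 'rV[R]_n -> R) i : 0 < L -> test_fun L f ->
  integral_rV ('D_(delta_mx 0 i) f) = 0.
Proof.
move=> L0; elim: n f i => [|n IH] f i tf; first by case: i.
rewrite integral_rVS.
have ei (j : 'I_n) : delta_mx 0 (rshift 1 j : 'I_(1 + n)) = rcons_vec 0 (delta_mx 0 j) :> 'rV[R]_(n.+1).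
  apply/rowP; elim/ordS_ind => [|k]; rewrite ?rcons_vec0 ?rcons_vecS !mxE//.
elim/ordS_ind: i => [|j]; last first.
  rewrite (_ : (fun t => _) = fun=> 0); last first.
    apply/funext => t; rewrite -[RHS](IH (fun v => f (rcons_vec t v)) j (test_slice t tf)).
    congr integral_rV; apply/funext => v; rewrite ei.
    have D := smooth_on_is_derive (rcons_vec 0 (delta_mx 0 j)) tf.1 (x := rcons_vec t v) I.
    apply/esym/derive_val; apply/is_derive_line; move/is_derive_line: D.
    congr (is_derive _ _ _ _); apply/funext => s.
    by rewrite rcons_vec_line mulr0 addr0.
  by rewrite Rintegral_cst ?mul0r//; exact: measurableT.
have e0 : delta_mx 0 (lshift n 0 : 'I_(1 + n)) = rcons_vec 1 0 :> 'rV[R]_(n.+1).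
  by apply/rowP; elim/ordS_ind => [|k]; rewrite ?rcons_vec0 ?rcons_vecS !mxE.
rewrite e0; set e := rcons_vec 1 0.
have tD := test_funD e tf; have tDD := test_funD e tD.
have [C hC] := test_fun_lip tD; have [C' hC'] := test_fun_lip tf.
have [bB bL] := integral_rV_facts n L0.
have C0 := lipc_ge0 hC; have L2 : 0 <= (2 * L) ^+ n by apply: exprn_ge0; lra.
apply: (@integral_of_derivative R (fun t => integral_rV (fun v => f (rcons_vec t v)))
  (fun t => integral_rV (fun v => 'D_e f (rcons_vec t v))) L L0).
- move=> t ht; rewrite (_ : (fun v => _) = fun=> 0) ?integral_rV0//; apply/funext => v.
  by apply: tf.2; rewrite rcons_vec_norm lt_max ht.
- move=> t; apply/is_deriveP.
  apply: (osm_le _ (@osm_sq R ((2 * L) ^+ n * C) _)); last exact: mulr_ge0.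
  move=> s; rewrite [s *: 1]mulr1 [s *: _]/(s * _).
  have h1 := lipc_slice (t + s) hC'; have h2 := lipc_slice t hC'; have h3 := lipc_slice t hC.
  have h12 := lipcD (-1) h1 h2.
  rewrite -mulN1r -[X in _ + X]mulNr -(bL _ _ _ _ _ h1 h2) -(bL _ _ _ _ _ h12 h3) -mulrA.
  apply: (bB _ _ _ (lipcD (- s) h12 h3)) => v.
  have eq1 r : rcons_vec (t + r) v = rcons_vec t v + r *: e.
    by rewrite /e rcons_vec_line mulr1 scaler0 addr0.
  (* By the mean value theorem the remainder is [s] times a difference of values of ['D_e f] at
     points of distance at most [|s|], hence O(s^2) uniformly in [v]. *)
  have [r [/andP[r0 r1] er]] := smooth_mvt (rcons_vec t v) (s *: e) tf.1.
  have Ds : 'D_(s *: e) f (rcons_vec t v + r *: (s *: e)) = s * 'D_e f (rcons_vec t v + (r * s) *: e).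
    have D := smooth_on_is_derive e tf.1 (x := rcons_vec t v + (r * s) *: e) I.
    rewrite scalerA; rewrite (smooth_deriveE _ openT tf.1)// (smooth_deriveE e openT tf.1)//.
    by rewrite mulr_sumr; apply: eq_bigr => l _; rewrite [(s *: e) 0 l]mxE; exact: (esym (mulrA _ _ _)).
  rewrite eq1 mulN1r -er Ds mulNr -mulrBr normrM.
  apply: (@le_trans _ _ (`|s| * (C * (`|r * s| * 1)))).
    rewrite ler_wpM2l//; apply: le_trans (hC.1 _ _) _; rewrite ler_wpM2l// addrAC subrr add0r normrZ.
    by rewrite /e rcons_vec_norm normr1 normr0 ler_wpM2l// ge_max lexx ler01.
  rewrite mulr1 normrM (ger0_norm r0) expr2.
  have := normr_ge0 s; move: (`|s|) => u u0; have := mulr_ge0 u0 u0; have := mulr_ge0 C0 (mulr_ge0 u0 u0); nra.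
- apply: (@lipschitz_continuous R R R _ ((2 * L) ^+ n * C)) => t s.
  have h1 := lipc_slice t hC; have h2 := lipc_slice s hC.
  rewrite -mulN1r -(bL _ _ _ _ _ h1 h2) -mulrA; apply: (bB _ _ _ (lipcD (-1) h1 h2)) => v.
  rewrite mulN1r; apply: le_trans (hC.1 _ _) _; rewrite rcons_vecB rcons_vec_norm subrr normr0.
  by rewrite (max_idPl (normr_ge0 _)).
Qed.

End integration_on_space.

Lemma det_inv_neq0 {R : realType} n (A B : 'M[R]_n) : A *m B = 1%:M -> \det A != 0.
Proof.
move=> h; apply/eqP => d0; have := congr1 determinant h; rewrite det_mulmx d0 mul0r det1 => /eqP.
by rewrite eq_sym oner_eq0.
Qed.

Lemma leibniz_comm {R : realType} (c s d a x y : R) : y = x ->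
  c * (s * d + y * a) = c *: (x *: (a : R^o) + s *: (d : R^o)).
Proof. by move=> ->; rewrite addrC. Qed.

Section stokes.
Context {R : realType} {n : nat} {M : manifold R n} (o : orientation M).
Implicit Types (phi psi : chart R n M) (w : preform M) (X : vfield M) (z : 'rV[R]_n).

Lemma jac_det_neq0 phi psi z : atlas phi -> atlas psi -> tdom phi psi z -> \det (jac phi psi z) != 0.
Proof.
by move=> a1 a2 hz; exact: (det_inv_neq0 (jac_inv a1 a2 hz)).
Qed.

Lemma orient_rep_sign phi z : atlas phi -> cimg phi z ->
  orient_rep o phi z = 1 \/ orient_rep o phi z = -1.
Proof.
move=> a1 hz; rewrite /orient_rep from_chartE; set d := \det _.
have d0 : d != 0 by exact: jac_det_neq0 (atlas_at _) (tdom_to hz).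
have [hp|hn] : Num.sg d = 1 \/ Num.sg d = -1.
  have [h|h|h] := ltrgtP 0 d; [by left; rewrite gtr0_sg|by right; rewrite ltr0_sg|].
  by move: d0; rewrite -h eqxx.
  by rewrite hp mulr1; exact: orient_sign.
by rewrite hn mulrN1; have [->|->] := orient_sign o (cinv phi z); [right|left; rewrite opprK].
Qed.

(** A continuous function with values 1 and -1 is locally constant. *)
Lemma orient_rep_near phi z : atlas phi -> cimg phi z ->
  \forall y \near z, cimg phi y /\ orient_rep o phi y = orient_rep o phi z.
Proof.
move=> a1 hz; have h1 := open_near (open_cimg phi) hz.
have /cvgrPdist_lt/(_ 1 ltr01) h2 := orient_continuous (o := o) a1 hz.
near=> y; have hy : cimg phi y by near: y.
split; first exact: hy.
have h3 : `|orient_rep o phi z - orient_rep o phi y| < 1 by near: y.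
move: h3; have [->|->] := orient_rep_sign a1 hz; have [->|->] := orient_rep_sign a1 hy => //.
  by rewrite opprK ger0_norm//; lra.
by rewrite ler0_norm//; lra.
Unshelve. all: by end_near. Qed.

(** The density of [L_X w] is the divergence of the density of [w] times [X]. The orientation sign
    is locally constant and passes into the components [b i], which extend by zero to test functions
    on the whole space. *)
Lemma chart_stokes X phi w : atlas phi -> Omega_c w -> supp w `<=` cdom phi ->
  integral_rV (fun z => if z \in cimg phi then
     orient_rep o phi z * form_rep phi (lie_form X w) z 1%:M else 0) = 0.
Proof.
move=> a1 [fw cw] sw; pose K := cmap phi @` supp w; have oU := open_cimg phi.
have cK : compact K.
  apply: continuous_compact cw; apply: continuous_in_subspaceT => p.
  by rewrite inE => /sw hp; exact: (cmap_continuous hp).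
have KU : K `<=` cimg phi by move=> _ [p /sw hp <-]; exact: cimg_cmap.
have oK : open (~` K).
  by apply: closed_openC; apply: compact_closed => //; exact: norm_hausdorff.
have [L [L0 hL]] : exists L : R, 0 < L /\ forall z, K z -> `| `|z| | <= L.
  by apply: (compact_cont_bounded (f := fun z => `|z|) cK) => z _; exact: norm_continuous.
have den0 z : cimg phi z -> ~ K z -> den phi w z = 0.
  move=> hz nK; apply: supp_out => h; apply: nK; exists (cinv phi z) => //.
  exact: cinvK.
pose b i z := if z \in cimg phi then orient_rep o phi z * (vfield_rep X phi z 0 i * den phi w z) else 0.
have b0 i z : ~ K z -> b i z = 0.
  by move=> nK; rewrite /b; case: ifP => //; rewrite inE => hz; rewrite den0// !mulr0.
have near_b z : cimg phi z -> exists2 O : set 'rV[R]_n, open O & [/\ O z, O `<=` cimg phi &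
    forall i, {in O, (fun y => orient_rep o phi z * (vfield_rep X phi y 0 i * den phi w y)) =1 b i}].
  move=> hz; exists ([set y | cimg phi y /\ orient_rep o phi y = orient_rep o phi z]^°).
    exact: open_interior.
  split; first exact: orient_rep_near.
    by move=> y /interior_subset[].
  move=> i y; rewrite inE => /interior_subset[hy e].
  rewrite /b; case: ifP => h; first exact: (congr1 ( *%R^~ _) (esym e)).
  by move: h; rewrite mem_set.
have sm i : smooth_on (cimg phi) (fun y => vfield_rep X phi y 0 i * den phi w y).
  apply: (smooth_mul oU _ (den_smooth fw a1)).
  exact: ((smooth_coord _ oU).1 (vfield_smooth X a1) i).
have tb i : test_fun L (b i).
  split=> [|x hx]; last first.
    by apply: b0 => /hL; rewrite normr_id => h; move: (lt_le_trans hx h); rewrite ltxx.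
  apply: smooth_on_local => z _; have [hz|hz] := pselect (cimg phi z).
    have [B oB [Bz BU E]] := near_b z hz; exists B => //.
    apply: (eq_smooth_on oB (E i)).
    apply: (smooth_mul oB (smooth_cst _ oB)); exact: (smooth_onS BU (sm i)).
  exists (~` K); first by move=> h; exact: hz (KU _ h).
  by apply: (eq_smooth_on oK _ (smooth_cst 0 oK)) => y; rewrite inE => hy; rewrite b0.
have E : (fun z => if z \in cimg phi then
     orient_rep o phi z * form_rep phi (lie_form X w) z 1%:M else 0) =
    (fun z => \sum_i 'D_(delta_mx 0 i) (b i) z).
  apply/funext => z; case: ifPn; rewrite ?inE ?notin_setE => hz; last first.
    rewrite big1// => i _; have nK : ~ K z by move=> h; exact: hz (KU _ h).
    have E : {in ~` K, b i =1 cst 0} by move=> y; rewrite inE => hy; rewrite b0.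
    by rewrite (eq_on_D _ oK E) ?inE//; exact: derive_cst.
  have [B oB [Bz BU E]] := near_b z hz; have zB : z \in B by rewrite inE.
  have h1 : den phi (lie_form X w) z = _ := den_lie X fw a1 hz.
  rewrite -/(den phi _ z) h1 /lie_den (divgE _ a1 hz).
  rewrite (smooth_deriveE _ oU (den_smooth fw a1) hz) mulr_suml -big_split mulr_sumr.
  apply: eq_bigr => i _; rewrite -(eq_on_D _ oB (E i) zB).
  have sX := (smooth_coord _ oU).1 (vfield_smooth X a1) i.
  have D1 := smooth_on_is_derive (delta_mx 0 i) sX hz.
  have D2 := smooth_on_is_derive (delta_mx 0 i) (den_smooth fw a1) hz.
  have D3 := is_deriveZ (orient_rep o phi z) (is_deriveZf D1 D2).
  rewrite (derive_val (is_derive := D3)).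
  have e2 : ('D_(delta_mx 0 i) (vfield_rep X phi) z) 0 i =
      'D_(delta_mx 0 i) (fun y => vfield_rep X phi y 0 i) z.
    by rewrite (derive_mx (smooth_on_derivable (vfield_smooth X a1) hz)) mxE.
  exact: (leibniz_comm _ _ _ _ e2).
rewrite E; have hlip i : exists C, lipc L C ('D_(delta_mx 0 i) (b i)) by exact/test_fun_lip/test_funD.
have [_ ->] := integral_rV_sum (index_enum _) L0 hlip.
by apply: big1 => i _; exact: (integral_rV_derive i L0 (tb i)).
Qed.

Lemma fmul_lin (f g : M -> R) w : fmul (fun x => f x + g x) w = 1 *: fmul f w + fmul g w.
Proof. by apply: preform_ext => p A; rewrite preform_combE mul1r /fmul mulrDl. Qed.

(** Instead of a partition of unity, [compact_ind] is applied to the sets on which some cut-off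
    [chi] equals 1 such that the claim holds for every [chi v]. *)
Lemma stokes (J : preform M -> R) X w : is_integral o J -> Omega_c w -> J (lie_form X w) = 0.
Proof.
move=> [Jl Jc] hw.
have J0 : J 0 = 0.
  by have := Jl (-1) 0 0 Omega_c0 Omega_c0; rewrite scaler0 addr0 mulN1r addNr.
have lie0 : lie_form X (0 : preform M) = 0.
  apply: preform_ext => p A; rewrite lie_formE; last exact: is_form0.
  have E : {in cimg (chart_at p), den (chart_at p) (0 : preform M) =1 cst 0} by [].
  rewrite /lie_den (eq_on_D _ (open_cimg _) E) ?inE; last exact: cimg_at.
  by rewrite (derive_cst _ _) /den /form_rep mulr0 addr0 mulr0.
pose Q A := exists2 chi : M -> R, smooth_fun chi /\ (forall q, A q -> chi q = 1) &
  forall v, Omega_c v -> J (lie_form X (fmul chi v)) = 0.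
have [] := @compact_ind M (supp w) Q hw.2.
- exists (fun=> 0); first by split=> //; exact: smooth_fun_cst.
  move=> v _; have -> : fmul (fun=> 0) v = 0.
    by apply: preform_ext => p A; rewrite /fmul mul0r.
  by rewrite lie0.
- move=> A B [a [sa a1] Ha] [b [sb b1] Hb].
  have sna : smooth_fun (fun x => 1 + -1 * a x).
    exact: (smooth_funD (smooth_fun_cst 1) (smooth_funM (smooth_fun_cst (-1)) sa)).
  have sba := smooth_funM sb sna.
  (* Equal to 1 where [a] or [b] is, and each summand has one of the two cut-offs as a factor. *)
  exists (fun x => a x + b x * (1 + -1 * a x)); first split.
  + exact: smooth_funD.
  + by move=> q [/a1|/b1] ->; ring.
  move=> v hv; rewrite fmul_lin.
  have hav := fmul_Omega_c sa hv; have hbv := fmul_Omega_c sba hv.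
  rewrite (lie_form_lin X 1 (Omega_c_is_form hav) (Omega_c_is_form hbv)).
  rewrite Jl; [|exact: lie_Omega_c..]; rewrite Ha// mulr0 add0r.
  have -> : fmul (fun x => b x * (1 + -1 * a x)) v = fmul b (fmul (fun x => 1 + -1 * a x) v).
    by apply: preform_ext => p C; rewrite /fmul mulrA.
  by apply: Hb; exact: fmul_Omega_c.
- move=> p _; have [rho [C [srho cC Cd r0 r1]]] := bump_at p.
  exists [set q | rho q = 1] => //; exists rho; first by split.
  move=> v hv; have hrv := fmul_Omega_c srho hv.
  have sC : supp (fmul rho v) `<=` C.
    by apply: (supp_sub (closed_compact cC)) => q nC A; rewrite /fmul r0// mul0r.
  have sd : supp (fmul rho v) `<=` cdom (chart_at p) by exact: subset_trans sC Cd.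
  rewrite (Jc (chart_at p) _ (atlas_at p) (lie_Omega_c X hrv)).
    exact: chart_stokes (atlas_at p) hrv sd.
  exact: (subset_trans (lie_form_supp (X := X) (Omega_c_is_form hrv)) sd).
move=> A [chi [schi chi1] H] hA; have := H w hw.
have -> : fmul chi w = w; last by [].
apply: preform_ext => p B; rewrite /fmul; have [hp|hp] := pselect (supp w p).
  by rewrite chi1 ?mul1r//; exact: nbhs_singleton (hA p hp).
by rewrite supp_out// mulr0.
Qed.

(** [integral_form] is selected among the functionals with the defining properties and has the
    default value 0 if there are none. Linearity and Stokes' theorem hold in both cases. *)
Lemma integral_formP : is_integral o (integral_form o) \/ integral_form o = fun=> 0.
Proof.
rewrite /integral_form; case: xgetP => [J _ hJ|_]; first by left.
by right.
Qed.

Lemma integral_form_lin (a : R) w1 w2 : Omega_c w1 -> Omega_c w2 ->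
  integral_form o (a *: w1 + w2) = a * integral_form o w1 + integral_form o w2.
Proof.
by move=> h1 h2; have [[h _]|->] := integral_formP; [exact: h|rewrite mulr0 addr0].
Qed.

Lemma integral_form_lie X w : Omega_c w -> integral_form o (lie_form X w) = 0.
Proof. by move=> hw; have [h|->//] := integral_formP; exact: stokes h hw. Qed.

Lemma integral_form_parts X (f : M -> R) w : smooth_fun f -> Omega_c w ->
  integral_form o (fmul f (lie_form X w)) = - integral_form o (fmul (lie_fun X f) w).
Proof.
move=> sf hw; have := integral_form_lie X (fmul_Omega_c sf hw).
rewrite (lie_fmul X sf (Omega_c_is_form hw)) -[fmul (lie_fun X f) w]scale1r.
rewrite integral_form_lin; last exact: (fmul_Omega_c sf (lie_Omega_c X hw)).
  by rewrite mul1r addrC scale1r => /eqP; rewrite addr_eq0 => /eqP.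
exact: (fmul_Omega_c (lie_fun_smooth X sf) hw).
Qed.

End stokes.

Lemma addAKK (V : zmodType) (a b : V) : a + b - a - b = 0.
Proof. by rewrite (addrAC a) subrr add0r subrr. Qed.

Lemma addr_split (V : zmodType) (a a' b b' c : V) : a = a' -> b = b' + c -> a + b = a' + b' + c.
Proof. by move=> -> ->; rewrite addrA. Qed.

Lemma addr_scale (R : pzRingType) (V : lmodType R) (f : R) (a b p q s : V) :
  a = p + f *: q -> b = f *: s -> a + b = p + f *: (q + s).
Proof. by move=> -> ->; rewrite scalerDr addrA. Qed.

(** [smooth_comp] composes with functions on row vectors, so the line is identified with the rows of
    length 1. *)
Lemma smooth_comp_open {R : realType} {W : normedModType R} (U : set R) (f : R -> W) (a : R -> R) :
  open U -> smooth_on setT a -> (forall t, U (a t)) -> smooth_on U f ->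
  smooth_on setT (fun t => f (a t)).
Proof.
move=> oU sa Ua sf; pose U' := [set v : 'rV[R]_1 | U (v 0 0)].
have sc : smooth_on setT (fun v : 'rV[R]_1 => v 0 0).
  exact: ((smooth_coord _ openT).1 (smooth_id (V := 'rV[R]_1)) 0).
have oU' : open U'.
  by apply: open_comp oU => v _; exact: (smooth_on_cont sc).
have sf' : smooth_on U' (fun v : 'rV[R]_1 => f (v 0 0)).
  apply: (@smooth_coind _ _ _ U' (fun h => exists2 g, smooth_on U g & h = fun v : 'rV[R]_1 => g (v 0 0)) oU'); last by exists f.
  move=> _ [g sg ->].
  have D (v u : 'rV[R]_1) : U' v -> is_derive v u (fun v : 'rV[R]_1 => g (v 0 0)) (u 0 0 *: 'D_1 g (v 0 0)).
    move=> hv; have D1 : is_derive v u (fun v : 'rV[R]_1 => v 0 0) (u 0 0).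
      apply/is_deriveP; apply: osm_le (osm0) => s.
      by rewrite rowDZE (addAKK (v 0 0) (s * u 0 0)) normr0.
    by refine (is_derive_eq (is_derive_comp1 D1 (smooth_on_is_derive (1 : R) sg hv)) _).
  split=> [v hv|u].
    split=> [|u]; last by have [] := D v u hv.
    exact: (continuous_comp (smooth_on_cont sc (x := v) I) (smooth_on_cont sg hv)).
  exists (fun v : 'rV[R]_1 => (u : 'rV[R]_1) 0 0 *: 'D_1 g (v 0 0)); last first.
    by move=> v; rewrite inE => hv; have [_ ->] := D v u hv.
  exists (fun s : R => (u : 'rV[R]_1) 0 0 *: 'D_1 g s) => //.
  exact: (@smooth_scalec R R W U ((u : 'rV[R]_1) 0 0) ('D_(1 : R) g) oU (smooth_onD (1 : R) sg)).
have sv : smooth_on setT (fun t => const_mx (a t) : 'rV[R]_1).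
  apply/(smooth_coord _ openT) => j; rewrite (_ : (fun t => _) = a)//.
  by apply/funext => t; rewrite mxE.
have := smooth_comp openT oU' _ sv sf'.
rewrite (_ : _ \o _ = fun t => f (a t)); last by apply/funext => t; rewrite /= mxE.
by apply=> t _; rewrite /U'/= mxE.
Qed.

(** * Smoothing kernels *)

Section parametrised_forms.
Context {R : realType} {n : nat} {M : manifold R n}.
Implicit Types (phi psi : chart R n M) (X Y : vfield M) (P Q : M -> preform M) (f : M -> R).

Lemma SC_eval (c : R -> preform M) y A : @SC R (FS M) c -> smooth_on setT (fun t => c t y A : R).
Proof.
move=> sc; apply/(@NS_SC R R).
apply: (@SC_lin R (FS M) (NS R) (fun w : preform M => w y A) c _ _ _ sc) => //.
move=> p ->; exists 1, (fun w => `|w y A : R|); split=> //; first exact: eval_seminorm.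
by move=> u _; rewrite mul1r.
Qed.

(** The slices of a smooth kernel at a fixed [e]; [lx], [ly] and [lxy] below are [Lx], [Ly] and
    [Lxy] on slices. *)
Definition xker P := forall c, smooth_curve c -> @SC R (FS M) (fun t => P (c t)).

Lemma xker_eval P y A : xker P -> smooth_fun (fun x => P x y A : R).
Proof. by move=> h; apply: curve_smooth_fun => c sc; exact: (SC_eval y A (h c sc)). Qed.

Lemma smooth_curve_cst (x : M) : smooth_curve (fun _ : R => x).
Proof.
split=> [|phi a1]; first by move=> t; exact: cvg_cst.
have [hx|hx] := pselect (cdom phi x).
  rewrite (_ : [set t | _] = setT); last by apply/seteqP; split.
  exact: smooth_cst openT.
rewrite (_ : [set t | _] = set0); last by apply/seteqP; split.
exact: smooth_cst open0.
Qed.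

Lemma smooth_curve_comp (c : R -> M) (a : R -> R) : smooth_curve c -> smooth_on setT a ->
  smooth_curve (c \o a).
Proof.
move=> [cc sc] sa; have ca : continuous a by move=> t; exact: (smooth_on_cont sa).
split=> [t|phi a1]; first exact: (continuous_comp (ca t) (cc (a t))).
have oU : open [set t | cdom phi (c t)] by exact: (continuous_open_preimage cc (@cdom_open _ _ _ phi)).
apply: smooth_on_local => t ht.
have /nbhs_ballP[r/= r0 hr] := open_near oU ht.
have cta : {for t, continuous a} := ca t.
have /cvgrPdist_lt/(_ (r / 2)) : a @ t --> a t by exact: cta.
move=> /(_ (divr_gt0 r0 (ltr0n _ 2)))/nbhs_ballP[d/= d0 hd].
exists (ball t d); first exact: ballxx.
(* Agrees with [a] near [t] and takes its values in the open set on which [c] is smooth in the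
   chart. *)
pose b s := a t + clamp r (a s - a t).
have sb : smooth_on setT b.
  apply: (smooth_add openT (smooth_cst _ openT)).
  exact: (smooth_comp1 (smooth_sub openT sa (smooth_cst _ openT)) (smooth_clamp r)).
have ob : open (ball t d : set R) by exact: ball_open.
apply: (@eq_smooth_on _ _ _ _ (fun s => (cmap phi \o c) (b s)) _ ob).
  move=> s; rewrite inE => hs; have := hd s hs; rewrite /= distrC => h.
  by rewrite /b clamp_id// 1?ltW// addrCA subrr addr0.
apply: (smooth_onS (@subsetT _ _)); apply: (smooth_comp_open oU sb _ (sc phi a1)) => s.
by apply: hr; rewrite /ball/= /b opprD addNKr normrN clamp_lt.
Qed.

Definition lx X P : M -> preform M := fun x y A => lie_fun X (fun x' => P x' y A) x.
Definition ly X P : M -> preform M := fun x => lie_form X (P x).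
Definition lxy X P : M -> preform M := fun x => lx X P x + ly X P x.

Lemma xker_Omega_c P x : xker P -> Omega_c (P x).
Proof. by move=> h; exact: (SC_S 0 (h _ (smooth_curve_cst x))). Qed.

(** [lx] is defined by pointwise derivatives. Along a curve with velocity [X] there is also a
    derivative in the space of forms, and evaluation identifies the two; so [lx X P x] is a
    compactly supported form. *)
Lemma lx_curve X P x : xker P -> exists c : R -> M, [/\ smooth_curve c, c 0 = x,
  forall f, smooth_fun f -> is_derive (0 : R) 1 (f \o c) (lie_fun X f x),
  Omega_c (lx X P x) & @der R (FS M) (fun t => P (c t)) 0 (lx X P x)].
Proof.
move=> hP; have [c [sc c0 hc]] := vfield_curve X x.
have [d [d0 dS dd]] := hP c sc.
have E : d 1%N 0 = lx X P x.
  apply: preform_ext => y A; apply: is_derive_unique (hc _ (xker_eval y A hP)).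
  by have := der_eval y A (dd 0%N 0); rewrite d0.
exists c; split; [exact: sc|exact: c0|exact: hc|rewrite -E; exact: dS|rewrite -E -d0; exact: dd].
Qed.

Lemma ly_xker X P : xker P -> xker (ly X P).
Proof. by move=> h c sc; exact: SC_lie (h c sc). Qed.

(** [L_Y] in the variable [y] is linear and continuous, so it commutes with the derivative in the
    parameter. *)
Lemma lx_ly X Y P x : xker P -> lx X (ly Y P) x = ly Y (lx X P) x.
Proof.
move=> hP; have [c [sc c0 hc Sl dl]] := lx_curve X x hP.
apply: preform_ext => y A.
have hly := ly_xker Y hP.
have D1 := hc _ (xker_eval y A hly).
have S s : Omega_c (P (c s)) by exact: xker_Omega_c.
have D2 := der_eval y A (der_lie Y S Sl dl).
exact: (is_derive_unique D1 D2).
Qed.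

Lemma lxD X P Q x : xker P -> xker Q -> lx X (fun x => P x + Q x) x = lx X P x + lx X Q x.
Proof.
move=> hP hQ; apply: preform_ext => y A; rewrite preform_addE.
exact: (lie_funD X x (xker_eval y A hP) (xker_eval y A hQ)).
Qed.

Lemma lxM X f P x : smooth_fun f -> xker P ->
  lx X (fun x => f x *: P x) x = lie_fun X f x *: P x + f x *: lx X P x.
Proof.
move=> sf hP; apply: preform_ext => y A; rewrite preform_combE preform_scaleE.
exact: (lie_funM X x sf (xker_eval y A hP)).
Qed.

Lemma lyD X P Q x : xker P -> xker Q -> ly X (fun x => P x + Q x) x = ly X P x + ly X Q x.
Proof.
move=> hP hQ; rewrite /ly -[P x]scale1r lie_form_lin ?scale1r//.
  exact/Omega_c_is_form/xker_Omega_c.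
exact/Omega_c_is_form/xker_Omega_c.
Qed.

Lemma lie_formZ X (k : R) (w : preform M) : is_form w -> lie_form X (k *: w) = k *: lie_form X w.
Proof.
move=> fw; have := lie_form_lin X k fw fw; have := lie_form_lin X (k + 1) fw fw.
have e1 : forall v : preform M, (k + 1) *: v + v = (k *: v + v) + v by move=> v; rewrite scalerDl scale1r.
move=> _ h; have := lie_form_lin X (k - 1) fw fw.
have e (v : preform M) : (k - 1) *: v + v = k *: v by rewrite scalerBl scale1r subrK.
by rewrite !e.
Qed.

Lemma lyM X f P x : xker P -> ly X (fun x => f x *: P x) x = f x *: ly X P x.
Proof. by move=> hP; apply: lie_formZ; exact/Omega_c_is_form/xker_Omega_c. Qed.

End parametrised_forms.

Section smooth_kernels.
Context {R : realType} {n : nat} {M : manifold R n}.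
Implicit Types (X Y : vfield M) (Phi Psi : @Defs.kernel R n M) (f : M -> R) (P Q : M -> preform M).

Lemma sk_xker Phi e : smooth_kernel Phi -> unitI e -> xker (Phi e).
Proof.
move=> h he c sc; apply/smooth_form_curveP.
exact: (h (fun=> e) c (smooth_cst e openT) (fun=> he) sc).
Qed.

Lemma sk_of_xker P : xker P -> smooth_kernel (fun _ : R => P).
Proof. by move=> h e c _ _ sc; apply/smooth_form_curveP; exact: h. Qed.

Lemma sk_Ly X Phi : smooth_kernel Phi -> smooth_kernel (Ly X Phi).
Proof.
move=> h e c se he sc; apply/smooth_form_curveP; apply: SC_lie.
by apply/smooth_form_curveP; exact: h.
Qed.

Lemma sk_add Phi Psi : smooth_kernel Phi -> smooth_kernel Psi ->
  smooth_kernel (fun e x => Phi e x + Psi e x).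
Proof.
move=> h1 h2 e c se he sc; apply/smooth_form_curveP; apply: (@SC_add R (FS M)).
  by apply/smooth_form_curveP; exact: h1.
by apply/smooth_form_curveP; exact: h2.
Qed.

Lemma sk_mul f Phi : smooth_fun f -> smooth_kernel Phi -> smooth_kernel (fun e x => f x *: Phi e x).
Proof.
move=> sf h e c se he sc; apply/smooth_form_curveP.
apply: (@SC_mul R (FS M) (f \o c)); first exact: (smooth_fun_curve sf sc).
by apply/smooth_form_curveP; exact: h.
Qed.

Lemma sk_scale (r : R -> R) Phi : smooth_on [set e : R | 0 < e] r -> smooth_kernel Phi ->
  smooth_kernel (fun e x => r e *: Phi e x).
Proof.
move=> sr h e c se he sc; apply/smooth_form_curveP.
apply: (@SC_mul R (FS M) (fun t => r (e t))); last by apply/smooth_form_curveP; exact: h.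
apply: (smooth_comp_open (@open_gt R 0) se _ sr) => t.
by have /andP[] := he t.
Qed.

Lemma sk_eq Phi Psi : (forall e, unitI e -> Phi e = Psi e) -> smooth_kernel Phi -> smooth_kernel Psi.
Proof.
move=> E h e c se he sc; have := h e c se he sc.
by congr smooth_form_curve; apply/funext => t; rewrite E.
Qed.

(** In a chart the points [z t + s X(z t)] form a two-parameter family with velocity [X] at [s = 0],
    to which [SC_two_parameters] applies. [G] has a time argument of its own, which covers kernels
    with moving [e] as well as the functions [F (w t)]. *)
Lemma SC_lie_param (E : cspace R) (G : R -> M -> E) X (c : R -> M) (t0 : R) : smooth_curve c ->
  (forall (a : R -> R) (b : R -> M), smooth_on setT a -> smooth_curve b ->
     @SC R E (fun t => G (a t) (b t))) ->
  exists2 g : R -> E, @SC R E g & \forall t \near t0, exists2 b : R -> M,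
    forall f, smooth_fun f -> is_derive (0 : R) 1 (f \o b) (lie_fun X f (c t)) &
    @der R E (fun s => G t (b s)) 0 (g t).
Proof.
move=> [cc sc] hG.
pose phi := chart_at (c t0); have a1 : atlas phi := atlas_at (c t0).
pose z0 := cmap phi (c t0); have hz0 : cimg phi z0 := cimg_at (c t0).
have oD : open [set t | cdom phi (c t)] by exact: (continuous_open_preimage cc (@cdom_open _ _ _ phi)).
have sz := sc phi a1; pose z := cmap phi \o c.
have sX := vfield_smooth X a1.
have /nbhs_ballP[r/= r0 hr] := open_near (open_cimg phi) hz0.
pose B := `|vfield_rep X phi z0| + 1; have B0 : 0 < B by rewrite ltr_wpDl.
have n1 : \forall t \near t0, `|z0 - z t| < r / 2.
  have /cvgrPdist_lt := smooth_on_cont sz (cdom_at (c t0)); apply; lra.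
have n2 : \forall y \near z0, `|vfield_rep X phi y| < B.
  have /cvgrPdist_lt/(_ 1 ltr01) := smooth_on_cont sX hz0.
  apply: filterS => y h; rewrite /B -ltrBlDl (le_lt_trans _ h)// distrC.
  by rewrite (le_trans (ler_norm _))// ler_dist_dist.
have n3 : \forall t \near t0, `|vfield_rep X phi (z t)| < B.
  have cz : {for t0, continuous z} := smooth_on_cont sz (cdom_at (c t0)).
  exact: (cz _ n2).
have n4 := open_near oD (cdom_at (c t0)).
have /nbhs_ballP[d/= d0 hd] : \forall t \near t0, [/\ cdom phi (c t), `|z0 - z t| < r / 2 & `|vfield_rep X phi (z t)| < B].
  by near=> t; split; near: t.
pose tau t := t0 + clamp d (t - t0).
have stau : smooth_on setT tau.
  apply: (smooth_add openT (smooth_cst _ openT)).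
  by apply: (smooth_comp1 _ (smooth_clamp d)); exact: (smooth_sub openT (smooth_id (V := R)) (smooth_cst _ openT)).
have htau t : [/\ cdom phi (c (tau t)), `|z0 - z (tau t)| < r / 2 & `|vfield_rep X phi (z (tau t))| < B].
  by apply: hd; rewrite /ball/= /tau opprD addNKr normrN clamp_lt.
have sz' : smooth_on setT (fun t => z (tau t)).
  by apply: (smooth_comp_open oD stau _ sz) => t; case: (htau t).
have hz' t : cimg phi (z (tau t)) by apply: cimg_cmap; case: (htau t).
have sv' : smooth_on setT (fun t => vfield_rep X phi (z (tau t))).
  exact: (smooth_comp openT (open_cimg phi) (fun t _ => hz' t) sz' sX).
(* Half of the radius [r] is left for the moving base point, the other half for the displacement
   along [X], whose representation is below [B] in norm. *)
pose d' := r / (2 * B); have d'0 : 0 < d' by rewrite divr_gt0// mulr_gt0.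
pose pt t s := z (tau t) + clamp d' s *: vfield_rep X phi (z (tau t)).
have hpt t s : cimg phi (pt t s).
  apply: hr; rewrite -ball_normE/= /pt opprD addrA.
  have [_ h1 h2] := htau t; apply: le_lt_trans (ler_normB _ _) _.
  have h3 := clamp_lt s d'0; rewrite normrZ.
  have : `|clamp d' s| * `|vfield_rep X phi (z (tau t))| <= d' * B.
    by apply: ler_pM => //; exact: ltW.
  have -> : d' * B = r / 2 by rewrite /d'; field; rewrite gt_eqF.
  lra.
pose H t s := G (tau t) (cinv phi (pt t s)).
have [a b sa sb|g sg dg] := @SC_two_parameters R E H.
  apply: (hG (fun t => tau (a t)) (fun t => cinv phi (pt (a t) (b t)))); first exact: (smooth_comp1 sa stau).
  apply: (chart_curve a1); last by move=> t; exact: hpt.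
  apply: (smooth_add openT (smooth_comp1 sa sz')).
  exact: (smooth_scale openT (smooth_comp1 sb (smooth_clamp d')) (smooth_comp1 sa sv')).
exists g => //.
have d2 : 0 < d / 2 by lra.
apply/nbhs_ballP; exists (d / 2) => // t; rewrite /ball/= distrC => ht.
have tt : tau t = t by rewrite /tau clamp_id// ?ltW// addrCA subrr addr0.
have ht' : cdom phi (c t) by have [] := htau t; rewrite tt.
exists (fun s => cinv phi (pt t s)); last by have := dg t; rewrite /H tt.
move=> f sf; rewrite (lie_fun_chart X sf a1 ht').
have /is_derive_line h := smooth_on_is_derive (vfield_rep X phi (cmap phi (c t))) (sf phi a1) (cimg_cmap ht').
have d'2 : 0 < d' / 2 by lra.
refine (near_eq_is_derive _ h).
apply: (filterS _ (near0_lt d'2)) => s sd; rewrite /= /pt tt clamp_id// ltW//.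
Unshelve. all: by end_near. Qed.

Lemma sk_Lx X Phi : smooth_kernel Phi -> smooth_kernel (Lx X Phi).
Proof.
move=> hPhi e c se he sc; apply/smooth_form_curveP; apply: SC_local => t0.
have [a b sa sb|g sg hg] := @SC_lie_param (FS M) (fun t => Phi (e t)) X c t0 sc.
  by apply/smooth_form_curveP; apply: (hPhi _ _ (smooth_comp1 sa se)).
exists g => //; apply: filterS hg => t [b hb db]; apply: preform_ext => y A.
have sf := xker_eval y A (sk_xker hPhi (he t)).
exact: (is_derive_unique (hb _ sf) (der_eval y A db)).
Qed.

Lemma sk_Lxy X Phi : smooth_kernel Phi -> smooth_kernel (Lxy X Phi).
Proof. by move=> h; exact: (sk_add (sk_Lx X h) (sk_Ly X h)). Qed.

Lemma lx_xker X P : xker P -> xker (lx X P).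
Proof.
move=> h; have h1 : unitI (1 : R) by rewrite /unitI/= ltr01 lexx.
exact: (sk_xker (sk_Lx X (sk_of_xker h)) h1).
Qed.

Lemma lxyD X P Q x : xker P -> xker Q -> lxy X (fun x => P x + Q x) x = lxy X P x + lxy X Q x.
Proof. by move=> hP hQ; rewrite /lxy lxD// lyD// addrACA. Qed.

Lemma lxyM X f P x : smooth_fun f -> xker P ->
  lxy X (fun x => f x *: P x) x = lie_fun X f x *: P x + f x *: lxy X P x.
Proof. move=> sf hP; exact: (addr_scale (lxM X x sf hP) (lyM X f x hP)). Qed.

Lemma ly_lxy X Y P x : xker P -> ly Y (lxy X P) x = lxy X (ly Y P) x + ly (bracket Y X) P x.
Proof.
move=> hP; refine (etrans (lyD Y x (lx_xker X hP) (ly_xker X hP)) _).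
apply: addr_split; first by rewrite (lx_ly X Y x hP).
have fw : is_form (P x) by exact/Omega_c_is_form/xker_Omega_c.
by rewrite /ly -(lie_form_bracket Y X fw) addrC subrK.
Qed.

End smooth_kernels.

(** * Uniform O-estimates for kernels *)

Section estimates.
Context {R : realType}.

Lemma bigOD (T : Type) (D : set T) (f1 f2 : R -> T -> R) (g : R -> R) : (forall e, unitI e -> 0 <= g e) ->
  bigO_unif D f1 g -> bigO_unif D f2 g -> bigO_unif D (fun e t => f1 e t + f2 e t) g.
Proof.
move=> g0 [e1 [C1 [h1 c1 b1]]] [e2 [C2 [h2 c2 b2]]].
exists (Num.min e1 e2), (C1 + C2); split; [by rewrite lt_min h1|by rewrite addr_gt0|].
move=> e t he; rewrite le_min => /andP[le1 le2] ht.
apply: le_trans (ler_normD _ _) _; rewrite mulrDl; apply: lerD; [exact: b1|exact: b2].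
Qed.

Lemma bigO_le (T : Type) (D D' : set T) (f1 f2 : R -> T -> R) (g : R -> R) (B : R) : D' `<=` D -> 0 < B ->
  (forall e, unitI e -> 0 <= g e) ->
  (forall e t, unitI e -> D' t -> `|f2 e t| <= B * `|f1 e t|) ->
  bigO_unif D f1 g -> bigO_unif D' f2 g.
Proof.
move=> DD B0 g0 h [e1 [C1 [h1 c1 b1]]]; exists e1, (B * C1); split=> //; first exact: mulr_gt0.
move=> e t he le1 ht; apply: le_trans (h e t he ht) _; rewrite -mulrA ler_wpM2l//; first exact: ltW.
by apply: b1 => //; exact: DD.
Qed.

Lemma bigO_eq (T : Type) (D : set T) (f1 f2 : R -> T -> R) (g : R -> R) :
  (forall e t, unitI e -> D t -> f1 e t = f2 e t) -> bigO_unif D f1 g -> bigO_unif D f2 g.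
Proof.
move=> h [e1 [C1 [h1 c1 b1]]]; exists e1, C1; split=> // e t he le1 ht.
by rewrite -h//; exact: b1.
Qed.

End estimates.

(* The operator [op] stands for [Lx] or [Lxy] and [N] for the quantities bounded in (SK3) and (SK2). *)
Section stable_estimates.
Context {R : realType} {n : nat} {M : manifold R n}.
Local Notation kernel := (@Defs.kernel R n M).
Variables (op : vfield M -> kernel -> kernel) (xop : vfield M -> (M -> preform M) -> M -> preform M).
Hypothesis opE : forall X Phi e, op X Phi e = xop X (Phi e).
Hypothesis sk_op : forall X Phi, smooth_kernel Phi -> smooth_kernel (op X Phi).
Hypothesis opD : forall X P Q x, xker P -> xker Q ->
  xop X (fun x => P x + Q x) x = xop X P x + xop X Q x.
Hypothesis opM : forall X (f : M -> R) P x, smooth_fun f -> xker P ->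
  xop X (fun x => f x *: P x) x = lie_fun X f x *: P x + f x *: xop X P x.
Variables (T idx : Type) (base : T -> M) (N : idx -> T -> preform M -> R) (g : R -> R).
Hypothesis g0 : forall e, unitI e -> 0 <= g e.
Hypothesis N_le : forall i t u v, Omega_c u -> Omega_c v -> `|N i t (u + v)| <= `|N i t u| + `|N i t v|.
Hypothesis NZ : forall i t (k : R) u, Omega_c u -> `|N i t (k *: u)| = `|k| * `|N i t u|.
Implicit Types (X Y : vfield M) (Phi Psi : kernel) (f : M -> R).

Definition estimate Phi := forall K, compact K -> forall (Xs : seq (vfield M)) i,
  bigO_unif [set t | K (base t)] (fun e t => N i t (iterL op Xs Phi e (base t))) g.

Lemma iterL_rcons Xs X Phi : iterL op (rcons Xs X) Phi = iterL op Xs (op X Phi).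
Proof. by rewrite /iterL foldr_rcons. Qed.

Lemma sk_iterL Xs Phi : smooth_kernel Phi -> smooth_kernel (iterL op Xs Phi).
Proof. by move=> h; elim: Xs => //= X Xs; exact: sk_op. Qed.

Lemma eq_iterL Xs Phi Psi e : Phi e = Psi e -> iterL op Xs Phi e = iterL op Xs Psi e.
Proof. by move=> h; elim: Xs => //= X Xs IH; rewrite !opE IH. Qed.

Lemma estimate_eq Phi Psi : (forall e, unitI e -> Phi e = Psi e) -> estimate Phi -> estimate Psi.
Proof.
move=> h hP K cK Xs i; apply: bigO_eq (hP K cK Xs i) => e t he _.
by rewrite (eq_iterL Xs (h e he)).
Qed.

Lemma estimate_op X Phi : estimate Phi -> estimate (op X Phi).
Proof. by move=> h K cK Xs i; rewrite -iterL_rcons; exact: h. Qed.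

Lemma iterL_add Xs Phi Psi e : smooth_kernel Phi -> smooth_kernel Psi -> unitI e ->
  iterL op Xs (fun e x => Phi e x + Psi e x) e = fun x => iterL op Xs Phi e x + iterL op Xs Psi e x.
Proof.
move=> h1 h2 he; elim: Xs => [//|X Xs IH].
have st (Th : kernel) : iterL op (X :: Xs) Th e = xop X (iterL op Xs Th e) by rewrite /= opE.
rewrite !st IH; apply/funext => x; rewrite opD.
- by [].
- exact: (sk_xker (sk_iterL Xs h1)).
- exact: (sk_xker (sk_iterL Xs h2)).
Qed.

Lemma estimate_add Phi Psi : smooth_kernel Phi -> smooth_kernel Psi ->
  estimate Phi -> estimate Psi -> estimate (fun e x => Phi e x + Psi e x).
Proof.
move=> s1 s2 h1 h2 K cK Xs i.
have Ogl (Theta : kernel) : smooth_kernel Theta -> estimate Theta ->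
    bigO_unif [set t | K (base t)] (fun e t => `|N i t (iterL op Xs Theta e (base t))|) g.
  move=> _ /(_ K cK Xs i); apply: (bigO_le (B := 1)) => // e t _ _; by rewrite normr_id mul1r.
apply: (bigO_le (B := 1) _ _ g0 _ (bigOD g0 (Ogl _ s1 h1) (Ogl _ s2 h2))) => // e t he _.
rewrite iterL_add// mul1r (ger0_norm (addr_ge0 _ _))//; apply: N_le.
  exact: (xker_Omega_c _ (sk_xker (sk_iterL Xs s1) he)).
exact: (xker_Omega_c _ (sk_xker (sk_iterL Xs s2) he)).
Qed.

(** Induction from the innermost field: [op X (f Phi)] is [(X f) Phi + f op X Phi], and the
    induction hypothesis is general in [f] and [Phi]. *)
Lemma estimate_mul f Phi : smooth_fun f -> smooth_kernel Phi -> estimate Phi ->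
  estimate (fun e x => f x *: Phi e x).
Proof.
move=> sf sP hP K cK Xs; elim/last_ind: Xs f Phi sf sP hP => [|Xs X IH] f Phi sf sP hP i.
  have [B [B0 hB]] := smooth_fun_bounded cK sf.
  apply: (bigO_le _ B0 g0 _ (hP K cK [::] i)) => // e t he Kt /=.
  rewrite NZ; last exact: (xker_Omega_c _ (sk_xker sP he)).
  by rewrite ler_wpM2r//; exact: hB.
pose A1 := (fun e x => lie_fun X f x *: Phi e x) : kernel.
pose A2 := (fun e x => f x *: op X Phi e x) : kernel.
have sA1 : smooth_kernel A1 by exact: (sk_mul (lie_fun_smooth X sf) sP).
have sA2 : smooth_kernel A2 by exact: (sk_mul sf (sk_op X sP)).
have h1 := IH _ _ (lie_fun_smooth X sf) sP hP i.
have h2 := IH _ _ sf (sk_op X sP) (@estimate_op X _ hP) i.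
have Ogl (F : R -> T -> R) : bigO_unif [set t | K (base t)] F g ->
    bigO_unif [set t | K (base t)] (fun e t => `|F e t|) g.
  by apply: (bigO_le (B := 1)) => // e t _ _; rewrite normr_id mul1r.
apply: (bigO_le (B := 1) _ _ g0 _ (bigOD g0 (Ogl _ h1) (Ogl _ h2))) => // e t he _.
rewrite iterL_rcons mul1r (ger0_norm (addr_ge0 _ _))//.
have E : op X (fun e x => f x *: Phi e x) e = (fun e x => A1 e x + A2 e x) e.
  by apply/funext => x; rewrite opE (opM X x sf (sk_xker sP he)) /A2 opE.
rewrite (@eq_iterL Xs (op X (fun e x => f x *: Phi e x)) (fun e x => A1 e x + A2 e x) e E) iterL_add//; apply: N_le.
  exact: (xker_Omega_c _ (sk_xker (sk_iterL Xs sA1) he)).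
exact: (xker_Omega_c _ (sk_xker (sk_iterL Xs sA2) he)).
Qed.

Lemma iterL_scale Xs (r : R -> R) Phi e : smooth_kernel Phi -> unitI e ->
  iterL op Xs (fun e x => r e *: Phi e x) e = fun x => r e *: iterL op Xs Phi e x.
Proof.
move=> h he; elim: Xs => [//|X Xs IH].
have st (Th : kernel) : iterL op (X :: Xs) Th e = xop X (iterL op Xs Th e) by rewrite /= opE.
rewrite !st IH; apply/funext => x; rewrite (opM X x (smooth_fun_cst (r e)) (sk_xker (sk_iterL Xs h) he)).
by rewrite lie_fun_cst scale0r add0r.
Qed.

Lemma estimate_scale (r : R -> R) B Phi : 0 < B -> (forall e, unitI e -> `|r e| <= B) ->
  smooth_kernel Phi -> estimate Phi -> estimate (fun e x => r e *: Phi e x).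
Proof.
move=> B0 hB sP hP K cK Xs i; apply: (bigO_le _ B0 g0 _ (hP K cK Xs i)) => // e t he _.
rewrite iterL_scale// NZ; last exact: (xker_Omega_c _ (sk_xker (sk_iterL Xs sP) he)).
by rewrite ler_wpM2r//; exact: hB.
Qed.

End stable_estimates.

Section norms_of_forms.
Context {R : realType} {n : nat} {M : manifold R n}.
Implicit Types (h : riemannian_metric M) (p y : M) (a b : 'M[R]_n -> R).

(** All [A] with [A h A^T = 1] have the same [|det A|], so the supremum is taken over one value.
    With no such [A] it would be the default 0 of the empty set; in both cases it is a seminorm on
    alternating forms. *)
Lemma form_norm_cases h p : (exists A0, forall a, alternating_form a -> form_norm h p a = `|a A0|) \/
  (forall a, form_norm h p a = 0).
Proof.
have [[A0 hA0]|nA] := pselect (exists A : 'M[R]_n, A *m h p *m A^T = 1%:M); last first.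
  right=> a; rewrite /form_norm (_ : [set _ | _ in _] = set0) ?sup0//.
  by apply/seteqP; split=> // r [A hA _]; exfalso; apply: nA; exists A.
left; exists A0 => a ha; rewrite /form_norm (_ : [set _ | _ in _] = [set `|a A0|]) ?sup1//.
apply/seteqP; split=> [_ [A hA <-]|_ ->]; last by exists A0.
rewrite /= (alternating_det A ha) (alternating_det A0 ha) !normrM; congr (_ * _).
have key (B : 'M[R]_n) : B *m h p *m B^T = 1%:M -> `|\det B| ^+ 2 * \det (h p) = 1.
  move=> e; rewrite -normrX ger0_norm ?sqr_ge0// expr2.
  by have := congr1 determinant e; rewrite !det_mulmx det_tr det1 mulrAC.
have e1 := key A hA; have e2 := key A0 hA0.
have d0 : \det (h p) != 0 by apply/eqP => e; move: e1; rewrite e mulr0 => /eqP; rewrite eq_sym oner_eq0.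
apply/eqP; rewrite -(@eqrXn2 R 2)//; apply/eqP/(mulIf d0).
by rewrite e1 e2.
Qed.

Lemma form_normD h p a b : alternating_form a -> alternating_form b ->
  `|form_norm h p (fun A => a A + b A)| <= `|form_norm h p a| + `|form_norm h p b|.
Proof.
move=> ha hb; have [[A0 e]|e] := form_norm_cases h p; last by rewrite !e normr0 addr0.
have hab : alternating_form (fun A => a A + b A).
  have := alternating_comb 1 ha hb.
  by rewrite (_ : (fun A => _) = fun A => a A + b A)//; apply/funext => A; rewrite mul1r.
by rewrite !e// !normr_id ler_normD.
Qed.

Lemma form_normZ h p (k : R) a : alternating_form a ->
  `|form_norm h p (fun A => k * a A)| = `|k| * `|form_norm h p a|.
Proof.
move=> ha; have [[A0 e]|e] := form_norm_cases h p; last by rewrite !e normr0 mulr0.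
have h0 : alternating_form (fun _ : 'M[R]_n => 0 : R).
  by split=> // *; rewrite !mulr0 addr0.
have hka : alternating_form (fun A => k * a A).
  have := alternating_comb k ha h0.
  by rewrite (_ : (fun A => _) = fun A => k * a A)//; apply/funext => A; rewrite addr0.
by rewrite !e// !normr_id normrM.
Qed.

Lemma Omega_c_alt (w : preform M) y : Omega_c w -> alternating_form (w y : 'M[R]_n -> R).
Proof. by move=> hw; exact: (is_form_alt (Omega_c_is_form hw) y). Qed.

End norms_of_forms.

(** * Condition (SK2) *)

Section derivative_estimates.
Context {R : realType} {n : nat} {M : manifold R n}.
Local Notation kernel := (@Defs.kernel R n M).
Variable h : riemannian_metric M.
Implicit Types (X Y : vfield M) (Phi Psi : kernel) (f : M -> R) (k : nat).

Definition norm_at (_ : unit) (t : M * M) (w : preform M) : R := form_norm h t.2 (w t.2).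

Lemma norm_at_le i t u v : Omega_c u -> Omega_c v ->
  `|norm_at i t (u + v)| <= `|norm_at i t u| + `|norm_at i t v|.
Proof. by move=> hu hv; exact: (form_normD h t.2 (Omega_c_alt t.2 hu) (Omega_c_alt t.2 hv)). Qed.

Lemma norm_atZ i t (k : R) u : Omega_c u -> `|norm_at i t (k *: u)| = `|k| * `|norm_at i t u|.
Proof. by move=> hu; exact: (form_normZ h t.2 k (Omega_c_alt t.2 hu)). Qed.

Definition power_gauge k (e : R) : R := e ^- k.

Lemma power_gauge_ge0 k e : unitI e -> 0 <= power_gauge k e.
Proof. by case/andP=> e0 _; rewrite invr_ge0 exprn_ge0// ltW. Qed.

Definition LxyE X Phi e : Lxy X Phi e = lxy X (Phi e) := erefl.

Definition lxy_bound k Phi := smooth_kernel Phi /\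
  estimate (@Lxy R n M) (@fst M M) norm_at (power_gauge k) Phi.

Lemma lxy_bound_eq k Phi Psi : (forall e, unitI e -> Phi e = Psi e) -> lxy_bound k Phi -> lxy_bound k Psi.
Proof. by move=> E [s1 b1]; split; [exact: sk_eq E s1|exact: (estimate_eq LxyE E b1)]. Qed.

Lemma lxy_bound_add k Phi Psi : lxy_bound k Phi -> lxy_bound k Psi ->
  lxy_bound k (fun e x => Phi e x + Psi e x).
Proof.
move=> [s1 b1] [s2 b2]; split; first exact: sk_add.
exact: (estimate_add LxyE (@sk_Lxy R n M) (@lxyD R n M) (@power_gauge_ge0 k) norm_at_le s1 s2 b1 b2).
Qed.

Lemma lxy_bound_mul k f Phi : smooth_fun f -> lxy_bound k Phi -> lxy_bound k (fun e x => f x *: Phi e x).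
Proof.
move=> sf [s1 b1]; split; first exact: sk_mul.
exact: (estimate_mul LxyE (@sk_Lxy R n M) (@lxyD R n M) (@lxyM R n M) (@power_gauge_ge0 k) norm_at_le norm_atZ sf s1 b1).
Qed.

Lemma lxy_bound_scale k (r : R -> R) B Phi : 0 < B -> (forall e, unitI e -> `|r e| <= B) ->
  smooth_on [set e : R | 0 < e] r -> lxy_bound k Phi -> lxy_bound k (fun e x => r e *: Phi e x).
Proof.
move=> B0 hB sr [s1 b1]; split; first exact: sk_scale.
exact: (estimate_scale LxyE (@sk_Lxy R n M) (@lxyM R n M) (@power_gauge_ge0 k) norm_atZ B0 hB s1 b1).
Qed.

Lemma lxy_bound_Lxy k X Phi : lxy_bound k Phi -> lxy_bound k (Lxy X Phi).
Proof. by move=> [s1 b1]; split; [exact: sk_Lxy|apply: estimate_op]. Qed.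

(* Condition (SK2) with [e ^- (k + size Ys)] as bound. *)
Definition ly_bounds k Phi := smooth_kernel Phi /\
  forall Ys, lxy_bound (k + size Ys) (iterL (@Ly R n M) Ys Phi).

Lemma sk_iterLy Ys Phi : smooth_kernel Phi -> smooth_kernel (iterL (@Ly R n M) Ys Phi).
Proof. by move=> s; elim: Ys => //= Y Ys; exact: sk_Ly. Qed.

Lemma iterLy_rcons Ys Y Phi : iterL (@Ly R n M) (rcons Ys Y) Phi = iterL (@Ly R n M) Ys (Ly Y Phi).
Proof. by rewrite /iterL foldr_rcons. Qed.

Lemma eq_iterLy Ys Phi Psi e : Phi e = Psi e ->
  iterL (@Ly R n M) Ys Phi e = iterL (@Ly R n M) Ys Psi e.
Proof. by move=> E; elim: Ys => //= Y Ys IH; rewrite /Ly IH. Qed.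

Lemma iterLy_add Ys Phi Psi e : smooth_kernel Phi -> smooth_kernel Psi -> unitI e ->
  iterL (@Ly R n M) Ys (fun e x => Phi e x + Psi e x) e =
  fun x => iterL (@Ly R n M) Ys Phi e x + iterL (@Ly R n M) Ys Psi e x.
Proof.
move=> s1 s2 he; elim: Ys => [//|Y Ys IH].
have st (Th : kernel) : iterL (@Ly R n M) (Y :: Ys) Th e = ly Y (iterL (@Ly R n M) Ys Th e) by [].
rewrite !st IH; apply/funext => x; apply: lyD; exact: (sk_xker (sk_iterLy Ys _) he).
Qed.

Lemma iterLy_mul Ys (f : R -> M -> R) Phi e : smooth_kernel Phi -> unitI e ->
  iterL (@Ly R n M) Ys (fun e x => f e x *: Phi e x) e =
  fun x => f e x *: iterL (@Ly R n M) Ys Phi e x.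
Proof.
move=> s1 he; elim: Ys => [//|Y Ys IH].
have st (Th : kernel) : iterL (@Ly R n M) (Y :: Ys) Th e = ly Y (iterL (@Ly R n M) Ys Th e) by [].
rewrite !st IH; apply/funext => x; apply: (lyM Y (f e) x); exact: (sk_xker (sk_iterLy Ys s1) he).
Qed.

Lemma ly_bounds_add k Phi Psi : ly_bounds k Phi -> ly_bounds k Psi ->
  ly_bounds k (fun e x => Phi e x + Psi e x).
Proof.
move=> [s1 b1] [s2 b2]; split=> [|Ys]; first exact: sk_add.
apply: lxy_bound_eq (lxy_bound_add (b1 Ys) (b2 Ys)) => e he.
by rewrite iterLy_add.
Qed.

Lemma ly_bounds_mul k f Phi : smooth_fun f -> ly_bounds k Phi -> ly_bounds k (fun e x => f x *: Phi e x).
Proof.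
move=> sf [s1 b1]; split=> [|Ys]; first exact: sk_mul.
apply: lxy_bound_eq (lxy_bound_mul sf (b1 Ys)) => e he.
by rewrite (iterLy_mul Ys (fun _ => f) s1 he).
Qed.

Lemma ly_bounds_scale k (r : R -> R) B Phi : 0 < B -> (forall e, unitI e -> `|r e| <= B) ->
  smooth_on [set e : R | 0 < e] r -> ly_bounds k Phi -> ly_bounds k (fun e x => r e *: Phi e x).
Proof.
move=> B0 hB sr [s1 b1]; split=> [|Ys]; first exact: sk_scale.
apply: lxy_bound_eq (lxy_bound_scale B0 hB sr (b1 Ys)) => e he.
by rewrite (iterLy_mul Ys (fun e _ => r e) s1 he).
Qed.

Lemma ly_bounds_Ly k Y Phi : ly_bounds k Phi -> ly_bounds k.+1 (Ly Y Phi).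
Proof.
move=> [s1 b1]; split=> [|Ys]; first exact: sk_Ly.
by rewrite -iterLy_rcons; have := b1 (rcons Ys Y); rewrite size_rcons addnS addSn.
Qed.

(* [L^y_Y L^{x+y}_X = L^{x+y}_X L^y_Y + L^y_[Y,X]] *)
Lemma ly_bounds_Lxy k X Phi : ly_bounds k Phi -> ly_bounds k (Lxy X Phi).
Proof.
move=> hP; split; first exact: sk_Lxy hP.1.
(* [k] is general, because moving [Lxy X] past the innermost [Ly Y] leaves [Ly Y Phi], whose bounds
   are of order [k.+1]. *)
move=> Ys; elim/last_ind: Ys k Phi hP => [|Ys Y IH] k Phi hP.
  exact: lxy_bound_Lxy (hP.2 [::]).
have [s1 b1] := hP.
have h1 := IH k.+1 (Ly Y Phi) (ly_bounds_Ly Y hP).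
have h2 := b1 (rcons Ys (bracket Y X)).
rewrite size_rcons addnS; rewrite addSn in h1; rewrite size_rcons addnS iterLy_rcons in h2.
apply: lxy_bound_eq (lxy_bound_add h1 h2) => e he.
rewrite iterLy_rcons -(iterLy_add Ys (sk_Lxy X (sk_Ly Y s1)) (sk_Ly _ s1) he).
apply: (@eq_iterLy Ys (fun e x => Lxy X (Ly Y Phi) e x + Ly (bracket Y X) Phi e x)).
by apply/funext => x; exact: (esym (ly_lxy X Y x (sk_xker s1 he))).
Qed.

Lemma SK2_ly_bounds Phi : smooth_kernel Phi -> SK2 h Phi <-> ly_bounds n Phi.
Proof.
have DE K : [set t : M * M | K t.1] = K `*` [set: M].
  by apply/seteqP; split=> [t /= ?|t []].
move=> sP; split=> [H|[_ H]].
  split=> // Ys; split; first exact: sk_iterLy.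
  by move=> K cK Xs i; have := H K cK Xs Ys; rewrite -DE.
by move=> K cK Xs Ys; have [_ /(_ K cK Xs tt)] := H Ys; rewrite DE.
Qed.

End derivative_estimates.

(** * Condition (SK3) *)

Section moment_estimates.
Context {R : realType} {n : nat} {M : manifold R n} (o : orientation M).
Local Notation kernel := (@Defs.kernel R n M).
Variable q : nat.
Implicit Types (X Y : vfield M) (Phi Psi : kernel) (f : M -> R).

(** Test functions are bundled with their smoothness, because the index of [N] in the general
    estimates ranges over a type. *)
Definition moment (f : {f : M -> R | smooth_fun f}) (_ : M) (w : preform M) : R :=
  integral_form o (fmul (sval f) w).

Lemma fmul_comb (f : M -> R) (k : R) (u v : preform M) : fmul f (k *: u + v) = k *: fmul f u + fmul f v.
Proof.
by apply: preform_ext => p A; rewrite preform_combE /fmul preform_combE mulrDr mulrCA.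
Qed.

Lemma momentE (f : M -> R) (k : R) (u v : preform M) : smooth_fun f -> Omega_c u -> Omega_c v ->
  integral_form o (fmul f (k *: u + v)) = k * integral_form o (fmul f u) + integral_form o (fmul f v).
Proof.
by move=> sf hu hv; rewrite fmul_comb integral_form_lin//; exact: fmul_Omega_c.
Qed.

Lemma moment_le i t u v : Omega_c u -> Omega_c v ->
  `|moment i t (u + v)| <= `|moment i t u| + `|moment i t v|.
Proof.
move=> hu hv; have sf := svalP i; rewrite /moment -[u]scale1r (momentE 1 sf hu hv) mul1r scale1r.
exact: ler_normD.
Qed.

Lemma integral_form0 : integral_form o (0 : preform M) = 0.
Proof.
have := integral_form_lin o (-1) (@Omega_c0 R n M) (@Omega_c0 R n M).
by rewrite scaler0 addr0 mulN1r addNr.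
Qed.

Lemma fmul0 (f : M -> R) : fmul f (0 : preform M) = 0.
Proof. by apply: preform_ext => p A; rewrite /fmul mulr0. Qed.

Lemma momentZ i t (k : R) u : Omega_c u -> `|moment i t (k *: u)| = `|k| * `|moment i t u|.
Proof.
move=> hu; have sf := svalP i; rewrite /moment -[k *: u]addr0 (momentE k sf hu (@Omega_c0 _ _ _)).
by rewrite fmul0 integral_form0 addr0 normrM.
Qed.

Definition moment_gauge (e : R) : R := e ^+ q.+1.

Lemma moment_gauge_ge0 e : unitI e -> 0 <= moment_gauge e.
Proof. by case/andP=> e0 _; rewrite exprn_ge0// ltW. Qed.

Definition LxE X Phi e : Lx X Phi e = lx X (Phi e) := erefl.

Definition zero_moments Phi := smooth_kernel Phi /\
  estimate (@Lx R n M) (@id M) moment moment_gauge Phi.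

Lemma zero_moments_add Phi Psi : zero_moments Phi -> zero_moments Psi ->
  zero_moments (fun e x => Phi e x + Psi e x).
Proof.
move=> [s1 b1] [s2 b2]; split; first exact: sk_add.
exact: (estimate_add LxE (@sk_Lx R n M) (@lxD R n M) moment_gauge_ge0 moment_le s1 s2 b1 b2).
Qed.

Lemma zero_moments_mul f Phi : smooth_fun f -> zero_moments Phi -> zero_moments (fun e x => f x *: Phi e x).
Proof.
move=> sf [s1 b1]; split; first exact: sk_mul.
exact: (estimate_mul LxE (@sk_Lx R n M) (@lxD R n M) (@lxM R n M) moment_gauge_ge0 moment_le momentZ sf s1 b1).
Qed.

Lemma zero_moments_scale (r : R -> R) B Phi : 0 < B -> (forall e, unitI e -> `|r e| <= B) ->
  smooth_on [set e : R | 0 < e] r -> zero_moments Phi -> zero_moments (fun e x => r e *: Phi e x).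
Proof.
move=> B0 hB sr [s1 b1]; split; first exact: sk_scale.
exact: (estimate_scale LxE (@sk_Lx R n M) (@lxM R n M) moment_gauge_ge0 momentZ B0 hB s1 b1).
Qed.

Lemma iterLx_Ly Xs X Phi e : smooth_kernel Phi -> unitI e ->
  iterL (@Lx R n M) Xs (Ly X Phi) e = Ly X (iterL (@Lx R n M) Xs Phi) e.
Proof.
move=> s1 he; elim: Xs => [//|Y Xs IH].
have st (Th : kernel) : iterL (@Lx R n M) (Y :: Xs) Th e = lx Y (iterL (@Lx R n M) Xs Th e) by [].
rewrite st IH; apply/funext => x.
exact: (lx_ly Y X x (sk_xker (sk_iterL (@sk_Lx R n M) Xs s1) he)).
Qed.

(** By (SK3) with one more field, the moments of [Lx X Phi] approximate derivatives of [X f]; those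
    of [Ly X Phi] are, after integration by parts, moments of [Phi] against [- X f]. The main terms
    cancel. *)
Lemma zero_moments_Lxy X Phi : smooth_kernel Phi -> SK3 o q Phi -> zero_moments (Lxy X Phi).
Proof.
move=> s1 H; split; first exact: sk_Lxy.
move=> K cK Xs [f sf]; rewrite /moment/=.
have h1 := H K cK (rcons Xs X) f sf; have h2 := H K cK Xs _ (lie_fun_smooth X sf).
have h2' : bigO_unif K (fun e x => - (integral_form o (fun y A => lie_fun X f y * iterL (@Lx R n M) Xs Phi e x y A)
    - iter_lie_fun Xs (lie_fun X f) x)) (fun e => e ^+ q.+1).
  by apply: (bigO_le (B := 1) _ _ moment_gauge_ge0 _ h2) => // e x _ _; rewrite normrN mul1r.
apply: bigO_eq (bigOD moment_gauge_ge0 h1 h2') => e x he _.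
have sI := sk_iterL (@sk_Lx R n M) Xs s1.
have sI' := sk_iterL (@sk_Lx R n M) Xs (sk_Lx X s1).
have -> : iterL (@Lx R n M) Xs (Lxy X Phi) e x =
    1 *: iterL (@Lx R n M) Xs (Lx X Phi) e x + lie_form X (iterL (@Lx R n M) Xs Phi e x).
  have := iterL_add LxE (@sk_Lx R n M) (@lxD R n M) Xs (sk_Lx X s1) (sk_Ly X s1) he.
  move=> /(congr1 (fun F => F x)); rewrite (iterLx_Ly _ _ s1 he) => ->.
  by rewrite scale1r.
have c1 : Omega_c (iterL (@Lx R n M) Xs Phi e x) by exact: (xker_Omega_c x (sk_xker sI he)).
rewrite (momentE 1 sf (xker_Omega_c x (sk_xker sI' he)) (lie_Omega_c X c1)) mul1r.
rewrite (integral_form_parts o X sf c1) iterL_rcons.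
have -> : iter_lie_fun (rcons Xs X) f = iter_lie_fun Xs (lie_fun X f) by rewrite /iter_lie_fun foldr_rcons.
rewrite /fmul; lra.
Qed.

Lemma SK3_add Phi Psi : smooth_kernel Phi -> SK3 o q Phi -> zero_moments Psi ->
  SK3 o q (fun e x => Phi e x + Psi e x).
Proof.
move=> s1 H [s2 b2] K cK Xs f sf.
apply: bigO_eq (bigOD moment_gauge_ge0 (H K cK Xs f sf) (b2 K cK Xs (exist _ f sf))) => e x he _.
rewrite (iterL_add LxE (@sk_Lx R n M) (@lxD R n M) Xs s1 s2 he).
have c1 := xker_Omega_c x (sk_xker (sk_iterL (@sk_Lx R n M) Xs s1) he).
have c2 := xker_Omega_c x (sk_xker (sk_iterL (@sk_Lx R n M) Xs s2) he).
have := momentE 1 sf c1 c2; rewrite scale1r mul1r /moment /fmul/= => ->; lra.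
Qed.

End moment_estimates.

Lemma quadratic_scale {R : realType} {n : nat} (d : R) (v : 'rV[R]_n) (F H : 'M[R]_n) :
  (d *: v *m F *m H *m (d *: v *m F)^T) 0 0 = d ^+ 2 * (v *m (F *m H *m F^T) *m v^T) 0 0.
Proof.
rewrite -(scalemxAl d v F); set u := v *m F.
have -> : (d *: u)^T = d *: u^T by apply/matrixP => i j; rewrite !mxE.
by rewrite -!scalemxAl -scalemxAr scalerA -expr2 mxE /u trmx_mul !mulmxA.
Qed.

Lemma sqrt_scale {R : realType} (C N B V : R) : 0 <= C -> 0 <= N -> 0 <= V ->
  C * N * Num.sqrt B * V = Num.sqrt (C ^+ 2 * (N ^+ 2 * B * V ^+ 2)).
Proof.
move=> C0 N0 V0; have -> : C ^+ 2 * (N ^+ 2 * B * V ^+ 2) = (C * N * V) ^+ 2 * B by ring.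
have h : 0 <= C * N * V by rewrite !mulr_ge0.
by rewrite (sqrtrM _ (sqr_ge0 _)) sqrtr_sqr (ger0_norm h); ring.
Qed.

(** * Condition (SK1): distances and supports *)

Section riemannian_distance.
Context {R : realType} {n : nat} {M : manifold R n}.
Variable h : riemannian_metric M.
Implicit Types (phi psi : chart R n M) (x y : M) (z : 'rV[R]_n).

Lemma piecewise_path_cat x y (z : M) (k l : R) : piecewise_path h x y k -> piecewise_path h y z l ->
  piecewise_path h x z (k + l).
Proof.
elim=> {x y k} [x|c y k sc _ IH] hl; first by rewrite add0r.
by rewrite -addrA; apply: path_cons sc (IH hl).
Qed.

Lemma hdist_lt_trans x y (z : M) (a b : R) : (hdist h x y < a%:E)%E -> (hdist h y z < b%:E)%E ->
  (hdist h x z < (a + b)%:E)%E.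
Proof.
move=> /ereal_inf_lt[_ [k hk <-] ka] /ereal_inf_lt[_ [l hl <-] lb].
apply: (@le_lt_trans _ _ (k + l)%:E).
  by apply: ereal_inf_lbound; exists (k + l) => //; exact: piecewise_path_cat hk hl.
by rewrite lte_fin; apply: ltrD; rewrite -lte_fin.
Qed.

Lemma hdist_curve (c : R -> M) : smooth_curve c -> (hdist h (c 0%R) (c 1%R) <= (curve_length h c)%:E)%E.
Proof.
move=> sc; apply: ereal_inf_lbound; exists (curve_length h c) => //.
by rewrite -[curve_length h c]addr0; apply: path_cons sc _; exact: path_const.
Qed.

Lemma quadratic_le (G : 'M[R]_n) (v : 'rV[R]_n) (B : R) : (forall i j, `|G i j| <= B) ->
  `|(v *m G *m v^T) 0 0| <= n%:R ^+ 2 * B * `|v| ^+ 2.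
Proof.
move=> hB; rewrite mxE; apply: le_trans (ler_norm_sum _ _ _) _.
have -> : n%:R ^+ 2 * B * `|v| ^+ 2 = \sum_(j < n) \sum_(i < n) `|v| * B * `|v|.
  by rewrite !big_const_ord !iter_addr_0 -mulrnA -[RHS]mulr_natr natrM; ring.
apply: ler_sum => j _; rewrite normrM [_^T _ _]mxE mxE.
apply: (@le_trans _ _ ((\sum_i `|v| * B) * `|v|)).
  apply: ler_pM => //; last exact: coord_le_norm.
  apply: le_trans (ler_norm_sum _ _ _) _; apply: ler_sum => i _.
  by rewrite normrM; apply: ler_pM => //; exact: coord_le_norm.
by rewrite mulr_suml.
Qed.

Section chart_segment.
Variables (phi : chart R n M) (z0 : 'rV[R]_n) (r B : R).
Hypotheses (a1 : atlas phi) (hr : forall z, `|z0 - z| <= r -> cimg phi z).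
Hypothesis hB : forall z, `|z0 - z| <= r -> forall i j, `|metric_rep h phi z i j| <= B.

Lemma segment_in_ball z1 z2 (s : R) : 0 <= s <= 1 -> `|z0 - z1| <= r -> `|z0 - z2| <= r ->
  `|z0 - (z1 + s *: (z2 - z1))| <= r.
Proof.
move=> /andP[s0 s1] h1 h2.
have -> : z0 - (z1 + s *: (z2 - z1)) = (1 - s) *: (z0 - z1) + s *: (z0 - z2).
  by lmod_with R ('rV[R]_n) ltac:(ring).
apply: le_trans (ler_normD _ _) _; rewrite !normrZ (ger0_norm s0) ger0_norm ?subr_ge0//.
have : (1 - s) * `|z0 - z1| <= (1 - s) * r by rewrite ler_wpM2l ?subr_ge0.
have : s * `|z0 - z2| <= s * r by rewrite ler_wpM2l.
lra.
Qed.

(** Parametrised by [step], the segment is a smooth curve on the whole line, constant outside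
    [0, 1]. [C] bounds the derivative of [step], and [n * sqrt B] bounds the length of vectors of
    maximum norm 1 when the entries of the metric are at most [B]. *)
Lemma chart_segment_length z1 z2 (C : R) : `|z0 - z1| <= r -> `|z0 - z2| <= r ->
  (forall t : R, 0 <= t <= 1 -> `|'D_(1 : R) (@step R) t| <= C) ->
  (hdist h (cinv phi z1) (cinv phi z2) <= (C * n%:R * Num.sqrt B * `|z2 - z1|)%:E)%E.
Proof.
move=> h1 h2 hC; pose v := z2 - z1; pose z (t : R) := z1 + step t *: v.
have st : smooth_on setT (@step R) by exact: smooth_step.
have sz : smooth_on setT z.
  by apply: (smooth_add openT (smooth_cst _ openT)); exact: (smooth_scale openT st (smooth_cst _ openT)).
have bz t : `|z0 - z t| <= r by apply: segment_in_ball => //; rewrite step_ge0 step_le1.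
have hz t : cimg phi (z t) := hr (bz t).
pose c := cinv phi \o z; have sc : smooth_curve c by exact: (chart_curve a1 sz hz).
have c0 : c 0 = cinv phi z1 by rewrite /c/= /z step_le0// scale0r addr0.
have c1 : c 1 = cinv phi z2 by rewrite /c/= /z step_ge1// scale1r addrCA subrr addr0.
have Dz (t : R) : is_derive t 1 z ('D_(1 : R) (@step R) t *: v).
  have := is_deriveD (is_derive_cst z1 t 1) (is_deriveZf (smooth_on_is_derive (1 : R) st (x := t) I) (is_derive_cst v t 1)).
  by move/is_derive_eq; apply; rewrite scaler0 addr0 add0r.
have vel t : velocity c t = ('D_(1 : R) (@step R) t *: v) *m from_chart phi (z t).
  rewrite /velocity; have ht : tdom phi (chart_at (c t)) (z t) by exact: tdom_to.
  have df := trans_differentiable a1 (atlas_at (c t)) ht.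
  have [_ e] := is_derive_comp (Dz t) df.
  have [_ e2] := transE ('D_(1 : R) (@step R) t *: v) a1 (atlas_at (c t)) ht.
  exact: etrans e e2.
pose Q t := (v *m metric_rep h phi (z t) *m v^T) 0 0.
pose g t := Num.sqrt (('D_(1 : R) (@step R) t) ^+ 2 * Q t).
have eg t : Num.sqrt ((velocity c t *m h (c t) *m (velocity c t)^T) 0 0) = g t.
  rewrite /g vel /Q /metric_rep; set F := from_chart phi (z t); set d := 'D_1 _ t.
  by congr Num.sqrt; exact: quadratic_scale.
have cQ : continuous Q.
  have sQ : smooth_on setT Q.
    have -> : Q = fun t => \sum_j (\sum_i v 0 i * metric_rep h phi (z t) i j) * v 0 j.
      by apply/funext => t; rewrite /Q mxE; apply: eq_bigr => j _; rewrite !mxE.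
    apply: (smooth_sumR _ openT) => j; apply: (smooth_mul openT _ (smooth_cst _ openT)).
    apply: (smooth_sumR _ openT) => i; apply: (smooth_mul openT (smooth_cst _ openT)).
    have sG : smooth_on (cimg phi) (fun z => metric_rep h phi z i j).
      apply: (@smooth_lin R _ _ R _ (metric_rep h phi) (fun A : 'M[R]_n => A i j) 1 (open_cimg phi)).
      + by move=> k A A'; rewrite !mxE.
      + by move=> A; rewrite mul1r; exact: coord_le_norm.
      + exact: (gram_smooth h a1).
    exact: (smooth_comp openT (open_cimg phi) (fun t _ => hz t) sz sG).
  by move=> t; exact: (smooth_on_cont sQ).
have cg : continuous g.
  move=> t; apply: continuous_comp; last exact: sqrt_continuous.
  apply: cvgM; last exact: cQ.
  have cD : {for t, continuous ('D_(1 : R) (@step R))} by exact: (smooth_on_cont (smooth_onD (1 : R) st)).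
  exact: cvgM.
have len : curve_length h c <= C * n%:R * Num.sqrt B * `|z2 - z1|.
  have -> : curve_length h c = \int[lebesgue_measure]_(t in `[0, 1]) g t.
    by apply: eq_Rintegral => t _; exact: eg.
  rewrite -[leRHS]mulr1 -[X in _ * X](subr0 1).
  apply: le_trans (ler_norm _) (integral_segment_le ler01 cg _) => t ht.
  rewrite ger0_norm ?sqrtr_ge0// /g.
  (* An entry of the metric shows [0 <= B]; in dimension 0 there is no entry, and the integrand
     vanishes. *)
  have B0 : 0 <= B \/ n = 0%N.
    have [n0|n0] := eqVneq n 0%N; first by right.
    have lt : (0 < n)%N by rewrite lt0n.
    by left; apply: le_trans (hB h1 (Ordinal lt) (Ordinal lt)).
  have q0 := quadratic_le v (hB (bz t)).
  have C0 : 0 <= C by apply: le_trans (hC t ht).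
  case: B0 => [B0|n0].
    have e : C * n%:R * Num.sqrt B * `|v| = Num.sqrt (C ^+ 2 * (n%:R ^+ 2 * B * `|v| ^+ 2)).
      exact: sqrt_scale.
    rewrite -/v e ler_wsqrtr//.
    apply: (@le_trans _ _ (`|'D_(1 : R) (@step R) t| ^+ 2 * `|Q t|)).
      by rewrite -normrX -normrM ler_norm.
    by apply: ler_pM => //; rewrite lerXn2r ?nnegrE//; exact: hC.
  have -> : Q t = 0.
    apply/eqP; rewrite -normr_le0; apply: le_trans q0 _.
    have nr : (n%:R : R) = 0 by rewrite n0.
    by rewrite nr expr2 !mul0r.
  by rewrite mulr0 sqrtr0 !mulr_ge0.
by rewrite -c0 -c1; apply: le_trans (hdist_curve sc) _; rewrite lee_fin.
Qed.

End chart_segment.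

Lemma step_derivative_bounded : exists C : R, 0 < C /\ forall t : R, 0 <= t <= 1 -> `|'D_(1 : R) (@step R) t| <= C.
Proof.
have [C [C0 hC]] : exists C : R, 0 < C /\ forall t, `[0 : R, 1]%classic t -> `|'D_(1 : R) (@step R) t| <= C.
  apply: compact_cont_bounded; first exact: segment_compact.
  by move=> t _; exact: (smooth_on_cont (smooth_onD (1 : R) (@smooth_step R))).
by exists C; split=> // t ht; apply: hC; rewrite /= in_itv.
Qed.

(** Chart segments are short and can be run either way, which gives both inequalities without a
    symmetry of [hdist]. *)
Lemma hdist_near x (d : R) : 0 < d ->
  \forall y \near x, (hdist h x y < d%:E)%E /\ (hdist h y x < d%:E)%E.
Proof.
move=> d0; pose phi := chart_at x; have [r r0 hr] := chart_ball x.
have hr' z : `|cmap_at x - z| <= r -> cimg phi z by move=> hz; apply: hr; apply: (le_trans hz); lra.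
have [B hB] : exists B : R, forall z, `|cmap_at x - z| <= r -> forall i j, `|metric_rep h phi z i j| <= B.
  have [B [_ hB]] : exists B : R, 0 < B /\ forall z, [set z | `|cmap_at x - z| <= r] z -> `| `|metric_rep h phi z| | <= B.
    apply: compact_cont_bounded; first exact: compact_closed_ball.
    move=> z hz; have cm : {for z, continuous (metric_rep h phi)}.
      exact: (smooth_on_cont (gram_smooth h (atlas_at x)) (hr' z hz)).
    exact: (continuous_comp cm (@norm_continuous _ _ _)).
  exists B => z hz i j; have := hB z hz; rewrite normr_id; apply: le_trans.
  exact: coord_le_norm.
have [C [C0 hC]] := step_derivative_bounded.
pose k := C * n%:R * Num.sqrt B; have k0 : 0 <= k by rewrite !mulr_ge0// ltW.
have k1 : 0 < k + 1 by lra.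
pose e := Num.min r (d / (k + 1)); have e0 : 0 < e by rewrite lt_min r0 divr_gt0.
have hN : \forall z \near cmap phi x, `|cmap_at x - z| < e.
  by apply/nbhs_ballP; exists e => // z; rewrite -ball_normE.
apply: (filterS _ (open_near_cinv (cdom_at x) hN)) => y [hy].
rewrite lt_min => /andP[yr yd].
have y1 : `|cmap_at x - cmap phi y| <= r by exact: ltW.
have y0 : `|cmap_at x - cmap_at x| <= r by rewrite subrr normr0 ltW.
have bd : k * `|cmap phi y - cmap_at x| < d.
  rewrite distrC; apply: (@le_lt_trans _ _ ((k + 1) * `|cmap_at x - cmap phi y|)).
    by rewrite ler_wpM2r// lerDl.
  by rewrite mulrC -ltr_pdivlMr.
have L1 := chart_segment_length (atlas_at x) hr' hB y0 y1 hC.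
have L2 := chart_segment_length (atlas_at x) hr' hB y1 y0 hC.
rewrite cinv_at (cmapK hy) in L1; rewrite cinv_at (cmapK hy) in L2.
split; first by apply: le_lt_trans L1 _; rewrite lte_fin.
by apply: le_lt_trans L2 _; rewrite lte_fin distrC.
Qed.

End riemannian_distance.

Section supports.
Context {R : realType} {n : nat} {M : manifold R n}.
Local Notation kernel := (@Defs.kernel R n M).
Implicit Types (X Y : vfield M) (Phi Psi : kernel) (f : M -> R).

Lemma lie_fun_near0 X f x : smooth_fun f -> (\forall y \near x, f y = 0) -> lie_fun X f x = 0.
Proof.
move=> sf f0; rewrite /lie_fun; have hz := cimg_at x.
have cc : cinv (chart_at x) @ cmap_at x --> cinv (chart_at x) (cmap_at x) := cinv_continuous hz.
rewrite cinv_at in cc; have n0 : \forall z \near cmap_at x, f (cinv (chart_at x) z) = 0 by exact: cc f0.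
rewrite (near_eq_derive (g := cst 0)); first exact: derive_cst.
by apply: filterS n0.
Qed.

(** If [y] lies outside the supports of [Phi e x'] for all [x'] near [x], the derivative in [x]
    vanishes at [y]. Otherwise [y] is in such a support with [x'] arbitrarily near [x], and (SK1) on
    a compact neighbourhood of [K] bounds its distance. *)
Lemma SK1_Lxy h X Phi : smooth_kernel Phi -> SK1 h Phi ->
  forall K, compact K -> exists e0 C : R, [/\ 0 < e0, 0 < C &
    forall x e, K x -> unitI e -> e < e0 ->
      supp (Phi e x) `<=` hball h x (C * e) /\ supp (Lxy X Phi e x) `<=` hball h x (C * e)].
Proof.
move=> sP H K cK; have [K' cK' KK'] := compact_nbhd cK.
have [e0 [C [e0_gt0 C0 hC]]] := H K' cK'.
(* One [C e] from [x] to [x'], one from [x'] to a point [y'] where the form is nonzero, and one for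
   the closure in the definition of the support. *)
exists e0, (3 * C); split=> //; first by rewrite mulr_gt0.
move=> x e Kx he ee0; have e1 : 0 < e by case/andP: he.
have Ce : 0 < C * e by rewrite mulr_gt0.
have Kx' : K' x by exact: nbhs_singleton (KK' x Kx).
have up (a : R) y : a <= 3 * C * e -> (hdist h x y < a%:E)%E -> hball h x (3 * C * e) y.
  by move=> ha hy; apply: lt_le_trans hy _; rewrite lee_fin.
have sx : supp (Phi e x) `<=` hball h x (3 * C * e).
  move=> y /(hC x e Kx' he ee0); apply: up.
  by rewrite -mulrA; lra.
split=> // y hy.
have [y' [[A hA] hy']] := hy _ (hdist_near h y Ce).
have hx := sk_xker sP he.
have key : (hdist h x y' < (2 * (C * e))%:E)%E.
  have [hs|hs] := pselect (supp (Phi e x) y').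
    by apply: lt_le_trans (hC x e Kx' he ee0 _ hs) _; rewrite lee_fin; lra.
  have ly0 : ly X (Phi e) x y' A = 0.
    exact: (lie_form_out X A (Omega_c_is_form (xker_Omega_c x hx)) hs).
  apply: contrapT => far; move/negP: hA; apply.
  have -> : Lxy X Phi e x y' A = (lx X (Phi e) x y' A : R) + (ly X (Phi e) x y' A : R) by [].
  rewrite ly0 addr0; apply/eqP; apply: (lie_fun_near0 X (xker_eval y' A hx)).
  near=> x'; apply: supp_out => hs'; apply: far.
  have h1 : (hdist h x x' < (C * e)%:E)%E.
    have [] : (hdist h x x' < (C * e)%:E)%E /\ (hdist h x' x < (C * e)%:E)%E by near: x'; exact: hdist_near.
    by [].
  have h2 : K' x' by near: x'; exact: KK'.
  have -> : 2 * (C * e) = C * e + C * e by ring.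
  exact: hdist_lt_trans h1 (hC x' e h2 he ee0 _ hs').
have -> : 3 * C * e = 2 * (C * e) + C * e by ring.
exact: hdist_lt_trans key hy'.2.
Unshelve. all: by end_near. Qed.

Lemma supp_comb (k : R) (u v : preform M) (S : set M) : supp u `<=` S -> supp v `<=` S ->
  supp (u + k *: v) `<=` S.
Proof.
move=> hu hv; apply: (@subset_trans _ (supp u `|` supp v)); last by move=> y [/hu|/hv].
apply: supp_sub; first by apply: closedU; exact: supp_closed.
move=> p hp A; rewrite addrC preform_combE !supp_out ?mulr0 ?addr0// => h; apply: hp; [by left|by right].
Qed.

(** The coefficient splits into a function of [x], handled by the Leibniz rule on compact sets, and
    a function of [e], which is a bounded constant for all operators in [x] and [y]. [r] is smooth
    for [e > 0] only: its values will come from interpolation and need not converge at 0. *)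
Lemma smoothing_kernel_perturbation (o : orientation M) q X Phi f (r : R -> R) B :
  smoothing_kernels o q Phi -> smooth_fun f -> 0 < B -> (forall e, unitI e -> `|r e| <= B) ->
  smooth_on [set e : R | 0 < e] r ->
  smoothing_kernels o q (fun e x => Phi e x + (f x + r e) *: Lxy X Phi e x).
Proof.
move=> [sP hP] sf B0 hB sr; pose Psi := Lxy X Phi; have sPsi := sk_Lxy X sP.
pose Th := (fun e x => f x *: Psi e x + r e *: Psi e x) : kernel.
have E : (fun e x => Phi e x + (f x + r e) *: Psi e x) = (fun e x => Phi e x + Th e x) :> kernel.
  by apply/funext => e; apply/funext => x; rewrite /Th scalerDl.
have sTh : smooth_kernel Th by exact: (sk_add (sk_mul sf sPsi) (sk_scale sr sPsi)).
split=> [|h]; first by rewrite E; exact: sk_add.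
have [h1 h2 h3] := hP h; split.
- move=> K cK; have [e0 [C [e0_gt0 C0 hC]]] := SK1_Lxy X sP h1 cK.
  exists e0, C; split=> // x e Kx he ee0; have [s1 s2] := hC x e Kx he ee0.
  exact: supp_comb s1 s2.
- rewrite E; apply/(SK2_ly_bounds h (sk_add sP sTh)).
  have b1 := (SK2_ly_bounds h sP).1 h2; have b2 := ly_bounds_Lxy X b1.
  exact: (ly_bounds_add b1 (ly_bounds_add (ly_bounds_mul sf b2) (ly_bounds_scale B0 hB sr b2))).
- rewrite E; have z := zero_moments_Lxy X sP h3; apply: (SK3_add sP h3).
  exact: (zero_moments_add (zero_moments_mul sf z) (zero_moments_scale B0 hB sr z)).
Qed.

Lemma smoothing_kernels_le (o : orientation M) p q : (p <= q)%N ->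
  smoothing_kernels o q `<=` @smoothing_kernels R n M o p.
Proof.
move=> pq Phi [sP hP]; split=> // h; have [h1 h2 h3] := hP h; split=> // K cK Xs f sf.
have [e0 [C [e0_gt0 C0 hC]]] := h3 K cK Xs f sf; exists e0, C; split=> // e x he ee0 Kx.
apply: le_trans (hC e x he ee0 Kx) _; apply: ler_wpM2l; first exact: ltW.
by case/andP: he => e1 e2; apply: ler_wiXn2l => //; exact: ltW.
Qed.

End supports.

Lemma count_step {R : realType} (b : bool) (c : nat) (P Q S : R) : P = S -> (b -> Q = S) ->
  c%:R * P + b%:R * Q = (b + c)%:R * S.
Proof. by move=> -> h; rewrite natrD mulrDl addrC; case: b h => [->|_] //; rewrite !mul0r. Qed.

(* Expansion in [a] of iterated derivatives in the directions [w i] or [w i + a *: v]. *)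
(** * The Lie derivative on the basic space *)

Section polynomial_expansion.
Context {R : realType} {d : nat} {I : eqType}.
Local Notation V := 'rV[R]_d.
Variables (U : set V) (H : V -> R) (w : I -> V) (v : V) (i0 : I).
Hypotheses (oU : open U) (sH : smooth_on U H).
Implicit Types (l : seq I) (k : nat).

Let dir (a : R) i := w i + (a * (i == i0)%:R) *: v.

(** The coefficient of [a ^+ k]: a derivative along [dir a i] keeps the degree through [w i] and,
    for [i = i0], raises it by one through [v]. *)
Fixpoint coefficient l k : V -> R :=
  if l is i :: l' then fun y => 'D_(w i) (coefficient l' k) y +
    (i == i0)%:R * (if k is k'.+1 then 'D_v (coefficient l' k') y else 0)
  else if k is 0%N then H else fun=> 0.

Lemma coefficient_smooth l k : smooth_on U (coefficient l k).
Proof.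
elim: l k => [|i l IH] [|k] /=; [exact: sH|exact: smooth_cst| |].
- apply: (smooth_addR oU (smooth_onD _ (IH 0%N))).
  exact: (smooth_mul oU (smooth_cst _ oU) (smooth_cst _ oU)).
- apply: (smooth_addR oU (smooth_onD _ (IH k.+1))).
  exact: (smooth_mul oU (smooth_cst _ oU) (smooth_onD _ (IH k))).
Qed.

Lemma coefficient_high l k : (size l < k)%N -> coefficient l k = fun=> 0.
Proof.
elim: l k => [|i l IH] [|k] //= lk; apply/funext => y.
rewrite (IH k.+1 (ltnW lk)) (IH k lk).
have z0 (u : V) : 'D_u (fun=> 0 : R) y = 0 by exact: derive_cst.
by rewrite (z0 (w i)) (z0 v) mulr0 addr0.
Qed.

Lemma coefficient0 l : {in U, coefficient l 0 =1 iterD (map w l) H}.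
Proof.
elim: l => [//|i l IH] y yU /=; rewrite mulr0 addr0.
exact: (eq_on_D _ oU IH yU).
Qed.

Lemma derive_power_sum m (a : R) (c : nat -> V -> R) i y : U y -> (forall k, smooth_on U (c k)) ->
  'D_(dir a i) (fun y => \sum_(k < m) a ^+ k * c k y) y =
  \sum_(k < m) a ^+ k * ('D_(w i) (c k) y + (a * (i == i0)%:R) * 'D_v (c k) y).
Proof.
move=> Uy sc.
have D (u : V) k := is_deriveZ (a ^+ k) (smooth_on_is_derive u (sc k) Uy).
have Dk k : is_derive y (dir a i) (fun y => a ^+ k * c k y) (a ^+ k * ('D_(w i) (c k) y + (a * (i == i0)%:R) * 'D_v (c k) y)).
  have := D (dir a i) k; move/is_derive_eq; apply; congr (_ * _).
  have lin : 'D_(dir a i) (c k) y = 'D_(w i) (c k) y + (a * (i == i0)%:R) *: 'D_v (c k) y.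
    by rewrite /dir addrC (smooth_derive_linear _ _ _ oU (sc k) Uy) addrC.
  exact: lin.
exact: (derive_val (is_derive := is_derive_bigsum (index_enum _) (fun k : 'I_m => Dk k))).
Qed.

Lemma coefficient_expansion l a y : U y ->
  iterD (map (dir a) l) H y = \sum_(k < (size l).+1) a ^+ k * coefficient l k y.
Proof.
elim: l y => [|i l IH] y Uy; first by rewrite /= big_ord1 expr0 mul1r.
have E : {in U, iterD (map (dir a) l) H =1 fun y => \sum_(k < (size l).+1) a ^+ k * coefficient l k y}.
  by move=> z; rewrite inE => /IH.
rewrite [LHS]/= (eq_on_D _ oU E) ?inE// (derive_power_sum _ _ _ Uy (@coefficient_smooth l)).
set m := (size l).+1.
under eq_bigr do rewrite mulrDr; rewrite big_split /=.
have -> : \sum_(k < m.+1) a ^+ k * coefficient (i :: l) k y =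
    \sum_(k < m.+1) a ^+ k * 'D_(w i) (coefficient l k) y +
    \sum_(k < m.+1) a ^+ k * ((i == i0)%:R * (if (k : nat) is k'.+1 then 'D_v (coefficient l k') y else 0)).
  by rewrite -big_split; apply: eq_bigr => k _; exact: mulrDr.
rewrite [X in _ = X + _]big_ord_recr /= (coefficient_high (ltnSn (size l))).
rewrite (_ : 'D_(w i) (fun=> 0) y = 0) ?mulr0 ?addr0; last exact: derive_cst.
congr (_ + _); rewrite [RHS]big_ord_recl /= !mulr0 add0r; apply: eq_bigr => k _.
by rewrite /bump /= add1n exprS; ring.
Qed.

(** The linear coefficient is a sum over the occurrences of [i0] in [l], with one [w i0] replaced by
    [v]. A further derivative along [w i0] restores what is missing, and by symmetry all terms
    become equal. *)
Lemma derive_coefficient1 l : {in U, 'D_(w i0) (coefficient l 1) =1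
  fun y => (count_mem i0 l)%:R * 'D_v (iterD (map w l) H) y}.
Proof.
elim: l => [|i l IH] y; rewrite inE => Uy.
  by rewrite /= mul0r; exact: derive_cst.
have yU : y \in U by rewrite inE.
have s1 := coefficient_smooth l 1; have s0 := coefficient_smooth l 0.
have sl := smooth_on_iterD (map w l) sH.
have D1 := smooth_on_is_derive (w i0) (smooth_onD (w i) s1) Uy.
have D2 := smooth_on_is_derive (w i0) (smooth_onD v s0) Uy.
have D3 := is_deriveD D1 (is_deriveZ ((i == i0)%:R : R) D2).
have -> : 'D_(w i0) (coefficient (i :: l) 1) y =
    'D_(w i0) ('D_(w i) (coefficient l 1)) y + (i == i0)%:R * 'D_(w i0) ('D_v (coefficient l 0)) y.
  exact: (derive_val (is_derive := D3)).
rewrite (smooth_schwarz (w i0) (w i) oU s1 Uy) (eq_on_D (w i) oU IH yU).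
have D4 := is_deriveZ ((count_mem i0 l)%:R : R) (smooth_on_is_derive (w i) (smooth_onD v sl) Uy).
have -> : 'D_(w i) (fun y => (count_mem i0 l)%:R * 'D_v (iterD (map w l) H) y) y =
    (count_mem i0 l)%:R * 'D_(w i) ('D_v (iterD (map w l) H)) y.
  exact: (derive_val (is_derive := D4)).
have e0 : {in U, 'D_v (coefficient l 0) =1 'D_v (iterD (map w l) H)}.
  exact: (eq_on_D v oU (coefficient0 l)).
apply: count_step; first exact: (smooth_schwarz (w i) v oU sl Uy).
move=> /eqP ii; refine (etrans (eq_on_D (w i0) oU e0 yU) _).
by rewrite ii; exact: (smooth_schwarz (w i0) v oU sl Uy).
Qed.

Lemma iterD_commute l : {in U, 'D_v (iterD (map w l) H) =1 iterD (map w l) ('D_v H)}.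
Proof.
elim: l => [//|i l IH] y yU; rewrite /= -(eq_on_D _ oU IH yU).
by rewrite inE in yU; exact: (smooth_schwarz v (w i) oU (smooth_on_iterD _ sH) yU).
Qed.

(** The leading [i0] makes the factor nonzero, so that the derivative along [v] can be recovered by
    division. *)
Lemma coefficient1 l y : U y ->
  coefficient (i0 :: l) 1 y = (count_mem i0 l).+1%:R * iterD (map w l) ('D_v H) y.
Proof.
move=> Uy; have yU : y \in U by rewrite inE.
rewrite /= eqxx mul1r (derive_coefficient1 l yU) (eq_on_D v oU (coefficient0 l) yU).
by rewrite (iterD_commute l yU) -[(count_mem i0 l).+1]addn1 natrD mulrDl mul1r.
Qed.

End polynomial_expansion.

Section chain_rule.
Context {R : realType} {n : nat} {M : manifold R n}.
Local Notation kernel := (@Defs.kernel R n M).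
Local Notation gfun := (@Defs.gfun R n M).
Implicit Types (X Y : vfield M) (F : gfun) (P : M -> preform M).

Lemma basic_SC F (w : R -> preform M) (c : R -> M) : basic_space F -> @SC R (FS M) w -> smooth_curve c ->
  smooth_on setT (fun t => F (w t) (c t)).
Proof. by move=> hF sw sc; apply: hF sc; apply/smooth_form_curveP. Qed.

Lemma basic_smooth_fun F w : basic_space F -> Omega_c w -> smooth_fun (F w).
Proof.
move=> hF hw; apply: curve_smooth_fun => c sc.
exact: (basic_SC hF (@SC_cst R (FS M) w hw) sc).
Qed.

(* The hypothesis makes [h] smooth, by Boman's theorem. *)
Lemma derive_diagonal (h : R -> R -> R) :
  (forall a b : R -> R, smooth_on setT a -> smooth_on setT b -> smooth_on setT (fun t => h (a t) (b t))) ->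
  'D_1 (fun t : R => h t t) 0 = 'D_1 (fun t : R => h t 0) 0 + 'D_1 (fun t : R => h 0 t) 0.
Proof.
move=> sh; pose k (v : 'rV[R]_2) := h (v 0 0) (v 0 1).
have sk : smooth_on setT k.
  apply: (boman_smooth openT) => c sc _.
  exact: (sh _ _ ((smooth_coord _ openT).1 sc 0) ((smooth_coord _ openT).1 sc 1)).
pose e1 : 'rV[R]_2 := delta_mx 0 0; pose e2 : 'rV[R]_2 := delta_mx 0 1.
have E (v : 'rV[R]_2) : 'D_1 (fun t : R => h (t * v 0 0) (t * v 0 1)) 0 = 'D_v k 0.
  have /is_derive_line[_ <-] := smooth_on_is_derive v sk (x := 0) I.
  apply: (congr1 (fun f : R -> R => 'D_(1 : R) f 0)); apply/funext => t.
  by rewrite /k add0r !mxE.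
have := smooth_derive_linear 1 e1 e2 openT sk (x := 0) I; rewrite scale1r -!E.
rewrite !mxE !eqxx /= !mulr1n !mulr0n ?addr0 ?add0r.
move=> e; have sc (r : R) : 1 *: r = r by rewrite scale1r.
rewrite sc in e; move: e.
rewrite (_ : (fun t : R => h (t * 1) (t * 1)) = fun t => h t t); last by apply/funext => t; rewrite mulr1.
rewrite (_ : (fun t : R => h (t * 1) (t * 0)) = fun t => h t 0); last by apply/funext => t; rewrite mulr1 mulr0.
by rewrite (_ : (fun t : R => h (t * 0) (t * 1)) = fun t => h 0 t)//; apply/funext => t; rewrite mulr1 mulr0.
Qed.

Lemma SC_line (u v : preform M) (a : R -> R) : Omega_c u -> Omega_c v -> smooth_on setT a ->
  @SC R (FS M) (fun t => u + a t *: v).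
Proof.
move=> hu hv sa; apply: (@SC_add R (FS M) _ _ (@SC_cst R (FS M) u hu)).
exact: (@SC_mul R (FS M) a _ sa (@SC_cst R (FS M) v hv)).
Qed.

Lemma d1D F w x u v : basic_space F -> Omega_c w -> Omega_c u -> Omega_c v ->
  d1 F w x (u + v) = d1 F w x u + d1 F w x v.
Proof.
move=> hF hw hu hv; pose h (a b : R) := F (w + a *: u + b *: v) x.
have := @derive_diagonal h; rewrite /h /d1 => H.
rewrite (_ : (fun t : R => F (w + t *: (u + v)) x) = fun t => F (w + t *: u + t *: v) x); last first.
  by apply/funext => t; rewrite scalerDr addrA.
rewrite H => [|a b sa sb]; last first.
  apply: (basic_SC hF _ (smooth_curve_cst x)).
  apply: (@SC_add R (FS M) _ _ (SC_line hw hu sa)).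
  exact: (@SC_mul R (FS M) b _ sb (@SC_cst R (FS M) v hv)).
congr (_ + _); apply: (congr1 (fun f : R -> R => 'D_(1 : R) f 0)); apply/funext => t.
  by rewrite scale0r addr0.
by rewrite scale0r addr0.
Qed.

Lemma chain_rule F X P x : basic_space F -> xker P ->
  smooth_fun (fun x => F (P x) x) /\
  lie_fun X (fun x => F (P x) x) x = d1 F (P x) x (lx X P x) + lie_fun X (F (P x)) x.
Proof.
move=> hF hP.
have sF : smooth_fun (fun x => F (P x) x).
  by apply: curve_smooth_fun => c sc; exact: (basic_SC hF (hP c sc) sc).
split=> //; have [c [sc c0 hc Sl dl]] := lx_curve X x hP.
have [r [sr wr dr]] := hadamard (hP c sc).
have w0 : Omega_c (P x) by exact: xker_Omega_c.
have r0 : r 0 = lx X P x.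
  apply: (@der_unique R (FS M)); [| | |exact: dr|exact: dl].
  - by move=> s; exact: xker_Omega_c.
  - exact: (SC_S 0 sr).
  - exact: Sl.
(* At [b = 0] the direction is [r 0], that is [lx X P x]; at [a = 0] only the second argument of [F]
   moves. *)
pose h (a b : R) := F (P x + a *: r b) (c b).
have Dt : 'D_1 (fun t : R => h t t) 0 = lie_fun X (fun x => F (P x) x) x.
  have [_ <-] := hc _ sF; apply: (congr1 (fun f : R -> R => 'D_(1 : R) f 0)); apply/funext => t.
  by rewrite /h /= wr c0.
rewrite -Dt derive_diagonal; last first.
  move=> a b sa sb; apply: (basic_SC hF _ (smooth_curve_comp sc sb)).
  apply: (@SC_add R (FS M) _ _ (@SC_cst R (FS M) _ w0)).
  by apply: (@SC_mul R (FS M) a _ sa); exact: (@SC_comp R (FS M) b r sb sr).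
congr (_ + _); first by rewrite /h r0 c0.
have [_ <-] := hc _ (basic_smooth_fun hF w0); apply: (congr1 (fun f : R -> R => 'D_(1 : R) f 0)); apply/funext => t.
by rewrite /h scale0r addr0.
Qed.

(* For [P = Phi_e] this expresses [hatL_X] by Lie derivatives of [x |-> F(Phi_{e,x}, x)] and by the derivative of
   [F] in the direction [L^{x+y}_X Phi]. *)
Lemma hatL_formula F X P x : basic_space F -> xker P ->
  hatL X F (P x) x = lie_fun X (fun x => F (P x) x) x - d1 F (P x) x (lxy X P x).
Proof.
move=> hF hP; have [_ ->] := chain_rule X x hF hP.
have w0 : Omega_c (P x) by exact: xker_Omega_c.
have c1 : Omega_c (lx X P x) by exact: (xker_Omega_c x (lx_xker X hP)).
have c2 : Omega_c (ly X P x) by exact: (xker_Omega_c x (ly_xker X hP)).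
rewrite /lxy (d1D x hF w0 c1 c2) /hatL /ly; ring.
Qed.

Lemma d1_smooth F P Q : basic_space F -> xker P -> xker Q -> smooth_fun (fun x => d1 F (P x) x (Q x)).
Proof.
move=> hF hP hQ; apply: curve_smooth_fun => c sc.
pose H (t s : R) := F (P (c t) + s *: Q (c t)) (c t).
have [a b sa sb|g sg dg] := @SC_two_parameters R (NS R) H.
  apply/NS_SC; have sca := smooth_curve_comp sc sa.
  apply: (basic_SC hF _ sca); apply: (@SC_add R (FS M) _ _ (hP _ sca)).
  exact: (@SC_mul R (FS M) b _ sb (hQ _ sca)).
move/NS_SC : sg; congr (smooth_on setT _); apply/funext => t.
by have /NS_der[_ <-] := dg t.
Qed.

(** Along given curves both terms are derivatives at 0 of functions of two parameters, hence smooth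
    by Boman's argument; for the second term this is [SC_lie_param]. *)
Lemma hatL_basic F X : basic_space F -> basic_space (hatL X F).
Proof.
move=> hF w c /smooth_form_curveP sw sc; rewrite /hatL.
apply: (smooth_addR openT); first apply: (smooth_oppR openT).
  pose H (t s : R) := F (w t + s *: lie_form X (w t)) (c t).
  have [a b sa sb|g sg dg] := @SC_two_parameters R (NS R) H.
    apply/NS_SC; apply: (basic_SC hF _ (smooth_curve_comp sc sa)).
    have swa := @SC_comp R (FS M) a w sa sw.
    apply: (@SC_add R (FS M) _ _ swa).
    exact: (@SC_mul R (FS M) b _ sb (SC_lie X swa)).
  move/NS_SC : sg; congr (smooth_on setT _); apply/funext => t.
  by have /NS_der[_ <-] := dg t.
apply/NS_SC; apply: SC_local => t0.
have [a b sa sb|g sg hg] := @SC_lie_param R n M (NS R) (fun t x => F (w t) x) X c t0 sc.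
  by apply/NS_SC; exact: (basic_SC hF (@SC_comp R (FS M) a w sa sw) sb).
exists g => //; apply: filterS hg => t [b hb db].
have sf : smooth_fun (F (w t)) by exact: (basic_smooth_fun hF (SC_S t sw)).
move/NS_der : db => db; exact: (is_derive_unique (hb _ sf) db).
Qed.

End chain_rule.

(** * Bounds uniform in the perturbation *)

Section uniform_bounds.
Context {R : realType} {n : nat} {M : manifold R n} (o : orientation M).
Local Notation kernel := (@Defs.kernel R n M).
Local Notation gfun := (@Defs.gfun R n M).
Variables (X : vfield M) (F : gfun) (q j : nat) (K : set M) (g : R -> R).
Hypothesis g0 : forall e, unitI e -> 0 <= g e.
Hypothesis hyp : forall i, (i <= j)%N -> forall Phi, smoothing_kernels o q Phi ->
  forall Xs : seq (vfield M), size Xs = i ->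
  bigO_unif K (fun e => iter_lie_fun Xs (fun x => F (Phi e x) x)) g.

Lemma bump_series_bound (T a : nat -> R) (b : R -> R) (B t : R) : (forall y, `|b y| <= 1) -> 0 <= B ->
  (forall k, `|a k| <= B) -> `|bump_series T b a t| <= B.
Proof.
move=> b1 B0 aB; rewrite /bump_series; case: pselect => [h|_]; last by rewrite normr0.
by rewrite normrM -[B]mul1r; apply: ler_pM.
Qed.

(* If the bound failed for (e_k, x_k, r_k) with [e_k -> 0], it would fail for a single kernel, obtained from a
   smooth function [r] with [r e_k = r_k]. *)
Lemma perturbation_bound Phi (f : M -> R) (r0 : R) (Zs : seq (vfield M)) :
  smoothing_kernels o q Phi -> smooth_fun f -> 0 < r0 -> (size Zs <= j)%N ->
  bigO_unif [set t : M * R | K t.1 /\ `|t.2| <= r0]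
    (fun e t => iter_lie_fun Zs (fun x => F (Phi e x + (f x + t.2) *: Lxy X Phi e x) x) t.1) g.
Proof.
move=> hPhi sf r0_gt0 sZ; apply: contrapT => nb.
pose val e (t : M * R) := iter_lie_fun Zs (fun x => F (Phi e x + (f x + t.2) *: Lxy X Phi e x) x) t.1.
pose bad (k : nat) (b : R) (u : R * (M * R)) := [/\ unitI u.1, u.1 <= b, u.1 <= k.+1%:R^-1,
  K u.2.1 /\ `|u.2.2| <= r0 & k.+1%:R * g u.1 < `|val u.1 u.2|].
have ex k b : 0 < b -> exists u, bad k b u.
  move=> b0; apply: contrapT => h; apply: nb.
  exists (Num.min b k.+1%:R^-1), k.+1%:R; split; [by rewrite lt_min b0 invr_gt0 ltr0n|by rewrite ltr0n|].
  move=> e t he; rewrite le_min => /andP[eb ek] ht; rewrite leNgt; apply/negP => hlt.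
  by apply: h; exists (e, t); split.
have [d _] := ex 0%N 1 ltr01.
have /choice[s hs] (kb : nat * R) : exists u, 0 < kb.2 -> bad kb.1 kb.2 u.
  have [b0|b0] := ltP 0 kb.2; last by exists d.
  by have [u hu] := ex kb.1 kb.2 b0; exists u.
(* Each violation is sought below a quarter of the previous parameter, the spacing that
   [bump_series] demands. *)
pose u := fix u k := if k is k'.+1 then s (k, (u k').1 / 4) else s (0%N, 1).
have hu k : exists2 b, 0 < b & bad k b (u k).
  elim: k => [|k [b _ [/andP[h1 _] _ _ _ _]]]; first by exists 1 => //; exact: (hs (0%N, 1)).
  have b0 : 0 < (u k).1 / 4 by rewrite divr_gt0.
  by exists ((u k).1 / 4) => //; exact: (hs (k.+1, (u k).1 / 4) b0).
pose T k := (u k).1; pose r k := (u k).2.2.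
have T0 k : 0 < T k by have [b _ [/andP[]]] := hu k.
have T4 k : T k.+1 <= T k / 4.
  have b0 : 0 < (u k).1 / 4 by rewrite divr_gt0// T0.
  by have [] := hs (k.+1, (u k).1 / 4) b0.
pose rho := bump_series T (@plateau R) r.
have pl1 (y : R) : `|plateau y| <= 1 by rewrite ger0_norm ?plateau_ge0// plateau_le1.
have rho_bd e : unitI e -> `|rho e| <= r0.
  by move=> _; apply: bump_series_bound => // [|k]; [exact: ltW|have [b _ [_ _ _ []]] := hu k].
(* The numbers [r k] are merely bounded; their decay would matter only at the parameter 0, which is
   excluded. *)
have s_rho : smooth_on [set e : R | 0 < e] rho.
  apply: (smooth_bump_series T0 T4 (@open_gt R 0) bump_like_plateau) => /=.
  by rewrite ltxx.
have rhoT k : rho (T k) = r k.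
  rewrite /rho (bump_series_near T0 T4 (j := k) _ bump_like_plateau); last by have := T0 k; lra.
  by rewrite subrr mul0r mulr0 plateau1 ?normr0// scale1r.
have [e0 [C [e0_gt0 C0 hC]]] := hyp sZ (smoothing_kernel_perturbation X hPhi sf r0_gt0 rho_bd s_rho) (erefl _).
(* So large that [T k <= e0] and that the [k]-th violation exceeds the constant [C]. *)
have [k hk] : exists k, C + e0^-1 <= k.+1%:R.
  exists (Num.bound (C + e0^-1)); apply: ltW.
  have c0 : 0 <= C + e0^-1 by rewrite addr_ge0// ltW// invr_gt0.
  by apply: lt_le_trans (archi_boundP c0) _; rewrite ler_nat.
have [b _ [hT _ hTk [hK _] hlt]] := hu k.
have i0 : 0 < e0^-1 by rewrite invr_gt0.
have Te0 : T k <= e0.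
  apply: le_trans hTk _; rewrite -[leRHS]invrK lef_pV2 ?posrE// ?ltr0n//; lra.
have := hC (T k) (u k).2.1 hT Te0 hK; rewrite rhoT => h.
move: hlt; rewrite ltNge => /negP; apply; apply: le_trans h _.
by rewrite ler_wpM2r ?g0//; lra.
Qed.

End uniform_bounds.

Section big_O_operations.
Context {R : realType}.

Lemma bigO_comp (T T' : Type) (D : set T) (D' : set T') (h : T' -> T) (f : R -> T -> R) (g : R -> R) :
  (forall t, D' t -> D (h t)) -> bigO_unif D f g -> bigO_unif D' (fun e t => f e (h t)) g.
Proof.
move=> hD [e0 [C [e00 C0 hC]]]; exists e0, C; split=> // e t he ee0 ht; apply: hC => //; exact: hD.
Qed.

Lemma bigO_scale (T : Type) (D : set T) (f : R -> T -> R) (g : R -> R) (k : R) : (forall e, unitI e -> 0 <= g e) ->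
  bigO_unif D f g -> bigO_unif D (fun e t => k * f e t) g.
Proof.
move=> g0; have k0 : 0 < `|k| + 1 by rewrite ltr_wpDl.
apply: (bigO_le _ k0 g0) => // e t _ _; rewrite normrM ler_wpM2r// lerDl//.
Qed.

Lemma bigO_sum (T : Type) (D : set T) (I : Type) (s : seq I) (f : I -> R -> T -> R) (g : R -> R) :
  (forall e, unitI e -> 0 <= g e) -> (forall i, bigO_unif D (f i) g) ->
  bigO_unif D (fun e t => \sum_(i <- s) f i e t) g.
Proof.
move=> g0 h; elim: s => [|i s IH].
  exists 1, 1; split=> // e t he _ _; rewrite big_nil normr0 mul1r; exact: g0.
by apply: bigO_eq (bigOD g0 (h i) IH) => e t _ _; rewrite big_cons.
Qed.

(** The difference quotients of both sides coincide, so the equality holds at every point and for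
    every [H]. *)
Lemma iterD_affine (V V' W : normedModType R) (A : V -> V') (L : V -> V') (H : V' -> W) vs :
  (forall z v (s : R), A (s *: v + z) = s *: L v + A z) ->
  iterD vs (fun z => H (A z)) = fun z => iterD (map L vs) H (A z).
Proof.
move=> hA; elim: vs => [//|v vs IH]; apply/funext => z; rewrite /= IH /derive.
apply: (congr1 (fun f : R -> W => lim (f h @[h --> 0^']))); apply/funext => s.
by rewrite /= hA.
Qed.

End big_O_operations.

(** * From coordinate derivatives to Lie derivatives along arbitrary fields *)

Section local_bounds.
Context {R : realType} {n : nat} {M : manifold R n}.
Variables (phi : chart R n M) (D : set 'rV[R]_n) (g : R -> R) (B : set 'rV[R]_n).
Hypotheses (a1 : atlas phi) (g0 : forall e, unitI e -> 0 <= g e).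
Hypotheses (DB : D `<=` B) (cB : compact B) (BU : B `<=` cimg phi).
Local Notation ei := (fun i : 'I_n => delta_mx 0 i : 'rV[R]_n).
Implicit Types (v : R -> 'rV[R]_n -> R) (k : nat) (l : seq 'I_n).

(** The perturbation argument controls derivatives in coordinate directions, while the definitions
    ask for all vector fields. Bounds are kept on [D], smoothness on the whole open image of the
    chart, where derivatives can be taken. *)
Definition partials_bounded k v := (forall e, unitI e -> smooth_on (cimg phi) (v e)) /\
  forall l, (size l <= k)%N -> bigO_unif D (fun e z => iterD (map ei l) (v e) z) g.

Lemma partials_bounded_eq k v v' : (forall e, unitI e -> {in cimg phi, v e =1 v' e}) ->
  partials_bounded k v -> partials_bounded k v'.
Proof.
move=> E [s b]; have oU := open_cimg phi; split=> [e he|l lk].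
  exact: (eq_smooth_on oU (E e he) (s e he)).
apply: bigO_eq (b l lk) => e z he Dz; apply: (eq_on_iterD _ oU (E e he)).
by rewrite inE; exact/BU/DB.
Qed.

Lemma partials_boundedD k i v : partials_bounded k.+1 v ->
  partials_bounded k (fun e => 'D_(ei i) (v e)).
Proof.
move=> [s b]; split=> [e he|l lk]; first exact: smooth_onD (s e he).
have := b (rcons l i); rewrite size_rcons => /(_ lk); apply: bigO_eq => e z _ _.
by rewrite map_rcons iterD_rcons.
Qed.

Lemma partials_bounded_le k k' v : (k' <= k)%N -> partials_bounded k v -> partials_bounded k' v.
Proof. by move=> kk [s b]; split=> // l lk; apply: b; exact: leq_trans kk. Qed.

Lemma partials_bounded_add k v v' : partials_bounded k v -> partials_bounded k v' ->
  partials_bounded k (fun e z => v e z + v' e z).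
Proof.
move=> [s b] [s' b']; have oU := open_cimg phi; split=> [e he|l lk].
  exact: (smooth_addR oU (s e he) (s' e he)).
apply: bigO_eq (bigOD g0 (b l lk) (b' l lk)) => e z he Dz.
rewrite (iterD_add oU _ (s e he) (s' e he))// inE; exact/BU/DB.
Qed.

Lemma partials_bounded_mul k (h : 'rV[R]_n -> R) v : smooth_on (cimg phi) h -> partials_bounded k v ->
  partials_bounded k (fun e z => h z * v e z).
Proof.
have oU := open_cimg phi.
elim: k h v => [|k IH] h v sh hv.
  split=> [e he|[|//] _]; first exact: (smooth_mul oU sh (hv.1 e he)).
  have [C [C0 hC]] : exists C : R, 0 < C /\ forall z, B z -> `|h z| <= C.
    by apply: (compact_cont_bounded cB) => z Bz; exact: (smooth_on_cont sh (BU Bz)).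
  apply: (bigO_le _ C0 g0 _ (hv.2 [::] isT)) => // e z _ Dz /=.
  by rewrite normrM ler_wpM2r// hC//; exact: DB.
split=> [e he|l]; first exact: (smooth_mul oU sh (hv.1 e he)).
case/lastP: l => [|l i]; first by move=> _; exact: (IH h v sh (partials_bounded_le (leqnSn k) hv)).2 [::] isT.
rewrite size_rcons ltnS => lk.
have h1 := IH _ _ (smooth_onD (ei i) sh) (partials_bounded_le (leqnSn k) hv).
have h2 := IH _ _ sh (partials_boundedD i hv).
have [_ /(_ l lk)] := partials_bounded_add h1 h2.
apply: bigO_eq => e z he Dz; rewrite map_rcons iterD_rcons.
apply: (eq_on_iterD _ oU); last by rewrite inE; exact/BU/DB.
move=> y; rewrite inE => Uy.
exact: (esym (derive_val (is_derive := is_deriveZf (smooth_on_is_derive (ei i) sh Uy) (smooth_on_is_derive (ei i) (hv.1 e he) Uy)))).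
Qed.

Lemma partials_bounded_sum k (I : Type) (s : seq I) (v : I -> R -> 'rV[R]_n -> R) :
  (forall i, partials_bounded k (v i)) -> partials_bounded k (fun e z => \sum_(i <- s) v i e z).
Proof.
move=> h; elim: s => [|i s IH]; last first.
  by apply: partials_bounded_eq (partials_bounded_add (h i) IH) => e _ z _; rewrite big_cons.
have E0 e : (fun z : 'rV[R]_n => \sum_(i <- [::]) v i e z) = fun=> 0 by apply/funext => z; rewrite big_nil.
split=> [e he|l lk]; first by rewrite E0; exact: smooth_cst (open_cimg phi).
have Z (vs : seq 'rV[R]_n) : iterD vs (fun=> 0 : R) = fun=> 0.
  by elim: vs => [//|w vs IH'] /=; rewrite IH'; apply/funext => z; exact: derive_cst.
exists 1, 1; split=> // e z he _ _; rewrite E0 Z normr0 mul1r; exact: g0.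
Qed.

Lemma partials_bounded_lie k (X : vfield M) v : partials_bounded k.+1 v ->
  partials_bounded k (fun e z => 'D_(vfield_rep X phi z) (v e) z).
Proof.
move=> hv; have oU := open_cimg phi.
have h i : partials_bounded k (fun e z => vfield_rep X phi z 0 i * 'D_(ei i) (v e) z).
  apply: partials_bounded_mul (partials_boundedD i hv).
  exact: ((smooth_coord _ oU).1 (vfield_smooth X a1) i).
apply: partials_bounded_eq (partials_bounded_sum (index_enum _) h) => e he z.
by rewrite inE => Uz; rewrite (smooth_deriveE _ oU (hv.1 e he) Uz).
Qed.

Lemma partials_bounded_iter_lie k (Xs : seq (vfield M)) (f : R -> M -> R) : (forall e, unitI e -> smooth_fun (f e)) ->
  partials_bounded (k + size Xs) (fun e z => f e (cinv phi z)) ->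
  partials_bounded k (fun e z => iter_lie_fun Xs (f e) (cinv phi z)).
Proof.
move=> sf; elim: Xs k => [|X Xs IH] k /=; first by rewrite addn0.
rewrite addnS -addSn => /IH/(partials_bounded_lie X); apply: partials_bounded_eq => e he z.
by rewrite inE => Uz; rewrite (lie_fun_cinv X (iter_lie_fun_smooth Xs (sf e he)) a1 Uz).
Qed.

End local_bounds.

(** * The derivative of [F] in the direction of the perturbation *)

Section derivative_in_the_kernel.
Context {R : realType} {n : nat} {M : manifold R n} (o : orientation M).
Local Notation kernel := (@Defs.kernel R n M).
Local Notation gfun := (@Defs.gfun R n M).
Variables (X : vfield M) (F : gfun) (q j : nat) (K : set M) (g : R -> R).
Hypothesis basicF : basic_space F.
Hypothesis g0 : forall e, unitI e -> 0 <= g e.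
Hypothesis hyp : forall i, (i <= j.+1)%N -> forall Phi, smoothing_kernels o q Phi ->
  forall Xs : seq (vfield M), size Xs = i ->
  bigO_unif K (fun e => iter_lie_fun Xs (fun x => F (Phi e x) x)) g.
Variable Phi : kernel.
Hypothesis hPhi : smoothing_kernels o q Phi.
Local Notation Psi := (Lxy X Phi).
Local Notation ei := (fun i : 'I_n => delta_mx 0 i : 'rV[R]_n).

Let xPhi e : unitI e -> xker (Phi e).
Proof. by move=> he; exact: sk_xker hPhi.1 he. Qed.

Let xPsi e : unitI e -> xker (Psi e).
Proof. by move=> he; exact: sk_xker (sk_Lxy X hPhi.1) he. Qed.

Definition kernel_derivative e x : R := d1 F (Phi e x) x (Psi e x).

Lemma kernel_derivative_smooth e : unitI e -> smooth_fun (kernel_derivative e).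
Proof. by move=> he; exact: (d1_smooth basicF (xPhi he) (xPsi he)). Qed.

Section near_a_point.
Variables (p : M) (i0 : 'I_n) (r : R) (P : 'I_n -> M -> R) (Z : 'I_n -> vfield M).
Local Notation phi := (chart_at p).
Hypotheses (r0 : 0 < r) (hr : forall z, `|cmap_at p - z| <= r -> cimg phi z).
Hypotheses (sP : forall i, smooth_fun (P i)).
Hypotheses (hP : forall i z, `|cmap_at p - z| <= r -> P i (cinv phi z) = z 0 i).
Hypotheses (hZ : forall i z, `|cmap_at p - z| <= r -> vfield_rep (Z i) phi z = delta_mx 0 i).

Let D := [set z | `|cmap_at p - z| < r].
Let DK := [set z | D z /\ K (cinv phi z)].

Let oD : open D.
Proof.
rewrite (_ : D = ball (cmap_at p) r); first exact: ball_open.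
by apply/seteqP; split=> z; rewrite -ball_normE.
Qed.

Let DU : D `<=` cimg phi.
Proof. by move=> z /ltW; exact: hr. Qed.

Lemma iter_lie_frame (f : M -> R) (l : seq 'I_n) : smooth_fun f ->
  {in D, (fun z => iter_lie_fun (map Z l) f (cinv phi z)) =1 iterD (map ei l) (f \o cinv phi)}.
Proof.
move=> sf; elim: l => [//|i l IH] z; rewrite inE => Dz.
have zD : z \in D by rewrite inE.
rewrite [LHS](lie_fun_cinv (Z i) (iter_lie_fun_smooth (map Z l) sf) (atlas_at p) (DU Dz)).
rewrite (hZ i (ltW Dz)); exact: (eq_on_D _ oD IH zD).
Qed.

Let tail (y : 'rV[R]_n.+1) : 'rV[R]_n := \row_i y 0 (rshift 1 i : 'I_(1 + n)).
Let head (y : 'rV[R]_n.+1) : R := y 0 (lshift n 0 : 'I_(1 + n)).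

Let tail_rcons t z : tail (rcons_vec t z) = z.
Proof. by apply/rowP => i; rewrite mxE rcons_vecS. Qed.

Let head_rcons t z : head (rcons_vec t z) = t.
Proof. exact: rcons_vec0. Qed.

Let U := [set y : 'rV[R]_n.+1 | cimg phi (tail y)].

(* [G e (s, z) = F (Phi_{e,x} + s Psi_{e,x}, x)] where [z] are the coordinates of [x]. *)
Let G e (y : 'rV[R]_n.+1) : R :=
  F (Phi e (cinv phi (tail y)) + head y *: Psi e (cinv phi (tail y))) (cinv phi (tail y)).

Let smooth_tail : smooth_on setT tail.
Proof.
apply/(smooth_coord _ openT) => i.
have := (smooth_coord _ openT).1 (smooth_id (V := 'rV[R]_n.+1)) (rshift 1 i : 'I_(1 + n)).
by congr (smooth_on setT _); apply/funext => y; rewrite mxE.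
Qed.

Let smooth_head : smooth_on setT head.
Proof. exact: ((smooth_coord _ openT).1 (smooth_id (V := 'rV[R]_n.+1)) (lshift n 0 : 'I_(1 + n))). Qed.

Let oU : open U.
Proof. by apply: open_comp (open_cimg phi) => y _; exact: (smooth_on_cont smooth_tail). Qed.

Let smooth_along (V : normedModType R) (f : 'rV[R]_n.+1 -> V) (c : R -> 'rV[R]_n.+1) :
  smooth_on setT f -> smooth_on setT c -> smooth_on setT (fun t => f (c t)).
Proof. by move=> sf sc; exact: (smooth_comp openT openT (fun _ _ => I) sc sf). Qed.

Let sG e : unitI e -> smooth_on U (G e).
Proof.
move=> he; apply: (boman_smooth oU) => c sc hc.
have sx : smooth_curve (fun t => cinv phi (tail (c t))).
  exact: (chart_curve (atlas_at p) (smooth_along smooth_tail sc) hc).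
apply: (basic_SC basicF _ sx); apply: (@SC_add R (FS M) _ _ (xPhi he sx)).
exact: (@SC_mul R (FS M) _ _ (smooth_along smooth_head sc) (xPsi he sx)).
Qed.

Let w (i : 'I_n) : 'rV[R]_n.+1 := rcons_vec 0 (delta_mx 0 i).
Let vs : 'rV[R]_n.+1 := rcons_vec 1 0.
Let dir (a : R) i := w i + (a * (i == i0)%:R) *: vs.

Let derive_G e z : unitI e -> cimg phi z ->
  'D_vs (G e) (rcons_vec 0 z) = kernel_derivative e (cinv phi z).
Proof.
move=> he hz; have hy : U (rcons_vec 0 z) by rewrite /U/= tail_rcons.
have /is_derive_line[_ <-] := smooth_on_is_derive vs (sG he) hy.
apply: (congr1 (fun f : R -> R => 'D_(1 : R) f 0)); apply/funext => t.
by rewrite /G /vs rcons_vec_line scaler0 addr0 add0r mulr1 tail_rcons head_rcons.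
Qed.

(** The graph of the coefficient [a z_i0 + b] over the chart; on it [G e] is [F] along the perturbed
    kernel. Its linear part maps the [i]-th basis vector to [dir a i]. *)
Let affine (a b : R) (z : 'rV[R]_n) := rcons_vec (a * z 0 i0 + b) z.
Let affine_dir (a : R) (v : 'rV[R]_n) := rcons_vec (a * v 0 i0) v.

Let affineE a b z v (s : R) : affine a b (s *: v + z) = s *: affine_dir a v + affine a b z.
Proof.
rewrite [RHS]addrC /affine /affine_dir rcons_vec_line addrC; congr rcons_vec.
  by rewrite !mxE; ring.
exact: addrC.
Qed.

Let affine_dirE a l : map (affine_dir a) (map ei l) = map (dir a) l.
Proof.
rewrite -map_comp; apply: eq_map => i; rewrite /= /affine_dir /dir /w /vs rcons_vec_line.
by rewrite scaler0 addr0 add0r mulr1 mxE eqxx /= eq_sym.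
Qed.

(** The perturbing coefficient vanishes at [z], so for every [a] the derivatives are taken at the
    same point [(0, z)] and form a polynomial in [a]. The additional leading [i0] lets one
    derivative fall on the coefficient; the linear term is then [count_mem i0 l + 1] times the
    derivative sought. *)
Let weights l : exists b : 'I_(size l).+2 -> R, forall e z, unitI e -> D z ->
  iterD (map ei l) (fun z => kernel_derivative e (cinv phi z)) z =
  ((count_mem i0 l).+1%:R)^-1 * \sum_a b a * iter_lie_fun (map Z (i0 :: l))
    (fun x => F (Phi e x + ((a : nat)%:R * P i0 x + - ((a : nat)%:R * z 0 i0)) *: Psi e x) x) (cinv phi z).
Proof.
(* [i0 :: l] has length [size l + 1], so the polynomial has at most this degree and [size l + 2]
   values determine it. *)
have [b hb] := @vandermonde_weights R (size l).+2 1 isT; exists b => e z he Dz.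
have zD : z \in D by rewrite inE.
have Uz t : U (rcons_vec t z) by rewrite /U/= tail_rcons; exact: DU.
have val (a : 'I_(size l).+2) : iter_lie_fun (map Z (i0 :: l))
    (fun x => F (Phi e x + ((a : nat)%:R * P i0 x + - ((a : nat)%:R * z 0 i0)) *: Psi e x) x) (cinv phi z) =
    \sum_(k < (size l).+2) (a : nat)%:R ^+ k * coefficient (G e) w vs i0 (i0 :: l) k (rcons_vec 0 z).
  set f := fun x => F _ x; pose c := - ((a : nat)%:R * z 0 i0).
  have sf : smooth_fun f.
    have sh : smooth_fun (fun x => (a : nat)%:R * P i0 x + c).
      exact: (smooth_funD (smooth_funM (smooth_fun_cst _) (sP i0)) (smooth_fun_cst _)).
    apply: curve_smooth_fun => cv sc; apply: (basic_SC basicF _ sc).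
    apply: (@SC_add R (FS M) _ _ (xPhi he sc)).
    exact: (@SC_mul R (FS M) _ _ (smooth_fun_curve sh sc) (xPsi he sc)).
  rewrite (iter_lie_frame (i0 :: l) sf zD).
  have E : {in D, f \o cinv phi =1 fun y => G e (affine (a : nat)%:R c y)}.
    move=> y; rewrite inE => Dy.
    by rewrite /f /G /affine /= tail_rcons head_rcons (hP i0 (ltW Dy)).
  rewrite (eq_on_iterD _ oD E zD) (iterD_affine (G e) _ (affineE _ c)) affine_dirE.
  have -> : affine (a : nat)%:R c z = rcons_vec 0 z by rewrite /affine /c subrr.
  exact: (coefficient_expansion w vs i0 oU (sG he) (i0 :: l) _ (Uz 0)).
under eq_bigr do rewrite val mulr_sumr.
rewrite exchange_big /=.
have -> : \sum_(k < (size l).+2) \sum_(a < (size l).+2)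
    b a * ((a : nat)%:R ^+ k * coefficient (G e) w vs i0 (i0 :: l) k (rcons_vec 0 z)) =
    coefficient (G e) w vs i0 (i0 :: l) 1 (rcons_vec 0 z).
  under eq_bigr do under eq_bigr do rewrite mulrA.
  under eq_bigr => k _ do rewrite -mulr_suml hb//.
  rewrite (bigD1 (1 : 'I_(size l).+2))//= mul1r big1 ?addr0// => k k1.
  by rewrite (_ : (k == 1%N :> nat) = false) ?mul0r//; apply/negbTE; apply: contra k1 => /eqP h; apply/eqP/val_inj.
rewrite (coefficient1 w vs i0 oU (sG he) l (Uz 0)) mulrA mulVf ?mul1r; last by rewrite pnatr_eq0.
have E : {in D, (fun z => kernel_derivative e (cinv phi z)) =1 fun y => 'D_vs (G e) (affine 0 0 y)}.
  move=> y; rewrite inE => Dy; rewrite /affine mul0r add0r.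
  by rewrite (derive_G he (DU Dy)).
rewrite (eq_on_iterD _ oD E zD) (iterD_affine ('D_vs (G e)) _ (affineE 0 0)) affine_dirE.
rewrite /affine mul0r add0r; congr (iterD _ _ _).
by apply: eq_map => i; rewrite /dir mul0r scale0r addr0.
Qed.

Lemma kernel_derivative_partials :
  partials_bounded phi DK g j (fun e z => kernel_derivative e (cinv phi z)).
Proof.
split=> [e he|l lj]; first exact: (kernel_derivative_smooth he (atlas_at p)).
have [b hb] := weights l.
(* A bound for [a * |z_i0|] over the nodes [a < m] and the ball around [cmap_at p]; the 1 makes it
   positive. *)
pose m := (size l).+2; pose rmax := m%:R * (`|cmap_at p| + r) + 1.
have rmax0 : 0 < rmax by rewrite ltr_wpDl// mulr_ge0// addr_ge0// ltW.
have h (a : 'I_m) : bigO_unif DK (fun e z => b a * iter_lie_fun (map Z (i0 :: l))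
    (fun x => F (Phi e x + ((a : nat)%:R * P i0 x + - ((a : nat)%:R * z 0 i0)) *: Psi e x) x) (cinv phi z)) g.
  apply: (bigO_scale _ g0).
  have sf : smooth_fun (fun x => (a : nat)%:R * P i0 x).
    exact: (smooth_funM (smooth_fun_cst _) (sP i0)).
  have sz : (size (map Z (i0 :: l)) <= j.+1)%N by rewrite size_map.
  have hb' := perturbation_bound X g0 hyp hPhi sf rmax0 sz.
  apply: (bigO_comp (h := fun z => (cinv phi z, - ((a : nat)%:R * z 0 i0))) _ hb') => z [Dz Kz] /=.
  split=> //; rewrite normrN normrM normr_nat /rmax.
  apply: (@le_trans _ _ (m%:R * (`|cmap_at p| + r))); last by rewrite lerDl.
  apply: ler_pM => //; first by rewrite ler_nat ltnW.
  apply: le_trans (coord_le_norm _ _ _) _.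
  rewrite -(subKr (cmap_at p) z); apply: le_trans (ler_normB _ _) _.
  by rewrite lerD2l; exact: ltW.
apply: bigO_eq (bigO_scale (((count_mem i0 l).+1%:R)^-1) g0 (bigO_sum (index_enum _) g0 h)) => e z he [Dz Kz].
by rewrite (hb e z he Dz).
Qed.

Lemma kernel_derivative_local (Xs : seq (vfield M)) : (size Xs <= j)%N ->
  bigO_unif DK (fun e z => iter_lie_fun Xs (kernel_derivative e) (cinv phi z)) g.
Proof.
move=> sX; pose B := [set z | `|cmap_at p - z| <= r].
have DB : DK `<=` B by move=> z [/ltW].
have cB : compact B by exact: compact_closed_ball.
have hB : partials_bounded phi DK g (0 + size Xs) (fun e z => kernel_derivative e (cinv phi z)).
  exact: (partials_bounded_le sX kernel_derivative_partials).
have [_ /(_ [::] isT)] := partials_bounded_iter_lie (atlas_at p) g0 DB cB hr kernel_derivative_smooth hB.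
by [].
Qed.

End near_a_point.

(** In dimension 0 there is no index [i0] for the perturbation, but all derivatives vanish, and
    [Psi] with them. *)
Lemma kernel_derivative_dim0 e x : n = 0%N -> unitI e -> kernel_derivative e x = 0.
Proof.
move=> n0 he.
have v0 (v : 'rV[R]_n) : v = 0 by apply/rowP => i; have := ltn_ord i; rewrite {2}n0.
have D0 (W : normedModType R) (f : 'rV[R]_n -> W) v z : 'D_v f z = 0.
  rewrite (_ : f = cst (f 0)); first exact: derive_cst.
  by apply/funext => y; rewrite (v0 y).
have P0 : Psi e x = 0.
  apply: preform_ext => y A.
  have -> : Psi e x y A = (lie_fun X (fun x => Phi e x y A) x : R) + (lie_form X (Phi e x) y A : R) by [].
  rewrite /lie_fun D0 add0r (lie_formE X y A (Omega_c_is_form (xker_Omega_c x (xPhi he)))).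
  rewrite /lie_den D0 add0r /divg /mxtrace big1 ?mul0r ?mulr0// => i _.
  by have := ltn_ord i; rewrite {2}n0.
rewrite /kernel_derivative P0 /d1 (_ : (fun t : R => _) = cst (F (Phi e x) x)); first exact: derive_cst.
by apply/funext => t; rewrite scaler0 addr0.
Qed.

Lemma kernel_derivative_bound (Xs : seq (vfield M)) : compact K -> (size Xs <= j)%N ->
  bigO_unif K (fun e => iter_lie_fun Xs (kernel_derivative e)) g.
Proof.
move=> cK sX; have [n0|n0] := posnP n.
  have Z (Ys : seq (vfield M)) : iter_lie_fun Ys (fun=> 0) = fun=> 0.
    by elim: Ys => [//|Y Ys IH] /=; rewrite IH; apply/funext => x; exact: lie_fun_cst.
  exists 1, 1; split=> // e x he _ _.
  rewrite (_ : kernel_derivative e = fun=> 0); last by apply/funext => y; exact: kernel_derivative_dim0.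
  by rewrite Z normr0 mul1r; exact: g0.
pose i0 := Ordinal n0.
have [|||A [e0 [C [e00 C0 hC]]] hA] := @compact_ind M K
  (fun A => bigO_unif (K `&` A) (fun e => iter_lie_fun Xs (kernel_derivative e)) g) cK.
- by exists 1, 1; split=> // e x _ _ [].
- move=> A B [e1 [C1 [h1 c1 b1]]] [e2 [C2 [h2 c2 b2]]].
  exists (Num.min e1 e2), (C1 + C2); split; [by rewrite lt_min h1|by rewrite addr_gt0|].
  move=> e x he; rewrite le_min => /andP[l1 l2] [Kx AB]; have ge := g0 he.
  case: AB => hx.
    apply: le_trans (b1 e x he l1 _) _ => //; rewrite ler_wpM2r// lerDl ltW//.
  apply: le_trans (b2 e x he l2 _) _ => //; rewrite ler_wpM2r// lerDr ltW//.
- move=> p _; have [r [P [Z [r0 hr sP hP hZ]]]] := local_frame p.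
  have hN : \forall z \near cmap (chart_at p) p, `|cmap_at p - z| < r.
    by apply/nbhs_ballP; exists r => // z; rewrite -ball_normE.
  exists [set x | cdom (chart_at p) x /\ `|cmap_at p - cmap (chart_at p) x| < r].
    exact: (open_near_cinv (cdom_at p) hN).
  have hl := kernel_derivative_local i0 r0 hr sP hP hZ sX.
  pose A := [set x | cdom (chart_at p) x /\ `|cmap_at p - cmap (chart_at p) x| < r].
  have hD x : (K `&` A) x -> [set z | [set z | `|cmap_at p - z| < r] z /\ K (cinv (chart_at p) z)] (cmap (chart_at p) x).
    by move=> [Kx [hx hxr]]; split; [exact: hxr|rewrite (cmapK hx)].
  by apply: bigO_eq (bigO_comp hD hl) => e x he [Kx [hx _]]; rewrite (cmapK hx).
exists e0, C; split=> // e x he ee0 Kx; apply: hC => //; split=> //.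
exact: nbhs_singleton (hA x Kx).
Qed.

Lemma iter_lie_sub (Xs : seq (vfield M)) (f1 f2 : M -> R) : smooth_fun f1 -> smooth_fun f2 ->
  iter_lie_fun Xs (fun x => f1 x - f2 x) = fun x => iter_lie_fun Xs f1 x - iter_lie_fun Xs f2 x.
Proof.
move=> s1 s2; elim: Xs => [//|Y Ys IH] /=; rewrite IH; apply/funext => x.
have sY1 := iter_lie_fun_smooth Ys s1; have sY2 := iter_lie_fun_smooth Ys s2.
rewrite (_ : (fun x => _) = fun x => iter_lie_fun Ys f1 x + -1 * iter_lie_fun Ys f2 x); last first.
  by apply/funext => y; rewrite mulN1r.
rewrite (lie_funD Y x sY1 (smooth_funM (smooth_fun_cst (-1)) sY2)) (lie_funZ Y (-1) x sY2).
by rewrite mulN1r.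
Qed.

(** Both terms of [hatL_formula] consume one order more than [Xs]: the first has [X] as an
    additional field, the second goes through the perturbed kernels. *)
Lemma hatL_bound (Xs : seq (vfield M)) : compact K -> size Xs = j ->
  bigO_unif K (fun e => iter_lie_fun Xs (fun x => hatL X F (Phi e x) x)) g.
Proof.
move=> cK sX.
have h1 : bigO_unif K (fun e => iter_lie_fun (rcons Xs X) (fun x => F (Phi e x) x)) g.
  by apply: (hyp (leqnn _) hPhi); rewrite size_rcons sX.
have h2 := kernel_derivative_bound (Xs := Xs) cK; rewrite sX in h2.
have h3 := bigO_scale (-1) g0 (h2 (leqnn _)).
apply: bigO_eq (bigOD g0 h1 h3) => e x he _.
have [sF _] := chain_rule X x basicF (xPhi he).
have -> : (fun x => hatL X F (Phi e x) x) =
    fun x => lie_fun X (fun x => F (Phi e x) x) x - kernel_derivative e x.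
  by apply/funext => y; exact: (hatL_formula X y basicF (xPhi he)).
rewrite (iter_lie_sub Xs (lie_fun_smooth X sF) (kernel_derivative_smooth he)) mulN1r.
by rewrite /iter_lie_fun foldr_rcons.
Qed.

End derivative_in_the_kernel.

(** The perturbation argument uses one set of kernels for all orders up to [j.+1], whereas the
    definitions give an index for each order separately. *)
Lemma exists_common_bound (j : nat) (P : nat -> nat -> Prop) :
  (forall i a b, (a <= b)%N -> P i a -> P i b) -> (forall i, exists a, P i a) ->
  exists a, forall i, (i <= j)%N -> P i a.
Proof.
move=> mono /choice[f hf]; exists (\max_(i < j.+1) f i) => i ij.
apply: mono (hf i); have ij' : (i < j.+1)%N by [].
exact: (@leq_bigmax _ (fun i : 'I_j.+1 => f i) (Ordinal ij')).
Qed.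

Lemma power_weaken {R : realType} (a b : nat) (e : R) : (a <= b)%N -> unitI e -> e ^- a <= e ^- b.
Proof.
move=> ab /andP[e0 e1]; rewrite lef_pV2 ?posrE ?exprn_gt0//.
by apply: ler_wiXn2l => //; exact: ltW.
Qed.

Unset Implicit Arguments.
Set Strict Implicit.
Set Printing Implicit Defensive.

Theorem theorem42 (R : realType) (n : nat) (M : manifold R n)
    (o : orientation M) (X : vfield M) :
  (hatL X @` moderate_gfun o `<=` moderate_gfun o) /\
  (hatL X @` negligible_gfun o `<=` negligible_gfun o).
Proof.
split=> _ [F [bF hF] <-]; (split; first exact: hatL_basic).
  move=> K cK j.
  (* One number serves both as kernel index [q] and as exponent [N]: raising [q] leaves fewer
     kernels, and raising [N] weakens the bound since [e <= 1]. *)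
  have [||N hN] := @exists_common_bound j.+1 (fun i N => forall Phi, smoothing_kernels o N Phi ->
    forall Xs : seq (vfield M), size Xs = i ->
    bigO_unif K (fun e => iter_lie_fun Xs (fun x => F (Phi e x) x)) (fun e => e ^- N)).
  - move=> i a b ab h Phi hPhi Xs sX.
    have [e0 [C [e00 C0 hC]]] := h Phi (smoothing_kernels_le ab hPhi) Xs sX.
    exists e0, C; split=> // e x he ee0 Kx; apply: le_trans (hC e x he ee0 Kx) _.
    by apply: ler_wpM2l; [exact: ltW|exact: power_weaken].
  - move=> i; have [q [N h]] := hF K cK i; exists (maxn q N) => Phi hPhi Xs sX.
    have [e0 [C [e00 C0 hC]]] := h Phi (smoothing_kernels_le (leq_maxl q N) hPhi) Xs sX.
    exists e0, C; split=> // e x he ee0 Kx; apply: le_trans (hC e x he ee0 Kx) _.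
    by apply: ler_wpM2l; [exact: ltW|apply: power_weaken he; exact: leq_maxr].
  - exists N, N => Phi hPhi Xs sX.
    have gN e : unitI e -> 0 <= e ^- N :> R by exact: power_gauge_ge0.
    exact: (hatL_bound X bF gN hN hPhi cK sX).
move=> K cK j m.
have [||q hq] := @exists_common_bound j.+1 (fun i q => forall Phi, smoothing_kernels o q Phi ->
  forall Xs : seq (vfield M), size Xs = i ->
  bigO_unif K (fun e => iter_lie_fun Xs (fun x => F (Phi e x) x)) (fun e => e ^+ m)).
- move=> i a b ab h Phi hPhi Xs sX; exact: (h Phi (smoothing_kernels_le ab hPhi) Xs sX).
- by move=> i; exact: hF K cK i m.
- exists q => Phi hPhi Xs sX.
  have gm e : unitI e -> 0 <= e ^+ m :> R by case/andP=> e0 _; rewrite exprn_ge0// ltW.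
  exact: (hatL_bound X bF gm hq hPhi cK sX).
Qed.
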